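(* Let $X\in\mathrm{Alex}^n(\kappa)$, and let $Y$ be a geodesic metric space, $m\le n$ an integer and $i:X\to Y\times\mathbb{R}^m$ an isometric embedding (product metric) such that: (a) $p_Y\circ i:X\to Y$ is surjective; (b) every Lipschitz continuous affine function $f:X\to\mathbb{R}$ factors as $f=\hat f\circ p_H\circ i$ with $\hat f:\mathbb{R}^m\to\mathbb{R}$ affine; (c) every isometry of $X$ extends uniquely to an isometry of $Y\times\mathbb{R}^m$; (d) $i$ is open on some open subset of $X$ containing all regular points of $X$. Then the metric completion $\bar Y$ of $Y$ belongs to $\mathrm{Alex}^{n-m}(\kappa)$.
   Context: $\mathrm{Alex}^n(\kappa)$ denotes the class of complete geodesic metric spaces of Hausdorff dimension $n<\infty$ with curvature $\geq\kappa$ in the sense of Alexandrov. $p_Y$, $p_H$ are the projections of $Y\times\mathbb{R}^m$ onto $Y$ and $\mathbb{R}^m$. A function on a geodesic space is affine if its composition with every geodesic (length-minimizing curve parametrized proportionally to arclength) is affine. A point $x\in X$ is regular if the tangent cone $T_xX$ is isometric to $\mathbb{R}^n$. (Such data $(Y,m,i)$ exist and are unique up to isometry.) *)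

(* Defs.v *)
From HB Require Import structures.
From mathcomp Require Import all_boot all_order all_algebra.
From mathcomp Require Import all_classical all_reals all_analysis.
Set Implicit Arguments. Unset Strict Implicit. Unset Printing Implicit Defensive.
Import Order.TTheory GRing.Theory Num.Theory.
Local Open Scope ring_scope.
Local Open Scope classical_set_scope.

Section AlexDefs.
Variable R : realType.

Definition is_metric (T : Type) (d : T -> T -> R) : Prop :=
  [/\ forall a, d a a = 0, forall a b, d a b = 0 -> a = b,
      forall a b, d a b = d b a & forall a b c, d a c <= d a b + d b c].

Definition is_geodesic (T : Type) (d : T -> T -> R) (g : R -> T) (a b : T) : Prop :=
  [/\ g 0 = a, g 1 = b &
      forall s t, 0 <= s <= 1 -> 0 <= t <= 1 -> d (g s) (g t) = `|s - t| * d a b].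

Definition geodesic_space (T : Type) (d : T -> T -> R) : Prop :=
  is_metric d /\ forall a b, exists g, is_geodesic d g a b.

Definition complete_metric (T : Type) (d : T -> T -> R) : Prop :=
  forall u : nat -> T,
    (forall e, 0 < e -> exists N, forall p q, (N <= p)%N -> (N <= q)%N -> d (u p) (u q) < e) ->
    exists l, forall e, 0 < e -> exists N, forall p, (N <= p)%N -> d (u p) l < e.

Definition open_in (T : Type) (d : T -> T -> R) (U : set T) : Prop :=
  forall a, U a -> exists2 r, 0 < r & forall b, d a b < r -> U b.

Definition alx_isometry (T1 T2 : Type) (d1 : T1 -> T1 -> R) (d2 : T2 -> T2 -> R)
  (f : T1 -> T2) : Prop :=
  (forall a b, d2 (f a) (f b) = d1 a b) /\ (forall y, exists x, f x = y).

Definition coshR (x : R) : R := (expR x + expR (- x)) / 2.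
Definition sinhR (x : R) : R := (expR x - expR (- x)) / 2.

(** Comparison with the model plane of curvature k: for a triangle with
    |pq| = a, |pr| = b, |qr| = c and a point s on [qr] with |qs| = t,
    [model_cmp k a b c t e] says e = |ps| is >= the corresponding distance
    in the model plane (Stewart's formula and its spherical/hyperbolic
    analogues). *)
Definition model_cmp (k a b c t e : R) : Prop :=
  if k == 0 then (c - t) * a ^+ 2 + t * b ^+ 2 - c * t * (c - t) <= c * e ^+ 2
  else if 0 < k then
    let s := Num.sqrt k in
    cos (s * e) * sin (s * c) <= sin (s * (c - t)) * cos (s * a) + sin (s * t) * cos (s * b)
  else
    let s := Num.sqrt (- k) in
    sinhR (s * (c - t)) * coshR (s * a) + sinhR (s * t) * coshR (s * b)
      <= coshR (s * e) * sinhR (s * c).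

Definition curv_ge (T : Type) (d : T -> T -> R) (k : R) : Prop :=
  forall x, exists2 rho, 0 < rho &
    forall p q r (g : R -> T) tau,
      d x p < rho -> d x q < rho -> d x r < rho ->
      is_geodesic d g q r -> 0 <= tau <= 1 ->
      (0 < k -> d p q + d p r + d q r < 2 * pi / Num.sqrt k) ->
      model_cmp k (d p q) (d p r) (d q r) (tau * d q r) (d p (g tau)).

Definition alx_diam (T : Type) (d : T -> T -> R) (A : set T) : R :=
  sup [set r | exists a b, [/\ A a, A b & r = d a b]].

Definition hterm (T : Type) (d : T -> T -> R) (s : R) (A : set T) : \bar R :=
  if pselect (A = set0) then 0%E else ((alx_diam d A) `^ s)%:E.

Definition delta_covers (T : Type) (d : T -> T -> R) (delta : R) : set (nat -> set T) :=
  [set U | (forall i a b, U i a -> U i b -> d a b <= delta) /\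
           setT `<=` \bigcup_i U i].

Definition Hdelta (T : Type) (d : T -> T -> R) (s delta : R) : \bar R :=
  ereal_inf [set (\sum_(i <oo) hterm d s (U i))%E | U in delta_covers d delta].

Definition hausdorff_measure (T : Type) (d : T -> T -> R) (s : R) : \bar R :=
  ereal_sup [set Hdelta d s delta | delta in [set delta : R | 0 < delta]].

Definition hausdorff_dim (T : Type) (d : T -> T -> R) : \bar R :=
  ereal_inf [set s%:E | s in [set s : R | 0 <= s /\ hausdorff_measure d s = 0%E]].

Definition Alex (n : nat) (k : R) (T : Type) (d : T -> T -> R) : Prop :=
  [/\ geodesic_space d, complete_metric d, curv_ge d k & hausdorff_dim d = (n%:R)%:E].

Definition euc_dist (m : nat) (v w : 'rV[R]_m) : R :=
  Num.sqrt (\sum_(i < m) (v ord0 i - w ord0 i) ^+ 2).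

Definition prod_dist (Y : Type) (dY : Y -> Y -> R) {m : nat}
  (p q : Y * 'rV[R]_m) : R :=
  Num.sqrt (dY p.1 q.1 ^+ 2 + euc_dist p.2 q.2 ^+ 2).

Definition affine_fun (T : Type) (d : T -> T -> R) (f : T -> R) : Prop :=
  forall g a b, is_geodesic d g a b ->
    forall tau, 0 <= tau <= 1 -> f (g tau) = (1 - tau) * f a + tau * f b.

Definition lipschitz_fun (T : Type) (d : T -> T -> R) (f : T -> R) : Prop :=
  exists L, forall a b, `|f a - f b| <= L * d a b.

(** x is regular: the tangent cone T_x X (pointed Gromov-Hausdorff limit of
    (X, lambda d, x) as lambda -> +oo) is isometric to (R^n, 0). *)
Definition regular_pt (T : Type) (d : T -> T -> R) (n : nat) (x : T) : Prop :=
  forall r e, 0 < r -> 0 < e ->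
    exists2 l0, 0 < l0 & forall l, l0 <= l ->
      exists f : T -> 'rV[R]_n,
        [/\ f x = 0,
            forall a b, l * d x a < r -> l * d x b < r ->
              `|euc_dist (f a) (f b) - l * d a b| < e &
            forall v, euc_dist v 0 < r - e ->
              exists2 a, l * d x a < r & euc_dist (f a) v < e].

Definition is_completion (Y Yb : Type) (dY : Y -> Y -> R) (dYb : Yb -> Yb -> R)
  (j : Y -> Yb) : Prop :=
  [/\ is_metric dYb, complete_metric dYb,
      forall y y', dYb (j y) (j y') = dY y y' &
      forall z e, 0 < e -> exists y, dYb (j y) z < e].

End AlexDefs.

(* Main.v *)
(** After rescaling, the curvature bound becomes a hyperbolic comparison, which globalizes.
    Contraction along geodesics then makes packing numbers see the Hausdorff dimension at
    every scale. At a Baire-generic point every direction has an almost opposite one, and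
    midpoints show that the cosines of angles form an approximately Euclidean Gram kernel;
    so the tangent cone is some R^j, and packing forces j = n. Thus a regular point exists,
    and by (d) the space X contains a full ball of the fibre of Y x R^m through it.

    If the Y-component of x lies between those of x1 and x2, then X contains the point above
    it whose height is interpolated between the heights of x1 and x2: it is reached by
    repeated small comparison steps of size eta, each of which moves the Y-component by only
    O(eta^(3/2)). Hence the points whose fibre contains a rho-ball form a closed convex set,
    and on slices of constant height the distance of X is that of Y, so that the comparison
    holds locally for Y, and then globally.

    Packing numbers of X and of Y differ by the exponent m; therefore the completion of Y is
    proper, has dimension n - m, and inherits geodesics and comparison as limits. For k > 0
    and m > 0 a flat rectangle would violate the curvature bound, so Y is a point; for m = 0
    the completion of Y is isometric to X. *)
Require Import Defs.
From HB Require Import structures.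
From mathcomp Require Import all_boot all_order all_algebra.
From mathcomp Require Import all_classical all_reals all_analysis.
From mathcomp Require Import ring lra.
Import Order.TTheory GRing.Theory Num.Theory.
Import numFieldNormedType.Exports.
Local Open Scope ring_scope.
Local Open Scope classical_set_scope.
Set Implicit Arguments.
Unset Strict Implicit.
Unset Printing Implicit Defensive.

(* [lraw hs] runs [lra] with the hypotheses [hs] only, since the cost of [lra] grows quickly
   with the context. Hypotheses [0 < x] stay: they may be section variables, and the
   reification of [lra] fails once a section variable has been cleared. *)
Ltac arith_hyp P := lazymatch P with
  | is_true (0 < ?v) => first [ is_var v; fail 1 | idtac ]
  | is_true (_ <= _) => idtac
  | is_true (_ < _) => idtac
  | is_true (andb _ _) => idtac
  | @eq (\bar _) _ _ => fail
  | @eq _ _ _ => idtac end.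
Ltac clear_arith := repeat match goal with H : ?P |- _ => arith_hyp P; clear H end.
Tactic Notation "lraw" hyp_list(hs) := revert hs; clear_arith; intros; lra.

(** * Hyperbolic functions *)

(** Scaling by [Num.sqrt (- k)], or by any positive factor when k >= 0, turns the local bound into
    that of curvature -1, where no perimeter condition intervenes. For k = 0 the flat inequality is
    recovered by letting the factor tend to 0; for k > 0 the passage loses information, hence the
    separate treatment of that case.

    The obstacle is that Y need not be complete and X need not be a product: a fibre may be a proper
    part of R^m, so a geodesic of Y need not lift to X at constant height. Therefore the distance of
    Y is kept as a pseudometric on X next to the metric D, and globalization is proved for the pair:
    D supplies geodesics, balls and completeness, the pseudometric is what is compared. For one
    fixed fibre radius the points form a complete space to which this applies; their union over all
    radii is only known to be dense.

    Dimensions are handled through packing exponents, since Hausdorff dimension itself is not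
    additive on products; contraction lets one ball at one scale control all the others. *)

HB.lock Definition hcosh (R : realType) (x : R) : R := coshR x.
HB.lock Definition hsinh (R : realType) (x : R) : R := sinhR x.

Section Hyperbolic.
Variable R : realType.
Implicit Types x y u v : R.
Local Notation ch := (@hcosh R).
Local Notation sh := (@hsinh R).

Lemma hcoshE : @hcosh R = @coshR R.
Proof. by apply/funext => x; rewrite hcosh.unlock. Qed.

Lemma hsinhE : @hsinh R = @sinhR R.
Proof. by apply/funext => x; rewrite hsinh.unlock. Qed.

Let chE x : ch x = (expR x + expR (- x)) / 2. Proof. by rewrite hcoshE. Qed.
Let shE x : sh x = (expR x - expR (- x)) / 2. Proof. by rewrite hsinhE. Qed.

Lemma chN x : ch (- x) = ch x.
Proof. by rewrite !chE opprK addrC. Qed.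

Lemma shN x : sh (- x) = - sh x.
Proof. by rewrite !shE opprK; lra. Qed.

Lemma ch0 : ch 0 = 1.
Proof. by rewrite !chE oppr0 expR0; lra. Qed.

Lemma sh0 : sh 0 = 0.
Proof. by rewrite !shE oppr0 expR0; lra. Qed.

Lemma chD x y : ch (x + y) = ch x * ch y + sh x * sh y.
Proof. by rewrite !chE !shE opprD !expRD; field. Qed.

Lemma shD x y : sh (x + y) = sh x * ch y + ch x * sh y.
Proof. by rewrite !chE !shE opprD !expRD; field. Qed.

Lemma chB x y : ch (x - y) = ch x * ch y - sh x * sh y.
Proof. by rewrite chD chN shN; ring. Qed.

Lemma shB x y : sh (x - y) = sh x * ch y - ch x * sh y.
Proof. by rewrite shD chN shN; ring. Qed.

Lemma ch2_sh2 x : ch x ^+ 2 - sh x ^+ 2 = 1.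
Proof. by have := chB x x; rewrite subrr ch0 => ->; ring. Qed.

Lemma sh_gt0 x : (0 < sh x) = (0 < x).
Proof.
rewrite !shE; apply/idP/idP => h.
  have : expR (- x) < expR x by lra.
  by rewrite ltr_expR; lra.
have : expR (- x) < expR x by rewrite ltr_expR; lra.
by lra.
Qed.

Lemma sh_ge0 x : 0 <= x -> 0 <= sh x.
Proof.
by rewrite le_eqVlt => /orP[/eqP <-|h]; rewrite ?sh0// ltW// sh_gt0.
Qed.

Lemma ch_gt0 x : 0 < ch x.
Proof. by rewrite !chE divr_gt0// addr_gt0 ?expR_gt0. Qed.

Lemma ch_ge1 x : 1 <= ch x.
Proof.
have h := ch2_sh2 x; have h1 := ch_gt0 x; have h2 := sqr_ge0 (sh x); nra.
Qed.

Lemma is_derive_ch x : is_derive x (1 : R) ch (sh x).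
Proof.
have h : is_derive x (1 : R) (fun t => (expR t + expR (- t)) / 2)
    ((expR x - expR (- x)) / 2).
  by apply: is_derive_eq; rewrite /GRing.scale /=; lraw.
by rewrite hcoshE shE; exact: h.
Qed.

Lemma is_derive_sh x : is_derive x (1 : R) sh (ch x).
Proof.
have h : is_derive x (1 : R) (fun t => (expR t - expR (- t)) / 2)
    ((expR x + expR (- x)) / 2).
  by apply: is_derive_eq; rewrite /GRing.scale /=; lra.
by rewrite hsinhE chE; exact: h.
Qed.

Lemma mvt_le (f df : R -> R) (a b : R) : a < b ->
  (forall x, is_derive x (1 : R) f (df x)) ->
  exists2 c, a < c < b & f b - f a = df c * (b - a).
Proof.
move=> ab fd.
have fc : {within `[a, b], continuous f}.
  by apply: derivable_within_continuous => x _; have ? := fd x; exact: ex_derive.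
have [c /itvP cab e] := MVT ab (fun x _ => fd x) fc.
by exists c => //; rewrite !cab.
Qed.

Lemma ch_lt x y : 0 <= x -> x < y -> ch x < ch y.
Proof.
move=> x0 xy; have [c /andP[xc cy] e] := mvt_le xy is_derive_ch.
by rewrite -subr_gt0 e mulr_gt0 ?subr_gt0// sh_gt0; lra.
Qed.

Lemma ch_le x y : 0 <= x -> x <= y -> ch x <= ch y.
Proof.
by move=> x0; rewrite le_eqVlt => /orP[/eqP ->//|h]; rewrite ltW// ch_lt.
Qed.

Lemma ch_abs x : ch `|x| = ch x.
Proof. by case: (ger0P x) => // _; rewrite chN. Qed.

Lemma sh_lt x y : x < y -> sh x < sh y.
Proof.
move=> xy; have [c _ e] := mvt_le xy is_derive_sh.
by rewrite -subr_gt0 e mulr_gt0 ?subr_gt0// ch_gt0.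
Qed.

Lemma sh_le x y : x <= y -> sh x <= sh y.
Proof. by rewrite le_eqVlt => /orP[/eqP ->//|h]; rewrite ltW// sh_lt. Qed.

Lemma sh_geid x : 0 <= x -> x <= sh x.
Proof.
rewrite le_eqVlt => /orP[/eqP <-|x0]; first by rewrite sh0.
have [c _] := mvt_le x0 is_derive_sh; rewrite sh0 !subr0 => ->.
by rewrite -[leLHS]mul1r ler_wpM2r ?ch_ge1// ltW.
Qed.

Lemma sh_le_ch x y : 0 <= x -> x <= y -> sh x <= x * ch y.
Proof.
rewrite le_eqVlt => /orP[/eqP <-|x0] xy; first by rewrite sh0 mul0r.
have [c /andP[c0 cx]] := mvt_le x0 is_derive_sh; rewrite sh0 !subr0 => ->.
by rewrite mulrC ler_wpM2l ?(ltW x0)// ch_le; lra.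
Qed.

Lemma ch_half x : ch x = 1 + 2 * sh (x / 2) ^+ 2.
Proof.
rewrite {1}(_ : x = x / 2 + x / 2); last by lra.
by rewrite chD; have := ch2_sh2 (x / 2); lra.
Qed.

Lemma ch_ge_sqr x : 1 + x ^+ 2 / 2 <= ch x.
Proof.
rewrite -ch_abs -(real_normK (num_real x)) ch_half.
have h0 := normr_ge0 x.
have h : `|x| / 2 <= sh (`|x| / 2) by apply: sh_geid; lra.
by nra.
Qed.

(** Upper counterpart of [ch_ge_sqr], from the half-angle formula; the two replace second-order
    Taylor expansions in the estimates below. *)
Lemma ch_le_sqr x y : `|x| <= y -> ch x <= 1 + x ^+ 2 / 2 * ch y ^+ 2.
Proof.
move=> xy; rewrite -ch_abs -(real_normK (num_real x)) ch_half.
have h0 := normr_ge0 x.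
have h : sh (`|x| / 2) <= `|x| / 2 * ch y by apply: sh_le_ch; lra.
have h1 : 0 <= sh (`|x| / 2) by apply: sh_ge0; lra.
have : sh (`|x| / 2) ^+ 2 <= (`|x| / 2 * ch y) ^+ 2 by rewrite ler_sqr ?nnegrE//; lra.
by lra.
Qed.

Lemma ch_sub_le x y : 0 <= x -> x <= y -> ch y - ch x <= (y - x) * sh y.
Proof.
move=> x0; rewrite le_eqVlt => /orP[/eqP ->|xy]; first by rewrite !subrr mul0r.
have [c /andP[xc cy] ->] := mvt_le xy is_derive_ch.
by rewrite mulrC ler_wpM2l ?sh_le//; lra.
Qed.

Lemma ch_tangent x y : 0 <= x -> 0 <= y -> ch x + (y - x) * sh x <= ch y.
Proof.
move=> x0 y0; have [xy|xy|->] := ltgtP x y; last by lra.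
- have [c /andP[xc cy] e] := mvt_le xy is_derive_ch.
  have := sh_le (ltW xc); have : 0 < y - x by lra.
  by nra.
- have [c /andP[yc cx] e] := mvt_le xy is_derive_ch.
  have := sh_le (ltW cx); have : 0 < x - y by lra.
  by nra.
Qed.

Lemma ch_continuous : continuous ch.
Proof.
move=> x; apply: differentiable_continuous; apply/derivable1_diffP.
by have ? := is_derive_ch x; exact: ex_derive.
Qed.

Lemma sh_continuous : continuous sh.
Proof.
move=> x; apply: differentiable_continuous; apply/derivable1_diffP.
by have ? := is_derive_sh x; exact: ex_derive.
Qed.

(** A function [f] of the form [F (t ^ 2)] with [F] strictly convex: the slope
    [f' t / t] is increasing because [f''] is. *)
Lemma chord_lt (f g h : R -> R) (M a x b : R) :
  (forall t, is_derive t (1 : R) f (g t)) ->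
  (forall t, is_derive t (1 : R) g (h t)) -> g 0 = 0 ->
  (forall u v, 0 <= u -> u < v -> v <= M -> h u < h v) ->
  0 <= a -> a < x -> x < b -> b <= M ->
  (b ^+ 2 - a ^+ 2) * f x < (b ^+ 2 - x ^+ 2) * f a + (x ^+ 2 - a ^+ 2) * f b.
Proof.
move=> df dg g0 hh a0 ax xb bM.
have slope u v : 0 < u -> u < v -> v <= M -> g u * v < g v * u.
  move=> u0 uv vM.
  have [c /andP[c0 cu]] := mvt_le u0 dg; rewrite g0 !subr0 => e1.
  have [d /andP[ud dv] e2] := mvt_le uv dg.
  have : h c < h d by apply: hh; lraw cu dv ud vM.
  have : 0 < u * (v - u) by rewrite mulr_gt0//; lra.
  by nra.
have ka : 0 < x ^+ 2 - a ^+ 2 by nra.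
have kb : 0 < b ^+ 2 - x ^+ 2 by nra.
rewrite ltNge; apply/negP => bad.
(* Subtracting k t^2 equalises the end values. If the claim failed, [F] would rise and then fall, so
   its derivative would be nonnegative at [c] and nonpositive at the later [d], against the strict
   growth of g t / t. *)
set k := (f b - f a) / (b ^+ 2 - a ^+ 2).
have kE : k * (b ^+ 2 - a ^+ 2) = f b - f a by rewrite divfK//; lra.
pose F (t : R) := f t - k * t ^+ 2.
have dF t : is_derive t (1 : R) F (g t - k * (2 * t)).
  have ? := df t.
  by apply: is_derive_eq; rewrite /GRing.scale /=; lraw.
have Fab : F a = F b by rewrite /F; lra.
have Fx : F a <= F x.
  rewrite -subr_ge0.
  have : 0 <= (b ^+ 2 - a ^+ 2) * (F x - F a).
    suff -> : (b ^+ 2 - a ^+ 2) * (F x - F a) = (b ^+ 2 - a ^+ 2) * f x -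
      ((b ^+ 2 - x ^+ 2) * f a + (x ^+ 2 - a ^+ 2) * f b).
      by lra.
    rewrite /F; rewrite (_ : _ * _ = (b ^+ 2 - a ^+ 2) * (f x - f a) -
      (k * (b ^+ 2 - a ^+ 2)) * (x ^+ 2 - a ^+ 2)); last by ring.
    by rewrite kE; ring.
  by rewrite pmulr_rge0//; lra.
have [c /andP[ac cx] e1] := mvt_le ax dF.
have [d /andP[xd db] e2] := mvt_le xb dF.
have h1 : 0 <= g c - k * (2 * c).
  rewrite -(@pmulr_lge0 _ (x - a)); lraw Fx ac cx e1.
have h2 : g d - k * (2 * d) <= 0.
  rewrite -(@pmulr_lle0 _ (b - x)); lraw Fab Fx db e2 xd.
have : g c * d < g d * c by apply: slope; lraw a0 ac bM cx db xd.
have c0 : 0 < c by lraw a0 ac.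
have d0 : 0 < d by lraw cx xd.
by nra.
Qed.

Lemma chord_le (f g h : R -> R) (M a x b : R) :
  (forall t, is_derive t (1 : R) f (g t)) ->
  (forall t, is_derive t (1 : R) g (h t)) -> g 0 = 0 ->
  (forall u v, 0 <= u -> u < v -> v <= M -> h u < h v) ->
  0 <= a -> a <= x -> x <= b -> b <= M ->
  (b ^+ 2 - a ^+ 2) * f x <= (b ^+ 2 - x ^+ 2) * f a + (x ^+ 2 - a ^+ 2) * f b.
Proof.
move=> df dg g0 hh a0; rewrite le_eqVlt => /orP[/eqP <-|ax]; first by lra.
rewrite le_eqVlt => /orP[/eqP <-|xb] bM; first by lra.
by apply: ltW; apply: chord_lt dg g0 hh _ _ _ _.
Qed.

Lemma ch_chord (a x b : R) : 0 <= a -> a <= x -> x <= b ->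
  (b ^+ 2 - a ^+ 2) * ch x <= (b ^+ 2 - x ^+ 2) * ch a + (x ^+ 2 - a ^+ 2) * ch b.
Proof.
move=> a0 ax xb; apply: (@chord_le ch sh ch b) => //.
- exact: is_derive_ch.
- exact: is_derive_sh.
- exact: sh0.
- by move=> u v u0 uv _; exact: ch_lt.
Qed.

(** On [0, pi] the second derivative - cos increases strictly, as [chord_lt] requires. *)
Lemma cos_chord_lt (a x b : R) : 0 <= a -> a < x -> x < b -> b <= pi ->
  (b ^+ 2 - a ^+ 2) * cos x < (b ^+ 2 - x ^+ 2) * cos a + (x ^+ 2 - a ^+ 2) * cos b.
Proof.
move=> a0 ax xb bpi.
apply: (@chord_lt cos (fun t => - sin t) (fun t => - cos t) pi) => //.
- by rewrite sin0 oppr0.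
- move=> u v u0 uv vpi; rewrite ltrN2 ltr_cos// in_itv/=; lra.
Qed.

Lemma cos_chord (a x b : R) : 0 <= a -> a <= x -> x <= b -> b <= pi ->
  (b ^+ 2 - a ^+ 2) * cos x <= (b ^+ 2 - x ^+ 2) * cos a + (x ^+ 2 - a ^+ 2) * cos b.
Proof.
move=> a0; rewrite le_eqVlt => /orP[/eqP <-|ax]; first by lra.
rewrite le_eqVlt => /orP[/eqP <-|xb] bM; first by lra.
by apply: ltW; exact: cos_chord_lt.
Qed.

End Hyperbolic.

(** * Comparison inequalities *)
Section Comparison.
Variable R : realType.
Local Notation ch := (@hcosh R).
Local Notation sh := (@hsinh R).

(** Stewart's formula of the hyperbolic plane of curvature -1. Written without division, it stays
    meaningful for a side c = 0. *)
Definition hyp_cmp (a b c tau e : R) : Prop :=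
  sh ((1 - tau) * c) * ch a + sh (tau * c) * ch b <= ch e * sh c.

Lemma hyp_cmp0 (a b c : R) : hyp_cmp a b c 0 a.
Proof. by rewrite /hyp_cmp subr0 mul1r mul0r sh0; lra. Qed.

Lemma hyp_cmp1 (a b c : R) : hyp_cmp a b c 1 b.
Proof. by rewrite /hyp_cmp subrr mul1r mul0r sh0; lra. Qed.

(** The hypothesis is the discrete form of f'' <= c^2 f, and the left side of the conclusion,
    divided by sh c, solves f'' = c^2 f with the same end values. The difference [G] has no negative
    minimum: there 2 G x <= G (x - h) + G (x + h) <= 2 ch (h c) G x < 2 G x. *)
Lemma hyp_interp (f : R -> R) (c : R) : 0 <= c ->
  {within `[0, 1], continuous f} ->
  (forall x h, 0 <= h -> 0 <= x - h -> x + h <= 1 ->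
     f (x - h) + f (x + h) <= 2 * ch (h * c) * f x) ->
  forall t, 0 <= t <= 1 ->
  sh ((1 - t) * c) * f 0 + sh (t * c) * f 1 <= f t * sh c.
Proof.
rewrite le_eqVlt => /orP[/eqP <- _ _ t _|c0 fc fmid t t01].
  by rewrite !mulr0 sh0; lra.
pose G (x : R) := f x * sh c - (sh ((1 - x) * c) * f 0 + sh (x * c) * f 1).
suff : 0 <= G t by rewrite /G; lra.
have G0 : G 0 = 0 by rewrite /G subr0 mul1r mul0r sh0; ring.
have G1 : G 1 = 0 by rewrite /G subrr mul1r mul0r sh0; ring.
have Gc : {within `[0, 1], continuous G}.
  move=> x; apply: cvgB.
    by apply: cvgM; [exact: fc|exact: cvg_cst].
  have cl (u : R -> R) : continuous u -> {within `[0, 1], continuous u}.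
    exact: continuous_subspaceT.
  apply: cvgD; apply: cvgM; try exact: cvg_cst.
    apply: (cl (fun x => sh ((1 - x) * c))) => y.
    have h : (1 - z) * c @[z --> y] --> (1 - y) * c.
      apply: cvgM; last exact: cvg_cst.
      by apply: cvgB; [exact: cvg_cst|exact: cvg_id].
    exact: (cvg_comp _ _ h (@sh_continuous _ _)).
  apply: (cl (fun x => sh (x * c))) => y.
  have h : z * c @[z --> y] --> y * c.
    by apply: cvgM; [exact: cvg_id|exact: cvg_cst].
  exact: (cvg_comp _ _ h (@sh_continuous _ _)).
have [x0 /itvP x01 xmin] := EVT_min (@ler01 R) Gc.
have xmin' s : 0 <= s <= 1 -> G x0 <= G s by move=> ?; apply: xmin; rewrite in_itv.
apply: le_trans (xmin' _ t01).
rewrite leNgt; apply/negP => neg.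
have x0p : 0 < x0.
  by rewrite lt_neqAle !x01 andbT; apply/eqP => e; move: neg; rewrite -e G0 ltxx.
have x0q : x0 < 1.
  by rewrite lt_neqAle !x01 andbT; apply/eqP => e; move: neg; rewrite e G1 ltxx.
pose h := Num.min x0 (1 - x0).
have hx : h <= x0 by rewrite ge_min lexx.
have hx1 : h <= 1 - x0 by rewrite ge_min lexx orbT.
have h0 : 0 < h by rewrite lt_min x0p subr_gt0.
have m1 : G x0 <= G (x0 - h) by apply: xmin'; lra.
have m2 : G x0 <= G (x0 + h) by apply: xmin'; lra.
have fm : f (x0 - h) + f (x0 + h) <= 2 * ch (h * c) * f x0.
  by apply: fmid; lraw hx hx1.
have shc : 0 < sh c by rewrite sh_gt0.
have : G (x0 - h) + G (x0 + h) <= 2 * ch (h * c) * G x0.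
  rewrite /G.
  rewrite (_ : (1 - (x0 - h)) * c = (1 - x0) * c + h * c); last by ring.
  rewrite (_ : (1 - (x0 + h)) * c = (1 - x0) * c - h * c); last by ring.
  rewrite (_ : (x0 - h) * c = x0 * c - h * c); last by ring.
  rewrite (_ : (x0 + h) * c = x0 * c + h * c); last by ring.
  rewrite !shB !shD.
  have := ler_wpM2r (ltW shc) fm.
  by lraw.
have : 1 < ch (h * c) by rewrite -(@ch0 R); apply: ch_lt => //; rewrite mulr_gt0.
by nra.
Qed.

(** Again a minimum principle, but without a factor ch (h c) > 1: the step [h] has to reach the
    nearer end of [0, 1], where [G] vanishes. *)
Lemma flat_interp (f : R -> R) (c : R) :
  {within `[0, 1], continuous f} ->
  (forall x h, 0 <= h -> 0 <= x - h -> x + h <= 1 ->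
     f (x - h) + f (x + h) <= 2 * f x + 2 * (h * c) ^+ 2) ->
  forall t, 0 <= t <= 1 ->
  (1 - t) * f 0 + t * f 1 - t * (1 - t) * c ^+ 2 <= f t.
Proof.
move=> fc fmid t t01.
pose G (x : R) := f x - ((1 - x) * f 0 + x * f 1 - x * (1 - x) * c ^+ 2).
suff : 0 <= G t by rewrite /G; lra.
have G0 : G 0 = 0 by rewrite /G; ring.
have G1 : G 1 = 0 by rewrite /G; ring.
have Gc : {within `[0, 1], continuous G}.
  have hc : {within `[0, 1], continuous
      (fun x => (1 - x) * f 0 + x * f 1 - x * (1 - x) * c ^+ 2)}.
    have -> : (fun x => (1 - x) * f 0 + x * f 1 - x * (1 - x) * c ^+ 2) =
      horner ((1 - 'X) * (f 0)%:P + 'X * (f 1)%:P - 'X * (1 - 'X) * (c ^+ 2)%:P).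
      by apply/funext => y; rewrite !hornerE.
    by apply: continuous_subspaceT; exact: continuous_horner.
  by move=> x; apply: cvgB; [exact: fc|exact: hc].
have [x0 /itvP x01 xmin] := EVT_min (@ler01 R) Gc.
have xmin' s : 0 <= s <= 1 -> G x0 <= G s by move=> ?; apply: xmin; rewrite in_itv.
apply: le_trans (xmin' _ t01).
rewrite leNgt; apply/negP => neg.
have x0p : 0 <= x0 by rewrite x01.
have x0q : x0 <= 1 by rewrite x01.
have fm h : 0 <= h -> 0 <= x0 - h -> x0 + h <= 1 ->
    G (x0 - h) + G (x0 + h) <= 2 * G x0.
  by move=> a1 a2 a3; have := fmid _ _ a1 a2 a3; rewrite /G; lra.
have [hh|hh] := leP x0 (1 - x0).
  have := fm x0 x0p; rewrite subrr G0 => /(_ (lexx _)) h1.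
  have : G x0 <= G (x0 + x0) by apply: xmin'; lraw hh x0p.
  by lra.
have h1 : G (x0 - (1 - x0)) + G (x0 + (1 - x0)) <= 2 * G x0 by apply: fm; lraw hh x0q.
have e : x0 + (1 - x0) = 1 by lra.
have : G x0 <= G (x0 - (1 - x0)) by apply: xmin'; lra.
by move: h1; rewrite e G1; lraw neg.
Qed.

(** As a function of t^2, [ch] is convex ([ch_chord]), so ch a and ch b lie below the chord from |e
    - h| to e + h. At these two ends the squares add up to 2 e^2 + 2 h^2 and the values of [ch] to 2
    ch h ch e. *)
Lemma mid_hyp_of_flat (a b e h : R) : 0 <= e -> 0 <= h ->
  `|e - h| <= a <= e + h -> `|e - h| <= b <= e + h ->
  a ^+ 2 + b ^+ 2 <= 2 * e ^+ 2 + 2 * h ^+ 2 ->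
  ch a + ch b <= 2 * ch h * ch e.
Proof.
move=> e0 h0 /andP[Ma aP] /andP[Mb bP] S.
have cE : ch `|e - h| + ch (e + h) = 2 * ch h * ch e.
  by rewrite ch_abs chB chD; ring.
rewrite -cE; set M := `|e - h| in Ma Mb cE *.
have M0 : 0 <= M by exact: normr_ge0.
have M2 : M ^+ 2 = (e - h) ^+ 2 by rewrite /M real_normK// num_real.
have MP : M <= e + h by lra.
move: MP; rewrite le_eqVlt => /orP[/eqP MP|MP].
  have -> : a = e + h by lra.
  have -> : b = e + h by lra.
  by rewrite MP.
have ca := ch_chord M0 Ma aP; have cb := ch_chord M0 Mb bP.
have cc := ch_le M0 (ltW MP).
have d0 : 0 < (e + h) ^+ 2 - M ^+ 2 by nra.
rewrite -(ler_pM2l d0).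
have : 0 <= (2 * e ^+ 2 + 2 * h ^+ 2 - (a ^+ 2 + b ^+ 2)) * (ch (e + h) - ch M).
  by apply: mulr_ge0; lraw S cc.
by move: ca cb; rewrite M2; lra.
Qed.

(** The argument of [mid_hyp_of_flat] with [cos], which is convex in t^2 and decreasing on [0, pi]:
    too large a sum of squares would force too small a sum of cosines. *)
Lemma mid_flat_of_sph (a b e h : R) : 0 <= e -> 0 <= h -> e + h <= pi ->
  `|e - h| <= a <= e + h -> `|e - h| <= b <= e + h ->
  2 * cos h * cos e <= cos a + cos b ->
  a ^+ 2 + b ^+ 2 <= 2 * e ^+ 2 + 2 * h ^+ 2.
Proof.
move=> e0 h0 ehpi /andP[Ma aP] /andP[Mb bP] S.
have cE : cos `|e - h| + cos (e + h) = 2 * cos h * cos e.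
  have -> : cos `|e - h| = cos (e - h) by case: (ger0P (e - h)) => // _; rewrite cosN.
  by rewrite cosB cosD; ring.
move: S; rewrite -cE; set M := `|e - h| in Ma Mb cE *.
have M0 : 0 <= M by exact: normr_ge0.
have M2 : M ^+ 2 = (e - h) ^+ 2 by rewrite /M real_normK// num_real.
have MP : M <= e + h by lra.
move: MP; rewrite le_eqVlt => /orP[/eqP MP _|MP S].
  have -> : a = M by lra.
  have -> : b = M by lra.
  by move: M2 (M2); rewrite {1}MP; nra.
have ca := cos_chord M0 Ma aP ehpi; have cb := cos_chord M0 Mb bP ehpi.
have cc : cos (e + h) < cos M by rewrite ltr_cos// in_itv/=; lraw M0 Ma aP e0 ehpi h0.
have d0 : 0 < (e + h) ^+ 2 - M ^+ 2 by nra.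
rewrite leNgt; apply/negP => neg.
have : 0 < ((a ^+ 2 + b ^+ 2) - (2 * e ^+ 2 + 2 * h ^+ 2)) * (cos M - cos (e + h)).
  by apply: mulr_gt0; lraw cc neg.
have : 0 <= ((e + h) ^+ 2 - M ^+ 2) * (cos a + cos b - cos M - cos (e + h)).
  by apply: mulr_ge0; lraw S d0.
by move: ca cb; rewrite M2; lraw.
Qed.

(** This is the second-order part of the hypothesis as k tends to 0. For k <= 1 the remainder is at
    most [k ^+ 2 * B], so an excess [g] is refuted by a [k] small against g / B. *)
Lemma mid_flat_of_hyp (a b e h : R) : 0 <= e -> 0 <= h ->
  (forall k, 0 < k -> ch (k * a) + ch (k * b) <= 2 * ch (k * h) * ch (k * e)) ->
  a ^+ 2 + b ^+ 2 <= 2 * e ^+ 2 + 2 * h ^+ 2.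
Proof.
move=> e0 h0 H; pose M := e + h.
pose D := M ^+ 2 * ch M ^+ 2.
pose S := e ^+ 2 + h ^+ 2.
have S0 : 0 <= S by rewrite /S; nra.
have D0 : 0 <= D by rewrite /D -exprMn sqr_ge0.
pose B := 2 * S * D + S ^+ 2 * (1 + D) ^+ 2.
have B0 : 0 <= B.
  have : 0 <= S * D by exact: mulr_ge0.
  by have := sqr_ge0 (S * (1 + D)); rewrite exprMn /B; lra.
have key k : 0 < k -> k <= 1 ->
    a ^+ 2 + b ^+ 2 <= 2 * e ^+ 2 + 2 * h ^+ 2 + k ^+ 2 * B.
  move=> k0 k1; have := H _ k0.
  have [ga gb] := (ch_ge_sqr (k * a), ch_ge_sqr (k * b)).
  have M0 : 0 <= M by rewrite /M; lra.
  have kM : k * M <= M by rewrite ler_piMl.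
  have kM0 : 0 <= k * M by rewrite mulr_ge0// ltW.
  have C1 : ch (k * M) ^+ 2 <= 1 + k ^+ 2 * D.
    have := ch2_sh2 (k * M).
    have : sh (k * M) <= (k * M) * ch M by apply: sh_le_ch.
    have s0 := sh_ge0 kM0.
    move=> h1; have : sh (k * M) ^+ 2 <= (k * M * ch M) ^+ 2.
      by rewrite ler_sqr ?nnegrE// mulr_ge0// ltW// ch_gt0.
    by rewrite /D !exprMn; lra.
  set C := 1 + k ^+ 2 * D in C1.
  have ub x : 0 <= x <= M -> ch (k * x) <= 1 + k ^+ 2 * x ^+ 2 / 2 * C.
    move=> /andP[x0 xM]; apply: le_trans (@ch_le_sqr _ (k * x) (k * M) _) _.
      by rewrite ger0_norm ?mulr_ge0 ?(ltW k0)// ler_wpM2l// ltW.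
    rewrite lerD2l exprMn ler_wpM2l// divr_ge0// mulr_ge0 ?sqr_ge0//.
  have ue : ch (k * e) <= 1 + k ^+ 2 * e ^+ 2 / 2 * C by apply: ub; rewrite /M; lra.
  have uh : ch (k * h) <= 1 + k ^+ 2 * h ^+ 2 / 2 * C by apply: ub; rewrite /M; lra.
  have pr : ch (k * h) * ch (k * e) <=
    (1 + k ^+ 2 * h ^+ 2 / 2 * C) * (1 + k ^+ 2 * e ^+ 2 / 2 * C).
    by apply: ler_pM => //; apply: ltW; exact: ch_gt0.
  move=> hk; rewrite !exprMn in ga gb.
  have k2 : 0 < k ^+ 2 by rewrite exprn_gt0.
  have k21 : k ^+ 2 <= 1 by rewrite expr_le1// ltW.
  have CD : C <= 1 + D by rewrite /C lerD2l ler_piMl.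
  have C0 : 0 <= C by rewrite /C addr_ge0// mulr_ge0// ltW.
  rewrite -(ler_pM2l k2).
  have e1 : k ^+ 2 * (a ^+ 2 + b ^+ 2) / 2 <=
      k ^+ 2 * S * C + 2 * (k ^+ 2) ^+ 2 * (h ^+ 2 * e ^+ 2 / 4) * C ^+ 2.
    by rewrite /S; lraw ga gb hk pr.
  have e2 : h ^+ 2 * e ^+ 2 <= S ^+ 2 by rewrite /S; nra.
  have e3 : h ^+ 2 * e ^+ 2 * C ^+ 2 <= S ^+ 2 * (1 + D) ^+ 2.
    apply: ler_pM => //; first by rewrite mulr_ge0 ?sqr_ge0.
      exact: sqr_ge0.
    by rewrite ler_sqr ?nnegrE//; lraw C0 CD.
  have e4 : (k ^+ 2) ^+ 2 * (h ^+ 2 * e ^+ 2 * C ^+ 2) <=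
      (k ^+ 2) ^+ 2 * (S ^+ 2 * (1 + D) ^+ 2).
    by rewrite ler_wpM2l// sqr_ge0.
  rewrite /B /C /S in e1 e4 *; lraw e1 e4.
rewrite leNgt; apply/negP => neg.
pose g := a ^+ 2 + b ^+ 2 - (2 * e ^+ 2 + 2 * h ^+ 2).
have g0 : 0 < g by rewrite /g; lra.
pose k := Num.min 1 (g / (2 * (B + 1))).
have B1 : 0 < 2 * (B + 1) by lra.
have k0 : 0 < k by rewrite lt_min ltr01 divr_gt0.
have k1 : k <= 1 by rewrite ge_min lexx.
have kg : k <= g / (2 * (B + 1)) by rewrite ge_min lexx orbT.
have := key _ k0 k1.
have : k ^+ 2 * B <= k * B.
  by rewrite ler_wpM2r// expr2 ler_piMl// ltW.
have : k * B <= k * (B + 1) by rewrite ler_pM2l//; lraw.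
have : k * (B + 1) <= g / 2.
  by move: kg; rewrite ler_pdivlMr//; lraw.
rewrite /g; lraw neg.
Qed.

End Comparison.

(** * Metric preliminaries *)
Section MetricPrelim.
Variable R : realType.
Variables (T : Type) (d : T -> T -> R).

Definition is_pseudometric : Prop :=
  [/\ forall a, d a a = 0, forall a b, d a b = d b a &
      forall a b c, d a c <= d a b + d b c].

Lemma metric_pseudo : is_metric d -> is_pseudometric.
Proof. by case. Qed.

Lemma pm_ge0 a b : is_pseudometric -> 0 <= d a b.
Proof. by case=> d0 ds dt; have := dt a b a; rewrite d0 (ds b a); lra. Qed.

Lemma geod_sub g a b (u v : R) : is_pseudometric -> is_geodesic d g a b ->
  0 <= u <= 1 -> 0 <= v <= 1 ->
  is_geodesic d (fun s => g (u + s * (v - u))) (g u) (g v).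
Proof.
move=> _ [g0 g1 gd] u01 v01; split.
- by congr g; ring.
- by congr g; ring.
- move=> s t s01 t01; have [s0 s1] := andP s01; have [t0 t1] := andP t01.
  have [[u0 u1] [v0 v1]] := (andP u01, andP v01).
  rewrite !gd //; try (apply/andP; split; nra).
  rewrite (_ : u + s * (v - u) - (u + t * (v - u)) = (s - t) * (v - u)); last by ring.
  by rewrite normrM (distrC v u) mulrA.
Qed.

Lemma geod_rev g a b : is_geodesic d g a b -> (forall x y, d x y = d y x) ->
  is_geodesic d (fun s => g (1 - s)) b a.
Proof.
move=> [g0 g1 gd] ds; split; rewrite ?subr0 ?subrr// => s t s01 t01.
rewrite gd; [|lra|lra].
by rewrite ds (_ : 1 - s - (1 - t) = t - s) 1?distrC//; ring.
Qed.

Lemma geod_d0 g a b t : is_geodesic d g a b -> 0 <= t <= 1 -> d a (g t) = t * d a b.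
Proof.
move=> [g0 g1 gd] t01; rewrite -{1}g0 gd//; last by rewrite lexx ler01.
by rewrite sub0r normrN ger0_norm//; case/andP: t01.
Qed.

Lemma geod_d1 g a b t : is_geodesic d g a b -> 0 <= t <= 1 ->
  d (g t) b = (1 - t) * d a b.
Proof.
move=> [g0 g1 gd] t01; rewrite -{1}g1 gd//; last by rewrite lexx ler01.
by rewrite distrC ger0_norm//; case/andP: t01 => *; rewrite subr_ge0.
Qed.

Lemma geom_small (q C e : R) : 0 <= q < 1 -> 0 < e ->
  exists N, forall n, (N <= n)%N -> C * q ^+ n < e.
Proof.
move=> /andP[q0 q1] e0.
have /cvgrPdist_lt/(_ _ e0) : (fun n => C * q ^+ n) @ \oo --> (0 : R).
  by rewrite -(mulr0 C); apply: cvgM; [exact: cvg_cst|apply: cvg_expr; rewrite ger0_norm].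
move=> [N _ h]; exists N => n Nn; have := h n Nn.
by rewrite /= sub0r normrN => /(le_lt_trans (ler_norm _)).
Qed.

Lemma geom_limit (v : nat -> T) (C q : R) : is_metric d -> complete_metric d ->
  0 <= q < 1 -> (forall n, d (v n) (v n.+1) <= C * q ^+ n) ->
  exists y, forall n, d (v n) y <= C / (1 - q) * q ^+ n.
Proof.
move=> dm dc q01 step; have dp := metric_pseudo dm; have [q0 q1] := andP q01.
have [d0 _ ds dt] := dm.
have q1' : 0 < 1 - q by lra.
have C0 : 0 <= C by have := step 0%N; rewrite expr0 mulr1; apply: le_trans; exact: pm_ge0.
have C1 : 0 <= C / (1 - q) by rewrite divr_ge0// ltW.
have far n k : d (v n) (v (n + k)%N) <= C / (1 - q) * q ^+ n * (1 - q ^+ k).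
  elim: k => [|k IH]; first by rewrite addn0 d0 expr0 subrr mulr0.
  apply: le_trans (dt _ (v (n + k)%N) _) _.
  have := step (n + k)%N; rewrite addnS => st.
  apply: le_trans (lerD IH st) _.
  rewrite exprD exprS -subr_ge0.
  rewrite (_ : _ - _ = 0)//; field.
  by rewrite gt_eqF.
have far' n k : (n <= k)%N -> d (v n) (v k) <= C / (1 - q) * q ^+ n.
  move=> nk; have := far n (k - n)%N; rewrite subnKC// => /le_trans; apply.
  have h : 0 <= C / (1 - q) * q ^+ n by rewrite mulr_ge0// exprn_ge0.
  by rewrite ler_piMr// gerBl exprn_ge0.
have [|y yl] := dc v.
  move=> e e0; have e2 : 0 < e / 2 by lra.
  have [N hN] := geom_small (C / (1 - q)) q01 e2.
  exists N => p p' Np Np'.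
  have h1 := le_lt_trans (far' N p Np) (hN N (leqnn N)).
  have h2 := le_lt_trans (far' N p' Np') (hN N (leqnn N)).
  by have := dt (v p) (v N) (v p'); rewrite (ds (v p) (v N)); lra.
exists y => n; rewrite leNgt; apply/negP => bad.
have [|N hN] := yl (d (v n) y - C / (1 - q) * q ^+ n); first by lra.
have h1 := hN (maxn n N) (leq_maxr _ _).
have h2 := far' n (maxn n N) (leq_maxl _ _).
by have := dt (v n) (v (maxn n N)) y; lra.
Qed.

End MetricPrelim.

(** * Local-to-global comparison *)
(** Scales for [ang_adj]: [m] is a parameter on the third side, and h = m tau (1 - tau) keeps both h
    / tau and h / (1 - tau) below [m]. These are the parameters that cut pieces of equal length off
    the two parts of a geodesic divided at [tau]. *)
Lemma adj_scale (R : realType) (tau e1 e2 u1 u2 u3 : R) :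
  0 < e1 -> 0 < e2 -> 0 < tau -> tau < 1 -> 0 < u1 -> 0 < u2 -> 0 < u3 <= 1 ->
  exists m h, [/\ 0 < m /\ m <= 1, [/\ m <= e1, m <= e2 & m <= u3],
    [/\ 0 < h, h <= tau & h <= 1 - tau],
    [/\ 0 < h / tau, h / tau <= e1 & h / tau <= u1] &
    [/\ 0 < h / (1 - tau), h / (1 - tau) <= e2 & h / (1 - tau) <= u2]].
Proof.
move=> e10 e20 t0 t1 u10 u20 /andP[u30 u31].
pose m := Num.min (Num.min e1 e2) (Num.min (Num.min u1 u2) u3).
have m0 : 0 < m by rewrite !lt_min e10 e20 u10 u20 u30.
have [me1 me2 mu1 mu2 mu3] : [/\ m <= e1, m <= e2, m <= u1, m <= u2 & m <= u3].
  by rewrite /m !ge_min !lexx !orbT.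
have t1' : 0 < 1 - tau by lra.
have sm : m * tau * (1 - tau) / tau = m * (1 - tau) by field; rewrite gt_eqF.
have sp : m * tau * (1 - tau) / (1 - tau) = m * tau by rewrite mulfK// gt_eqF.
have mt0 : 0 < m * tau by rewrite mulr_gt0.
have mt1 : 0 < m * (1 - tau) by rewrite mulr_gt0.
have mt2 : m * tau <= m by rewrite ler_piMr ?ltW.
have mt3 : m * (1 - tau) <= m by rewrite ler_piMr ?ltW//; lra.
exists m, (m * tau * (1 - tau)); rewrite sm sp; split; try (split; lra).
split; first by rewrite mulr_gt0.
  by rewrite mulrAC ler_piMl ?(ltW t0)//; lraw mt0 mu3 u31.
by rewrite ler_piMl ?(ltW t1')//; lraw mt1 mu3 u31.
Qed.

Section Globalization.
Variable R : realType.
Variables (T : Type) (D Y : T -> T -> R).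
Local Notation ch := (@hcosh R).
Local Notation sh := (@hsinh R).

(** [D] carries the geodesics and the balls, [Y] is the distance compared. For Y = D this is a local
    curvature bound -1; the other application has for [Y] the first component of a split
    distance. *)
Definition loc_cmp (y : T) (rho : R) : Prop :=
  forall p q r (g : R -> T) tau,
    D y p < rho -> D y q < rho -> D y r < rho ->
    is_geodesic D g q r -> 0 <= tau <= 1 ->
    hyp_cmp (Y p q) (Y p r) (Y q r) tau (Y p (g tau)).

Definition geod_from (al : R -> T) : Prop := is_geodesic D al (al 0) (al 1).

(** Cosine of the comparison angle at the common origin, by the hyperbolic law of cosines; it is 0
    when a side has [Y]-length 0. *)
Definition chat (al be : R -> T) (s t : R) : R :=
  (ch (s * Y (al 0) (al 1)) * ch (t * Y (be 0) (be 1)) - ch (Y (al s) (be t))) /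
  (sh (s * Y (al 0) (al 1)) * sh (t * Y (be 0) (be 1))).

Definition is_ang (al be : R -> T) (c : R) : Prop :=
  forall e, 0 < e -> exists2 eps, 0 < eps &
    forall s t, 0 < s <= eps -> 0 < t <= eps -> `|chat al be s t - c| <= e.

Definition ang (al be : R -> T) : R := xget 0 (is_ang al be).

Definition hinge (al be : R -> T) : Prop :=
  [/\ geod_from al, geod_from be & al 0 = be 0].

Definition hinge_len (al be : R -> T) : R := D (al 0) (al 1) + D (be 0) (be 1).

(** [ch] of the third side of the model triangle with the same two sides and the same angle. *)
Definition hinge_side (al be : R -> T) : R :=
  ch (Y (al 0) (al 1)) * ch (Y (be 0) (be 1)) -
  ang al be * (sh (Y (al 0) (al 1)) * sh (Y (be 0) (be 1))).

Definition good_hinge (al be : R -> T) : Prop :=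
  ch (Y (al 1) (be 1)) <= hinge_side al be.

Hypothesis Dmet : is_metric D.
Hypothesis Ypm : is_pseudometric Y.
Hypothesis YD : forall a b, Y a b <= D a b.
Hypothesis Ygeo : forall g a b, is_geodesic D g a b ->
  forall s t, 0 <= s <= 1 -> 0 <= t <= 1 -> Y (g s) (g t) = `|s - t| * Y a b.

Let Dpm : is_pseudometric D. Proof. exact: metric_pseudo. Qed.
Let Yge0 a b : 0 <= Y a b. Proof. exact: pm_ge0. Qed.
Let Dge0 a b : 0 <= D a b. Proof. exact: pm_ge0. Qed.

Lemma Ygeo0 al t : geod_from al -> 0 <= t <= 1 ->
  Y (al 0) (al t) = t * Y (al 0) (al 1).
Proof.
move=> ga t01; rewrite (Ygeo ga)// ?lexx ?ler01//.
by rewrite sub0r normrN ger0_norm//; case/andP: t01.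
Qed.

Lemma chat_sym al be s t : chat al be s t = chat be al t s.
Proof.
case: Ypm => _ ys _.
by rewrite /chat (ys (al s)) [ch (s * _) * _]mulrC [sh (s * _) * _]mulrC.
Qed.

Lemma is_ang_sym al be c : is_ang al be c -> is_ang be al c.
Proof.
by move=> h e e0; have [eps ep0 H] := h e e0; exists eps => // s t s0 t0;
  rewrite chat_sym; exact: H.
Qed.

Lemma is_ang_uniq al be c c' : is_ang al be c -> is_ang al be c' -> c = c'.
Proof.
move=> h h'; apply/eqP; rewrite -subr_eq0 -normr_eq0; apply/eqP.
apply/le_anti; rewrite normr_ge0 andbT leNgt; apply/negP => pos.
have pos3 : 0 < `|c - c'| / 3 by lra.
have [e1 e10 H1] := h _ pos3; have [e2 e20 H2] := h' _ pos3.
pose e := Num.min e1 e2.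
have ee1 : e <= e1 by rewrite ge_min lexx.
have ee2 : e <= e2 by rewrite ge_min lexx orbT.
have e0 : 0 < e by rewrite lt_min e10.
have a1 : `|chat al be e e - c| <= `|c - c'| / 3 by apply: H1; rewrite e0.
have a2 : `|chat al be e e - c'| <= `|c - c'| / 3 by apply: H2; rewrite e0.
have := ler_distD (chat al be e e) c c'; rewrite (distrC c (chat _ _ _ _)); lraw a1 a2 pos.
Qed.

Lemma angE al be c : is_ang al be c -> ang al be = c.
Proof.
move=> h; rewrite /ang; case: xgetP => [c' _ h'|/(_ c)//].
exact: is_ang_uniq h' h.
Qed.

(** Comparison at an interior point of one side, rewritten: shortening that side lowers the
    comparison cosine, that is, enlarges the comparison angle. *)
Lemma chat_alg (A A' B f f' : R) : 0 < A' -> A' <= A -> 0 < B ->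
  sh (A - A') * ch B + sh A' * ch f <= ch f' * sh A ->
  (ch A' * ch B - ch f') / (sh A' * sh B) <= (ch A * ch B - ch f) / (sh A * sh B).
Proof.
move=> A'0 AA B0 H.
have hA : 0 < sh A by rewrite sh_gt0; lra.
have hA' : 0 < sh A' by rewrite sh_gt0.
have hB : 0 < sh B by rewrite sh_gt0.
rewrite ler_pdivrMr ?mulr_gt0//.
rewrite [leRHS]mulrAC ler_pdivlMr ?mulr_gt0//.
suff /(ler_wpM2r (ltW hB)) : (ch A' * ch B - ch f') * sh A <= (ch A * ch B - ch f) * sh A'.
  by lra.
by move: H; rewrite shB; lra.
Qed.

(** In terms of angles: the inequality at the midpoint of a segment of length 2 A makes the two
    comparison angles at the midpoint add up to at most pi. *)
Lemma adj_alg (A B f1 f2 : R) : 0 <= A -> 0 <= B ->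
  sh A * ch f1 + sh A * ch f2 <= ch B * sh (A + A) ->
  0 <= (ch A * ch B - ch f1) / (sh A * sh B) + (ch A * ch B - ch f2) / (sh A * sh B).
Proof.
move=> A0 B0; rewrite -mulrDl shD.
move: A0; rewrite le_eqVlt => /orP[/eqP <- _|A0 H].
  by rewrite sh0 mul0r invr0 mulr0.
have sA : 0 < sh A by rewrite sh_gt0.
apply: divr_ge0; last by apply: mulr_ge0; [exact: ltW|exact: sh_ge0].
have {}H : sh A * (ch f1 + ch f2) <= sh A * (2 * ch B * ch A) by lra.
by move: H; rewrite ler_pM2l//; lra.
Qed.

Lemma chat_ge al be s t : hinge al be -> 0 <= s <= 1 -> 0 <= t <= 1 ->
  -1 <= chat al be s t.
Proof.
move=> [ga gb e0] s01 t01; rewrite /chat.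
set A := s * _; set B := t * _.
have A0 : 0 <= A by rewrite mulr_ge0//; case/andP: s01.
have B0 : 0 <= B by rewrite mulr_ge0//; case/andP: t01.
have [->|h] := eqVneq (sh A * sh B) 0; first by rewrite invr0 mulr0 lerN10.
have hp : 0 < sh A * sh B by rewrite lt_neqAle eq_sym h mulr_ge0// sh_ge0.
rewrite ler_pdivlMr//.
have : ch (Y (al s) (be t)) <= ch (A + B).
  apply: ch_le => //; case: Ypm => _ ys yt.
  by apply: le_trans (yt _ (al 0) _) _; rewrite ys Ygeo0// lerD2l e0 Ygeo0.
by rewrite chD; lra.
Qed.

Lemma chat_mono1 y rho al be s s' t : loc_cmp y rho -> hinge al be ->
  (forall s, 0 <= s <= 1 -> D y (al s) < rho) ->
  (forall s, 0 <= s <= 1 -> D y (be s) < rho) ->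
  0 < s' <= s -> s <= 1 -> 0 < t <= 1 ->
  chat al be s' t <= chat al be s t.
Proof.
move=> L [ga gb e0] ina inb /andP[s'0 ss] s1 /andP[t0 t1].
have [a0|a0] := eqVneq (Y (al 0) (al 1)) 0.
  by rewrite /chat a0 !mulr0 sh0 !mul0r invr0 !mulr0.
have [b0|b0] := eqVneq (Y (be 0) (be 1)) 0.
  by rewrite /chat b0 !mulr0 sh0 !mulr0 invr0 !mulr0.
have ap : 0 < Y (al 0) (al 1) by rewrite lt_neqAle eq_sym a0 Yge0.
have bp : 0 < Y (be 0) (be 1) by rewrite lt_neqAle eq_sym b0 Yge0.
have s0 : 0 < s by lra.
have z01 : 0 <= (0 : R) <= 1 by rewrite lexx ler01.
have s01 : 0 <= s <= 1 by lra.
have gs := geod_sub Dpm ga z01 s01.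
have f01 : 0 <= s' / s <= 1.
  by rewrite divr_ge0 ?(ltW s0) ?(ltW s'0)//= ler_pdivrMr// mul1r.
have := L (be t) (al 0) (al s) _ (s' / s) (inb _ _) (ina _ z01) (ina _ s01) gs f01.
rewrite (_ : 0 + s' / s * (s - 0) = s'); last by rewrite subr0 add0r divfK// gt_eqF.
case: (Ypm) => _ ys yt.
have Yb : Y (be t) (al 0) = t * Y (be 0) (be 1).
  by rewrite ys e0 Ygeo0//; lraw t1.
rewrite /hyp_cmp (Ygeo0 ga s01) Yb (ys (be t) (al s)) (ys (be t) (al s')).
move=> /(_ ltac:(lraw t1)) H.
apply: chat_alg; rewrite ?mulr_gt0// ?ler_pM2r//.
move: H; rewrite (_ : (1 - s' / s) * (s * Y (al 0) (al 1)) =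
  s * Y (al 0) (al 1) - s' * Y (al 0) (al 1)); last by field; rewrite gt_eqF.
by rewrite (_ : s' / s * (s * Y (al 0) (al 1)) = s' * Y (al 0) (al 1)) //; field; rewrite gt_eqF.
Qed.

Lemma chat_mono y rho al be s s' t t' : loc_cmp y rho -> hinge al be ->
  (forall s, 0 <= s <= 1 -> D y (al s) < rho) ->
  (forall s, 0 <= s <= 1 -> D y (be s) < rho) ->
  0 < s' <= s -> s <= 1 -> 0 < t' <= t -> t <= 1 ->
  chat al be s' t' <= chat al be s t.
Proof.
move=> L H ina inb s's s1 t't t1.
apply: (@le_trans _ _ (chat al be s t')).
  by apply: chat_mono1 L H ina inb s's s1 _; lra.
rewrite chat_sym [leRHS]chat_sym.
apply: chat_mono1 L _ inb ina t't t1 _; last by lra.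
by case: H.
Qed.

(** By monotonicity the limit is the infimum over all parameters, which [chat_ge] bounds from
    below. *)
Lemma ang_ex_in y rho al be : loc_cmp y rho -> hinge al be ->
  (forall s, 0 <= s <= 1 -> D y (al s) < rho) ->
  (forall s, 0 <= s <= 1 -> D y (be s) < rho) ->
  exists2 c, is_ang al be c &
    forall s t, 0 < s <= 1 -> 0 < t <= 1 -> c <= chat al be s t.
Proof.
move=> L H ina inb.
pose S := [set c | exists s t, [/\ 0 < s <= 1, 0 < t <= 1 & c = chat al be s t]].
have o1 : 0 < (1 : R) <= 1 by rewrite ltr01 lexx.
have S0 : S !=set0 by exists (chat al be 1 1), 1, 1.
have Sb : has_lbound S.
  by exists (-1) => _ [s [t [s0 t0 ->]]]; apply: chat_ge => //; lra.
have lb s t : 0 < s <= 1 -> 0 < t <= 1 -> inf S <= chat al be s t.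
  by move=> s0 t0; apply: ge_inf => //; exists s, t.
exists (inf S) => // e e0.
have [_ [s1 [t1 [s10 t10 ->]]] hl] : exists2 c, S c & c < inf S + e.
  by apply: inf_adherent => //; split.
exists (Num.min s1 t1); first by rewrite lt_min; lra.
move=> s t /andP[s0 sm] /andP[t0 tm].
have [ss st] : s <= s1 /\ t <= t1.
  by move: sm tm; rewrite !le_min => /andP[-> _] /andP[_ ->].
have h1 : inf S <= chat al be s t by apply: lb; lraw s10 ss st t10.
have h2 : chat al be s t <= chat al be s1 t1.
  by apply: chat_mono L H ina inb _ _ _ _; lraw s10 ss st t10.
by rewrite ger0_norm; lraw h1 h2 hl.
Qed.

Definition rst (u : R) (al : R -> T) : R -> T := fun s => al (u * s).

Lemma rst_geod u al : geod_from al -> 0 <= u <= 1 -> geod_from (rst u al).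
Proof.
move=> ga u01; have z01 : 0 <= (0 : R) <= 1 by rewrite lexx ler01.
have := geod_sub Dpm ga z01 u01.
rewrite /geod_from /rst mulr0 mulr1 subr0.
by congr is_geodesic; apply/funext => s; rewrite add0r mulrC.
Qed.

Lemma chat_rst u v al be s t : geod_from al -> geod_from be ->
  0 <= u <= 1 -> 0 <= v <= 1 ->
  chat (rst u al) (rst v be) s t = chat al be (u * s) (v * t).
Proof.
move=> ga gb u01 v01; rewrite /chat /rst !mulr0 !mulr1 (Ygeo0 ga u01) (Ygeo0 gb v01).
by rewrite !mulrA (mulrC s) (mulrC t).
Qed.

Lemma is_ang_rst u v al be c : geod_from al -> geod_from be ->
  0 < u <= 1 -> 0 < v <= 1 -> is_ang (rst u al) (rst v be) c <-> is_ang al be c.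
Proof.
move=> ga gb /andP[u0 u1] /andP[v0 v1]; split => h e e0; have [eps ep0 H] := h e e0.
  exists (Num.min u v * eps); first by rewrite mulr_gt0// lt_min u0.
  move=> s t /andP[s0 se] /andP[t0 te].
  have -> : s = u * (s / u) by rewrite mulrC divfK// gt_eqF.
  have -> : t = v * (t / v) by rewrite mulrC divfK// gt_eqF.
  rewrite -chat_rst//; try lra.
  have mu : Num.min u v <= u by rewrite ge_min lexx.
  have mv : Num.min u v <= v by rewrite ge_min lexx orbT.
  by apply: H; rewrite divr_gt0//= ler_pdivrMr//; nra.
exists eps => // s t /andP[s0 se] /andP[t0 te]; rewrite chat_rst//; try lra.
by apply: H; rewrite mulr_gt0//=; nra.
Qed.

Hypothesis loc : forall y, exists2 rho, 0 < rho & loc_cmp y rho.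

Lemma small_ball al (rho : R) : geod_from al -> 0 < rho ->
  exists2 u, 0 < u <= 1 & forall s, 0 <= s <= 1 -> D (al 0) (rst u al s) < rho.
Proof.
move=> ga r0; pose A := D (al 0) (al 1) + 1.
have A0 : 0 < A by rewrite /A; have := Dge0 (al 0) (al 1); lra.
exists (Num.min 1 (rho / (2 * A))).
  by rewrite lt_min ltr01 ge_min lexx divr_gt0 ?mulr_gt0.
set u := Num.min _ _ => s /andP[s0 s1].
have u0 : 0 < u by rewrite lt_min ltr01 divr_gt0 ?mulr_gt0.
have u1 : u <= 1 by rewrite ge_min lexx.
have ur : u <= rho / (2 * A) by rewrite ge_min lexx orbT.
rewrite /rst (geod_d0 ga); last by nra.
apply: (@le_lt_trans _ _ (u * A)).
  rewrite -mulrA ler_pM2l//; rewrite /A; have := Dge0 (al 0) (al 1); nra.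
move: ur; rewrite ler_pdivlMr ?mulr_gt0//; lra.
Qed.

Lemma ang_ex al be : hinge al be -> is_ang al be (ang al be).
Proof.
move=> [ga gb e0]; have [rho r0 L] := loc (al 0).
have [u u01 hu] := small_ball ga r0; have [v v01 hv] := small_ball gb r0.
have [|||c hc _] := @ang_ex_in (al 0) rho (rst u al) (rst v be) L.
- split; [apply: rst_geod => //; lra|apply: rst_geod => //; lra|].
  by rewrite /rst !mulr0.
- exact: hu.
- by rewrite e0.
have h : is_ang al be c by apply/(is_ang_rst _ ga gb u01 v01).
by rewrite (angE h).
Qed.

Lemma ang_sym al be : hinge al be -> ang al be = ang be al.
Proof. by move=> H; apply: angE; apply: is_ang_sym; apply: ang_ex; case: H. Qed.

Lemma ang_rst u v al be : hinge al be -> 0 < u <= 1 -> 0 < v <= 1 ->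
  ang (rst u al) (rst v be) = ang al be.
Proof.
move=> H u0 v0; apply: angE; case: (H) => ga gb _.
by apply/(is_ang_rst _ ga gb u0 v0); exact: ang_ex.
Qed.

Lemma ang_geN1 al be : hinge al be -> -1 <= ang al be.
Proof.
move=> H; rewrite leNgt; apply/negP => bad.
have [|eps ep0 h] := ang_ex H (e := (-1 - ang al be) / 2); first by lra.
pose e := Num.min eps 1.
have e0 : 0 < e by rewrite lt_min ep0 ltr01.
have ee : e <= eps by rewrite ge_min lexx.
have e1 : e <= 1 by rewrite ge_min lexx orbT.
have : `|chat al be e e - ang al be| <= (-1 - ang al be) / 2 by apply: h; lra.
have : -1 <= chat al be e e by apply: chat_ge => //; lra.
by move=> h1 /(le_trans (ler_norm _)); lra.
Qed.

(** Comparison at the midpoint of a short segment centred at [g tau] becomes [adj_alg]; the third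
    side is cut short too, so that all points lie in one comparison ball. In terms of angles:
    adjacent ones add up to at most pi. *)
Lemma ang_adj g a b tau be : is_geodesic D g a b -> 0 < tau < 1 ->
  geod_from be -> be 0 = g tau ->
  0 <= ang (fun s => g (tau + s * (0 - tau))) be +
       ang (fun s => g (tau + s * (1 - tau))) be.
Proof.
move=> gg /andP[t0 t1] gb b0; set am := fun s => _; set ap := fun s => _.
have tau01 : 0 <= tau <= 1 by lra.
have z01 : 0 <= (0 : R) <= 1 by rewrite lexx ler01.
have o01 : 0 <= (1 : R) <= 1 by rewrite lexx ler01.
have am0 : am 0 = g tau by rewrite /am mul0r addr0.
have ap0 : ap 0 = g tau by rewrite /ap mul0r addr0.
have am1 : am 1 = g 0 by rewrite /am; congr g; ring.
have ap1 : ap 1 = g 1 by rewrite /ap; congr g; ring.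
have gam : geod_from am by rewrite /geod_from am0 am1; exact: geod_sub Dpm gg _ _.
have gap : geod_from ap by rewrite /geod_from ap0 ap1; exact: geod_sub Dpm gg _ _.
have Hm : hinge am be by split => //; rewrite am0.
have Hp : hinge ap be by split => //; rewrite ap0.
rewrite leNgt; apply/negP => bad.
set e := - (ang am be + ang ap be) / 4.
have e0 : 0 < e by rewrite /e; lra.
have [e1 e10 h1] := ang_ex Hm e0; have [e2 e20 h2] := ang_ex Hp e0.
have [rho r0 L] := loc (g tau).
have [u1 u10 k1] := small_ball gam r0.
have [u2 u20 k2] := small_ball gap r0.
have [u3 u30 k3] := small_ball gb r0.
have [m [h [[m0 m1] [me1 me2 mu3] [h0 ht ht'] [sm0 sme smu] [sp0 spe spu]]]] :=
  adj_scale e10 e20 t0 t1 (andP u10).1 (andP u20).1 u30.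
have inb : D (g tau) (be m) < rho.
  rewrite -b0; have -> : be m = rst u3 be (m / u3).
    by rewrite /rst; congr be; rewrite mulrC divfK// gt_eqF//; case/andP: u30.
  case/andP: u30 => u3p _; apply: k3; apply/andP.
  by split; [apply: divr_ge0; exact: ltW|rewrite ler_pdivrMr ?mul1r].
have inm : D (g tau) (am (h / tau)) < rho.
  rewrite -am0; have -> : am (h / tau) = rst u1 am (h / tau / u1).
    by rewrite /rst; congr am; rewrite [RHS]mulrC divfK// gt_eqF//; case/andP: u10.
  by case/andP: u10 => u1p _; apply: k1; apply/andP;
    split; [apply: divr_ge0; exact: ltW|rewrite ler_pdivrMr ?mul1r].
have inp : D (g tau) (ap (h / (1 - tau))) < rho.
  rewrite -ap0; have -> : ap (h / (1 - tau)) = rst u2 ap (h / (1 - tau) / u2).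
    by rewrite /rst; congr ap; rewrite [RHS]mulrC divfK// gt_eqF//; case/andP: u20.
  by case/andP: u20 => u2p _; apply: k2; apply/andP;
    split; [apply: divr_ge0; exact: ltW|rewrite ler_pdivrMr ?mul1r].
have amh : am (h / tau) = g (tau - h).
  by rewrite /am; congr g; field; rewrite gt_eqF.
have aph : ap (h / (1 - tau)) = g (tau + h).
  by rewrite /ap divfK// gt_eqF// subr_gt0.
have i1 : 0 <= tau - h <= 1 by apply/andP; split; lraw ht ht'.
have i2 : 0 <= tau + h <= 1 by apply/andP; split; lraw ht'.
have hf01 : 0 <= (1 / 2 : R) <= 1 by lraw.
rewrite amh in inm; rewrite aph in inp.
have := L (be m) _ _ _ (1 / 2) inb inm inp (geod_sub Dpm gg i1 i2) hf01.
rewrite (_ : tau - h + 1 / 2 * (tau + h - (tau - h)) = tau); last by field.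
pose Lg := Y a b.
have Yam : Y (am 0) (am 1) = tau * Lg.
  by rewrite am0 am1 (Ygeo gg)// subr0 ger0_norm ?(ltW t0).
have Yap : Y (ap 0) (ap 1) = (1 - tau) * Lg.
  by rewrite ap0 ap1 (Ygeo gg)// distrC ger0_norm ?subr_ge0 ?(ltW t1).
have Yc : Y (g (tau - h)) (g (tau + h)) = 2 * h * Lg.
  rewrite (Ygeo gg)// (_ : tau - h - (tau + h) = - (2 * h)); last by ring.
  by rewrite normrN ger0_norm// mulr_ge0// ltW.
case: (Ypm) => _ ys yt.
rewrite /hyp_cmp Yc (ys (be m) (g tau)) -b0 Ygeo0//; last by rewrite ltW.
rewrite (_ : (1 - 1 / 2) * (2 * h * Lg) = h * Lg); last by field.
rewrite (_ : 1 / 2 * (2 * h * Lg) = h * Lg); last by field.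
rewrite (_ : 2 * h * Lg = h * Lg + h * Lg); last by ring.
move=> PS.
have c1 : `|chat am be (h / tau) m - ang am be| <= e.
  by apply: h1; apply/andP.
have c2 : `|chat ap be (h / (1 - tau)) m - ang ap be| <= e.
  by apply: h2; apply/andP.
suff : 0 <= chat am be (h / tau) m + chat ap be (h / (1 - tau)) m.
  have := le_trans (ler_norm _) c1; have := le_trans (ler_norm _) c2.
  by rewrite /e; lraw bad.
rewrite /chat Yam Yap (_ : h / tau * (tau * Lg) = h * Lg); last first.
  by rewrite mulrA divfK// gt_eqF.
rewrite (_ : h / (1 - tau) * ((1 - tau) * Lg) = h * Lg); last first.
  by rewrite mulrA divfK// gt_eqF// subr_gt0.
rewrite amh aph (ys (g (tau - h))) (ys (g (tau + h))).
by apply: adj_alg PS; rewrite mulr_ge0 ?Yge0// ltW.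
Qed.

Lemma degenerate_hinge al be : hinge al be -> Y (al 0) (al 1) = 0 -> good_hinge al be.
Proof.
move=> [ga gb e0] a0; rewrite /good_hinge /hinge_side a0 ch0 sh0 mul0r mulr0 subr0 mul1r.
apply: ch_le => //; case: Ypm => _ ys yt.
by apply: le_trans (yt _ (al 0) _) _; rewrite ys a0 add0r e0.
Qed.

Lemma good_sym al be : hinge al be -> good_hinge al be -> good_hinge be al.
Proof.
move=> H; rewrite /good_hinge /hinge_side (ang_sym H); case: Ypm => _ ys _.
by rewrite (ys (be 1)) (mulrC (ch (Y (be 0) _))) (mulrC (sh (Y (be 0) _))).
Qed.

Lemma loc_good y rho al be : loc_cmp y rho -> hinge al be ->
  (forall s, 0 <= s <= 1 -> D y (al s) < rho) ->
  (forall s, 0 <= s <= 1 -> D y (be s) < rho) -> good_hinge al be.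
Proof.
move=> L H ina inb; have [ga gb e0] := H.
have [a0|a0] := eqVneq (Y (al 0) (al 1)) 0; first exact: degenerate_hinge.
have [b0|b0] := eqVneq (Y (be 0) (be 1)) 0.
  apply: good_sym; first by case: H.
  by apply: degenerate_hinge => //; case: H.
have [c hc cle] := ang_ex_in L H ina inb.
rewrite /good_hinge /hinge_side (angE hc).
have o1 : 0 < (1 : R) <= 1 by rewrite ltr01 lexx.
have := cle 1 1 o1 o1; rewrite /chat !mul1r ler_pdivlMr; first by lra.
by rewrite mulr_gt0// sh_gt0 lt_neqAle eq_sym ?a0 ?b0 Yge0.
Qed.

Lemma side_alg (a A b b' c cm cp : R) : 0 < A -> A <= a -> 0 <= b' ->
  ch b' <= ch A * ch b - c * (sh A * sh b) ->
  ch b <= ch A * ch b' - cm * (sh A * sh b') -> 0 <= cm + cp ->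
  ch (a - A) * ch b' - cp * (sh (a - A) * sh b') <= ch a * ch b - c * (sh a * sh b).
Proof.
move=> A0 Aa b0 h1 h2 h3.
have sA : 0 < sh A by rewrite sh_gt0.
have saA : 0 <= sh (a - A) by apply: sh_ge0; lra.
have sb : 0 <= sh b' by exact: sh_ge0.
have sa : 0 <= sh a by apply: sh_ge0; lra.
rewrite -(ler_pM2l sA).
have k1 : 0 <= (cm + cp) * (sh (a - A) * sh b' * sh A).
  by rewrite !mulr_ge0// ltW.
have k2 := ler_wpM2r saA h2.
have k3 := ler_wpM2r sa h1.
have e1 : sh a = ch (a - A) * sh A + ch A * sh (a - A).
  by rewrite -{1}(subrK A a) (shD (a - A)); ring.
have k4 : ch b' * (ch (a - A) * sh A + ch A * sh (a - A)) = ch b' * sh a by rewrite -e1.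
have k5 : ch b * sh (a - A) = ch b * (sh a * ch A - ch a * sh A) by rewrite shB.
lraw k1 k2 k3 k4 k5.
Qed.

(** The left side measures how far the hinge fails. Since pq <= a + b it is at most (1 + c) sh a sh
    b, and comparison for the shortened side th a bounds (1 + c) sh (th a) sh b through the excess
    th a + b - b'. The factor 18 comes from th >= 1/18. *)
Lemma excess_alg (a b b' pq th c l : R) : -1 <= c -> 0 <= a -> a <= l -> 0 <= b -> b <= l ->
  0 <= b' -> 1 / 18 <= th -> th <= 1 -> b' <= th * a + b -> 0 <= pq -> pq <= a + b ->
  ch b' <= ch (th * a) * ch b - c * (sh (th * a) * sh b) ->
  ch pq - (ch a * ch b - c * (sh a * sh b)) <=
    18 * ch l * sh (2 * l) * (th * a + b - b').
Proof.
move=> c1 a0 al b0 bl b'0 th1 th2 ex0 pq0 pqab h.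
have ta0 : 0 <= th * a by apply: mulr_ge0; lraw a0 th1.
have taa : th * a <= a by apply: ler_piMl; lraw a0 th2.
have k1 : ch pq <= ch a * ch b + sh a * sh b by rewrite -chD; exact: ch_le.
have k2 : (1 + c) * (sh (th * a) * sh b) <= ch (th * a + b) - ch b' by rewrite chD; lra.
have k3 := ch_sub_le b'0 ex0.
have k4 : sh (th * a + b) <= sh (2 * l) by apply: sh_le; lra.
have k5 : (th * a + b - b') * sh (th * a + b) <= (th * a + b - b') * sh (2 * l).
  by apply: ler_wpM2l => //; lraw ex0.
have k6 : sh a <= 18 * ch l * sh (th * a).
  apply: le_trans (sh_le_ch a0 al) _.
  have : a <= 18 * (th * a) by nra.
  have := sh_geid ta0; have := ch_gt0 l => cl sg ag.
  have : a * ch l <= 18 * sh (th * a) * ch l by rewrite ler_pM2r//; lraw ag sg.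
  by lraw.
have k7 : (1 + c) * (sh a * sh b) <= (1 + c) * (18 * ch l * sh (th * a) * sh b).
  by rewrite ler_wpM2l ?ler_wpM2r ?sh_ge0//; lraw c1.
have k8 : 18 * ch l * ((1 + c) * (sh (th * a) * sh b)) <=
    18 * ch l * ((th * a + b - b') * sh (2 * l)).
  by rewrite ler_wpM2l ?mulr_ge0 ?(ltW (ch_gt0 _))//; lraw k2 k3 k5.
lraw k1 k7 k8.
Qed.

Hypothesis Dgeo : forall a b, exists g, is_geodesic D g a b.
(** Hinge lengths are measured in [D] but model sides in [Y]: a step that saves little [D]-length
    must have a small [Y]-excess. For Y = D this follows from the triangle inequality. *)
Hypothesis Yexcess : forall a b c,
  (Y a b + Y b c - Y a c) ^+ 2 <= (D a b + D b c + D a c) * (D a b + D b c - D a c).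

(** The ends [p] and [q] are those of a longer hinge and never move while its vertex slides; the
    vertices of the small hinges stay near both. With 2/3 l in place of l the bound on the distances
    is l. *)
Definition small_good (p q : T) (l : R) : Prop :=
  forall al be, hinge al be -> hinge_len al be < l ->
    D p (al 0) < 3 / 2 * l -> D q (al 0) < 3 / 2 * l -> good_hinge al be.

(* Sliding the vertex along the longer side decreases the model side; if the
   hinge length hardly drops, the hinge is almost straight. *)
Lemma hinge_step l al be : hinge al be -> D (be 0) (be 1) <= D (al 0) (al 1) ->
  2 / 3 * l <= hinge_len al be -> hinge_len al be < l ->
  small_good (al 1) (be 1) (2 / 3 * l) ->
  exists al' be', [/\ hinge al' be', al' 1 = al 1, be' 1 = be 1,
    hinge_side al' be' <= hinge_side al be &
    exists2 ex, ch (Y (al 1) (be 1)) - hinge_side al be <= 18 * ch l * sh (2 * l) * ex &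
      ex ^+ 2 <= 4 * l * (hinge_len al be - hinge_len al' be')].
Proof.
move=> H; have [ga gb e0] := H; rewrite /hinge_len /small_good.
set A := D (al 0) (al 1); set B := D (be 0) (be 1) => BA l1 l2 small.
have A0 : 0 <= A by exact: Dge0.
have B0 : 0 <= B by exact: Dge0.
have l0 : 0 < l by lra.
have Ap : 0 < A by lra.
(* The piece th A is a third of 2/3 l - B. Since B < l / 2, the hinges over this piece at [al 0] and
   at [al th] are shorter than 5/9 l and 11/18 l, hence than 2/3 l; moreover th >= 1/18. *)
pose th := (2 / 3 * l - B) / (3 * A).
have A3 : 0 < 3 * A by lra.
have thA : th * (3 * A) = 2 / 3 * l - B by rewrite divfK// gt_eqF.
have th1 : 1 / 18 <= th by rewrite /th ler_pdivlMr//; lra.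
have th2 : th <= 2 / 3 by rewrite /th ler_pdivrMr//; lraw l1.
have th01 : 0 <= th <= 1 by apply/andP; split; lraw th1 th2.
have thp : 0 < th <= 1 by apply/andP; split; lraw th1 th2.
have tho : 0 < th < 1 by apply/andP; split; lraw th1 th2.
have o01 : 0 <= (1 : R) <= 1 by rewrite lexx ler01.
have z01 : 0 <= (0 : R) <= 1 by rewrite lexx ler01.
have [be' gb'] := Dgeo (al th) (be 1).
have b'0 : be' 0 = al th by case: gb'.
have b'1 : be' 1 = be 1 by case: gb'.
have gb'' : geod_from be' by rewrite /geod_from b'0 b'1.
pose am := fun s : R => al (th + s * (0 - th)).
pose ap := fun s : R => al (th + s * (1 - th)).
have am0 : am 0 = al th by rewrite /am mul0r addr0.
have ap0 : ap 0 = al th by rewrite /ap mul0r addr0.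
have am1 : am 1 = al 0 by rewrite /am; congr al; ring.
have ap1 : ap 1 = al 1 by rewrite /ap; congr al; ring.
have gam : geod_from am by rewrite /geod_from am0 am1; exact: geod_sub Dpm ga _ _.
have gap : geod_from ap by rewrite /geod_from ap0 ap1; exact: geod_sub Dpm ga _ _.
have Hm : hinge am be' by split => //; rewrite am0.
have Hp : hinge ap be' by split => //; rewrite ap0.
have H1 : hinge (rst th al) be by split => //; [exact: rst_geod|rewrite /rst mulr0].
have adj := ang_adj ga tho gb'' b'0.
have [Ds Dt] : (forall a b, D a b = D b a) /\ (forall a b c, D a c <= D a b + D b c).
  by case: Dpm.
have [Ys Yt] : (forall a b, Y a b = Y b a) /\ (forall a b c, Y a c <= Y a b + Y b c).
  by case: Ypm.
have Dx : D (al 0) (al th) = th * A by rewrite (geod_d0 ga).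
have Dp : D (al th) (al 1) = (1 - th) * A by rewrite (geod_d1 ga).
have Yx : Y (al 0) (al th) = th * Y (al 0) (al 1) by rewrite Ygeo0.
have Yp : Y (al th) (al 1) = (1 - th) * Y (al 0) (al 1).
  by rewrite (Ygeo ga)// distrC ger0_norm// subr_ge0; case/andP: th01.
set B' := D (al th) (be 1).
have B'le : B' <= th * A + B.
  by rewrite /B'; apply: le_trans (Dt _ (al 0) _) _; rewrite Ds Dx lerD2l e0.
have good1 : good_hinge (rst th al) be.
  apply: small => //; rewrite /hinge_len /rst ?mulr0 ?mulr1.
  - by rewrite Dx -/B; lraw BA l2 thA.
  - by rewrite Ds -/A; lraw B0 l2.
  - by rewrite Ds e0 -/B; lraw l2.
have good2 : good_hinge am be'.
  apply: small => //; rewrite /hinge_len ?am0 ?am1 ?b'0 ?b'1.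
  - by rewrite Ds Dx -/B'; lraw B'le BA l2 thA.
  - by rewrite Ds Dp; lraw B0 l2 thA.
  - by rewrite Ds -/B'; lraw B'le l2 thA.
move: good1; rewrite /good_hinge /hinge_side -[be in ang _ be](_ : rst 1 be = be); last first.
  by apply/funext => s; rewrite /rst mul1r.
rewrite ang_rst ?ltr01 ?lexx// /rst mulr0 mulr1 Yx => good1.
move: good2; rewrite /good_hinge /hinge_side am0 am1 b'0 b'1 (Ys (al th) (al 0)) Yx => good2.
rewrite (_ : Y (al 0) (be 1) = Y (be 0) (be 1)) in good2; last by rewrite e0.
exists ap, be'; split => //.
  have [a0|a0] := eqVneq (Y (al 0) (al 1)) 0.
    rewrite /hinge_side ap0 ap1 b'0 b'1 Yp a0 mulr0 ch0 sh0 !mul0r !mulr0 !subr0 !mul1r.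
    apply: ch_le => //; apply: le_trans (Yt _ (al 0) _) _.
    by rewrite Ys Yx a0 mulr0 add0r e0.
  have ap' : 0 < Y (al 0) (al 1) by rewrite lt_neqAle eq_sym a0 Yge0.
  have tap : 0 < th * Y (al 0) (al 1) by apply: mulr_gt0 => //; lraw tho.
  have := @side_alg (Y (al 0) (al 1)) (th * Y (al 0) (al 1)) _ _ _ _ _ tap _ (Yge0 _ _)
     good1 good2 adj.
  rewrite /hinge_side ap0 ap1 b'0 b'1 Yp.
  rewrite (_ : Y (al 0) (al 1) - th * Y (al 0) (al 1) = (1 - th) * Y (al 0) (al 1)).
    by apply; rewrite ler_piMl//; case/andP: th01.
  by ring.
exists (th * Y (al 0) (al 1) + Y (be 0) (be 1) - Y (al th) (be 1)).
  apply: excess_alg good1 => //; try lra.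
  - exact: ang_geN1.
  - by apply: le_trans (YD _ _) _; rewrite -/A; lraw B0 l2.
  - by apply: le_trans (YD _ _) _; rewrite -/B; lraw l2.
  - by apply: le_trans (Yt _ (al 0) _) _; rewrite Ys Yx lerD2l e0.
  - by apply: le_trans (Yt _ (al 0) _) _; rewrite Ys lerD2l e0.
have := Yexcess (al th) (al 0) (be 1).
rewrite (Ys (al th) (al 0)) (Ds (al th) (al 0)) Yx Dx -/B'.
rewrite (_ : Y (al 0) (be 1) = Y (be 0) (be 1)); last by rewrite e0.
rewrite (_ : D (al 0) (be 1) = B) => [/le_trans|]; last by rewrite e0.
apply.
rewrite ap0 ap1 b'0 b'1 Dp -/B'.
have B'0 : 0 <= B' by exact: Dge0.
have -> : A + B - ((1 - th) * A + B') = th * A + B - B' by ring.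
by apply: ler_wpM2r; lraw B'le l2 thA.
Qed.

Lemma hinge_len_sym al be : hinge_len al be = hinge_len be al.
Proof. by rewrite /hinge_len addrC. Qed.

Lemma hinge_side_sym al be : hinge al be -> hinge_side al be = hinge_side be al.
Proof.
move=> H; rewrite /hinge_side (ang_sym H).
by rewrite (mulrC (ch (Y (be 0) _))) (mulrC (sh (Y (be 0) _))).
Qed.

(** Along [hinge_step] the ends stay and the model side does not grow, so a hinge failing by [de]
    keeps failing by [de]. Each step then shortens the hinge by the fixed [eta], which cannot go on:
    below length 2/3 l the hinge is good by hypothesis. *)
Lemma small_good_extend l al be : hinge al be -> hinge_len al be < l ->
  small_good (al 1) (be 1) (2 / 3 * l) -> good_hinge al be.
Proof.
move=> H Hl small; rewrite /good_hinge leNgt; apply/negP => bad.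
set p := al 1 in small bad; set q := be 1 in small bad.
have l0 : 0 < l.
  by apply: le_lt_trans Hl; rewrite /hinge_len addr_ge0.
pose K := 18 * ch l * sh (2 * l).
have K0 : 0 < K by rewrite !mulr_gt0 ?ch_gt0 ?sh_gt0//; lra.
pose de := ch (Y p q) - hinge_side al be.
have de0 : 0 < de by rewrite subr_gt0.
pose eta := (de / K) ^+ 2 / (4 * l).
have eta0 : 0 < eta.
  by apply: divr_gt0; [apply: exprn_gt0; exact: divr_gt0|exact: mulr_gt0].
have sg' : small_good q p (2 / 3 * l) by move=> a b h1 h2 h3 h4; exact: small h1 h2 h4 h3.
have step a b : hinge a b -> hinge_len a b < l -> D (b 0) (b 1) <= D (a 0) (a 1) ->
    small_good (a 1) (b 1) (2 / 3 * l) -> Y (a 1) (b 1) = Y p q ->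
    de <= ch (Y (a 1) (b 1)) - hinge_side a b ->
    exists a' b', [/\ hinge a' b', a' 1 = a 1, b' 1 = b 1,
      de <= ch (Y (a 1) (b 1)) - hinge_side a' b' &
      hinge_len a' b' <= hinge_len a b - eta].
  move=> Hab ab1 ab2 sg Yab dab.
  have ab3 : 2 / 3 * l <= hinge_len a b.
    rewrite leNgt; apply/negP => sm.
    suff : good_hinge a b by rewrite /good_hinge; lra.
    have [_ _ ee] := Hab; have Ds : forall x y, D x y = D y x by case: Dpm.
    have := Dge0 (a 0) (a 1); have := Dge0 (b 0) (b 1); rewrite /hinge_len in ab1 => u1 u2.
    by apply: sg => //; rewrite Ds ?ee; rewrite ?ee in ab1 u2; lraw ab1 u1 u2.
  have [a' [b' [Hab' e1 e2 sd [ex ex1 ex2]]]] := hinge_step Hab ab2 ab3 ab1 sg.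
  exists a', b'; split => //; first by lraw dab sd.
  have exK : de / K <= ex by rewrite ler_pdivrMr// mulrC; exact: le_trans dab ex1.
  have dK0 : 0 <= de / K by rewrite divr_ge0// ltW.
  have : (de / K) ^+ 2 <= ex ^+ 2 by rewrite ler_sqr ?nnegrE//; lraw dK0 exK.
  move=> /le_trans/(_ ex2); rewrite -lerBlDr opprK => h.
  have : eta <= hinge_len a b - hinge_len a' b'.
    by rewrite /eta ler_pdivrMr ?mulr_gt0//; lraw h.
  by lraw.
have iter n : exists a b, [/\ hinge a b, a 1 = p, b 1 = q,
    de <= ch (Y p q) - hinge_side a b & hinge_len a b <= hinge_len al be - n%:R * eta].
  elim: n => [|n [a [b [Hab a1 b1 dab lab]]]].
    by exists al, be; split => //; rewrite mul0r subr0.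
  have ltl : hinge_len a b < l.
    apply: le_lt_trans Hl; apply: le_trans lab _.
    by rewrite gerBl mulr_ge0// ltW.
  have [ab|ab] := leP (D (b 0) (b 1)) (D (a 0) (a 1)).
    have [|||a' [b' [H' e1 e2 s1 s2]]] := step _ _ Hab ltl ab; rewrite ?a1 ?b1//.
    exists a', b'; split => //; rewrite ?e1 ?e2//; first by move: s1; rewrite a1 b1.
    by rewrite -natr1 mulrDl mul1r; lraw lab s2.
  (* The vertex slides along the longer side, so the sides are exchanged here. *)
  have Hba : hinge b a by case: Hab.
  have Ys : Y q p = Y p q by case: Ypm.
  have [||||a' [b' [H' e1 e2 s1 s2]]] := step b a Hba _ (ltW ab); rewrite ?a1 ?b1//.
  - by rewrite hinge_len_sym.
  - by rewrite hinge_side_sym// Ys.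
  exists b', a'; split => //; rewrite ?e1 ?e2//; first by case: H'.
    by move: s1; rewrite a1 b1 Ys hinge_side_sym.
  move: s2; rewrite hinge_len_sym (hinge_len_sym b).
  by rewrite -natr1 mulrDl mul1r; lraw lab.
have [n hn] : exists n : nat, l / eta < n%:R.
  by exists (Num.bound (l / eta)); apply: archi_boundP; rewrite divr_ge0// ltW.
have [a [b [Hab _ _ _ lab]]] := iter n.
have : 0 <= hinge_len a b by rewrite /hinge_len addr_ge0.
move: hn; rewrite ltr_pdivrMr//; lra.
Qed.

Hypothesis Dcpl : complete_metric D.

(** By [small_good_extend] a bad hinge of length below l yields a bad one of length below 2/3 l
    whose vertex is at distance O(l). The vertices form a geometric Cauchy sequence, and near its
    limit the local comparison contradicts badness. *)
Theorem global_hinge al be : hinge al be -> good_hinge al be.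
Proof.
move=> H; apply: contrapT => bad.
pose St := ((R -> T) * (R -> T))%type.
pose l0 := hinge_len al be + 1.
have l00 : 0 < l0 by rewrite /l0 /hinge_len ltr_wpDl// addr_ge0.
pose ll n := l0 * (2 / 3) ^+ n.
have ll0 n : 0 < ll n by rewrite mulr_gt0// exprn_gt0//; lra.
pose badst n (s : St) := [/\ hinge s.1 s.2, hinge_len s.1 s.2 < ll n & ~ good_hinge s.1 s.2].
have next (ns : nat * St) : exists s' : St, badst ns.1 ns.2 ->
    badst ns.1.+1 s' /\ D (ns.2.1 0) (s'.1 0) <= 2 * l0 * (2 / 3) ^+ ns.1.
  case: ns => n s /=; have [bs|nb] := pselect (badst n s); last by exists s.
  case: (bs) => Hs ls gs.
  have : ~ small_good (s.1 1) (s.2 1) (2 / 3 * ll n).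
    by move=> sg; apply: gs; exact: small_good_extend ls sg.
  move=> /existsNP[a /existsNP[b /not_implyP[Hab /not_implyP[lab
    /not_implyP[pa /not_implyP[qa nab]]]]]].
  exists (a, b) => _; split.
    by split => //=; rewrite /ll exprS mulrCA.
  have [_ Ds Dt] := Dpm; rewrite /=.
  apply: le_trans (Dt _ (s.1 1) _) _.
  have : D (s.1 0) (s.1 1) <= hinge_len s.1 s.2 by rewrite /hinge_len lerDl.
  by move: pa ls; rewrite /ll; lra.
have [F HF] := choice next.
pose sq := fix sq n := match n with 0%N => (al, be) | m.+1 => F (m, sq m) end.
have bsq n : badst n (sq n).
  elim: n => [|n IH]; first by split => //=; rewrite /ll expr0 mulr1 /l0; lra.
  by have [] := HF (n, sq n) IH.
have dsq n : D ((sq n).1 0) ((sq n.+1).1 0) <= 2 * l0 * (2 / 3) ^+ n.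
  by have [] := HF (n, sq n) (bsq n).
have q01 : 0 <= (2 / 3 : R) < 1 by apply/andP; split; lra.
have [y hy] := geom_limit Dmet Dcpl q01 dsq.
have [rho r0 L] := loc y.
pose C := 2 * l0 / (1 - 2 / 3).
have r2 : 0 < rho / 2 by lra.
have [N1 hN1] := geom_small C q01 r2.
have [N2 hN2] := geom_small l0 q01 r2.
pose n := maxn N1 N2.
have d1 : D ((sq n).1 0) y < rho / 2.
  by apply: le_lt_trans (hy n) _; apply: hN1; exact: leq_maxl.
have [Hn ln bn] := bsq n.
have d2 : hinge_len (sq n).1 (sq n).2 < rho / 2.
  by apply: lt_trans ln _; apply: hN2; exact: leq_maxr.
case: bn; have [_ Ds Dt] := Dpm; have [ga gb e0] := Hn.
have inn (g : R -> T) s : geod_from g -> D (g 0) y < rho / 2 -> D (g 0) (g 1) < rho / 2 ->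
    0 <= s <= 1 -> D y (g s) < rho.
  move=> gg g1 g2 s01; apply: le_lt_trans (Dt _ (g 0) _) _.
  rewrite Ds (geod_d0 gg s01).
  have : s * D (g 0) (g 1) <= D (g 0) (g 1) by rewrite ler_piMl//; case/andP: s01.
  by lraw g1 g2.
apply: (loc_good L Hn) => s s01; apply: inn => //.
- by apply: le_lt_trans d2; rewrite /hinge_len lerDl.
- by rewrite -e0.
- by apply: le_lt_trans d2; rewrite /hinge_len lerDr.
Qed.

(** The two hinges formed at [g tau] by the parts of [g] and a geodesic to [p] are good. Each is
    weighted by the [sh] term of the other part, and the angles drop out because their cosines have
    a nonnegative sum. *)
Theorem global_cmp p q r g tau : is_geodesic D g q r -> 0 <= tau <= 1 ->
  hyp_cmp (Y p q) (Y p r) (Y q r) tau (Y p (g tau)).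
Proof.
move=> gg /andP[]; rewrite le_eqVlt => /orP[/eqP <- _|t0].
  by case: (gg) => -> _ _; exact: hyp_cmp0.
rewrite le_eqVlt => /orP[/eqP ->|t1].
  by case: (gg) => _ -> _; exact: hyp_cmp1.
have t01 : 0 <= tau <= 1 by rewrite !ltW.
have tt : 0 < tau < 1 by rewrite t0.
have z01 : 0 <= (0 : R) <= 1 by rewrite lexx ler01.
have o01 : 0 <= (1 : R) <= 1 by rewrite lexx ler01.
have [be gb] := Dgeo (g tau) p.
have b0 : be 0 = g tau by case: gb.
have b1 : be 1 = p by case: gb.
have gb' : geod_from be by rewrite /geod_from b0 b1.
pose am := fun s : R => g (tau + s * (0 - tau)).
pose ap := fun s : R => g (tau + s * (1 - tau)).
have am0 : am 0 = g tau by rewrite /am mul0r addr0.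
have ap0 : ap 0 = g tau by rewrite /ap mul0r addr0.
have am1 : am 1 = q by case: (gg) => <- _ _; rewrite /am; congr g; ring.
have ap1 : ap 1 = r by case: (gg) => _ <- _; rewrite /ap; congr g; ring.
have gam : geod_from am.
  by rewrite /geod_from am0 am1; case: (gg) => <- _ _; exact: geod_sub Dpm gg _ _.
have gap : geod_from ap.
  by rewrite /geod_from ap0 ap1; case: (gg) => _ <- _; exact: geod_sub Dpm gg _ _.
have adj := ang_adj gg tt gb' b0.
have Hm : hinge am be by split => //; rewrite am0.
have Hp : hinge ap be by split => //; rewrite ap0.
have [_ Ys _] := Ypm.
have [gq gr _] := gg.
have Yq : Y (g tau) q = tau * Y q r.
  by rewrite -{1}gq (Ygeo gg)// subr0 ger0_norm// ltW.
have Yr : Y (g tau) r = (1 - tau) * Y q r.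
  by rewrite -{1}gr (Ygeo gg)// distrC ger0_norm// subr_ge0 ltW.
move: (global_hinge Hm) (global_hinge Hp).
rewrite /good_hinge /hinge_side am0 am1 ap0 ap1 b0 b1 Yq Yr (Ys q p) (Ys r p).
rewrite (Ys (g tau) p) /hyp_cmp; move: adj; rewrite -/am -/ap.
set cm := ang am be; set cp := ang ap be; set L := Y q r; set e := Y p (g tau).
move=> adj h1 h2.
have s1 : 0 <= sh (tau * L) by rewrite sh_ge0 ?mulr_ge0 ?Yge0// ltW.
have s2 : 0 <= sh ((1 - tau) * L).
  by rewrite sh_ge0 ?mulr_ge0 ?Yge0// subr_ge0 ltW.
have s3 : 0 <= sh e by rewrite sh_ge0 ?Yge0.
have k1 := ler_wpM2l s2 h1; have k2 := ler_wpM2l s1 h2.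
have k3 : 0 <= (cm + cp) * (sh (tau * L) * sh ((1 - tau) * L) * sh e).
  by rewrite !mulr_ge0.
have -> : sh L = sh (tau * L + (1 - tau) * L) by congr hsinh; ring.
rewrite shD; lraw k1 k2 k3.
Qed.

End Globalization.

(** * Consequences of the global comparison: monotone angles and contraction *)

Section GlobalCmp.
Variable R : realType.
Variables (T : Type) (D Y : T -> T -> R).
Local Notation ch := (@hcosh R).
Local Notation sh := (@hsinh R).

Definition glob_cmp : Prop := forall p q r (g : R -> T) tau,
  is_geodesic D g q r -> 0 <= tau <= 1 ->
  hyp_cmp (Y p q) (Y p r) (Y q r) tau (Y p (g tau)).

Hypothesis Dmet : is_metric D.
Hypothesis Ypm : is_pseudometric Y.
Hypothesis Ygeo : forall g a b, is_geodesic D g a b ->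
  forall s t, 0 <= s <= 1 -> 0 <= t <= 1 -> Y (g s) (g t) = `|s - t| * Y a b.
Hypothesis glob : glob_cmp.

Lemma glob_loc y rho : loc_cmp D Y y rho.
Proof. by move=> p q r g tau _ _ _; exact: glob. Qed.

Lemma geod_bounded (al be : R -> T) : hinge D al be -> exists2 rho,
  forall s, 0 <= s <= 1 -> D (al 0) (al s) < rho &
  forall s, 0 <= s <= 1 -> D (al 0) (be s) < rho.
Proof.
move=> [ga gb e0]; have Dpm := metric_pseudo Dmet.
have lt1 (x y s : R) : 0 <= x -> 0 <= y -> 0 <= s <= 1 -> s * x < x + y + 1.
  move=> x0 y0 /andP[s0 s1]; have : s * x <= x by rewrite ler_piMl.
  by lra.
exists (D (al 0) (al 1) + D (be 0) (be 1) + 1) => s s01.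
  by rewrite (geod_d0 ga s01) lt1// pm_ge0.
have -> : D (al 0) (be s) = s * D (be 0) (be 1) by rewrite e0 (geod_d0 gb s01).
by rewrite (addrC (D (al 0) _)) lt1 ?pm_ge0.
Qed.

Lemma glob_chat_mono al be s s' t t' : hinge D al be ->
  0 < s' <= s -> s <= 1 -> 0 < t' <= t -> t <= 1 ->
  chat Y al be s' t' <= chat Y al be s t.
Proof.
move=> H; have [rho ina inb] := geod_bounded H.
exact: (chat_mono Dmet Ypm Ygeo (@glob_loc (al 0) rho) H ina inb).
Qed.

Lemma glob_ang_le al be s t : hinge D al be -> 0 < s <= 1 -> 0 < t <= 1 ->
  ang Y al be <= chat Y al be s t.
Proof.
move=> H s0 t0; have [rho ina inb] := geod_bounded H.
have [c hc cl] := ang_ex_in Dmet Ypm Ygeo (@glob_loc (al 0) rho) H ina inb.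
by rewrite (angE hc); exact: cl.
Qed.

Lemma chat_le1 al be s t : hinge D al be -> 0 <= s <= 1 -> 0 <= t <= 1 ->
  chat Y al be s t <= 1.
Proof.
move=> [ga gb e0] s01 t01; rewrite /chat.
set A := s * _; set B := t * _.
have A0 : 0 <= A by rewrite mulr_ge0 ?pm_ge0//; case/andP: s01.
have B0 : 0 <= B by rewrite mulr_ge0 ?pm_ge0//; case/andP: t01.
have [->|h] := eqVneq (sh A * sh B) 0; first by rewrite invr0 mulr0 ler01.
have hp : 0 < sh A * sh B by rewrite lt_neqAle eq_sym h mulr_ge0// sh_ge0.
rewrite ler_pdivrMr// mul1r.
have : ch (A - B) <= ch (Y (al s) (be t)).
  rewrite -ch_abs; apply: ch_le => //; case: Ypm => _ ys yt.
  have hA : Y (al 0) (al s) = A by rewrite (Ygeo0 Ygeo ga s01).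
  have hB : Y (al 0) (be t) = B by rewrite e0 (Ygeo0 Ygeo gb t01).
  have := yt (al 0) (al s) (be t); have := yt (al 0) (be t) (al s).
  rewrite hA hB (ys (be t)) => h1 h2.
  by rewrite ler_norml; apply/andP; split; lra.
by rewrite chB; lra.
Qed.

(** The factor ch M absorbs sh x <= x ch M for sides up to M, the factor ch (2 M) the quadratic
    bound of [ch] at the distance of the contracted ends. *)
Definition contr_cst (M : R) : R := ch M * ch (2 * M).

Lemma contr_cst_ge1 M : 1 <= contr_cst M.
Proof. by rewrite -[1]mulr1 ler_pM// ch_ge1. Qed.

Lemma contr_alg (M a b c la dl d : R) : 0 <= la <= 1 -> 0 <= a <= M -> 0 <= b <= M ->
  c <= 1 -> 0 <= d -> 0 <= dl -> dl <= 2 * M ->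
  ch d = ch a * ch b - c * (sh a * sh b) ->
  ch (la * a) * ch (la * b) - c * (sh (la * a) * sh (la * b)) <= ch dl ->
  la * d <= contr_cst M * dl.
Proof.
move=> /andP[l0 l1] /andP[a0 aM] /andP[b0 bM] c1 d0 dl0 dlM h1 h2.
have C0 : 0 < ch M by exact: ch_gt0.
have C20 : 0 < ch (2 * M) by exact: ch_gt0.
have C1 : 1 <= ch M by exact: ch_ge1.
have C1' : 1 <= ch M ^+ 2 by nra.
have la0 : 0 <= la * a by rewrite mulr_ge0.
have lb0 : 0 <= la * b by rewrite mulr_ge0.
have k1 : la ^+ 2 * (ch (a - b) - 1) <= ch M ^+ 2 * (ch (la * (a - b)) - 1).
  have := @ch_le_sqr _ (a - b) M; rewrite ler_norml => /(_ ltac:(apply/andP; split; lraw a0 aM b0 bM)) u1.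
  have := ch_ge_sqr (la * (a - b)); rewrite exprMn => u2.
  have l20 : 0 <= la ^+ 2 by exact: sqr_ge0.
  have := ler_wpM2l l20 (_ : ch (a - b) - 1 <= (a - b) ^+ 2 / 2 * ch M ^+ 2).
  move=> /(_ ltac:(lraw u1)) u3.
  have := ler_wpM2l (le_trans ler01 C1') (_ : la ^+ 2 * (a - b) ^+ 2 / 2 <= ch (la * (a - b)) - 1).
  move=> /(_ ltac:(lraw u2)) u4.
  by lraw u3 u4.
have k2 : la ^+ 2 * (sh a * sh b) <= ch M ^+ 2 * (sh (la * a) * sh (la * b)).
  have u x : 0 <= x <= M -> la * sh x <= ch M * sh (la * x).
    move=> /andP[x0 xM]; apply: (@le_trans _ _ (la * (x * ch M))).
      by rewrite ler_wpM2l// sh_le_ch.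
    by rewrite mulrA mulrC ler_pM2l// sh_geid// mulr_ge0.
  have ua : la * sh a <= ch M * sh (la * a) by apply: u; rewrite a0.
  have ub : la * sh b <= ch M * sh (la * b) by apply: u; rewrite b0.
  have := ler_pM (mulr_ge0 l0 (sh_ge0 a0)) (mulr_ge0 l0 (sh_ge0 b0)) ua ub.
  by lraw.
have k3 : la ^+ 2 * (ch d - 1) <= ch M ^+ 2 * (ch dl - 1).
  have e1 : ch d = ch (a - b) + (1 - c) * (sh a * sh b) by rewrite h1 chB; ring.
  have e2 : ch (la * (a - b)) + (1 - c) * (sh (la * a) * sh (la * b)) <= ch dl.
    by apply: le_trans h2; rewrite mulrBr chB; lraw.
  have c1' : 0 <= 1 - c by lraw c1.
  have := ler_wpM2l c1' k2.
  have := ler_wpM2l (le_trans ler01 C1') e2.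
  by rewrite e1; lraw k1.
have k4 := ch_ge_sqr d.
have := @ch_le_sqr _ dl (2 * M); rewrite ger0_norm// => /(_ dlM) k5.
have k6 : (la * d) ^+ 2 <= (contr_cst M * dl) ^+ 2.
  have u1 := ler_wpM2l (sqr_ge0 la) (_ : d ^+ 2 / 2 <= ch d - 1).
  have {}u1 := u1 ltac:(lraw k4).
  have u2 := ler_wpM2l (le_trans ler01 C1') (_ : ch dl - 1 <= dl ^+ 2 / 2 * ch (2 * M) ^+ 2).
  have {}u2 := u2 ltac:(lraw k5).
  by rewrite /contr_cst !exprMn; lraw k3 u1 u2.
have := k6; rewrite ler_sqr// nnegrE; first by rewrite mulr_ge0.
by rewrite mulr_ge0// (le_trans ler01)// contr_cst_ge1.
Qed.

(** By monotonicity the contracted ends are at least as far apart as in the model triangle with the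
    comparison angle of the full hinge; there, scaling by [la] behaves as in the flat plane up to
    [contr_cst]. *)
Lemma contraction M al be la : hinge D al be ->
  Y (al 0) (al 1) <= M -> Y (be 0) (be 1) <= M -> 0 <= la <= 1 ->
  la * Y (al 1) (be 1) <= contr_cst M * Y (al la) (be la).
Proof.
move=> H aM bM l01; have [ga gb e0] := H; have [l0 l1] := andP l01.
have Y0 a b : 0 <= Y a b by exact: pm_ge0.
have C1 := contr_cst_ge1 M.
case: (Ypm) => _ ys yt.
have deg (u v : R -> T) : hinge D u v -> Y (u 0) (u 1) = 0 ->
    la * Y (u 1) (v 1) <= contr_cst M * Y (u la) (v la).
  move=> [gu gv uv] u0.
  have z x y w : Y x y = 0 -> Y x w = Y y w.
    by move=> e; apply/le_anti; have := yt x y w; have := yt y x w; rewrite (ys y x) e; lra.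
  have -> : Y (u 1) (v 1) = Y (v 0) (v 1) by rewrite -uv -(z _ _ _ u0).
  have ul : Y (u 0) (u la) = 0 by rewrite (Ygeo0 Ygeo gu l01) u0 mulr0.
  rewrite -(z _ _ _ ul) uv (Ygeo0 Ygeo gv l01) -[leLHS]mul1r ler_wpM2r//.
  by rewrite mulr_ge0.
have [a0|a0] := eqVneq (Y (al 0) (al 1)) 0; first exact: deg.
have [b0|b0] := eqVneq (Y (be 0) (be 1)) 0.
  by rewrite (ys (al 1)) (ys (al la)); apply: deg => //; case: H.
have ap : 0 < Y (al 0) (al 1) by rewrite lt_neqAle eq_sym a0 Y0.
have bp : 0 < Y (be 0) (be 1) by rewrite lt_neqAle eq_sym b0 Y0.
move: (l0); rewrite le_eqVlt => /orP[/eqP <-|lp].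
  by rewrite mul0r mulr_ge0// (le_trans ler01).
have o1 : 0 < (1 : R) <= 1 by rewrite ltr01 lexx.
have o01 : 0 <= (1 : R) <= 1 by rewrite ler01 lexx.
have lp1 : 0 < la <= 1 by rewrite lp.
have mono := glob_chat_mono H lp1 (lexx 1) lp1 (lexx 1).
apply: (@contr_alg M (Y (al 0) (al 1)) (Y (be 0) (be 1)) (chat Y al be 1 1)) => //.
- by rewrite Y0.
- by rewrite Y0.
- exact: chat_le1.
- apply: le_trans (yt _ (al 0) _) _.
  rewrite (ys (al la)) (Ygeo0 Ygeo ga l01) e0 (Ygeo0 Ygeo gb l01) -e0.
  have : la * Y (al 0) (al 1) <= Y (al 0) (al 1) by rewrite ler_piMl.
  have : la * Y (be 0) (be 1) <= Y (be 0) (be 1) by rewrite ler_piMl.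
  by rewrite -e0 in bM *; lraw aM bM.
- rewrite /chat !mul1r divfK; first by ring.
  by rewrite mulf_neq0// gt_eqF// sh_gt0.
- have sp : 0 < sh (la * Y (al 0) (al 1)) * sh (la * Y (be 0) (be 1)).
    by rewrite mulr_gt0// sh_gt0 mulr_gt0.
  move: (mono); rewrite {1}/chat ler_pdivrMr//; lraw.
Qed.

End GlobalCmp.

(** * Hausdorff measure and separated sets *)
Section Packing.
Variable R : realType.
Variables (T : Type) (d : T -> T -> R).

Definition separated (I : finType) (f : I -> T) (r : R) : Prop :=
  forall i j, i != j -> r <= d (f i) (f j).

Hypothesis dmet : is_metric d.
Hypothesis dcpl : complete_metric d.

Let dpm : is_pseudometric d. Proof. exact: metric_pseudo. Qed.
Let d_ge0 a b : 0 <= d a b. Proof. exact: pm_ge0. Qed.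

Lemma hterm_ge0 b A : (0 <= hterm d b A)%E.
Proof. by rewrite /hterm; case: pselect => h //=; rewrite lee_fin powR_ge0. Qed.

Lemma cover_of_null b (eta : R) : hausdorff_measure d b = 0%E -> 0 < eta ->
  exists2 U : nat -> set T, delta_covers d 1 U &
    (\sum_(i <oo) hterm d b (U i) < eta%:E)%E.
Proof.
move=> H0 e0.
have e0' : (0 < eta%:E)%E by rewrite lte_fin.
have h : (Hdelta d b 1 <= 0)%E.
  by rewrite -H0; apply: ereal_sup_ubound; exists 1 => //=; exact: ltr01.
by have /ereal_inf_lt[_ [U HU <-] hU] := le_lt_trans h e0'; exists U.
Qed.

Lemma le_diam (A : set T) a b delta : (forall a b, A a -> A b -> d a b <= delta) ->
  A a -> A b -> d a b <= alx_diam d A.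
Proof.
move=> bd Aa Ab; rewrite /alx_diam; apply: ub_le_sup; last by exists a, b.
by exists delta => _ [u [v [Au Av ->]]]; exact: bd.
Qed.

Lemma diam_ge0 (A : set T) delta : (forall a b, A a -> A b -> d a b <= delta) ->
  0 <= alx_diam d A.
Proof.
move=> bd; have [A0|/set0P[a Aa]] := eqVneq A set0; last first.
  by apply: le_trans (le_diam bd Aa Aa).
rewrite /alx_diam (_ : [set _ | _] = set0) ?sup0//.
by rewrite -subset0 => r [u [v [Au _ _]]]; move: Au; rewrite A0.
Qed.

(** The only trace of curvature in the packing argument: simultaneous contraction of a finite family
    towards an arbitrary centre. *)
Definition contracting (M C : R) : Prop := forall y la (I : finType) (f : I -> T),
  0 <= la <= 1 -> (forall i, d y (f i) <= M) ->
  exists g : I -> T, (forall i, d y (g i) = la * d y (f i)) /\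
    forall i j, la * d (f i) (f j) <= C * d (g i) (g j).

(** * Trees of separated points against covers of small total weight *)

Section Tree.
Variables (C b : R).
Hypothesis C1 : 1 <= C.
Hypothesis b0 : 0 <= b.
Hypothesis contr : contracting 2 C.
Variables (x : T) (s K : R) (I : finType) (f : I -> T).
Hypothesis s01 : 0 < s <= 1.
Hypothesis K1 : 1 <= K.
Hypothesis fin : forall i, d x (f i) <= s.
Hypothesis fsep : separated f (s / K).
Hypothesis bigI : 2 * (16 * C * K) `^ b <= #|I|%:R.

(** Ratio of consecutive radii of the tree. *)
Let q : R := (16 * C * K)^-1.

Let CK1 : 1 <= C * K. Proof. by rewrite -[1]mulr1 ler_pM// ler01. Qed.

Let CK16 : 1 <= 16 * C * K. Proof. by move: CK1; rewrite -mulrA; lra. Qed.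

Let q0 : 0 < q. Proof. by rewrite invr_gt0; apply: lt_le_trans CK16; exact: ltr01. Qed.

Let qle : q <= 16^-1.
Proof.
have := CK1; have := CK16 => h1 h2.
by rewrite lef_pV2 ?posrE//; lra.
Qed.

Let N2 : 2 <= #|I|%:R :> R.
Proof.
apply: le_trans bigI; have := ler_powR CK16 b0; rewrite powRr0.
by lra.
Qed.

Let Nq : 1 <= #|I|%:R * q `^ b.
Proof.
have e : (16 * C * K) `^ b * q `^ b = 1.
  have ck : 0 < 16 * C * K by apply: lt_le_trans CK16; exact: ltr01.
  rewrite -powRM; [|exact: ltW|exact: (ltW q0)].
  by rewrite mulfV ?powR1// gt_eqF.
have := ler_wpM2r (powR_ge0 q b) bigI; move: e; lra.
Qed.

(** The family [f] lies within 2 s of [y]; contraction by rho / (4 s) brings it within rho / 2, with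
    separation rho / (4 C K) = 4 q rho. *)
Lemma tree_children y rho : d x y <= s -> 0 < rho <= s ->
  exists g : I -> T, (forall i, d y (g i) <= rho / 2) /\ separated g (4 * q * rho).
Proof.
move=> xy /andP[r0 rs]; have [s0 s1] := andP s01.
have [_ ds dt] := dpm.
have f2 i : d y (f i) <= 2 * s.
  by apply: le_trans (dt _ x _) _; rewrite ds; have := fin i; lra.
have la01 : 0 <= rho / (4 * s) <= 1.
  apply/andP; split; first by rewrite divr_ge0//; lra.
  by rewrite ler_pdivrMr; lra.
have [i|g [g1 g2]] := contr (y := y) (f := f) la01; first by have := f2 i; lra.
have lE : rho / (4 * s) * s = rho / 4 by field; rewrite gt_eqF.
have la0 : 0 <= rho / (4 * s) by case/andP: la01.
exists g; split.
  by move=> i; rewrite g1; have := ler_wpM2l la0 (f2 i); lra.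
move=> i j ij; have := g2 i j; have := ler_wpM2l la0 (fsep ij) => h1 h2.
have C0 : 0 < C by exact: lt_le_trans ltr01 C1.
rewrite -(ler_pM2l C0); apply: le_trans h2; apply: le_trans h1.
rewrite [leRHS]mulrA lE /q.
by rewrite le_eqVlt; apply/orP; left; apply/eqP; field; rewrite !gt_eqF//; exact: lt_le_trans ltr01 K1.
Qed.

Variable U : nat -> set T.
Hypothesis Ucov : delta_covers d 1 U.

Let hr i : R := if pselect (U i = set0) then 0 else (alx_diam d (U i)) `^ b.

Let hrE i : hterm d b (U i) = (hr i)%:E.
Proof. by rewrite /hterm /hr; case: pselect. Qed.

Let hr0 i : 0 <= hr i.
Proof. by have := hterm_ge0 b (U i); rewrite hrE lee_fin. Qed.

Variable eta : R.
Hypothesis eta0 : 0 < eta.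
Hypothesis etas : 2 * eta <= (2 * q * s) `^ b.
Hypothesis Usum : (\sum_(i <oo) hterm d b (U i) < eta%:E)%E.

(** The summand eta / 2^(i+1) gives every member of the cover a positive weight, even one of
    diameter 0, and keeps the total below 2 eta. *)
Let W i : R := hr i + eta / (2 ^ i.+1)%:R.

Let W0 i : 0 < W i.
Proof. by rewrite /W ltr_wpDl// divr_gt0// ltr0n expn_gt0. Qed.

Definition meets i y rho : bool := `[< exists2 z, U i z & d y z <= rho >].

Let S y rho : \bar R := (\sum_(i <oo) (if meets i y rho then W i else 0)%:E)%E.

Let term_ge0 y rho i : (0 <= (if meets i y rho then W i else 0)%:E)%E.
Proof. by rewrite lee_fin; case: ifP => // _; exact: ltW. Qed.

Let S_ge0 y rho : (0 <= S y rho)%E.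
Proof. by apply: nneseries_ge0 => i _ _; exact: term_ge0. Qed.

Let S_lt y rho : (S y rho < (2 * eta)%:E)%E.
Proof.
apply: (@le_lt_trans _ _ (\sum_(i <oo) (hterm d b (U i) + (eta / (2 ^ i.+1)%:R)%:E))%E).
  apply: lee_nneseries => [i _ _|i _]; first exact: term_ge0.
  rewrite hrE -EFinD lee_fin -/(W i).
  by case: ifP => _; [exact: lexx|exact: ltW].
apply: le_lt_trans (epsilon_trick _ _ (ltW eta0)) _; first by move=> i; exact: hterm_ge0.
rewrite (_ : 2 * eta = eta + eta)%R; last by ring.
by rewrite EFinD lteD2rE.
Qed.

Let S_fin y rho : S y rho = (fine (S y rho))%:E.
Proof.
by rewrite fineK// ge0_fin_numE//; apply: lt_trans (S_lt _ _) _; exact: ltry.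
Qed.

Let W_le i y rho : meets i y rho -> (W i <= fine (S y rho))%R.
Proof.
move=> m; rewrite -lee_fin -S_fin /S.
apply: le_trans (nneseries_lim_ge i.+1 _) => [|n _ _]; last exact: term_ge0.
rewrite big_nat_recr//= m leeDr// sume_ge0// => k _; exact: term_ge0.
Qed.

(** Under the bound on [S], no member of the cover that meets the ball has diameter 2 q rho or more,
    whereas the child balls of radius q rho are at least that far apart. So a member meets at most
    one child ball, and some child carries at most the average weight. *)
Lemma tree_step y rho : d x y <= s -> 0 < rho <= s ->
  fine (S y rho) < (2 * q * rho) `^ b ->
  exists y', d y y' <= rho / 2 /\ #|I|%:R * fine (S y' (q * rho)) <= fine (S y rho).
Proof.
move=> xy rs Sy; have [r0 _] := andP rs.
have [g [g1 g2]] := tree_children xy rs.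
have [_ ds dt] := dpm; have qr0 : 0 < q * rho by rewrite mulr_gt0.
have qr : q * rho <= rho / 2.
  have : q * rho <= 16^-1 * rho by rewrite ler_pM2r.
  by lra.
have sub k i : meets k (g i) (q * rho) -> meets k y rho.
  move=> /asboolP[z Uz gz]; apply/asboolP; exists z => //.
  by apply: le_trans (dt _ (g i) _) _; have := g1 i; lra.
have one k i j : meets k (g i) (q * rho) -> meets k (g j) (q * rho) -> i = j.
  move=> mi mj; apply/eqP/negPn/negP => ij.
  have := le_lt_trans (W_le (sub _ _ mi)) Sy.
  case/asboolP: mi => z Uz gz; case/asboolP: mj => z' Uz' gz'.
  have hk : (alx_diam d (U k)) `^ b <= W k.
    rewrite /W /hr; case: pselect => [U0|U0] /=; first by move: Uz; rewrite U0.
    by rewrite lerDl divr_ge0// ltW.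
  move=> /(le_lt_trans hk); apply/negP; rewrite -leNgt.
  have bd := fun a b => Ucov.1 k a b.
  apply: ge0_ler_powR => //; rewrite ?nnegrE.
  - by rewrite mulr_ge0// ?mulr_ge0// ltW.
  - exact: diam_ge0 bd.
  - apply: le_trans (le_diam bd Uz Uz').
    have := g2 _ _ ij; have := dt (g i) z (g j); have := dt z z' (g j).
    by rewrite (ds z' (g j)); lra.
have sumS : \sum_i fine (S (g i) (q * rho)) <= fine (S y rho).
  rewrite -lee_fin -sumEFin -S_fin.
  under eq_bigr do rewrite -S_fin.
  rewrite /S -nneseries_sum; last by move=> i k _; exact: term_ge0.
  apply: lee_nneseries => [k _ _|k _].
    by apply: sume_ge0 => i _; exact: term_ge0.
  have [[i mi]|no] := pselect (exists i, meets k (g i) (q * rho)).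
    rewrite (bigD1 i)//= mi (sub _ _ mi) big1 ?adde0// => j ji.
    by case: ifP => // mj; move: ji; rewrite (one _ _ _ mj mi) eqxx.
  rewrite big1 ?term_ge0// => i _; case: ifP => // mi.
  by case: no; exists i.
apply: contrapT => no.
have lt i : fine (S y rho) < #|I|%:R * fine (S (g i) (q * rho)).
  by rewrite ltNge; apply/negP => h; apply: no; exists (g i).
have [i0] : exists i : I, true.
  have /card_gt0P[i _] : (0 < #|I|)%N by rewrite -(ltr0n R); have := N2; lra.
  by exists i.
have : \sum_(i : I) fine (S y rho) < \sum_(i : I) #|I|%:R * fine (S (g i) (q * rho)).
  by apply: ltr_sum => [|i _]; [apply/hasP; exists i0; rewrite ?mem_index_enum|exact: lt].
have N0 : 0 < #|I|%:R :> R by have := N2; lra.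
rewrite sumr_const -mulr_sumr -[X in X < _]mulr_natl ltr_pM2l//.
by move=> /lt_le_trans/(_ sumS); rewrite ltxx.
Qed.

(** Along light children the weight [S] is at least halved at each level, and the bound required by
    [tree_step] is inherited because #|I| q^b >= 1. The limit point lies in a member of the cover
    whose positive weight would be at most 2 eta 2^-n for all n. *)
Lemma tree_absurd : False.
Proof.
have [s0 s1] := andP s01; have [d0 ds dt] := dpm.
pose rho n := s * q ^+ n.
have q1 : q < 1 by have := qle; lra.
have r0 n : 0 < rho n by rewrite mulr_gt0// exprn_gt0.
have rS n : rho n.+1 = q * rho n by rewrite /rho exprS mulrCA.
have rs n : rho n <= s by rewrite ler_piMr ?(ltW s0)// exprn_ile1// ltW.
pose inv n y := [/\ d x y + rho n <= s, fine (S y (rho n)) < (2 * q * rho n) `^ b &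
  fine (S y (rho n)) <= 2 * eta * (1 / 2) ^+ n].
have next (ny : nat * T) : exists y', inv ny.1 ny.2 ->
    inv ny.1.+1 y' /\ d ny.2 y' <= s / 2 * q ^+ ny.1.
  case: ny => n y /=; have [iv|nv] := pselect (inv n y); last by exists y.
  case: (iv) => i1 i2 i3.
  have xy : d x y <= s by have := r0 n; lra.
  have rr : 0 < rho n <= s by rewrite r0 rs.
  have [y' [y1 y2]] := tree_step xy rr i2.
  exists y' => _; split; last by rewrite mulrAC.
  have St0 : 0 <= fine (S y' (q * rho n)) by rewrite fine_ge0.
  split.
  - rewrite rS; have := dt x y y'; have : q * rho n <= 16^-1 * rho n by rewrite ler_pM2r.
    by lra.
  - have q2r : 0 <= 2 * q * rho n by apply/ltW/mulr_gt0 => //; apply: mulr_gt0.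
    rewrite rS (mulrCA (2 * q) q) powRM//; last exact: ltW.
    have N0 : 0 < #|I|%:R :> R by have := N2; lra.
    rewrite -(ltr_pM2l N0); apply: le_lt_trans y2 _; apply: lt_le_trans i2 _.
    by rewrite [leRHS]mulrA -[leLHS]mul1r ler_wpM2r ?powR_ge0 ?Nq.
  - rewrite rS exprS; have : 2 * fine (S y' (q * rho n)) <= 2 * eta * (1 / 2) ^+ n.
      by apply: le_trans i3; apply: le_trans y2; rewrite ler_wpM2r// N2.
    by lra.
have [F HF] := choice next.
pose sq := fix sq n := match n with 0%N => x | m.+1 => F (m, sq m) end.
have isq n : inv n (sq n).
  elim: n => [|n IH]; last by have [] := HF (n, sq n) IH.
  have SL := S_lt x (rho 0%N); rewrite S_fin lte_fin in SL.
  split => /=; rewrite /rho expr0 mulr1 ?d0 ?add0r//.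
  - by move: SL; rewrite /rho expr0 mulr1 => /lt_le_trans; apply.
  - by move: SL; rewrite /rho expr0 !mulr1; exact: ltW.
have dsq n : d (sq n) (sq n.+1) <= s / 2 * q ^+ n.
  by have [] := HF (n, sq n) (isq n).
have q01 : 0 <= q < 1 by rewrite ltW.
have [z hz] := geom_limit dmet dcpl q01 dsq.
have hz' n : d (sq n) z <= rho n.
  apply: le_trans (hz n) _; rewrite /rho ler_wpM2r ?exprn_ge0 ?(ltW q0)//.
  have := qle; rewrite ler_pdivrMr => [h|]; [nra|lra].
have [k _ Ukz] := Ucov.2 z Logic.I.
have Wk n : W k <= 2 * eta * (1 / 2) ^+ n.
  have [_ _] := isq n; apply: le_trans; apply: W_le.
  by apply/asboolP; exists z.
have h01 : 0 <= (1 / 2 : R) < 1 by apply/andP; split; lra.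
have [n hn] := geom_small (2 * eta) h01 (W0 k).
by have := hn n (leqnn n); have := Wk n; lra.
Qed.

End Tree.

(** A family violating the bound would be the pattern of such a tree; 2 (16 C)^b is the threshold in
    [bigI]. *)
Lemma null_packing C b : 1 <= C -> 0 <= b -> contracting 2 C ->
  hausdorff_measure d b = 0%E ->
  exists2 A, 0 < A & forall x s K (I : finType) (f : I -> T),
    0 < s <= 1 -> 1 <= K -> (forall i, d x (f i) <= s) -> separated f (s / K) ->
    #|I|%:R <= A * K `^ b.
Proof.
move=> C1 b0 contr H0; exists (2 * (16 * C) `^ b).
  by rewrite mulr_gt0// powR_gt0; lra.
move=> x s K I f s01 K1 fin fsep; rewrite leNgt; apply/negP => big.
have bigI : 2 * (16 * C * K) `^ b <= #|I|%:R.
  by rewrite powRM ?mulrA ?ltW//; lra.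
have [s0 _] := andP s01.
pose eta := (2 * (16 * C * K)^-1 * s) `^ b / 2.
have CK : 0 < 16 * C * K by rewrite !mulr_gt0//; lraw C1 K1.
have eta0 : 0 < eta by rewrite divr_gt0// powR_gt0// mulr_gt0// mulr_gt0// invr_gt0.
have [U Ucov Usum] := cover_of_null H0 eta0.
apply: (@tree_absurd C b C1 b0 contr x s K I f s01 K1 fin fsep bigI U Ucov eta eta0 _ Usum).
by rewrite /eta mulrC divfK// pnatr_eq0.
Qed.

End Packing.

(** * From packing exponents back to null measures *)

Section Covering.
Variable R : realType.
Variables (T : Type) (d : T -> T -> R).
Hypothesis dmet : is_metric d.

Let dpm : is_pseudometric d. Proof. exact: metric_pseudo. Qed.
Let d_ge0 a b : 0 <= d a b. Proof. exact: pm_ge0. Qed.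

Lemma geod_affine g a b : is_geodesic d g a b ->
  forall s t, 0 <= s <= 1 -> 0 <= t <= 1 -> d (g s) (g t) = `|s - t| * d a b.
Proof. by case. Qed.

Lemma glob_contracting M : (forall a b, exists g, is_geodesic d g a b) ->
  glob_cmp d d -> contracting d M (contr_cst M).
Proof.
move=> geo gl y la I f l01 fM.
have [al Hal] := choice (fun i => geo y (f i)).
exists (fun i => al i la); split => [i|i j].
  by rewrite (geod_d0 (Hal i)).
have [ai0 ai1 _] := Hal i; have [aj0 aj1 _] := Hal j.
have H : hinge d (al i) (al j).
  by split; rewrite /geod_from ?ai0 ?ai1 ?aj0 ?aj1.
have := contraction (M := M) dmet dpm geod_affine gl H.
by rewrite ai0 ai1 aj0 aj1; apply.
Qed.

(** A separated family of maximal size is a net. *)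
Lemma max_net x0 r eta (M : R) : 0 <= r -> (forall (I : finType) (f : I -> T),
    (forall i, d x0 (f i) <= r) -> separated d f eta -> #|I|%:R <= M) -> 0 < eta ->
  exists N (h : nat -> T), N%:R <= M /\
    forall z, d x0 z <= r -> exists2 k, (k < N)%N & d (h k) z < eta.
Proof.
move=> r0 bd eta0.
pose P N := `[< exists (I : finType) (f : I -> T), [/\ #|I| = N,
  forall i, d x0 (f i) <= r & separated d f eta] >].
pose f0 (i : void) : T := match i with end.
have f0r : forall i, d x0 (f0 i) <= r by case.
have f0s : separated d f0 eta by case.
have M0 : 0 <= M by apply: le_trans (bd _ _ f0r f0s).
have exP : exists n, P n.
  by exists 0%N; apply/asboolP; exists void, f0; rewrite card_void.
have ubP n : P n -> (n <= Num.trunc M)%N.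
  move=> /asboolP[I [f [In fin fs]]]; rewrite -In.
  by rewrite truncn_ge_nat//; exact: bd fin fs.
case: (ex_maxnP exP ubP) => N /asboolP[I [f [IN fin fs]]] Nmax.
have cov z : d x0 z <= r -> exists i, d (f i) z < eta.
  move=> zr; apply: contrapT => /forallNP no.
  have : P N.+1.
    apply/asboolP; exists (option I), (fun o => if o is Some i then f i else z); split.
    - by rewrite card_option IN.
    - by case.
    - have [_ ds _] := dpm.
      case=> [i|] [j|] // ij.
      + by apply: fs; apply: contra_neq ij => ->.
      + by rewrite leNgt; apply/negP; exact: no.
      + by rewrite ds leNgt; apply/negP; exact: no.
  by move/Nmax; rewrite ltnn.
have [i0 _] : exists i, d (f i) x0 < eta.
  by apply: cov; have [d0 _ _] := dpm; rewrite d0.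
exists N, (fun k => f (nth i0 (enum I) k)); split; first by rewrite -IN; exact: bd.
move=> z /cov[i iz]; exists (enum_rank i); first by rewrite -IN.
by rewrite -(enum_val_nth i0) enum_rankK.
Qed.

Lemma hterm_le b (c : R) (A : set T) : 0 <= b -> 0 <= c ->
  (forall u v, A u -> A v -> d u v <= c) -> (hterm d b A <= (c `^ b)%:E)%E.
Proof.
move=> b0 c0 bd; rewrite /hterm; case: pselect => A0 /=; rewrite lee_fin.
  exact: powR_ge0.
apply: ge0_ler_powR; rewrite ?nnegrE//; first exact: (diam_ge0 dmet bd).
have [a Aa] : A !=set0 by apply/set0P/eqP.
apply: ge_sup; first by exists (d a a), a, a.
by move=> _ [u [v [Au Av ->]]]; exact: bd.
Qed.

Lemma nneseries_le_block (u : nat -> \bar R) N (c : R) :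
  (forall k, (0 <= u k)%E) -> (forall k, (k < N)%N -> (u k <= c%:E)%E) ->
  (forall k, (N <= k)%N -> u k = 0%E) ->
  (\sum_(k <oo) u k <= (N%:R * c)%:E)%E.
Proof.
move=> u0 uc u00; rewrite (nneseries_split _ N)//= add0n.
rewrite [X in (_ + X)%E]eseries0; last by move=> k Nk _; exact: u00.
rewrite adde0 big_nat; apply: (@le_trans _ _ (\sum_(0 <= k < N) c%:E)%E).
  by rewrite [leRHS]big_nat; apply: lee_sum => k /andP[_ kN]; exact: uc.
by rewrite sumEFin lee_fin big_const_nat iter_addr_0 subn0 mulr_natl.
Qed.

Lemma nneseries2 (u : nat -> nat -> \bar R) (f : nat -> nat * nat) :
  set_bij setT setT f -> (forall n k, (0 <= u n k)%E) ->
  (\sum_(i <oo) u (f i).1 (f i).2 = \sum_(n <oo) \sum_(k <oo) u n k)%E.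
Proof.
move=> bf u0; rewrite nneseries_esumT//.
rewrite -(@reindex_esum _ _ _ _ _ f (fun p => u p.1 p.2) bf).
rewrite nneseries_esumT; last by move=> n; apply: nneseries_ge0.
rewrite (_ : (fun n => \sum_(k <oo) u n k)%E =
  (fun n => \esum_(k in [set: nat]) u n k)%E); last first.
  by apply/funext => n; rewrite nneseries_esumT.
rewrite esum_esum//; congr esum.
by apply/seteqP; split.
Qed.

Lemma small_powR (be c : R) : 0 < be -> 0 < c -> exists2 e, 0 < e &
  forall x, 0 < x <= e -> x `^ be <= c.
Proof.
move=> be0 c0; exists (c `^ be^-1); first exact: powR_gt0.
move=> x /andP[x0 xe]; apply: le_trans (_ : (c `^ be^-1) `^ be <= _).
  by apply: ge0_ler_powR => //; rewrite ?nnegrE ?ltW// powR_gt0.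
by rewrite -powRrM mulVf ?gt_eqF// powRr1// ltW.
Qed.

Hypothesis geo : forall a b, exists g, is_geodesic d g a b.
Hypothesis glob : glob_cmp d d.

(** Contraction carries a separated family of the ball of radius M into the ball of radius r, the
    separation losing the constant factor [k]. *)
Lemma packing_all x0 r A b : 0 < r -> 0 < A -> 0 <= b ->
  (forall eta (I : finType) (f : I -> T), 0 < eta <= 1 ->
     (forall i, d x0 (f i) <= r) -> separated d f eta -> #|I|%:R <= A * eta^-1 `^ b) ->
  forall M, 0 < M -> exists2 A', 0 < A' &
    forall eta (I : finType) (f : I -> T), 0 < eta <= 1 ->
     (forall i, d x0 (f i) <= M) -> separated d f eta -> #|I|%:R <= A' * eta^-1 `^ b.
Proof.
move=> r0 A0 b0 H M M0.
pose la := Num.min 1 (r / M).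
have la0 : 0 < la by rewrite lt_min ltr01 divr_gt0.
have la1 : la <= 1 by rewrite ge_min lexx.
have laM : la * M <= r.
  by rewrite -ler_pdivlMr// ge_min lexx orbT.
have C1 := contr_cst_ge1 M; have C0 : 0 < contr_cst M by apply: lt_le_trans C1.
pose k := la / contr_cst M.
have k0 : 0 < k by rewrite divr_gt0.
have k1 : k <= 1 by rewrite ler_pdivrMr// mul1r (le_trans la1).
exists (A * k^-1 `^ b); first by rewrite mulr_gt0// powR_gt0// invr_gt0.
move=> eta I f /andP[e0 e1] fM fs.
have [|g [g1 g2]] := glob_contracting geo glob (M := M) (y := x0) (la := la) _ fM.
  by rewrite ltW.
have e : k^-1 `^ b * eta^-1 `^ b = (k * eta)^-1 `^ b.
  by rewrite (invfM k eta) powRM// invr_ge0 ltW.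
rewrite -mulrA e.
apply: (H (k * eta) I g).
- by rewrite mulr_gt0//= -[1]mulr1 ler_pM// ltW.
- move=> i; rewrite g1; apply: le_trans laM; rewrite ler_wpM2l ?(ltW la0)//.
- move=> i j ij; rewrite /k mulrAC ler_pdivrMr// mulrC [leRHS]mulrC.
  by apply: le_trans (g2 i j); rewrite mulrC ler_wpM2l ?(ltW la0)//; exact: fs.
Qed.

(** The balls of radius n + 1 exhaust the space. Each is covered by a net at its own scale eta
    contributing at most ep / 2^(n+1), which is possible since the number of cells times eta^b' is
    O(eta^(b' - b)). *)
Lemma packing_null x0 r A b b' : 0 < r -> 0 < A -> 0 <= b -> b < b' ->
  (forall eta (I : finType) (f : I -> T), 0 < eta <= 1 ->
     (forall i, d x0 (f i) <= r) -> separated d f eta -> #|I|%:R <= A * eta^-1 `^ b) ->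
  hausdorff_measure d b' = 0%E.
Proof.
move=> r0 A0 b0 bb' H; have b'0 : 0 <= b' by lra.
have be0 : 0 < b' - b by lra.
have H0 (de : R) : 0 < de -> Hdelta d b' de = 0%E.
  move=> de0; apply/eqP; rewrite eq_le; apply/andP; split; last first.
    apply: le_ereal_inf_tmp => _ [U _ <-].
    by apply: nneseries_ge0 => i _ _; exact: hterm_ge0.
  apply/lee_addgt0Pr => ep ep0; rewrite add0e.
  have net (n : nat) : exists (Nh : nat * (nat -> T)) (eta : R),
      (0 < eta /\ 2 * eta <= de) /\
      [/\ Nh.1%:R * (2 * eta) `^ b' <= ep / (2 ^ n.+1)%:R &
       forall z, d x0 z <= n.+1%:R -> exists2 k, (k < Nh.1)%N & d (Nh.2 k) z <= eta].
    have [A' A'0 HA'] := packing_all r0 A0 b0 H (ltr0Sn R n).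
    have c0 : 0 < ep / (2 ^ n.+1)%:R / (A' * 2 `^ b').
      by rewrite !divr_gt0 ?mulr_gt0 ?powR_gt0// ltr0n expn_gt0.
    have [e e0 He] := small_powR be0 c0.
    pose eta := Num.min (Num.min 1 (de / 2)) e.
    have eta0 : 0 < eta by rewrite !lt_min ltr01 e0 divr_gt0.
    have eta1 : eta <= 1 by rewrite !ge_min lexx.
    have eta2 : eta <= de / 2 by rewrite !ge_min lexx orbT.
    have etae : eta <= e by rewrite !ge_min lexx orbT.
    have eta01 : 0 < eta <= 1 by rewrite eta0.
    have [N [h [hN hc]]] := max_net (ler0n R n.+1)
      (fun I f h1 h2 => HA' eta I f eta01 h1 h2) eta0.
    exists (N, h), eta; split; first by split => //; lraw eta2.
    split; last by move=> z /hc[k kN kz]; exists k => //; exact: ltW.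
    change (N%:R * (2 * eta) `^ b' <= ep / (2 ^ n.+1)%:R).
    have := He eta; rewrite eta0 etae => /(_ isT).
    rewrite ler_pdivlMr ?mulr_gt0 ?powR_gt0// => h1.
    have e1 : (2 * eta) `^ b' = 2 `^ b' * eta `^ b' by rewrite powRM// ltW.
    have e2 : eta `^ (b' - b) = eta `^ b' / eta `^ b.
      by rewrite powRB// gt_eqF ?implybT.
    have e3 : eta^-1 `^ b = (eta `^ b)^-1.
      by rewrite -(powR_inv1 (ltW eta0)) -powRrM mulN1r powRN.
    rewrite e1; rewrite e2 in h1; rewrite e3 in hN.
    have z0 : 0 <= 2 `^ b' * eta `^ b' by rewrite mulr_ge0// powR_ge0.
    by apply: le_trans (ler_wpM2r z0 hN) _; move: h1; lraw.
  have [Nh Hnet] := choice net.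
  have [eta Heta] := choice Hnet.
  pose G n k : set T := if (k < (Nh n).1)%N
    then [set z | d ((Nh n).2 k) z <= eta n] else set0.
  have /card_esym/ppcard_eqP[f] := card_nat2.
  have bf : set_bij setT setT f by exact: bij.
  have Gd n k u v : G n k u -> G n k v -> d u v <= 2 * eta n.
    rewrite /G; case: ifP => // _ /= h1 h2; have [_ ds dt] := dpm.
    by apply: le_trans (dt _ ((Nh n).2 k) _) _; rewrite ds; lra.
  have cov : delta_covers d de (fun i => G (f i).1 (f i).2).
    split=> [i u v h1 h2|z _].
      have [[_ h] _] := Heta (f i).1; exact: le_trans (Gd _ _ _ _ h1 h2) h.
    have [n nz] : exists n : nat, d x0 z <= n.+1%:R.
      exists (Num.bound (d x0 z)); apply: ltW.
      by apply: lt_le_trans (archi_boundP (d_ge0 _ _)) _; rewrite ler_nat.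
    have [_ [_ /(_ _ nz)[k kN kz]]] := Heta n.
    have [_ _ sf] := bf; have [i _ fi] := sf (n, k) Logic.I.
    by exists i => //; rewrite fi /= /G kN.
  apply: le_trans (ereal_inf_lbound _) _; first by exists (fun i => G (f i).1 (f i).2).
  rewrite (nneseries2 bf (u := fun n k => hterm d b' (G n k))); last first.
    by move=> n k; exact: hterm_ge0.
  apply: le_trans (epsilon_trick0 xpredT (ltW ep0)).
  apply: lee_nneseries => [n _ _|n _].
    by apply: nneseries_ge0 => k _ _; exact: hterm_ge0.
  have [[e0 e1] [hs _]] := Heta n.
  apply: (@le_trans _ _ ((Nh n).1%:R * (2 * eta n) `^ b')%:E); last by rewrite lee_fin.
  apply: nneseries_le_block => k.
  - exact: hterm_ge0.
  - by move=> kN; apply: hterm_le => //; [lraw e0|exact: Gd].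
  - move=> kN; rewrite /hterm /G ltnNge kN /=.
    by case: pselect.
apply/eqP; rewrite eq_le; apply/andP; split.
  by apply: ge_ereal_sup => _ [de /= de0 <-]; rewrite H0.
rewrite -(H0 1 ltr01); apply: ereal_sup_ubound.
by exists 1 => //=; exact: ltr01.
Qed.

End Covering.

(** * Infinitesimal geometry *)
Section Expansion.
Variable R : realType.
Local Notation ch := (@hcosh R).
Local Notation sh := (@hsinh R).

Lemma taylor_bounds : exists2 C : R, 0 < C & forall y, 0 <= y <= 4 ->
  [/\ sh y <= y + C * y ^+ 3 & ch y <= 1 + y ^+ 2 / 2 + C * y ^+ 4].
Proof.
pose H := ch (4 : R) ^+ 2.
have H1 : 1 <= H by have := ch_ge1 (4 : R); rewrite /H; nra.
exists (H + H ^+ 2); first by nra.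
move=> y /andP[y0 y4].
have cy z : 0 <= z <= 4 -> ch z <= 1 + z ^+ 2 / 2 * H.
  by move=> /andP[z0 z4]; apply: ch_le_sqr; rewrite ger0_norm.
have sy z : 0 <= z <= 4 -> sh z <= z * (1 + z ^+ 2 / 2 * H).
  move=> /andP[z0 z4]; apply: le_trans (sh_le_ch z0 (lexx z)) _.
  by rewrite ler_wpM2l// cy// z0.
split.
  have y3 : 0 <= y ^+ 3 by rewrite exprn_ge0.
  have := sy y; rewrite y0 y4 => /(_ isT) h.
  have : y ^+ 3 * (H / 2) <= y ^+ 3 * (H + H ^+ 2) by rewrite ler_wpM2l//; nra.
  by lra.
have := sy (y / 2) ltac:(lra) => h.
have s0 : 0 <= sh (y / 2) by apply: sh_ge0; lra.
have h2 : sh (y / 2) ^+ 2 <= (y / 2 * (1 + (y / 2) ^+ 2 / 2 * H)) ^+ 2.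
  by rewrite ler_sqr ?nnegrE//; apply: le_trans s0 _.
rewrite ch_half; set z := y ^+ 2 in h2 *.
have z0 : 0 <= z by rewrite sqr_ge0.
have z16 : z <= 16 by rewrite /z; nra.
have e : (y / 2 * (1 + (y / 2) ^+ 2 / 2 * H)) ^+ 2 =
   z / 4 + z ^+ 2 * (H / 16) + z ^+ 2 * (z * (H ^+ 2 / 256)).
  by rewrite /z; field.
have e4 : y ^+ 4 = z ^+ 2 by rewrite /z; ring.
have k : z ^+ 2 * (z * (H ^+ 2 / 256)) <= z ^+ 2 * (16 * (H ^+ 2 / 256)).
  by rewrite ler_wpM2l ?sqr_ge0// ler_wpM2r//; nra.
have k2 : 0 <= z ^+ 2 * H by rewrite mulr_ge0 ?sqr_ge0//; lra.
have k3 : 0 <= z ^+ 2 * H ^+ 2 by rewrite mulr_ge0 ?sqr_ge0.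
by rewrite e4; lraw e h2 k k2 k3.
Qed.

(** The hyperbolic and the Euclidean law of cosines differ by terms of fourth order in the sides,
    uniformly in the cosine. *)
Lemma hinge_expansion : exists2 C : R, 0 < C & forall s t c D,
  0 <= s <= 1 -> 0 <= t <= 1 -> -1 <= c <= 1 -> 0 <= D <= s + t ->
  (ch D <= ch s * ch t - c * (sh s * sh t) ->
     D ^+ 2 <= s ^+ 2 + t ^+ 2 - 2 * s * t * c + C * (s ^+ 2 + t ^+ 2) ^+ 2) /\
  (ch s * ch t - c * (sh s * sh t) <= ch D ->
     s ^+ 2 + t ^+ 2 - 2 * s * t * c - C * (s ^+ 2 + t ^+ 2) ^+ 2 <= D ^+ 2).
Proof.
have [C C0 HC] := taylor_bounds.
exists (20 * (C + 1) ^+ 2); first by rewrite mulr_gt0// exprn_gt0//; lra.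
move=> s t c D /andP[s0 s1] /andP[t0 t1] /andP[c0 c1] /andP[D0 Dst].
have [us cs'] := HC s ltac:(lra).
have [ut ct'] := HC t ltac:(lra).
have [_ cD] := HC D ltac:(lra).
have ls := sh_geid s0; have lt' := sh_geid t0.
have gs := ch_ge_sqr s; have gt' := ch_ge_sqr t; have gD := ch_ge_sqr D.
have ps := ch_gt0 s; have pt' := ch_gt0 t.
set Q := s ^+ 2 + t ^+ 2.
have s2 : 0 <= s ^+ 2 by exact: sqr_ge0.
have t2 : 0 <= t ^+ 2 by exact: sqr_ge0.
have st0 : 0 <= s * t by exact: mulr_ge0.
have st1 : s * t <= 1 by rewrite -[1]mulr1 ler_pM.
have stQ : 2 * (s * t) <= Q by rewrite /Q; have := sqr_ge0 (s - t); lraw.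
have stQ2 : 4 * (s * t) ^+ 2 <= Q ^+ 2.
  have : (2 * (s * t)) ^+ 2 <= Q ^+ 2 by rewrite ler_sqr ?nnegrE ?mulr_ge0//; lraw st0 stQ.
  by rewrite exprMn; lraw.
have Q0 : 0 <= Q by rewrite addr_ge0.
have Q2 : 0 <= Q ^+ 2 by exact: sqr_ge0.
have s4 : s ^+ 4 + t ^+ 4 <= Q ^+ 2.
  have : 0 <= s ^+ 2 * t ^+ 2 by exact: mulr_ge0.
  by rewrite /Q; lraw.
have s2t2 : s ^+ 2 * t ^+ 2 = (s * t) ^+ 2 by rewrite exprMn.
have cc : ch s * ch t <= 1 + Q / 2 + (C + (1 / 2 + C) ^+ 2) * Q ^+ 2.
  have b x : 0 <= x -> x <= 1 -> x ^+ 2 / 2 + C * x ^+ 4 <= x ^+ 2 * (1 / 2 + C).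
    move=> x0 x1; have : x ^+ 4 <= x ^+ 2.
      by rewrite (_ : x ^+ 4 = x ^+ 2 * x ^+ 2) ?ler_piMr ?sqr_ge0 ?expr_le1//; ring.
    by move=> h; have := ler_wpM2l (ltW C0) h; lraw.
  have := ler_pM (ltW ps) (ltW pt') cs' ct'.
  have bs := b s s0 s1; have bt := b t t0 t1.
  have xs : 0 <= s ^+ 2 / 2 + C * s ^+ 4.
    by rewrite addr_ge0 ?divr_ge0 ?mulr_ge0 ?(ltW C0)// exprn_ge0.
  have xt : 0 <= t ^+ 2 / 2 + C * t ^+ 4.
    by rewrite addr_ge0 ?divr_ge0 ?mulr_ge0 ?(ltW C0)// exprn_ge0.
  have := ler_pM xs xt bs bt.
  have : C * (s ^+ 4 + t ^+ 4) <= C * Q ^+ 2 by rewrite ler_wpM2l// ltW.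
  have : (1 / 2 + C) ^+ 2 * (s * t) ^+ 2 <= (1 / 2 + C) ^+ 2 * Q ^+ 2.
    by rewrite ler_wpM2l ?sqr_ge0//; have := sqr_ge0 (s * t); lraw stQ2.
  move: s2t2; rewrite /Q; set S4 := s ^+ 4; set T4 := t ^+ 4; lraw.
have cl : 1 + Q / 2 <= ch s * ch t.
  have := ler_pM (_ : 0 <= 1 + s ^+ 2 / 2) (_ : 0 <= 1 + t ^+ 2 / 2) gs gt'.
  move=> /(_ ltac:(lraw s2) ltac:(lraw t2)); have : 0 <= s ^+ 2 * t ^+ 2 by exact: mulr_ge0.
  by rewrite /Q; lraw.
pose E := (C + C ^+ 2) * Q ^+ 2.
have su : sh s * sh t <= s * t + E.
  have := ler_pM (sh_ge0 s0) (sh_ge0 t0) us ut.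
  have k1 : C * (s * t * Q) <= C * Q ^+ 2.
    by rewrite ler_wpM2l ?(ltW C0)// expr2 ler_wpM2r//; lraw Q0 stQ.
  have k2 : C ^+ 2 * ((s * t) * (s * t) ^+ 2) <= C ^+ 2 * Q ^+ 2.
    rewrite ler_wpM2l ?sqr_ge0//; apply: le_trans (ler_piMl _ st1) _; rewrite ?sqr_ge0//.
    by have := sqr_ge0 (s * t); lraw stQ2.
  rewrite /E; move: k1 k2; rewrite /Q; lraw.
have sl : s * t <= sh s * sh t by apply: ler_pM.
set S := sh s * sh t in su sl *.
have cS : `|c * S - c * (s * t)| <= E.
  rewrite -mulrBr normrM -[leRHS]mul1r; apply: ler_pM; rewrite ?normr_ge0//.
    by rewrite ler_norml c0.
  by rewrite ger0_norm; lraw sl su.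
have cS1 : c * S - c * (s * t) <= E := le_trans (ler_norm _) cS.
have cS2 : - E <= c * S - c * (s * t) by move: cS; rewrite ler_norml => /andP[].
have DQ : D ^+ 4 <= 4 * Q ^+ 2.
  have h : D ^+ 2 <= 2 * Q.
    have : D ^+ 2 <= (s + t) ^+ 2 by rewrite ler_sqr ?nnegrE//; lraw s0 t0.
    by rewrite /Q; have := sqr_ge0 (s - t); lraw.
  have : (D ^+ 2) ^+ 2 <= (2 * Q) ^+ 2 by rewrite ler_sqr ?nnegrE ?sqr_ge0//; lraw st0 stQ.
  by lraw.
have k5 : C * D ^+ 4 <= C * (4 * Q ^+ 2) by rewrite ler_wpM2l// ltW.
have k6 : (C + C ^+ 2 + C + (1 / 2 + C) ^+ 2 + 4 * C) * Q ^+ 2 <= 10 * (C + 1) ^+ 2 * Q ^+ 2.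
  by rewrite ler_wpM2r//; have := sqr_ge0 C; lraw.
have k7 : 0 <= (1 / 2 + C) ^+ 2 * Q ^+ 2 by rewrite mulr_ge0 ?sqr_ge0.
have k8 : 0 <= C * Q ^+ 2 by rewrite mulr_ge0 ?(ltW C0).
rewrite /E in cS1 cS2 su.
set D4 := D ^+ 4 in cD DQ k5.
by split => h; lraw Q2 cD cS1 cS2 cc cl gD h k5 k6 k8.
Qed.

Lemma midpoint_expansion : exists2 C : R, 0 < C & forall A B c e ep,
  0 <= A -> 0 <= B -> 0 <= c <= ep -> 0 <= e <= ep -> ep <= 1 ->
  ch A + ch B <= 2 * ch e * ch (c / 2) ->
  A ^+ 2 / 2 + B ^+ 2 / 2 - c ^+ 2 / 4 <= e ^+ 2 + C * ep ^+ 4.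
Proof.
have [C C0 HC] := taylor_bounds.
exists (10 * (C + 1) ^+ 2); first by rewrite mulr_gt0// exprn_gt0//; lra.
move=> A B c e ep A0 B0 /andP[c0 cp] /andP[e0 ep'] ep1 h.
have [_ ce] := HC e ltac:(lra).
have [_ cc] := HC (c / 2) ltac:(lra).
have gA := ch_ge_sqr A; have gB := ch_ge_sqr B.
pose F := ep ^+ 4.
have ep0 : 0 <= ep by lraw e0 ep'.
have F0 : 0 <= F by rewrite exprn_ge0.
have F1 : F <= 1 by rewrite exprn_ile1.
have e4 : e ^+ 4 <= F by rewrite ler_pXn2r ?nnegrE.
have c4 : (c / 2) ^+ 4 <= F by rewrite ler_pXn2r ?nnegrE//; lraw c0 cp.
have {}ce : ch e <= 1 + e ^+ 2 / 2 + C * F.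
  by apply: le_trans ce _; rewrite lerD2l ler_wpM2l// ltW.
have {}cc : ch (c / 2) <= 1 + c ^+ 2 / 8 + C * F.
  have : C * (c / 2) ^+ 4 <= C * F by rewrite ler_wpM2l// ltW.
  by move: cc; set Z := (c / 2) ^+ 4; lraw.
have pr := ler_pM (ltW (ch_gt0 e)) (ltW (ch_gt0 (c / 2))) ce cc.
have ec : e ^+ 2 * c ^+ 2 <= F.
  have h1 : e ^+ 2 <= ep ^+ 2 by rewrite ler_sqr ?nnegrE.
  have h2 : c ^+ 2 <= ep ^+ 2 by rewrite ler_sqr ?nnegrE.
  have := ler_pM (sqr_ge0 e) (sqr_ge0 c) h1 h2; rewrite /F; lraw.
have e21 : e ^+ 2 <= 1 by rewrite expr_le1//; lraw ep' ep1.
have c21 : c ^+ 2 <= 1 by rewrite expr_le1//; lraw cp ep1.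
have CF : 0 <= C * F by rewrite mulr_ge0 ?(ltW C0).
have k1 : C * F * e ^+ 2 <= C * F by rewrite ler_piMr.
have k2 : C * F * c ^+ 2 <= C * F by rewrite ler_piMr.
have k3 : C ^+ 2 * F * F <= C ^+ 2 * F by rewrite ler_piMr// mulr_ge0 ?sqr_ge0.
have k4 : 0 <= C ^+ 2 * F by rewrite mulr_ge0 ?sqr_ge0.
rewrite -/F; set e2 := e ^+ 2 in pr ec k1 e21 *; set c2 := c ^+ 2 in pr ec k2 c21 *.
clearbody F e2 c2; lraw CF F0 ec gA gB h k1 k2 k3 k4 pr.
Qed.

End Expansion.

Section Directions.
Variable R : realType.
Variables (T : Type) (d : T -> T -> R).
Local Notation ch := (@hcosh R).
Local Notation sh := (@hsinh R).
Variable G : T -> T -> R -> T.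
Hypothesis dmet : is_metric d.
Hypothesis HG : forall x y, is_geodesic d (G x y) x y.
Hypothesis glob : glob_cmp d d.

Let dpm : is_pseudometric d. Proof. exact: metric_pseudo. Qed.
Let d_ge0 a b : 0 <= d a b. Proof. exact: pm_ge0. Qed.
Let ds a b : d a b = d b a. Proof. by case: dmet. Qed.
Let dt a b c : d a c <= d a b + d b c. Proof. by case: dmet. Qed.
Let d0 a : d a a = 0. Proof. by case: dmet. Qed.

Let daff := @geod_affine R T d.

(** [G] is a fixed choice of geodesics, so directions at [x] are indexed by end points. *)
Definition cs (x p q : T) : R := ang d (G x p) (G x q).

Definition pt (x p : T) (s : R) : T := G x p (s / d x p).

Definition ccos (x p q : T) : R :=
  (ch (d x p) * ch (d x q) - ch (d p q)) / (sh (d x p) * sh (d x q)).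

Lemma G0 x p : G x p 0 = x. Proof. by case: (HG x p). Qed.
Lemma G1 x p : G x p 1 = p. Proof. by case: (HG x p). Qed.

Lemma G_hinge x p q : hinge d (G x p) (G x q).
Proof. by split; rewrite /geod_from ?G0 ?G1. Qed.

Lemma G_loc y : exists2 rho, 0 < rho & loc_cmp d d y rho.
Proof. by exists 1; [exact: ltr01|exact: glob_loc]. Qed.

Lemma cs_sym x p q : cs x p q = cs x q p.
Proof. exact: (ang_sym dmet dpm daff G_loc (G_hinge x p q)). Qed.

Lemma cs_le_ccos x p q : cs x p q <= ccos x p q.
Proof.
have o1 : 0 < (1 : R) <= 1 by rewrite ltr01 lexx.
have := glob_ang_le dmet dpm daff glob (G_hinge x p q) o1 o1.
by rewrite /chat !G0 !G1 !mul1r.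
Qed.

Lemma cs_geN1 x p q : -1 <= cs x p q.
Proof. exact: (ang_geN1 dmet dpm daff G_loc (G_hinge x p q)). Qed.

Lemma cs_le1 x p q : cs x p q <= 1.
Proof.
have o1 : 0 < (1 : R) <= 1 by rewrite ltr01 lexx.
have o01 : 0 <= (1 : R) <= 1 by rewrite ler01 lexx.
apply: le_trans (glob_ang_le dmet dpm daff glob (G_hinge x p q) o1 o1) _.
by apply: (chat_le1 dpm daff (G_hinge x p q)).
Qed.

Lemma cs_bound x p q : -1 <= cs x p q <= 1.
Proof. by rewrite cs_geN1 cs_le1. Qed.

Lemma cs_diag x p : 0 < d x p -> cs x p p = 1.
Proof.
move=> xp; apply: angE => e e0; exists 1 => // s t /andP[s0 s1] /andP[t0 t1].
rewrite /chat !G0 !G1 (geod_affine (HG x p)); [|lra|lra].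
have -> : ch (`|s - t| * d x p) = ch (s * d x p - t * d x p).
  by rewrite -(ch_abs (_ - _)) -mulrBl normrM (ger0_norm (d_ge0 _ _)).
rewrite chB opprB addrCA subrr addr0 divff ?subrr ?normr0 ?ltW//.
by rewrite mulf_neq0// gt_eqF// sh_gt0 mulr_gt0.
Qed.

Lemma pt_d x p s : 0 < d x p -> 0 <= s <= d x p -> d x (pt x p s) = s.
Proof.
move=> xp /andP[s0 s1]; rewrite /pt (geod_d0 (HG x p)) ?divfK ?gt_eqF//.
by rewrite divr_ge0//= ler_pdivrMr// mul1r.
Qed.

Lemma pt_end x p : 0 < d x p -> pt x p (d x p) = p.
Proof. by move=> xp; rewrite /pt divff ?G1// gt_eqF. Qed.

Lemma pt0 x p : pt x p 0 = x.
Proof. by rewrite /pt mul0r G0. Qed.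

Lemma pt_pt x p s t : 0 < d x p -> 0 <= s <= d x p -> 0 <= t <= d x p ->
  d (pt x p s) (pt x p t) = `|s - t|.
Proof.
move=> xp /andP[s0 s1] /andP[t0 t1]; rewrite /pt (geod_affine (HG x p)).
- by rewrite -mulrBl normrM (gtr0_norm (_ : 0 < (d x p)^-1)) ?invr_gt0// divfK// gt_eqF.
- by rewrite divr_ge0//= ler_pdivrMr// mul1r.
- by rewrite divr_ge0//= ler_pdivrMr// mul1r.
Qed.

Lemma pt_geod x p s : 0 < d x p -> 0 <= s <= d x p ->
  is_geodesic d (fun u => pt x p (u * s)) x (pt x p s).
Proof.
move=> xp s01; split => [||u v /andP[u0 u1] /andP[v0 v1]].
- by rewrite mul0r pt0.
- by rewrite mul1r.
- have [s0 s1] := andP s01.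
  rewrite pt_pt//; [|nra|nra].
  by rewrite pt_d// -mulrBl normrM (ger0_norm s0).
Qed.

Lemma pt_chat x p q s t : 0 < d x p -> 0 < d x q -> 0 < s <= d x p -> 0 < t <= d x q ->
  ch (d (pt x p s) (pt x q t)) = ch s * ch t -
    chat d (G x p) (G x q) (s / d x p) (t / d x q) * (sh s * sh t).
Proof.
move=> xp xq /andP[s0 s1] /andP[t0 t1].
have e1 : s / d x p * d x p = s by rewrite divfK// gt_eqF.
have e2 : t / d x q * d x q = t by rewrite divfK// gt_eqF.
rewrite /chat !G0 !G1 e1 e2 divfK; first by rewrite /pt; ring.
by rewrite mulf_neq0// gt_eqF// sh_gt0.
Qed.

Lemma pt_le x p q s t : 0 < d x p -> 0 < d x q -> 0 <= s <= d x p -> 0 <= t <= d x q ->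
  d (pt x p s) (pt x q t) <= s + t.
Proof.
move=> xp xq s0 t0; apply: le_trans (dt _ x _) _.
by rewrite ds !pt_d.
Qed.

(** No smallness depending on the directions is needed, because the cosine of the angle is at most
    every comparison cosine; the two-sided estimate [cs_near] is only asymptotic. *)
Lemma cs_upper : exists2 C, 0 < C & forall x p q s t,
  0 < d x p -> 0 < d x q -> 0 <= s <= d x p -> 0 <= t <= d x q -> s <= 1 -> t <= 1 ->
  d (pt x p s) (pt x q t) ^+ 2 <=
    s ^+ 2 + t ^+ 2 - 2 * s * t * cs x p q + C * (s ^+ 2 + t ^+ 2) ^+ 2.
Proof.
have [C C0 HC] := hinge_expansion R; exists C => // x p q s t xp xq s01 t01 sle tle.
have [s0 s1] := andP s01; have [t0 t1] := andP t01.
have Q0 u : 0 <= C * u ^+ 2 by rewrite mulr_ge0 ?sqr_ge0// ltW.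
move: s0; rewrite le_eqVlt => /orP[/eqP es|sp].
  by rewrite -es pt0 pt_d//; have := Q0 (0 ^+ 2 + t ^+ 2); lra.
move: t0; rewrite le_eqVlt => /orP[/eqP et|tp].
  by rewrite -et pt0 ds pt_d//; have := Q0 (s ^+ 2 + 0 ^+ 2); lra.
have [] := HC s t (cs x p q) (d (pt x p s) (pt x q t)).
- by rewrite ltW.
- by rewrite ltW.
- exact: cs_bound.
- by rewrite d_ge0 pt_le.
move=> + _; apply; rewrite (pt_chat xp xq); [|by rewrite sp|by rewrite tp].
have ss : 0 <= sh s * sh t by apply: mulr_ge0; apply: sh_ge0; exact: ltW.
rewrite lerD2l lerN2 ler_wpM2r//.
apply: (glob_ang_le dmet dpm daff glob (G_hinge x p q)).
  by rewrite divr_gt0//= ler_pdivrMr// mul1r.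
by rewrite divr_gt0//= ler_pdivrMr// mul1r.
Qed.

Lemma cs_near x p q e : 0 < d x p -> 0 < d x q -> 0 < e ->
  exists2 s0, [/\ 0 < s0, s0 <= d x p, s0 <= d x q & s0 <= 1] &
  forall s t, 0 <= s <= s0 -> 0 <= t <= s0 ->
  `|d (pt x p s) (pt x q t) ^+ 2 - (s ^+ 2 + t ^+ 2 - 2 * s * t * cs x p q)| <=
    e * (s ^+ 2 + t ^+ 2).
Proof.
move=> xp xq e0; have [C C0 HC] := hinge_expansion R.
have e2 : 0 < e / 2 by lra.
have [eps ep0 Hep] := ang_ex dmet dpm daff G_loc (G_hinge x p q) e2.
pose m := Num.min (Num.min (d x p) (d x q)) (Num.min 1 (e / (4 * C))).
have eC : 0 < e / (4 * C) by rewrite divr_gt0// mulr_gt0.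
have m0 : 0 < m by rewrite !lt_min xp xq ltr01.
have [mp mq m1 mC] : [/\ m <= d x p, m <= d x q, m <= 1 & m <= e / (4 * C)].
  by rewrite /m !ge_min !lexx !orbT.
pose s0 := m * Num.min 1 eps.
have me0 : 0 < Num.min 1 eps by rewrite lt_min ltr01.
have me1 : Num.min 1 eps <= 1 by rewrite ge_min lexx.
have mee : Num.min 1 eps <= eps by rewrite ge_min lexx orbT.
have s00 : 0 < s0 by rewrite mulr_gt0.
have s0m : s0 <= m by rewrite ler_piMr// ltW.
exists (s0 * m); first by split; [rewrite mulr_gt0|nra|nra|nra].
move=> s t /andP[sge sle] /andP[tge tle].
have sm : s0 * m <= m * m by rewrite ler_wpM2r// ltW.
have mm : m * m <= m by rewrite ler_piMl// ltW.
have s0m' : s0 * m <= s0 by rewrite ler_piMr// ltW.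
have sp1 : s <= d x p by lraw mm mp sle sm.
have tq1 : t <= d x q by lraw mm mq sm tle.
set Q := s ^+ 2 + t ^+ 2; have Q0 : 0 <= Q by rewrite addr_ge0 ?sqr_ge0.
have eQ : 0 <= e * Q by rewrite mulr_ge0// ltW.
move: sge; rewrite le_eqVlt => /orP[/eqP es|sp].
  rewrite -es pt0 pt_d//; last by rewrite tge.
  by rewrite (_ : _ - _ = 0) ?normr0//; rewrite /Q -es; ring.
move: tge; rewrite le_eqVlt => /orP[/eqP et|tp].
  rewrite -et pt0 ds pt_d//; last by rewrite ltW.
  by rewrite (_ : _ - _ = 0) ?normr0//; rewrite /Q -et; ring.
have E := @pt_chat x p q s t xp xq ltac:(by rewrite sp) ltac:(by rewrite tp).
set c := chat _ _ _ _ _ in E.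
have sf : 0 <= s / d x p <= 1 by rewrite divr_ge0 1?(ltW sp)//= ler_pdivrMr// mul1r.
have tf : 0 <= t / d x q <= 1 by rewrite divr_ge0 1?(ltW tp)//= ler_pdivrMr// mul1r.
have cb : -1 <= c <= 1.
  apply/andP; split.
    exact: (chat_ge dpm daff (G_hinge x p q) sf tf).
  exact: (chat_le1 dpm daff (G_hinge x p q) sf tf).
have ce : `|c - cs x p q| <= e / 2.
  have s0p : s0 <= eps * d x p by rewrite /s0 mulrC ler_pM// ltW.
  have s0q : s0 <= eps * d x q by rewrite /s0 mulrC ler_pM// ltW.
  apply: Hep; rewrite divr_gt0//= ler_pdivrMr//.
    by apply: le_trans s0p; lraw s0m' sle.
  by apply: le_trans s0q; lraw s0m' tle.
have [] := HC s t c (d (pt x p s) (pt x q t)) _ _ cb.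
- by rewrite ltW//; lraw m1 mm sle sm.
- by rewrite ltW//; lraw m1 mm sm tle.
- by rewrite d_ge0 pt_le// ltW.
rewrite E lexx => /(_ isT) u1 /(_ isT) u2.
have CQ : C * Q ^+ 2 <= e / 2 * Q.
  rewrite expr2 mulrA ler_wpM2r//.
  have : Q <= 2 * m.
    have h z : 0 <= z -> z <= m -> z ^+ 2 <= m by move=> z0 zm; nra.
    have := h s (ltW sp) ltac:(lraw mm sle sm); have := h t (ltW tp) ltac:(lraw mm sm tle); rewrite /Q; lraw.
  move: mC; rewrite ler_pdivlMr ?mulr_gt0// => h1 h2.
  have := ler_wpM2l (ltW C0) h2; lraw h1.
have st : 2 * (s * t) <= Q by rewrite /Q; have := sqr_ge0 (s - t); lraw.
have stc : `|2 * s * t * (c - cs x p q)| <= e / 2 * Q.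
  have st2 : 0 <= 2 * s * t by have := mulr_gt0 sp tp; lraw.
  rewrite normrM (ger0_norm st2) mulrC.
  by apply: ler_pM => //; lraw st.
move: stc; rewrite !ler_norml -/Q => /andP[v1 v2].
by rewrite -/Q in u1 u2; apply/andP; split; lraw CQ u1 u2 v1 v2.
Qed.

(** Comparison at a midpoint to second order. Being free of angles, it can be used at points other
    than the base point of the directions. *)
Lemma mid_stewart : exists2 C, 0 < C & forall p q r g ep, is_geodesic d g q r ->
  d q r <= ep -> d p (g (1 / 2)) <= ep -> ep <= 1 ->
  d p q ^+ 2 / 2 + d p r ^+ 2 / 2 - d q r ^+ 2 / 4 <=
    d p (g (1 / 2)) ^+ 2 + C * ep ^+ 4.
Proof.
have [C C0 HC] := midpoint_expansion R; exists C => // p q r g ep gg qr pm e1.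
apply: HC => //; rewrite ?d_ge0//.
have h01 : 0 <= (1 / 2 : R) <= 1 by lra.
have := glob p gg h01; rewrite /hyp_cmp.
have := d_ge0 q r; rewrite le_eqVlt => /orP[/eqP e0 _|qr0].
  have qm : q = g (1 / 2).
    by case: dmet => _ dz _ _; apply: dz; rewrite (geod_d0 gg h01) -e0 mulr0.
  have qr' : q = r by case: dmet => _ dz _ _; exact: dz.
  by rewrite -qr' d0 mul0r ch0 -qm; lra.
have -> : (1 - 1 / 2) * d q r = d q r / 2 by field.
have -> : 1 / 2 * d q r = d q r / 2 by field.
have -> : sh (d q r) = 2 * (sh (d q r / 2) * ch (d q r / 2)).
  rewrite {1}(_ : d q r = d q r / 2 + d q r / 2); last by field.
  by rewrite shD; ring.
have sp : 0 < sh (d q r / 2) by rewrite sh_gt0; lra.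
by move=> h; rewrite -(ler_pM2l sp); lra.
Qed.

End Directions.

Lemma le_of_sqr (R : realDomainType) (a b : R) : 0 <= b -> a ^+ 2 <= b ^+ 2 -> a <= b.
Proof. by move=> b0 h; rewrite leNgt; apply/negP => ba; nra. Qed.

Lemma small_scale (R : realType) (b1 b2 b3 C e : R) :
  0 < b1 -> 0 < b2 -> 0 < b3 -> 0 < C -> 0 < e ->
  exists2 s, 0 < s & [/\ 4 * s <= b1, 4 * s <= b2, 4 * s <= b3, 4 * s <= 1 &
    C * (4 * s) ^+ 4 <= e * s ^+ 2].
Proof.
move=> b10 b20 b30 C0 e0; pose K : R := C * 4 ^+ 4.
have K0 : 0 < K by rewrite mulr_gt0// exprn_gt0.
have eK : 0 < e / K by rewrite divr_gt0.
pose m := Num.min (Num.min b1 b2) (Num.min (Num.min b3 1) (e / K)).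
have m0 : 0 < m by rewrite !lt_min b10 b20 b30 ltr01.
have [m1 m2 m3 m4 m5] : [/\ m <= b1, m <= b2, m <= b3, m <= 1 & m <= e / K].
  by rewrite /m !ge_min !lexx !orbT.
exists (m / 4); first by lra.
have e4 : 4 * (m / 4) = m by field.
have s1 : m / 4 <= 1 by lra.
have s0 : 0 < m / 4 by lra.
have sK : m / 4 <= e / K by lra.
rewrite e4 /=; split => //.
have -> : C * m ^+ 4 = K * (m / 4) ^+ 2 * (m / 4) ^+ 2.
  by rewrite /K -{1}e4; set z := m / 4; ring.
rewrite ler_pM2r ?exprn_gt0//.
apply: (@le_trans _ _ (K * (m / 4))).
  by rewrite ler_pM2l// expr2 ler_piMl// ltW.
by move: sK; rewrite ler_pdivlMr// mulrC.
Qed.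

Lemma scale_bounds (R : realType) (s b : R) : 0 < s -> 4 * s <= b ->
  0 <= s <= b /\ 0 <= 2 * s <= b.
Proof. by move=> s0 sb; split; apply/andP; split; lra. Qed.

Lemma norm_lower (R : realType) (A B e : R) : `|A - B| <= e -> B - e <= A.
Proof. by rewrite ler_norml => /andP[]; lra. Qed.

(** * Almost opposite directions *)

Section Opposite.
Variable R : realType.
Variables (T : Type) (d : T -> T -> R).
Variable G : T -> T -> R -> T.
Hypothesis dmet : is_metric d.
Hypothesis HG : forall x y, is_geodesic d (G x y) x y.
Hypothesis glob : glob_cmp d d.
Local Notation cs := (cs d G).
Local Notation pt := (pt d G).

Let dpm : is_pseudometric d. Proof. exact: metric_pseudo. Qed.
Let d_ge0 a b : 0 <= d a b. Proof. exact: pm_ge0. Qed.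
Let ds a b : d a b = d b a. Proof. by case: dmet. Qed.
Let dt a b c : d a c <= d a b + d b c. Proof. by case: dmet. Qed.

Lemma adj_num (s u C cpq cpw cqw dPQ dP2Q dmP2 D dWm dWP dWQ : R) :
  0 < s -> 0 < u <= 1 -> 0 <= dPQ <= 2 * s -> 0 <= dmP2 -> 0 <= D -> 0 <= dWm ->
  cpq <= -1 + u ^+ 2 -> 0 <= dP2Q ->
  5 * s ^+ 2 - 4 * s ^+ 2 * cpq - u ^+ 2 / 10 * (5 * s ^+ 2) <= dP2Q ^+ 2 ->
  dP2Q <= dmP2 + dPQ / 2 ->
  D ^+ 2 / 2 + dmP2 ^+ 2 / 2 - (2 * s) ^+ 2 / 4 <= (dPQ / 2) ^+ 2 + C ->
  dWP ^+ 2 / 2 + dWQ ^+ 2 / 2 - dPQ ^+ 2 / 4 <= dWm ^+ 2 + C ->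
  dWm <= s + D -> C <= u ^+ 2 / 10 * s ^+ 2 ->
  2 * s ^+ 2 - 2 * s ^+ 2 * cpw - u ^+ 2 / 10 * (2 * s ^+ 2) <= dWP ^+ 2 ->
  2 * s ^+ 2 - 2 * s ^+ 2 * cqw - u ^+ 2 / 10 * (2 * s ^+ 2) <= dWQ ^+ 2 ->
  - (12 * u) <= cpw + cqw.
Proof.
move=> s0 /andP[u0 u1] /andP[PQ0 PQ1] mP0 D0 Wm0 hpq P2Q0 h1 h2 h3 h4 h5 hC h6 h7.
have s2 : 0 < s ^+ 2 by rewrite exprn_gt0.
pose y := 11 / 10 * u ^+ 2.
have u2 : 0 < u ^+ 2 by rewrite exprn_gt0.
have u21 : u ^+ 2 <= u by rewrite expr2 ler_piMl// ltW.
have k1 : s * (3 - y) <= dP2Q.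
  apply: le_of_sqr => //; apply: le_trans h1.
  have : s ^+ 2 * cpq <= s ^+ 2 * (-1 + u ^+ 2) by rewrite ler_pM2l.
  have : s ^+ 2 * (3 - y) ^+ 2 <= s ^+ 2 * (9 - 9 / 2 * u ^+ 2).
    by rewrite ler_pM2l// /y; nra.
  by rewrite exprMn; lraw.
have k2 : s * (2 - y) <= dmP2 by lraw PQ1 h2 k1.
have k3 : s ^+ 2 * (4 - 4 * y) <= dmP2 ^+ 2.
  apply: (@le_trans _ _ ((s * (2 - y)) ^+ 2)).
    by rewrite exprMn ler_pM2l//; have := sqr_ge0 y; lraw.
  by rewrite ler_sqr ?nnegrE// mulr_ge0 ?(ltW s0)// /y; lraw u1 u21.
have k4 : (dPQ / 2) ^+ 2 <= s ^+ 2 by rewrite ler_sqr ?nnegrE//; lraw PQ0 PQ1.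
have k5 : D <= 22 / 10 * u * s.
  apply: le_of_sqr; first by rewrite !mulr_ge0// ltW.
  have e : (22 / 10 * u * s) ^+ 2 = 484 / 100 * (u ^+ 2 * s ^+ 2) by field.
  have e2 : 0 < u ^+ 2 * s ^+ 2 by exact: mulr_gt0.
  rewrite e; rewrite /y in k3; set us := u ^+ 2 * s ^+ 2 in e2 *.
  have : s ^+ 2 * (4 - 4 * (11 / 10 * u ^+ 2)) = 4 * s ^+ 2 - 44 / 10 * us by rewrite /us; field.
  have : u ^+ 2 / 10 * s ^+ 2 = us / 10 by rewrite /us; field.
  by lraw h3 hC k3 k4.
have k6 : dWm ^+ 2 <= s ^+ 2 * (1 + 22 / 10 * u) ^+ 2.
  rewrite -exprMn ler_sqr ?nnegrE//; first by lraw h5 k5.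
  by rewrite mulr_ge0// ?ltW//; lraw.
have k7 : dPQ ^+ 2 / 4 <= s ^+ 2 by move: k4; lraw.
rewrite -(ler_pM2l s2).
have k8 : s ^+ 2 * (1 + 22 / 10 * u) ^+ 2 <= s ^+ 2 * (1 + 10 * u).
  by rewrite ler_pM2l//; nra.
have k9 : s ^+ 2 * u ^+ 2 <= s ^+ 2 * u by rewrite ler_pM2l.
have k10 : 0 < s ^+ 2 * u by rewrite mulr_gt0.
lraw h4 h6 h7 hC k10 k4 k6 k8.
Qed.

Lemma min3 (x y z : R) : 0 < x -> 0 < y -> 0 < z ->
  exists2 m, 0 < m & [/\ m <= x, m <= y & m <= z].
Proof.
move=> x0 y0 z0; exists (Num.min x (Num.min y z)); first by rewrite !lt_min x0 y0.
by rewrite !ge_min !lexx !orbT.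
Qed.

(** [P1] and [Q1], at distance s from x, are almost 2 s apart, and [P1] is the midpoint of x and
    [P2]. [mid_stewart] from the midpoint [mm] of [P1] and [Q1] places [mm] within O(u s) of x;
    applied at [mm] from [W], it bounds the sum of the cosines from below. *)
Lemma cs_opp_ge x p q w u : 0 < d x p -> 0 < d x q -> 0 < d x w -> 0 < u <= 1 ->
  cs x p q <= -1 + u ^+ 2 -> - (12 * u) <= cs x p w + cs x q w.
Proof.
move=> xp xq xw u01 h; have [u0 u1] := andP u01.
have [C C0 HC] := mid_stewart dmet glob.
have e0 : 0 < u ^+ 2 / 10 by rewrite divr_gt0// exprn_gt0.
have [s1 [s10 s1p s1q s11] H1] := cs_near dmet HG glob xp xq e0.
have [s2 [s20 s2p s2w s21] H2] := cs_near dmet HG glob xp xw e0.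
have [s3 [s30 s3q s3w s31] H3] := cs_near dmet HG glob xq xw e0.
have [s s0 [ss1 ss2 ss3 ss4 hC]] := small_scale s10 s20 s30 C0 e0.
have [bs1 b2s1] := scale_bounds s0 ss1; have [bs2 b2s2] := scale_bounds s0 ss2.
have [bs3 b2s3] := scale_bounds s0 ss3.
have [bp b2] := scale_bounds s0 (le_trans ss1 s1p).
have [bq _] := scale_bounds s0 (le_trans ss1 s1q).
have [bw _] := scale_bounds s0 (le_trans ss2 s2w).
pose P1 := pt x p s; pose P2 := pt x p (2 * s); pose Q1 := pt x q s; pose W := pt x w s.
pose mm := G P1 Q1 (1 / 2).
have h01 : 0 <= (1 / 2 : R) <= 1 by lraw.
have PQ : d P1 Q1 <= 2 * s.
  by have := pt_le dmet HG xp xq bp bq; rewrite /P1 /Q1; lraw.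
have mP : d mm P1 = d P1 Q1 / 2 by rewrite ds (geod_d0 (HG _ _) h01); field.
have mQ : d mm Q1 = d P1 Q1 / 2 by rewrite (geod_d1 (HG _ _) h01); field.
have xP2 : d x P2 = 2 * s by exact: (pt_d dmet HG xp b2).
have xW : d x W = s by exact: (pt_d dmet HG xw bw).
have gP := pt_geod dmet HG xp b2.
have m1' : pt x p (1 / 2 * (2 * s)) = P1 by rewrite /P1; congr pt; field.
have S1 := HC mm x P2 _ (4 * s) gP.
rewrite m1' xP2 mP in S1.
have S2 := HC W P1 Q1 _ (4 * s) (HG P1 Q1).
rewrite -/mm in S2.
have e1 := norm_lower (H1 (2 * s) s b2s1 bs1).
have e2 := norm_lower (H2 s s bs2 bs2).
have e3 := norm_lower (H3 s s bs3 bs3).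
rewrite -/P2 -/Q1 in e1; rewrite -/P1 -/W in e2; rewrite -/Q1 -/W in e3.
clear H1 H2 H3 b2s1 bs1 b2s2 bs2 b2s3 bs3 s10 s1p s1q s11 s20 s2p s2w s21 s30 s3q s3w s31.
clear ss1 ss2 ss3.
have D1 : d W mm <= s + d mm x.
  by apply: le_trans (dt _ x _) _; rewrite ds xW (ds x).
have mx : d mm x <= 2 * s.
  by apply: le_trans (dt _ P1 _) _; rewrite mP (ds P1 x) (pt_d dmet HG xp bp); lraw PQ.
apply: (@adj_num s u (C * (4 * s) ^+ 4) (cs x p q) (cs x p w) (cs x q w) (d P1 Q1)
  (d P2 Q1) (d mm P2) (d mm x) (d W mm) (d W P1) (d W Q1)) => //.
- by rewrite d_ge0.
- by lraw e1.
- by have := dt P2 mm Q1; rewrite (ds P2 mm) mQ.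
- by apply: S1; lraw PQ ss4.
- by apply: S2; lraw D1 PQ mx ss4.
- by rewrite (ds W P1); lraw e2.
- by rewrite (ds W Q1); lraw e3.
Qed.

(** First variation: the point towards [w] is taken at distance u r, and the triangle inequality
    through it between the points at distance r towards [p] and [q] is expanded. *)
Lemma cs_opp_le x p q w u : 0 < d x p -> 0 < d x q -> 0 < d x w -> 0 < u <= 1 ->
  cs x p q <= -1 + u ^+ 2 -> cs x p w + cs x q w <= 3 * u.
Proof.
move=> xp xq xw u01 h; have [u0 u1] := andP u01.
have e0 : 0 < u ^+ 2 / 4 by rewrite divr_gt0// exprn_gt0.
have [s1 [s10 s1p s1q s11] H1] := cs_near dmet HG glob xp xq e0.
have [s2 [s20 s2p s2w s21] H2] := cs_near dmet HG glob xp xw e0.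
have [s3 [s30 s3q s3w s31] H3] := cs_near dmet HG glob xq xw e0.
have [r r0 [r1 r2 r3]] := min3 s10 s20 s30.
pose s := u * r.
have s0 : 0 < s by rewrite mulr_gt0.
have sr : s <= r by rewrite ler_piMl// ltW.
have e1 := H1 r r ltac:(lraw r1) ltac:(lraw r1).
have e2 := H2 r s ltac:(lraw r2) ltac:(lraw r2 sr).
have e3 := H3 r s ltac:(lraw r3) ltac:(lraw r3 sr).
have tri := dt (pt x p r) (pt x w s) (pt x q r).
rewrite (ds (pt x w s)) in tri.
set Dpq := d (pt x p r) (pt x q r) in e1 tri.
set Dpw := d (pt x p r) (pt x w s) in e2 tri.
set Dqw := d (pt x q r) (pt x w s) in e3 tri.
have p0 : 0 <= Dpq by exact: d_ge0.
move: e1 e2 e3; rewrite !ler_norml => /andP[e1 _] /andP[_ e2] /andP[_ e3].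
set a := cs x p w in e2 *; set b := cs x q w in e3 *.
have u2 : 0 < u ^+ 2 by rewrite exprn_gt0.
have r2' : 0 < r ^+ 2 by rewrite exprn_gt0.
have u21 : u ^+ 2 <= 1 by rewrite expr_le1// ltW.
have amgm (D c : R) : D ^+ 2 <= r ^+ 2 * (1 + u ^+ 2 - 2 * u * c + u ^+ 2 / 4 * (1 + u ^+ 2)) ->
    D <= r * (1 + u ^+ 2 / 2 - u * c + u ^+ 2 / 4).
  move=> hD; rewrite -(ler_pM2l (_ : 0 < 2 * r)); last by lraw.
  have : r ^+ 2 * (u ^+ 2 / 4 * (1 + u ^+ 2)) <= r ^+ 2 * (u ^+ 2 / 4 * 2).
    by rewrite ler_pM2l// ler_pM2l//; lraw u21.
  by have := sqr_ge0 (D - r); lraw hD.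
have k1 : Dpw <= r * (1 + u ^+ 2 / 2 - u * a + u ^+ 2 / 4).
  by apply: amgm; move: e2; rewrite /s; lraw.
have k2 : Dqw <= r * (1 + u ^+ 2 / 2 - u * b + u ^+ 2 / 4).
  by apply: amgm; move: e3; rewrite /s; lraw.
have k3 : r * (2 - 5 / 4 * u ^+ 2) <= Dpq.
  apply: le_of_sqr => //.
  have : r ^+ 2 * cs x p q <= r ^+ 2 * (-1 + u ^+ 2) by rewrite ler_pM2l.
  have : r ^+ 2 * (2 - 5 / 4 * u ^+ 2) ^+ 2 <= r ^+ 2 * (4 - 5 / 2 * u ^+ 2).
    by rewrite ler_pM2l//; nra.
  by rewrite exprMn; lraw e1.
have ru : 0 < r * u ^+ 2 by exact: mulr_gt0.
have k4 : r * (u * (a + b)) <= r * (u * (3 * u)) by lraw k1 k2 k3 ru tri.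
by move: k4; rewrite ler_pM2l// ler_pM2l.
Qed.

Lemma cs_opp x p q w u : 0 < d x p -> 0 < d x q -> 0 < d x w -> 0 < u <= 1 ->
  cs x p q <= -1 + u ^+ 2 -> `|cs x p w + cs x q w| <= 12 * u.
Proof.
move=> xp xq xw u01 h; rewrite ler_norml (cs_opp_ge xp xq xw u01 h) /=.
by apply: le_trans (cs_opp_le xp xq xw u01 h) _; lra.
Qed.

End Opposite.

Lemma fin_min (R : realType) (I : finType) (f : I -> R) : (forall i, 0 < f i) ->
  exists2 m, 0 < m & forall i, m <= f i.
Proof.
move=> f0; suff [m m0 mf] : exists2 m, 0 < m & forall i, i \in enum I -> m <= f i.
  by exists m => // i; apply: mf; rewrite mem_enum.
elim: (enum I) => [|i s [m m0 ms]]; first by exists 1.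
exists (Num.min m (f i)); first by rewrite lt_min m0 f0.
move=> j; rewrite inE => /orP[/eqP ->|/ms h]; first by rewrite ge_min lexx orbT.
by rewrite ge_min h.
Qed.

Lemma infinite_pigeonhole (V : eqType) (L : seq V) (Q : nat -> V -> Prop) :
  (forall n, exists2 v, v \in L & Q n v) ->
  exists2 v, v \in L & forall N, exists2 n, (N <= n)%N & Q n v.
Proof.
move=> H; apply: contrapT => no.
have bad v : v \in L -> exists N, forall n, (N <= n)%N -> ~ Q n v.
  move=> vL; apply: contrapT => /forallNP h; apply: no; exists v => // N.
  have /existsNP[n /not_implyP[Nn /contrapT Qn]] := h N.
  by exists n.
suff [N HN] : exists N, forall v, v \in L -> forall n, (N <= n)%N -> ~ Q n v.
  by have [v vL Qv] := H N; exact: (HN v vL N (leqnn N) Qv).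
elim: L bad {H no} => [|v L IH] bad; first by exists 0%N.
have [u uL|N1 HN1] := IH; first by apply: bad; rewrite inE uL orbT.
have [N2 HN2] := bad v (mem_head _ _).
exists (maxn N1 N2) => u; rewrite inE => /orP[/eqP ->|uL] n; rewrite geq_max => /andP[h1 h2].
  exact: HN2.
exact: HN1.
Qed.

(** Algebra of [lin_tail] in units of the scale [si]: the leading squares of [U] cancel, and what is
    linear in [U] is kept, to be divided by a large [U]. *)
Lemma lin_num (R : realType) (si U B s t r ci ck cl C e2 eta Wp Wq pq Wm Wl : R) :
  0 < si -> 1 <= U -> 1 <= B -> 0 <= s -> 0 <= t -> s + t <= B -> 0 <= r <= B ->
  0 <= Wm -> 0 <= Wl -> 0 < e2 -> 0 <= eta ->
  Wp / 2 + Wq / 2 - pq / 4 <= Wm ^+ 2 + C -> C <= e2 * si ^+ 2 ->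
  si ^+ 2 * (U ^+ 2 + s ^+ 2 - 2 * U * s * ci) - e2 * (si ^+ 2 * (U ^+ 2 + s ^+ 2)) <= Wp ->
  si ^+ 2 * (U ^+ 2 + t ^+ 2 - 2 * U * t * ck) - e2 * (si ^+ 2 * (U ^+ 2 + t ^+ 2)) <= Wq ->
  pq <= si ^+ 2 * B ^+ 2 -> Wm <= Wl + eta * si -> Wl <= (U + B) * si ->
  Wl ^+ 2 <= si ^+ 2 * (U ^+ 2 + r ^+ 2 - 2 * U * r * cl) +
     e2 * (si ^+ 2 * (U ^+ 2 + r ^+ 2)) ->
  2 * U * (r * cl - (s * ci + t * ck) / 2) <=
    2 * B ^+ 2 + 2 * (U + B) * eta + eta ^+ 2 + e2 * (2 * U ^+ 2 + 2 * B ^+ 2 + 1).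
Proof.
move=> si0 U1 B1 s0 t0 stB /andP[r0 rB] Wm0 Wl0 e20 eta0 h1 hC h2 h3 h4 h5 h6 h7.
have si2 : 0 < si ^+ 2 by rewrite exprn_gt0.
rewrite -(ler_pM2l si2).
have k1 : Wm ^+ 2 <= Wl ^+ 2 + 2 * (U + B) * si * (eta * si) + (eta * si) ^+ 2.
  have es0 : 0 <= eta * si by rewrite mulr_ge0// ltW.
  have : Wm ^+ 2 <= (Wl + eta * si) ^+ 2 by rewrite ler_sqr ?nnegrE// addr_ge0.
  have := ler_wpM2r es0 h6; lraw.
have sq (z : R) : 0 <= z -> z <= B -> z ^+ 2 <= B ^+ 2.
  by move=> z0 zB; rewrite ler_sqr ?nnegrE//; lraw z0 zB.
have r2 : si ^+ 2 * r ^+ 2 <= si ^+ 2 * B ^+ 2 by rewrite ler_pM2l// sq.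
have s2 : si ^+ 2 * s ^+ 2 <= si ^+ 2 * B ^+ 2 by rewrite ler_pM2l// sq//; lraw stB t0.
have t2 : si ^+ 2 * t ^+ 2 <= si ^+ 2 * B ^+ 2 by rewrite ler_pM2l// sq//; lraw s0 stB.
have s2' : 0 <= si ^+ 2 * s ^+ 2 by rewrite mulr_ge0 ?sqr_ge0.
have t2' : 0 <= si ^+ 2 * t ^+ 2 by rewrite mulr_ge0 ?sqr_ge0.
have r2e := ler_wpM2l (ltW e20) r2.
have s2e := ler_wpM2l (ltW e20) s2.
have t2e := ler_wpM2l (ltW e20) t2.
lraw h1 h2 h3 h4 h7 hC k1 r2 r2e s2 s2' s2e t2' t2e.
Qed.

Lemma close_num (R : realType) (si dd S Q eta : R) : 0 < si <= 1 -> 0 <= dd ->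
  dd ^+ 2 <= si ^+ 2 * S + Q * si ^+ 4 -> S <= (eta / 2) ^+ 2 -> 0 <= Q ->
  (Q + 4) * si <= (eta / 2) ^+ 2 -> 0 < eta <= 1 -> dd + si ^+ 2 <= eta * si.
Proof.
move=> /andP[s0 s1] dd0 h1 h2 Q0 h3 /andP[e0 e1].
have s2 : 0 < si ^+ 2 by rewrite exprn_gt0.
have k1 : si ^+ 2 * S <= si ^+ 2 * (eta / 2) ^+ 2 by rewrite ler_pM2l.
have k0 : si ^+ 2 <= si by rewrite expr2 ler_piMl// ltW.
have k2 : Q * si ^+ 2 <= (eta / 2) ^+ 2.
  have : Q * si ^+ 2 <= Q * si by rewrite ler_wpM2l.
  by lra.
have k3 : Q * si ^+ 4 <= si ^+ 2 * (eta / 2) ^+ 2.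
  by rewrite (_ : Q * si ^+ 4 = si ^+ 2 * (Q * si ^+ 2)); [rewrite ler_pM2l|ring].
have e2 : eta ^+ 2 <= eta by rewrite expr2 ler_piMl// ltW.
have k4 : 4 * si <= eta / 4.
  have : 0 <= Q * si by rewrite mulr_ge0// ltW.
  by rewrite (_ : (eta / 2) ^+ 2 = eta ^+ 2 / 4) in h3; [lra|field].
have k5 : dd <= 3 / 4 * eta * si.
  apply: le_of_sqr; first by rewrite !mulr_ge0// ltW.
  have : 0 < si ^+ 2 * eta ^+ 2 by rewrite mulr_gt0// exprn_gt0.
  by lra.
have : si ^+ 2 <= eta / 4 * si by rewrite expr2 ler_pM2r//; lraw k4.
lraw k5.
Qed.

Lemma close_num2 (R : realType) (si dd r rho B C c e1 eta : R) : 0 < si <= 1 -> 0 <= dd ->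
  0 <= r <= B -> 0 <= rho <= B -> 0 < C -> `|rho - r| <= e1 -> 1 - e1 <= c ->
  e1 ^+ 2 + 2 * B ^+ 2 * e1 <= (eta / 2) ^+ 2 -> 0 < eta <= 1 ->
  dd ^+ 2 <= (r * si) ^+ 2 + (rho * si) ^+ 2 - 2 * (r * si) * (rho * si) * c +
    C * ((r * si) ^+ 2 + (rho * si) ^+ 2) ^+ 2 ->
  (C * (4 * B ^+ 4) + 4) * si <= (eta / 2) ^+ 2 -> dd + si ^+ 2 <= eta * si.
Proof.
move=> si01 dd0 /andP[r0 rB] /andP[rho0 rhoB] C0 hr hc e1B eta01 h1 h2.
have B0 : 0 <= B by lra.
have e10 : 0 <= e1 by apply: le_trans hr.
apply: (@close_num _ si _ (r ^+ 2 + rho ^+ 2 - 2 * r * rho * c) (C * (4 * B ^+ 4)) eta) => //.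
- have rr : (r ^+ 2 + rho ^+ 2) ^+ 2 <= 4 * B ^+ 4.
    have -> : 4 * B ^+ 4 = (B ^+ 2 + B ^+ 2) ^+ 2 by ring.
    rewrite ler_sqr ?nnegrE ?addr_ge0 ?sqr_ge0//.
    by rewrite lerD// ler_sqr ?nnegrE.
  apply: le_trans h1 _.
  have -> : ((r * si) ^+ 2 + (rho * si) ^+ 2) ^+ 2 =
     si ^+ 4 * (r ^+ 2 + rho ^+ 2) ^+ 2 by ring.
  have [si0 _] := andP si01.
  have : C * (si ^+ 4 * (r ^+ 2 + rho ^+ 2) ^+ 2) <= C * (si ^+ 4 * (4 * B ^+ 4)).
    by rewrite ler_pM2l// ler_pM2l// exprn_gt0.
  lraw.
- apply: le_trans e1B.
  have rr0 : 0 <= r * rho by rewrite mulr_ge0.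
  have rr : r * rho <= B ^+ 2 by rewrite expr2 ler_pM.
  have k1 : r * rho * (1 - c) <= r * rho * e1 by rewrite ler_wpM2l//; lraw hc.
  have k2 : r * rho * e1 <= B ^+ 2 * e1 by rewrite ler_wpM2r.
  have k3 : (rho - r) ^+ 2 <= e1 ^+ 2.
    by rewrite -real_normK ?num_real// ler_sqr ?nnegrE ?normr_ge0.
  lraw k1 k2 k3.
- by rewrite mulr_ge0 ?(ltW C0)// mulr_ge0// exprn_ge0.
Qed.

(** * Directions at a generic point and their sums *)

Section Tangent.
Variable R : realType.
Variables (T : Type) (d : T -> T -> R).
Variable G : T -> T -> R -> T.
Hypothesis dmet : is_metric d.
Hypothesis HG : forall x y, is_geodesic d (G x y) x y.
Hypothesis glob : glob_cmp d d.
Variable a : nat -> T.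
Hypothesis adense : forall x e, 0 < e -> exists i, d x (a i) < e.
Variables A b : R.
Hypothesis A0 : 0 < A.
Hypothesis pk : forall x s K (I : finType) (f : I -> T),
    0 < s <= 1 -> 1 <= K -> (forall i, d x (f i) <= s) -> separated d f (s / K) ->
    #|I|%:R <= A * K `^ b.

(** The dense sequence supplies the directions; the almost opposite ones serve to turn one-sided
    comparison inequalities into approximate equalities. *)
Definition generic (x : T) : Prop := (forall i, 0 < d x (a i)) /\
  forall i e, 0 < e -> exists k, cs d G x (a i) (a k) <= -1 + e.

Variable x : T.
Hypothesis gx : generic x.
Local Notation c i k := (cs d G x (a i) (a k)).
Local Notation P i s := (pt d G x (a i) s).

Let dpm : is_pseudometric d. Proof. exact: metric_pseudo. Qed.
Let d_ge0 p q : 0 <= d p q. Proof. exact: pm_ge0. Qed.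
Let ds p q : d p q = d q p. Proof. by case: dmet. Qed.
Let dt p q r : d p r <= d p q + d q r. Proof. by case: dmet. Qed.
Let xa i : 0 < d x (a i). Proof. by case: gx. Qed.

Lemma c_sym i k : c i k = c k i. Proof. exact: cs_sym. Qed.
Lemma c_diag i : c i i = 1. Proof. exact: cs_diag. Qed.
Lemma c_abs i k : `|c i k| <= 1. Proof. by rewrite ler_norml cs_bound. Qed.

Lemma c_opp i e : 0 < e -> exists k, forall w, `|c i w + c k w| <= e.
Proof.
move=> e0; pose u := Num.min 1 (e / 12).
have u0 : 0 < u by rewrite lt_min ltr01 divr_gt0.
have u1 : u <= 1 by rewrite ge_min lexx.
have ue : u <= e / 12 by rewrite ge_min lexx orbT.
have u20 : 0 < u ^+ 2 by rewrite exprn_gt0.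
have [_ /(_ i _ u20)[k hk]] := gx.
exists k => w; have u01 : 0 < u <= 1 by rewrite u0.
by apply: le_trans (cs_opp dmet HG glob (xa i) (xa k) (xa w) u01 hk) _; lra.
Qed.

(** Pairs of a direction and a radius are points of a Euclidean cone. By [cs_near] finitely many of
    them are realised at one small scale with half of the separation, where the packing bound
    applies. *)
Lemma finite_separated (I : finType) (idx : I -> nat) (rr : I -> R) (M del : R) :
  1 <= M -> 0 < del <= M -> (forall i, 0 <= rr i <= M) ->
  (forall i j, i != j ->
     del ^+ 2 <= rr i ^+ 2 + rr j ^+ 2 - 2 * rr i * rr j * c (idx i) (idx j)) ->
  #|I|%:R <= A * (2 * M / del) `^ b.
Proof.
move=> M1 /andP[del0 delM] rM sep.
have M0 : 0 < M by lra.
have M2 : 0 < M ^+ 2 by rewrite exprn_gt0.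
pose e := del ^+ 2 / (4 * M ^+ 2).
have e0 : 0 < e by rewrite divr_gt0 ?exprn_gt0// mulr_gt0.
have near (p : I * I) : exists s0, 0 < s0 /\ forall s t, 0 <= s <= s0 -> 0 <= t <= s0 ->
   (s0 <= 1 /\ s0 <= d x (a (idx p.1)) /\
   `|d (P (idx p.1) s) (P (idx p.2) t) ^+ 2 -
     (s ^+ 2 + t ^+ 2 - 2 * s * t * c (idx p.1) (idx p.2))| <= e * (s ^+ 2 + t ^+ 2)).
  have [s0 [h1 h2 h3 h4] h5] := cs_near dmet HG glob (xa (idx p.1)) (xa (idx p.2)) e0.
  by exists s0; split => // s t hs ht; split => //; split => //; exact: h5.
have [s0 Hs0] := choice near.
have [m m0 mle] := fin_min (fun p => (Hs0 p).1).
pose s := Num.min 1 m / M.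
have mm0 : 0 < Num.min 1 m by rewrite lt_min ltr01.
have mm1 : Num.min 1 m <= 1 by rewrite ge_min lexx.
have mmm : Num.min 1 m <= m by rewrite ge_min lexx orbT.
have sp : 0 < s by rewrite divr_gt0.
have sM : s * M = Num.min 1 m by rewrite divfK// gt_eqF.
have in0 i p : 0 <= rr i * s <= s0 p.
  have /andP[r0 r1] := rM i; rewrite mulr_ge0 ?(ltW sp)//=.
  apply: le_trans (mle p); apply: le_trans mmm; rewrite -sM mulrC.
  by rewrite ler_pM2l.
apply: (pk (x := x) (s := s * M) (f := fun i => P (idx i) (rr i * s))).
- by rewrite sM mm0.
- by rewrite ler_pdivlMr//; lraw delM.
- move=> i; have [_ [h _]] := (Hs0 (i, i)).2 _ _ (in0 i (i, i)) (in0 i (i, i)).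
  have h' := in0 i (i, i); have /andP[r0 r1] := rM i.
  rewrite (pt_d dmet HG (xa _)); first by rewrite mulrC ler_pM2l.
  by case/andP: h' => -> /= h''; exact: le_trans h'' h.
move=> i j ij.
have [_ [_ h]] := (Hs0 (i, j)).2 _ _ (in0 i (i, j)) (in0 j (i, j)).
have -> : s * M / (2 * M / del) = s * del / 2 by field; rewrite !gt_eqF.
apply: le_of_sqr; first exact: d_ge0.
apply: le_trans (norm_lower h); rewrite /=.
have hs := sep i j ij.
have sq z : 0 <= z <= M -> z ^+ 2 <= M ^+ 2.
  by move=> /andP[z0 zM]; rewrite ler_sqr ?nnegrE// ltW.
have q1 := sq _ (rM i); have q2 := sq _ (rM j).
have s2 : 0 < s ^+ 2 by rewrite exprn_gt0.
have k1 := ler_wpM2l (ltW s2) hs.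
have k2 : e * ((rr i * s) ^+ 2 + (rr j * s) ^+ 2) <= s ^+ 2 * (del ^+ 2 / 2).
  have -> : e * ((rr i * s) ^+ 2 + (rr j * s) ^+ 2) =
    s ^+ 2 * (e * (rr i ^+ 2 + rr j ^+ 2)) by ring.
  rewrite ler_pM2l//.
  have -> : del ^+ 2 / 2 = e * (2 * M ^+ 2) by rewrite /e; field; rewrite gt_eqF.
  by rewrite ler_pM2l//; lraw q1 q2.
have k3 : 0 < s ^+ 2 * del ^+ 2 by rewrite mulr_gt0// exprn_gt0.
lraw k1 k2 k3.
Qed.

Lemma no_big_family (e : R) : 0 < e <= 1 -> ~ (forall N, exists idx : 'I_N -> nat,
  forall i j, i != j -> c (idx i) (idx j) < 1 - e).
Proof.
move=> /andP[e0 e1] H.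
pose B := A * (2 * 1 / e) `^ b.
have [idx sep] := H (Num.bound B).+1.
have : #|'I_(Num.bound B).+1|%:R <= B.
  apply: (@finite_separated _ idx (fun _ => 1)) => //.
  - by rewrite e0.
  - by move=> _; rewrite ler01 lexx.
  - move=> i j ij; have := sep _ _ ij => h.
    have : e ^+ 2 <= e by rewrite expr2 ler_piMl// ltW.
    lra.
have B0 : 0 <= B by rewrite mulr_ge0 ?(ltW A0)// powR_ge0.
rewrite card_ord -natr1; have := archi_boundP B0; lra.
Qed.

(** A greedy choice that never stopped would give arbitrarily large families of separated
    directions. *)
Lemma dir_net (e : R) : 0 < e <= 1 -> exists S : seq nat,
  forall i, exists2 k, k \in S & 1 - e <= c i k.
Proof.
move=> e01; apply: contrapT => no; apply: (no_big_family e01) => N.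
have pick (S : seq nat) : exists i, forall k, k \in S -> c i k < 1 - e.
  apply: contrapT => /forallNP h; apply: no; exists S => i.
  have /existsNP[k /not_implyP[kS /negP]] := h i; rewrite -leNgt => ?.
  by exists k.
have [F HF] := choice pick.
pose sq := fix sq n := match n with 0%N => [::] | m.+1 => F (sq m) :: sq m end.
have mem m n : (m < n)%N -> F (sq m) \in sq n.
  elim: n => // n IH; rewrite ltnS leq_eqVlt => /orP[/eqP ->|/IH h] /=.
    by rewrite mem_head.
  by rewrite inE h orbT.
exists (fun i : 'I_N => F (sq i)) => i j; rewrite neq_ltn => /orP[ij|ij].
  by rewrite c_sym; apply: HF; exact: mem.
by apply: HF; exact: mem.
Qed.

(** A test point [W] far out, at distance U si towards [w], acts like a Busemann function. The
    midpoint [m] is within eta si of the ray of [l], and [mid_stewart] from [W] bounds 2 U times the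
    left side by 2 B^2 + 2, which is at most 2 U e by the choice of [U]. *)
Lemma lin_tail i k l s t r B U eta e1 e : 0 <= s -> 0 <= t -> 2 * (s + t) + 1 <= B ->
  1 <= U -> 2 * B ^+ 2 + 2 <= 2 * U * e -> 0 < eta <= 1 ->
  2 * (U + B) * eta + eta ^+ 2 <= 1 -> 0 < e1 -> e1 ^+ 2 + 2 * B ^+ 2 * e1 <= (eta / 2) ^+ 2 ->
  0 <= r <= B ->
  (forall sg, 0 < sg -> exists si L rho, [/\ 0 < si <= sg,
     0 <= s * si <= d x (a i) /\ 0 <= t * si <= d x (a k),
     d (G (P i (s * si)) (P k (t * si)) (1 / 2)) (a L) <= si ^+ 2,
     d x (a L) = rho * si /\ 1 - e1 <= c L l & 0 <= rho <= B /\ `|rho - r| <= e1]) ->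
  forall w, r * c l w - (s * c i w + t * c k w) / 2 <= e.
Proof.
move=> s0 t0 stB U1 Ue /andP[eta0 eta1] etaU e10 e1B /andP[r0 rB] Hinf w.
have B1 : 1 <= B by lraw s0 stB t0.
have h01 : 0 <= (1 / 2 : R) <= 1 by lraw.
have sB : s <= B by lraw s0 stB t0.
have tB : t <= B by lraw s0 stB t0.
have stB' : s + t <= B by lraw s0 stB t0.
have sstB : s + (s + t) / 2 <= B by lraw s0 stB t0.
have B0 : 0 <= B by lraw r0 rB.
have U0 : 0 < U by lraw U1.
have fin2 : 2 * B ^+ 2 + 2 * (U + B) * eta + eta ^+ 2 + 1 <= 2 * B ^+ 2 + 2 by lraw etaU.
have [e2 e20 e2E] : exists2 e2, 0 < e2 & e2 * (2 * U ^+ 2 + 2 * B ^+ 2 + 1) = 1.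
  have e2d : 0 < 2 * U ^+ 2 + 2 * B ^+ 2 + 1 by have := sqr_ge0 U; have := sqr_ge0 B; lraw.
  by exists (2 * U ^+ 2 + 2 * B ^+ 2 + 1)^-1; rewrite ?invr_gt0// mulVf// gt_eqF.
have [C C0 HC] := mid_stewart dmet glob.
have [C' C'0 HC'] := cs_upper dmet HG glob.
have [s1 [s10 s1i s1w s11] H1] := cs_near dmet HG glob (xa i) (xa w) e20.
have [s2 [s20 s2k s2w s21] H2] := cs_near dmet HG glob (xa k) (xa w) e20.
have [s3 [s30 s3l s3w s31] H3] := cs_near dmet HG glob (xa l) (xa w) e20.
have [V VE V1] : exists2 V, V = U + B & 1 <= V.
  by exists (U + B) => //; apply: le_trans U1 _; rewrite lerDl ltW// (lt_le_trans ltr01).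
have V0 : 0 < V := lt_le_trans ltr01 V1.
have UV : U <= V by rewrite VE lerDl.
have BV : B <= V by rewrite VE lerDr ltW.
have V41 : V <= 4 * V by rewrite ler_peMl ?(ltW V0)// ler1n.
have [D1 D1E D10] : exists2 D1, D1 = C * (4 * V) ^+ 4 & 0 < D1.
  by exists (C * (4 * V) ^+ 4) => //; rewrite mulr_gt0// exprn_gt0// mulr_gt0.
have [D2 D2E D20] : exists2 D2, D2 = C' * (4 * B ^+ 4) + 4 & 0 < D2.
  exists (C' * (4 * B ^+ 4) + 4) => //.
  by rewrite ltr_wpDl// mulr_ge0 ?(ltW C'0)// mulr_ge0// exprn_ge0// (le_trans ler01).
have h2 : 0 < eta / 2 by rewrite divr_gt0.
have [mm mm0 [[q1 q2 q3] [q4 q5 q6]]] : exists2 mm, 0 < mm & ([/\ mm <= s1, mm <= s2 & mm <= s3] /\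
   [/\ mm <= 1, mm <= e2 / D1 & mm <= (eta / 2) ^+ 2 / D2]).
  pose mm := Num.min (Num.min (Num.min s1 s2) (Num.min s3 1))
   (Num.min (e2 / D1) ((eta / 2) ^+ 2 / D2)).
  exists mm; first by rewrite !lt_min s10 s20 s30 ltr01 !divr_gt0 ?exprn_gt0.
  by rewrite /mm !ge_min !lexx !orbT.
have [|si' [L [rho [/andP[si'0 siV'] [bi bk] hL1 [hL2 hL3] [/andP[rho0 rhoB] hL4]]]]] :=
  Hinf (mm / (4 * V)); first by rewrite divr_gt0// mulr_gt0.
have siV : 4 * V * si' <= mm by rewrite mulrC -ler_pdivlMr// mulr_gt0.
have PQ' : d (P i (s * si')) (P k (t * si')) <= (s + t) * si'.
  by rewrite mulrDl; exact: (pt_le dmet HG (xa i) (xa k) bi bk).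
set m := G (P i (s * si')) (P k (t * si')) (1 / 2) in hL1.
have sile1 : si' <= mm.
  by apply: le_trans siV; rewrite ler_peMl ?(ltW si'0)// (le_trans V1).
have sUB z : 0 <= z -> z <= V -> 0 <= z * si' <= mm.
  move=> z0 zV; rewrite mulr_ge0 ?(ltW si'0)//=; apply: le_trans siV.
  by rewrite ler_pM2r// (le_trans zV).
have VB z : 0 <= z -> z <= B -> 0 <= z * si' <= mm by move=> z0 zB; apply: sUB => //; exact: le_trans BV.
have up z y : mm <= y -> 0 <= z <= mm -> 0 <= z <= y.
  by move=> my /andP[-> /=]; move/le_trans; apply.
have bU : 0 <= U * si' <= mm by apply: sUB => //; exact: ltW.
have bs := VB _ s0 sB; have bt := VB _ t0 tB; have br := VB _ r0 rB.
have brho := VB _ rho0 rhoB.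
set W := P w (U * si').
have hl : 0 <= r * si' <= d x (a l) by apply: up br; exact: le_trans q3 s3l.
have hw : 0 <= U * si' <= d x (a w) by apply: up bU; exact: le_trans q3 s3w.
have hL : 0 <= rho * si' <= d x (a L) by rewrite hL2 lexx andbT mulr_ge0// ltW.
have le1 z : 0 <= z <= mm -> z <= 1 by move=> /andP[_ /le_trans]; apply.
have eL : P L (rho * si') = a L by rewrite -hL2 (pt_end HG).
have cl1 := HC' x (a l) (a L) _ _ (xa l) (xa L) hl hL (le1 _ br) (le1 _ brho).
rewrite eL c_sym in cl1.
have si1 : si' <= 1 by exact: le_trans q4.
have close : d (P l (r * si')) (a L) + si' ^+ 2 <= eta * si'.
  apply: (close_num2 (B := B) (C := C') _ _ _ _ _ hL4 hL3 e1B _ cl1) => //;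
    rewrite ?r0 ?rho0 ?si'0 ?eta0 ?C'0//.
  by rewrite -D2E mulrC -ler_pdivlMr//; apply: le_trans sile1 q6.
have Wml : d W m <= d W (P l (r * si')) + eta * si'.
  apply: le_trans (dt W (P l (r * si')) m) _; rewrite lerD2l.
  apply: le_trans (dt _ (a L) _) _; apply: le_trans close.
  by rewrite lerD2l ds.
have dxm : d x m <= B * si'.
  have h1 := dt x (P i (s * si')) m.
  rewrite (pt_d dmet HG (xa i) bi) (geod_d0 (HG _ _) h01) in h1.
  apply: le_trans h1 _; apply: (@le_trans _ _ ((s + (s + t) / 2) * si')).
    rewrite mulrDl lerD2l (_ : (s + t) / 2 * si' = 1 / 2 * ((s + t) * si')); last by field.
    by rewrite ler_pM2l// divr_gt0.
  by rewrite ler_pM2r.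
have Wm : d W m <= V * si'.
  apply: le_trans (dt _ x _) _; rewrite ds /W (pt_d dmet HG (xa w) hw) VE mulrDl.
  by rewrite lerD2l.
have ms := HC W _ _ _ (4 * V * si') (HG (P i (s * si')) (P k (t * si'))).
have Vs0 : 0 < V * si' by rewrite mulr_gt0.
have stV : (s + t) * si' <= V * si' by rewrite ler_pM2r// (le_trans stB').
have V4 : V * si' <= 4 * V * si' by rewrite ler_pM2r.
have {}ms := ms (le_trans PQ' (le_trans stV V4)) (le_trans Wm V4) (le_trans siV q4).
have n1 := norm_lower (H1 _ _ (up _ _ q1 bs) (up _ _ q1 bU)).
have n2 := norm_lower (H2 _ _ (up _ _ q2 bt) (up _ _ q2 bU)).
have n3 := H3 _ _ (up _ _ q3 br) (up _ _ q3 bU).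
rewrite (ds _ (P w _)) -/W in n1; rewrite (ds _ (P w _)) -/W in n2.
rewrite (ds _ (P w _)) -/W in n3.
suff : 2 * U * (r * c l w - (s * c i w + t * c k w) / 2) <= 2 * U * e.
  by rewrite ler_pM2l// mulr_gt0.
apply: le_trans (_ : 2 * B ^+ 2 + 2 <= _); last exact: Ue.
apply: (@le_trans _ _ (2 * B ^+ 2 + 2 * (U + B) * eta + eta ^+ 2 +
   e2 * (2 * U ^+ 2 + 2 * B ^+ 2 + 1))); last by rewrite e2E; exact: fin2.
apply: (lin_num (si := si') (C := C * (4 * V * si') ^+ 4) (Wl := d W (P l (r * si')))
   _ _ _ _ _ _ _ _ _ _ _ ms) => //.
- by rewrite r0.
- exact: ltW.
- have -> : C * (4 * V * si') ^+ 4 = D1 * si' ^+ 2 * si' ^+ 2 by rewrite D1E; ring.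
  rewrite ler_pM2r ?exprn_gt0//; apply: (@le_trans _ _ (D1 * si')).
    by rewrite ler_pM2l// expr2 ler_piMl// ltW.
  by rewrite mulrC -ler_pdivlMr//; exact: le_trans q5.
- by apply: le_trans n1; rewrite le_eqVlt; apply/orP; left; apply/eqP; ring.
- by apply: le_trans n2; rewrite le_eqVlt; apply/orP; left; apply/eqP; ring.
- rewrite -exprMn ler_sqr ?nnegrE//; last by rewrite mulr_ge0 ?(ltW si'0).
  by apply: le_trans PQ' _; rewrite mulrC ler_pM2l.
- apply: le_trans (pt_le dmet HG (xa w) (xa l) hw hl) _.
  by rewrite mulrDl lerD2l ler_pM2r.
- move: n3; rewrite ler_norml => /andP[_ n3].
  have -> : si' ^+ 2 * (U ^+ 2 + r ^+ 2 - 2 * U * r * c l w) + e2 * (si' ^+ 2 * (U ^+ 2 + r ^+ 2))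
    = ((r * si') ^+ 2 + (U * si') ^+ 2 - 2 * (r * si') * (U * si') * c l w) +
      e2 * ((r * si') ^+ 2 + (U * si') ^+ 2) by ring.
  by rewrite -lerBlDl.
Qed.

(** Half the sum of the vectors s i and t k is seen as a limit of midpoints at scales tending to 0.
    Up to [e1] their directions and rescaled lengths take finitely many values, so one pair recurs
    at infinitely many scales. Only one inequality results, comparison being one-sided. *)
Lemma lin_one_sided i k s t e : 0 <= s -> 0 <= t -> 0 < e ->
  exists l r, 0 <= r <= 2 * (s + t) + 1 /\
    forall w, r * c l w - (s * c i w + t * c k w) / 2 <= e.
Proof.
move=> s0 t0 e0; pose B := 2 * (s + t) + 1.
have B1 : 1 <= B by rewrite /B; lra.
(* [U] beats the quadratic error 2 B^2 + 2. Below, [eta] is the tolerance for the midpoint in units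
   of the scale, and [e1] the tolerance for direction and length that ensures it. *)
pose U := (2 * B ^+ 2 + 2) / e + 1.
have U1 : 1 <= U by rewrite /U lerDr divr_ge0 ?(ltW e0)//; have := sqr_ge0 B; lra.
have Ue : 2 * B ^+ 2 + 2 <= 2 * U * e.
  have -> : 2 * U * e = 2 * (2 * B ^+ 2 + 2) + 2 * e by rewrite /U; field; rewrite gt_eqF.
  by have := sqr_ge0 B; lra.
pose eta := (4 * (U + B) + 1)^-1.
have UB : 1 < 4 * (U + B) + 1 by lra.
have eta0 : 0 < eta by rewrite invr_gt0; lra.
have eta1 : eta <= 1 by rewrite invf_le1; lraw B1 U1.
have etaU : 2 * (U + B) * eta + eta ^+ 2 <= 1.
  have e1 : (4 * (U + B) + 1) * eta = 1 by rewrite mulfV// gt_eqF//; lra.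
  have : eta ^+ 2 <= eta by rewrite expr2 ler_piMl// ltW.
  have : 0 < (U + B) * eta by rewrite mulr_gt0//; lra.
  lra.
pose e1 := (eta / 2) ^+ 2 / (4 * B ^+ 2).
have B2 : 1 <= B ^+ 2 by nra.
have e10 : 0 < e1 by rewrite divr_gt0 ?exprn_gt0 ?mulr_gt0//; lraw B1.
have e11 : e1 <= 1.
  rewrite /e1 ler_pdivrMr; last by lra.
  have : (eta / 2) ^+ 2 <= 1 by rewrite expr_le1//; lraw eta1.
  by lra.
have e1B : e1 ^+ 2 + 2 * B ^+ 2 * e1 <= (eta / 2) ^+ 2.
  have -> : (eta / 2) ^+ 2 = 4 * B ^+ 2 * e1 by rewrite /e1 [RHS]mulrC divfK// gt_eqF//; lraw B2.
  have : e1 ^+ 2 <= e1 by rewrite expr2 ler_piMl// ltW.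
  have : e1 <= B ^+ 2 * e1 by rewrite ler_peMl// ltW.
  have : 0 <= B ^+ 2 * e1 by rewrite mulr_ge0 ?sqr_ge0// ltW.
  lraw.
have e101 : 0 < e1 <= 1 by rewrite e10.
have [S HS] := dir_net e101.
(* Lengths in [0, B] are rounded down to multiples of [e1], which leaves at most [J] values. *)
pose J := (Num.bound (B / e1)).+1.
have [sg sg0 [sgi sgk sg1 _]] : exists2 sg : R, 0 < sg &
    [/\ sg * B <= d x (a i), sg * B <= d x (a k), sg <= 1 & True].
  pose m := Num.min (Num.min (d x (a i)) (d x (a k))) 1.
  have m0 : 0 < m by rewrite !lt_min !xa ltr01.
  have Bp : 0 < B by lraw B1.
  exists (m / B); first by rewrite divr_gt0.
  have eB : m / B * B = m by rewrite divfK// gt_eqF.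
  rewrite eB; split => //; first by rewrite /m !ge_min lexx.
    by rewrite /m !ge_min lexx orbT.
  by rewrite ler_pdivrMr// mul1r; apply: le_trans B1; rewrite /m !ge_min lexx orbT.
pose si (n : nat) := sg / n.+1%:R.
have si0 n : 0 < si n by rewrite divr_gt0.
have sile n : si n <= sg by rewrite ler_pdivrMr// ler_peMr ?(ltW sg0)// ler1n.
have siB n : si n * B <= d x (a i) /\ si n * B <= d x (a k).
  have : si n * B <= sg * B by rewrite ler_wpM2r//; lraw B1.
  by lraw sgi sgk.
pose m n := G (P i (s * si n)) (P k (t * si n)) (1 / 2).
pose Q n (v : nat * nat) := exists L rho, [/\ d (m n) (a L) <= si n ^+ 2,
  d x (a L) = rho * si n, 1 - e1 <= c L v.1,
  0 <= rho <= B & `|rho - v.2%:R * e1| <= e1 /\ v.2%:R * e1 <= rho].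
have h01 : 0 <= (1 / 2 : R) <= 1 by lraw.
have bi n : 0 <= s * si n <= d x (a i).
  rewrite mulr_ge0 ?(ltW (si0 n))//=; apply: le_trans (siB n).1.
  by rewrite mulrC ler_pM2l ?si0// /B; lraw s0 t0.
have bk n : 0 <= t * si n <= d x (a k).
  rewrite mulr_ge0 ?(ltW (si0 n))//=; apply: le_trans (siB n).2.
  by rewrite mulrC ler_pM2l ?si0// /B; lraw s0 t0.
have PQle n : d (P i (s * si n)) (P k (t * si n)) <= (s + t) * si n.
  by rewrite mulrDl; exact: (pt_le dmet HG (xa i) (xa k) (bi n) (bk n)).
have hQ n : exists2 v, v \in [seq (l, j) | l <- S, j <- iota 0 J] & Q n v.
  have si2 : 0 < si n ^+ 2 by rewrite exprn_gt0.
  have [L hL] := adense (m n) si2.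
  have [l lS hl] := HS L.
  pose rho := d x (a L) / si n.
  have rhoE : d x (a L) = rho * si n by rewrite divfK// gt_eqF.
  have rho0 : 0 <= rho by rewrite divr_ge0// ltW.
  have rhoB : rho <= B.
    rewrite ler_pdivrMr ?si0//.
    have h1 := dt x (P i (s * si n)) (m n); have h2 := dt x (m n) (a L).
    rewrite (pt_d dmet HG (xa i) (bi n)) (geod_d0 (HG _ _) h01) in h1.
    have h3 := PQle n; have s1 : si n ^+ 2 <= si n.
      by rewrite expr2 ler_piMl ?(ltW (si0 n))//; apply: le_trans (sile n) _.
    have h5 : 0 <= t * si n by rewrite mulr_ge0// ltW.
    have h6 : 0 <= s * si n by rewrite mulr_ge0// ltW.
    by rewrite /B; lraw h1 h2 h3 h5 h6 hL s1.
  pose j := Num.trunc (rho / e1).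
  have r1 : 0 <= rho / e1 by rewrite divr_ge0// ltW.
  have /andP[j1 j2] := truncn_itv r1.
  have j1' : j%:R * e1 <= rho by rewrite -ler_pdivlMr.
  have j2' : rho < j.+1%:R * e1 by rewrite -ltr_pdivrMr.
  exists (l, j).
    apply/allpairsP; exists (l, j); split; [exact: lS| |by []]; rewrite mem_iota add0n leq0n andTb ltnS.
    rewrite -(ler_nat R); apply: le_trans (ltW (archi_boundP _)); last first.
      by rewrite divr_ge0 ?(ltW e10)//; lraw rho0 rhoB.
    by apply: le_trans j1 _; rewrite ler_pM2r// invr_gt0.
  exists L, rho; split => //=; first exact: ltW.
    by rewrite rho0.
  split => //; rewrite ger0_norm ?subr_ge0//.
  by move: j2'; rewrite -natr1 mulrDl mul1r; lraw.
have [[l j] _ Hinf] := infinite_pigeonhole hQ.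
pose r := j%:R * e1.
have r0 : 0 <= r by rewrite mulr_ge0// ltW.
have rB : r <= B.
  have [n _ [L [rho [_ _ _ /andP[_ rhoB] [_ /= h]]]]] := Hinf 0%N.
  exact: le_trans h rhoB.
exists l, r; split; first by rewrite r0.
apply: (lin_tail s0 t0 (lexx _) U1 Ue _ etaU e10 e1B); first by rewrite eta0.
  by rewrite r0.
move=> sg' sg'0; have [n Nn [L [rho [hL1 hL2 hL3 hL4 [hL5 _]]]]] := Hinf (Num.bound (sg / sg')).
exists (si n), L, rho; split => //; rewrite si0 /=.
have sV : 0 <= sg / sg' by rewrite divr_ge0 ?ltW.
rewrite ler_pdivrMr// mulrC -ler_pdivrMr//.
apply: le_trans (ltW (archi_boundP sV)) _.
by rewrite ler_nat; apply: leq_trans Nn _.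
Qed.

End Tangent.

(** * Euclidean norms and the tangent space at a generic point *)

Section Euclid.
Variable R : realType.

Definition enorm (I : finType) (f : I -> R) : R := Num.sqrt (\sum_i f i ^+ 2).

Lemma sumsq_ge0 (I : finType) (f : I -> R) : 0 <= \sum_i f i ^+ 2.
Proof. by apply: sumr_ge0 => i _; exact: sqr_ge0. Qed.

Lemma enorm_ge0 (I : finType) (f : I -> R) : 0 <= enorm f.
Proof. exact: sqrtr_ge0. Qed.

Lemma enorm_sqr (I : finType) (f : I -> R) : enorm f ^+ 2 = \sum_i f i ^+ 2.
Proof. by rewrite sqr_sqrtr// sumsq_ge0. Qed.

Lemma cauchy_schwarz (I : finType) (f g : I -> R) :
  (\sum_i f i * g i) ^+ 2 <= (\sum_i f i ^+ 2) * (\sum_i g i ^+ 2).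
Proof.
set A := \sum_i f i ^+ 2; set B := \sum_i _ * _; set C := \sum_i g i ^+ 2.
have e : \sum_i (C * f i - B * g i) ^+ 2 = C * (A * C - B ^+ 2).
  have e' (x y : R) : \sum_i (x * f i - y * g i) ^+ 2 = x ^+ 2 * A - 2 * x * y * B + y ^+ 2 * C.
    rewrite /A /B /C !mulr_sumr -sumrB -big_split /=.
    by apply: eq_bigr => i _; ring.
  by rewrite e'; ring.
have : 0 <= C by exact: sumsq_ge0.
rewrite le_eqVlt => /orP[/eqP C0|C0].
  have g0 i : g i = 0.
    apply/eqP; rewrite -sqrf_eq0; move/eqP: C0; rewrite eq_sym psumr_eq0.
      by move/allP/(_ i (mem_index_enum i)).
    by move=> k _; exact: sqr_ge0.
  rewrite -C0 mulr0 (_ : B = 0) ?expr0n// /B big1// => i _.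
  by rewrite g0 mulr0.
by have := sumsq_ge0 (fun i => C * f i - B * g i); rewrite e pmulr_rge0// subr_ge0.
Qed.

Lemma dot_le_enorm (I : finType) (f g : I -> R) : `|\sum_i f i * g i| <= enorm f * enorm g.
Proof.
rewrite -(ler_pXn2r (_ : 0 < 2)%N)// ?nnegrE ?mulr_ge0 ?enorm_ge0//.
by rewrite real_normK ?num_real// exprMn !enorm_sqr cauchy_schwarz.
Qed.

Lemma enormD (I : finType) (f g : I -> R) : enorm (fun i => f i + g i) <= enorm f + enorm g.
Proof.
rewrite -(ler_pXn2r (_ : 0 < 2)%N)// ?nnegrE ?addr_ge0 ?enorm_ge0//.
rewrite enorm_sqr sqrrD !enorm_sqr.
have -> : \sum_i (f i + g i) ^+ 2 =
    \sum_i f i ^+ 2 + (\sum_i f i * g i) *+ 2 + \sum_i g i ^+ 2.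
  by rewrite -sumrMnl -!big_split /=; apply: eq_bigr => i _; rewrite sqrrD.
rewrite lerD2r lerD2l ler_wMn2r//.
by apply: le_trans (dot_le_enorm f g); exact: ler_norm.
Qed.

Lemma eq_enorm (I : finType) (f g : I -> R) : f =1 g -> enorm f = enorm g.
Proof. by move=> e; congr Num.sqrt; apply: eq_bigr => i _; rewrite e. Qed.

Lemma enormZ (I : finType) (s : R) (f : I -> R) : enorm (fun i => s * f i) = `|s| * enorm f.
Proof.
rewrite /enorm (_ : \sum_i _ = s ^+ 2 * \sum_i f i ^+ 2).
  by rewrite sqrtrM ?sqr_ge0// sqrtr_sqr.
by rewrite mulr_sumr; apply: eq_bigr => i _; rewrite exprMn.
Qed.

Lemma enorm_le (I : finType) (f : I -> R) c : 0 <= c -> (forall i, `|f i| <= c) ->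
  enorm f <= #|I|%:R * c.
Proof.
move=> c0 fc; rewrite -(ler_pXn2r (_ : 0 < 2)%N)// ?nnegrE ?mulr_ge0 ?enorm_ge0//.
rewrite enorm_sqr exprMn; apply: (@le_trans _ _ (#|I|%:R * c ^+ 2)).
  apply: le_trans (_ : \sum_(i : I) c ^+ 2 <= _).
    apply: ler_sum => i _; rewrite -[leLHS]real_normK ?num_real//.
    by rewrite ler_sqr ?nnegrE.
  by rewrite sumr_const mulr_natl.
apply: ler_wpM2r; first exact: sqr_ge0.
rewrite expr2 -natrM ler_nat; by case: #|I| => // k; rewrite leq_pmulr.
Qed.

Lemma coord_le_enorm (I : finType) (f : I -> R) i : `|f i| <= enorm f.
Proof.
rewrite -(ler_pXn2r (_ : 0 < 2)%N)// ?nnegrE ?enorm_ge0//.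
rewrite enorm_sqr real_normK ?num_real// (bigD1 i)//= lerDl.
by apply: sumr_ge0 => k _; exact: sqr_ge0.
Qed.

Lemma euc_distE m (v w : 'rV[R]_m) : euc_dist v w = enorm (fun i => v ord0 i - w ord0 i).
Proof. by []. Qed.

Lemma euc_metric m : is_metric (@euc_dist R m).
Proof.
split.
- move=> v; rewrite /euc_dist big1 ?sqrtr0// => i _; by rewrite subrr expr0n.
- move=> v w h; apply/rowP => i; apply/eqP; rewrite -subr_eq0 -normr_eq0 eq_le normr_ge0 andbT.
  have := coord_le_enorm (fun i => v ord0 i - w ord0 i) i.
  by rewrite -euc_distE h.
- move=> v w; rewrite /euc_dist; congr Num.sqrt; apply: eq_bigr => i _.
  by rewrite -sqrrN opprB.
- move=> u v w; rewrite !euc_distE.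
  rewrite (eq_enorm (g := fun i => (u ord0 i - v ord0 i) + (v ord0 i - w ord0 i))).
    exact: enormD.
  by move=> i; rewrite addrA subrK.
Qed.

Lemma sqr_sub_le (u v e : R) : 0 <= u -> 0 <= v -> 0 <= e -> `|u ^+ 2 - v ^+ 2| <= e ^+ 2 ->
  `|u - v| <= e.
Proof.
move=> u0 v0 e0 h; rewrite -(ler_pXn2r (_ : 0 < 2)%N)// ?nnegrE//.
apply: le_trans h; rewrite subr_sqr normrM expr2.
apply: ler_wpM2l => //; rewrite (ger0_norm (_ : 0 <= u + v)) ?addr_ge0//.
by rewrite ler_norml; apply/andP; split; lra.
Qed.

End Euclid.

(** * Linear functionals and the Gram kernel of the directions *)

Section Parseval.
Variable R : realType.
Variables (T : Type) (d : T -> T -> R).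
Variable G : T -> T -> R -> T.
Hypothesis dmet : is_metric d.
Hypothesis HG : forall x y, is_geodesic d (G x y) x y.
Hypothesis glob : glob_cmp d d.
Variable a : nat -> T.
Hypothesis adense : forall x e, 0 < e -> exists i, d x (a i) < e.
Variables A b : R.
Hypothesis A0 : 0 < A.
Hypothesis pk : forall x s K (I : finType) (f : I -> T),
    0 < s <= 1 -> 1 <= K -> (forall i, d x (f i) <= s) -> separated d f (s / K) ->
    #|I|%:R <= A * K `^ b.
Variable x : T.
Hypothesis gx : generic d G a x.
Local Notation c i k := (cs d G x (a i) (a k)).
Local Notation P i s := (pt d G x (a i) s).

Let cC i k : c i k = c k i. Proof. exact: (c_sym dmet HG glob). Qed.
Let c_le1 i k : `|c i k| <= 1. Proof. exact: (c_abs dmet HG glob). Qed.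
Let cxx i : c i i = 1. Proof. exact: (c_diag dmet HG gx). Qed.
Let cN i e : 0 < e -> exists k, forall w, `|c i w + c k w| <= e.
Proof. exact: (c_opp dmet HG glob gx). Qed.

(** Doubling [s] and [t] turns the average in [lin_one_sided] into a sum; the reverse inequality at
    [w] is the same one at a direction [w'] almost opposite to [w]. *)
Lemma lin_comb i k s t e : 0 <= s -> 0 <= t -> 0 < e ->
  exists l r, 0 <= r /\ forall w, `|r * c l w - (s * c i w + t * c k w)| <= e.
Proof.
move=> s0 t0 e0.
have [s20 t20 e20] : [/\ 0 <= 2 * s, 0 <= 2 * t & 0 < e / 2] by split; lra.
have [l [r [/andP[r0 rB] H]]] :=
  lin_one_sided dmet HG glob adense A0 pk gx i k s20 t20 e20.
exists l, r; split => // w.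
pose M := r + s + t + 1.
have M0 : 0 < M by rewrite /M; lra.
have [|w' Hw'] := cN w (e := e / 2 / M); first by rewrite divr_gt0.
have h1 := H w; have h2 := H w'.
have opp z v : 0 <= z -> `|z * c v w + z * c v w'| <= z * (e / 2 / M).
  move=> z0; rewrite -mulrDr normrM (ger0_norm z0) ler_wpM2l//.
  by rewrite !(cC v).
have o1 := opp r l r0; have o2 := opp s i s0; have o3 := opp t k t0.
have eM : r * (e / 2 / M) + s * (e / 2 / M) + t * (e / 2 / M) <= e / 2.
  rewrite -!mulrDl -[leRHS](divfK (lt0r_neq0 M0)) mulrC ler_pM2l ?divr_gt0//.
  by rewrite /M; lraw.
move: o1 o2 o3; rewrite !ler_norml => /andP[? ?] /andP[? ?] /andP[? ?].
by apply/andP; split; lra.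
Qed.

(** Uniform limits of nonnegative multiples of the cosine with one direction: the linear functionals
    of the future tangent space, stable under sum and sign. *)
Definition approx (phi : nat -> R) : Prop := forall e, 0 < e ->
  exists l r, 0 <= r /\ forall w, `|r * c l w - phi w| <= e.

Lemma approx_add f g : approx f -> approx g -> approx (fun w => f w + g w).
Proof.
move=> af ag e e0; have e3 : 0 < e / 3 by lra.
have [i [s [s0 hs]]] := af _ e3; have [k [t [t0 ht]]] := ag _ e3.
have [l [r [r0 hr]]] := lin_comb i k s0 t0 e3.
exists l, r; split => // w.
move: (hs w) (ht w) (hr w); rewrite !ler_norml => /andP[? ?] /andP[? ?] /andP[? ?].
by apply/andP; split; lra.
Qed.

Lemma approx_opp f : approx f -> approx (fun w => - f w).
Proof.
move=> af e e0; have e2 : 0 < e / 2 by lra.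
have [i [s [s0 hs]]] := af _ e2.
have [|k Hk] := cN i (e := e / 2 / (s + 1)); first by rewrite divr_gt0//; lra.
exists k, s; split => // w.
have : `|s * c i w + s * c k w| <= e / 2.
  rewrite -mulrDr normrM (ger0_norm s0).
  apply: le_trans (ler_wpM2l s0 (Hk w)) _.
  rewrite mulrCA ler_piMr ?(ltW e2)// ler_pdivrMr; lra.
move: (hs w); rewrite !ler_norml => /andP[? ?] /andP[? ?].
by apply/andP; split; lra.
Qed.

Lemma approx_c z i : approx (fun w => z * c i w).
Proof.
have pos y : 0 <= y -> approx (fun w => y * c i w).
  by move=> y0 e e0; exists i, y; split => // w; rewrite subrr normr0 ltW.
have [/pos//|z0] := leP 0 z.
have := @approx_opp (fun w => - z * c i w); rewrite (_ : (fun w => - _) = (fun w => z * c i w)).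
  by apply; apply: pos; lra.
by apply/funext => w; rewrite mulNr opprK.
Qed.

Lemma approx_sum n (z : 'I_n -> R) (idx : 'I_n -> nat) :
  approx (fun w => \sum_p z p * c (idx p) w).
Proof.
elim: n z idx => [|n IH] z idx.
  move=> e e0; exists 0%N, 0; split => // w.
  by rewrite big_ord0 mul0r subrr normr0 ltW.
rewrite (_ : (fun w => _) = fun w =>
  z ord0 * c (idx ord0) w + \sum_(p < n) z (lift ord0 p) * c (idx (lift ord0 p)) w).
  by apply: approx_add; [exact: approx_c|exact: IH].
by apply/funext => w; rewrite big_ord_recl.
Qed.

Definition orthosys (j : nat) (tau : R) (idx : 'I_j -> nat) : Prop :=
  forall p q, p != q -> `|c (idx p) (idx q)| <= tau.

(** Almost orthogonal families have bounded size by [no_big_family], used with 1/4 because 1/2 < 1 -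
    1/4. The tolerance excluding j + 1 members is retained for the contradiction in [parseval]. *)
Lemma ortho_rank : exists j, (forall tau, 0 < tau -> exists idx : 'I_j -> nat, orthosys tau idx)
  /\ exists2 tau, 0 < tau & forall idx : 'I_j.+1 -> nat, ~ orthosys tau idx.
Proof.
pose Q N := `[< exists2 tau, 0 < tau & forall idx : 'I_N -> nat, ~ orthosys tau idx >].
have exQ : exists N, Q N.
  have q4 : 0 < (4^-1 : R) <= 1 by lra.
  apply: contrapT => /forallNP no; apply: (no_big_family dmet HG glob A0 pk gx q4) => N.
  have h : 0 < (2^-1 : R) by lra.
  have : ~ forall idx : 'I_N -> nat, ~ orthosys 2^-1 idx.
    by move=> h'; apply: (no N); apply/asboolP; exists 2^-1.
  move=> /existsNP[idx /contrapT Hi]; exists idx => p q pq.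
  by have := Hi _ _ pq; rewrite ler_norml => /andP[? ?]; lra.
case: (ex_minnP exQ) => -[|j] /asboolP[tau tau0 Hj] jmin.
  by exfalso; apply: (Hj (fun=> 0%N)) => -[].
exists j; split; last by exists tau.
move=> t t0; apply: contrapT => /forallNP no.
have /jmin : Q j by apply/asboolP; exists t.
by rewrite ltnn.
Qed.

(** The functional of [i] minus its projection is approximately r times the cosine with some [l]. If
    r were not small, [l] would be almost orthogonal to all of [idx] and enlarge a system of maximal
    size. *)
Lemma parseval : exists j, forall e, 0 < e -> exists idx : 'I_j -> nat, orthosys e idx /\
  forall i k, `|c i k - \sum_p c (idx p) i * c (idx p) k| <= e.
Proof.
have [j [Ej [ts ts0 nE]]] := ortho_rank; exists j => e e0.
pose rho := e / 2; have rho0 : 0 < rho by rewrite /rho; lra.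
have [e2 e20 [e2e e2r]] : exists2 e2, 0 < e2 & e2 <= e / 2 /\ e2 <= rho * ts / 2.
  exists (Num.min (e / 2) (rho * ts / 2)).
    by rewrite lt_min divr_gt0//= divr_gt0// mulr_gt0.
  by rewrite !ge_min !lexx orbT.
have [tau tau0 [te tts tr]] : exists2 tau, 0 < tau &
    [/\ tau <= e, tau <= ts & tau <= rho * ts / 2 / j.+1%:R].
  apply: min3 => //; by rewrite divr_gt0// divr_gt0// mulr_gt0.
have [idx Hi] := Ej tau tau0; exists idx; split.
  by move=> p q pq; apply: le_trans te; exact: Hi.
move=> i k.
have ap : approx (fun w => c i w + \sum_p (- c (idx p) i) * c (idx p) w).
  apply: approx_add; last exact: approx_sum.
  by have := approx_c 1 i; rewrite (_ : (fun w => 1 * _) = fun w => c i w)//;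
    apply/funext => w; rewrite mul1r.
have [l [r [r0 hr]]] := ap _ e20.
have fE w : \sum_p (- c (idx p) i) * c (idx p) w = - \sum_p c (idx p) i * c (idx p) w.
  by rewrite -sumrN; apply: eq_bigr => p _; rewrite mulNr.
have rle : r <= rho.
  rewrite leNgt; apply/negP => rr.
  have rp : 0 < r by lra.
  have small q : `|c l (idx q)| <= ts.
    have := hr (idx q); rewrite fE (bigD1 q)//= cxx mulr1 (cC (idx q) i).
    set S := \sum_(p | _) _.
    rewrite (_ : c i (idx q) + - (c i (idx q) + S) = - S) => [h|]; last by ring.
    have Sle : `|S| <= rho * ts / 2.
      apply: le_trans (ler_norm_sum _ _ _) _.
      apply: (@le_trans _ _ (\sum_(p : 'I_j) tau)).
        rewrite [leRHS](bigD1 q)//= -[leLHS]add0r lerD ?(ltW tau0)//.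
        apply: ler_sum => p pq; rewrite normrM -[leRHS]mul1r.
        by apply: ler_pM => //; exact: Hi.
      rewrite sumr_const card_ord -[tau *+ j]mulr_natl.
      apply: (@le_trans _ _ (j.+1%:R * tau)); first by rewrite ler_pM2r// ler_nat.
      by rewrite mulrC -ler_pdivlMr.
    have h3 : `|r * c l (idx q)| <= r * ts.
      have h4 : rho * ts <= r * ts by rewrite ler_pM2r// ltW.
      move: h Sle; rewrite !ler_norml => /andP[i1 i2] /andP[i3 i4]; apply/andP; split; lraw e2r h4 i1 i2 i3 i4.
    by move: h3; rewrite normrM (gtr0_norm rp) ler_pM2l.
  apply: (nE (fun p => if unlift ord0 p is Some q then idx q else l)) => p q.
  case: (unliftP ord0 p) => [p' ->|->]; case: (unliftP ord0 q) => [q' ->|->].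
  - by move=> pq; apply: le_trans tts; apply: Hi; apply: contra_neq pq => ->.
  - by move=> _; rewrite cC.
  - by [].
  - by rewrite eqxx.
have := hr k; rewrite fE; set S := \sum_p _ => h.
have h2 : `|r * c l k| <= rho.
  rewrite normrM (ger0_norm r0); apply: le_trans rle.
  by rewrite ler_piMr.
move: h h2; rewrite /rho !ler_norml => /andP[i1 i2] /andP[i3 i4]; apply/andP; split; lraw e2e i1 i2 i3 i4.
Qed.

End Parseval.

(** * Almost isometric charts at a generic point *)

Lemma near_num (R : realType) (e s t s0 c C dd : R) : 0 < e <= 1 -> 0 < C -> 0 < s <= s0 ->
  s0 <= 1 -> 0 <= t <= 2 * s -> 8 * C * s0 <= (e / 8) ^+ 2 -> 1 - (e / 8) ^+ 2 <= c ->
  dd ^+ 2 <= t ^+ 2 + t ^+ 2 - 2 * t * t * c + C * (t ^+ 2 + t ^+ 2) ^+ 2 ->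
  dd <= e / 2 * s.
Proof.
move=> /andP[e0 e1] C0 /andP[s0' ss0] s01 /andP[t0 ts] hC hc h.
have tt : t ^+ 2 <= 4 * s ^+ 2 by rewrite (_ : 4 * s ^+ 2 = (2 * s) ^+ 2); [rewrite ler_sqr ?nnegrE//; lra|ring].
have t20 : 0 <= t ^+ 2 by exact: sqr_ge0.
have k1 : t ^+ 2 * (1 - c) <= t ^+ 2 * (e / 8) ^+ 2 by rewrite ler_wpM2l//; lra.
have k2 : t ^+ 2 * (e / 8) ^+ 2 <= 4 * s ^+ 2 * (e / 8) ^+ 2 by rewrite ler_wpM2r ?sqr_ge0.
have sle1 : s <= 1 := le_trans ss0 s01.
have s2 : s ^+ 2 <= s0.
  by apply: (le_trans _ ss0); rewrite expr2 ler_piMl// ltW.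
have k3 : C * t ^+ 2 * t ^+ 2 <= C * (4 * s ^+ 2) * (4 * s ^+ 2).
  apply: ler_pM => //; first by rewrite mulr_ge0// ltW.
  by rewrite ler_pM2l.
have k4 : C * (4 * s ^+ 2) * (4 * s ^+ 2) <= 2 * s ^+ 2 * (e / 8) ^+ 2.
  have -> : C * (4 * s ^+ 2) * (4 * s ^+ 2) = 2 * s ^+ 2 * (8 * C * s ^+ 2) by ring.
  apply: ler_wpM2l; first by rewrite mulr_ge0 ?sqr_ge0.
  by apply: le_trans hC; rewrite ler_pM2l// mulr_gt0.
apply: le_of_sqr; first by rewrite mulr_ge0//; lraw.
have : (e / 2 * s) ^+ 2 = 16 * (s ^+ 2 * (e / 8) ^+ 2) by field.
have : 0 <= s ^+ 2 * (e / 8) ^+ 2 by rewrite mulr_ge0 ?sqr_ge0.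
lraw h k1 k2 k3 k4.
Qed.

Section Regular.
Variable R : realType.
Variables (T : Type) (d : T -> T -> R).
Variable G : T -> T -> R -> T.
Hypothesis dmet : is_metric d.
Hypothesis HG : forall x y, is_geodesic d (G x y) x y.
Hypothesis glob : glob_cmp d d.
Variable a : nat -> T.
Hypothesis adense : forall x e, 0 < e -> exists i, d x (a i) < e.
Variables A b : R.
Hypothesis A0 : 0 < A.
Hypothesis pk : forall x s K (I : finType) (f : I -> T),
    0 < s <= 1 -> 1 <= K -> (forall i, d x (f i) <= s) -> separated d f (s / K) ->
    #|I|%:R <= A * K `^ b.
Variable x : T.
Hypothesis gx : generic d G a x.
Local Notation c i k := (cs d G x (a i) (a k)).
Local Notation P i s := (pt d G x (a i) s).

Let dpm : is_pseudometric d. Proof. exact: metric_pseudo. Qed.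
Let d_ge0 p q : 0 <= d p q. Proof. exact: pm_ge0. Qed.
Let ds p q : d p q = d q p. Proof. by case: dmet. Qed.
Let dt p q r : d p r <= d p q + d q r. Proof. by case: dmet. Qed.
Let xa i : 0 < d x (a i). Proof. by case: gx. Qed.

(** [cs_near] is uniform only for one pair of directions; reduction to finitely many rays gives a
    single scale [s0] good for all points near [x]. *)
Lemma near_net e : 0 < e <= 1 -> exists N (h : 'I_N -> nat) s0, [/\ 0 < s0 <= 1,
  (forall i, s0 <= d x (a (h i))),
  (forall k, exists i, 1 - e <= c k (h i)),
  (forall p, d x p <= s0 -> exists i, d p (P (h i) (d x p)) <= e * d x p) &
  forall i k s t, 0 <= s <= s0 -> 0 <= t <= s0 ->
    `|d (P (h i) s) (P (h k) t) ^+ 2 - (s ^+ 2 + t ^+ 2 - 2 * s * t * c (h i) (h k))| <=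
      e * (s ^+ 2 + t ^+ 2)].
Proof.
move=> e01; have [e0 e1] := andP e01.
have e80 : 0 < (e / 8) ^+ 2 by rewrite exprn_gt0// divr_gt0.
have e8e : (e / 8) ^+ 2 <= e.
  have : (e / 8) ^+ 2 <= e / 8 by rewrite expr2 ler_piMl//; lra.
  lra.
have e81 : 0 < (e / 8) ^+ 2 <= 1 by rewrite e80 (le_trans e8e).
have [S HS] := dir_net dmet HG glob A0 pk gx e81.
pose N := size S; pose h (i : 'I_N) := nth 0%N S i.
have Hh k : exists i, 1 - (e / 8) ^+ 2 <= c k (h i).
  have [l lS hl] := HS k; have lN : (index l S < N)%N by rewrite index_mem.
  by exists (Ordinal lN); rewrite /h /= nth_index.
have near (p : 'I_N * 'I_N) : exists s0, 0 < s0 /\ [/\ s0 <= 1, s0 <= d x (a (h p.1)) &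
   forall s t, 0 <= s <= s0 -> 0 <= t <= s0 ->
   `|d (P (h p.1) s) (P (h p.2) t) ^+ 2 -
     (s ^+ 2 + t ^+ 2 - 2 * s * t * c (h p.1) (h p.2))| <= e * (s ^+ 2 + t ^+ 2)].
  have [s0 [h1 h2 h3 h4] h5] := cs_near dmet HG glob (xa (h p.1)) (xa (h p.2)) e0.
  by exists s0; split => //; split.
have [s1 Hs1] := choice near.
have [m m0 mle] := fin_min (fun p => (Hs1 p).1).
have [C C0 HC] := cs_upper dmet HG glob.
have [s0 s00 [s0m s01 s0C]] : exists2 s0, 0 < s0 &
    [/\ s0 <= m / 2, s0 <= 1 / 2 & s0 <= (e / 8) ^+ 2 / (8 * C)].
  by apply: min3; rewrite ?divr_gt0// mulr_gt0.
exists N, h, s0; split.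
- by rewrite s00/=; lraw s01.
- move=> i; have [_ [_ h2 _]] := Hs1 (i, i).
  by apply: le_trans h2; apply: le_trans (mle _); lraw s0m.
- by move=> k; have [i hi] := Hh k; exists i; apply: le_trans hi; lraw e8e.
- move=> p ps0; have := d_ge0 x p; rewrite le_eqVlt => /orP[/eqP p0|p0].
    have [i _] := Hh 0%N; exists i; rewrite -p0 mulr0 (pt0 HG).
    by rewrite ds -p0.
  have e8p : 0 < e / 8 * d x p by rewrite mulr_gt0//; lraw.
  (* The direction of [p] is that of a dense point [a k] close to it. The net ray is met first at
     the distance t of [a k], then followed to the distance s of [p]. *)
  have [k hk] := adense p e8p; have [i hi] := Hh k; exists i.
  set s := d x p in ps0 p0 e8p hk *; set t := d x (a k).
  have t1 := dt x p (a k); have t2 := dt x (a k) p.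
  rewrite (ds (a k)) -/s -/t in t1 t2.
  have es : e / 8 * s <= s / 8 by rewrite mulrAC ler_pM2r; [rewrite ler_piMl//; lraw|lraw].
  have t0 : 0 <= t by exact: d_ge0.
  have [_ [_ hm _]] := Hs1 (i, i); have hm' := mle (i, i).
  have tm : 0 <= t <= d x (a (h i)) by rewrite t0/=; apply: le_trans hm; apply: le_trans hm'; lraw es hk ps0 s0m t1.
  have sm : 0 <= s <= d x (a (h i)).
    by rewrite ltW//=; apply: le_trans hm; apply: le_trans hm'; lraw ps0 s0m.
  have tk : 0 <= t <= d x (a k) by rewrite t0 lexx.
  have tle1 : t <= 1 by lraw es hk ps0 s01 t1.
  have := HC x (a k) (a (h i)) t t (xa k) (xa _) tk tm tle1 tle1.
  rewrite (pt_end HG (xa k)) => hd.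
  have hd' : d (a k) (P (h i) t) <= e / 2 * s.
    apply: (near_num (s0 := s0) (C := C) _ _ _ _ _ _ hi hd) => //; first by rewrite p0.
    - by lraw s01.
    - by rewrite t0/=; lraw es hk t1.
    - by rewrite mulrC -ler_pdivlMr// mulr_gt0.
  have hp : d (P (h i) t) (P (h i) s) = `|t - s| by rewrite (pt_pt dmet HG (xa _)).
  have := dt p (a k) (P (h i) s); have := dt (a k) (P (h i) t) (P (h i) s).
  rewrite hp; have : `|t - s| <= e / 8 * s by rewrite ler_norml; apply/andP; split; lraw hk t1 t2.
  have : 0 < e * s by rewrite mulr_gt0.
  by lraw hd' hk.
- move=> i k s t /andP[sp ss0] /andP[tp ts0]; have [_ [_ _ H]] := Hs1 (i, k).
  have hm := mle (i, k).
  by apply: H; apply/andP; split => //; lraw hm s0m ss0 ts0.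
Qed.

(** By [parseval] the coordinate vectors have almost the prescribed scalar products, hence the
    distances of the Euclidean law of cosines. *)
Lemma gram_dist j (idx : 'I_j -> nat) e1 i k S S' : 0 <= S -> 0 <= S' ->
  (forall i k, `|c i k - \sum_p c (idx p) i * c (idx p) k| <= e1) ->
  `|enorm (fun q => S * c (idx q) i - S' * c (idx q) k) ^+ 2 -
    (S ^+ 2 + S' ^+ 2 - 2 * S * S' * c i k)| <= e1 * (S + S') ^+ 2.
Proof.
move=> S0 S'0 par; rewrite enorm_sqr.
have -> : \sum_q (S * c (idx q) i - S' * c (idx q) k) ^+ 2 =
  S ^+ 2 * (\sum_q c (idx q) i * c (idx q) i) + S' ^+ 2 * (\sum_q c (idx q) k * c (idx q) k)
  - 2 * S * S' * \sum_q c (idx q) i * c (idx q) k.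
  rewrite !mulr_sumr -big_split -sumrB /=; apply: eq_bigr => q _; ring.
have p1 := par i i; have p2 := par k k; have p3 := par i k.
rewrite !(c_diag dmet HG gx) in p1 p2.
have bd w z : 0 <= w -> `|z| <= e1 -> `|w * z| <= w * e1.
  by move=> w0 hz; rewrite normrM (ger0_norm w0) ler_wpM2l.
have := bd _ _ (sqr_ge0 S) p1; have := bd _ _ (sqr_ge0 S') p2.
have SS : 0 <= 2 * S * S' by rewrite !mulr_ge0.
have := bd _ _ SS p3.
set s1 := \sum_p _; set s2 := \sum_p _; set s3 := \sum_p _.
rewrite !ler_norml => /andP[i1 i2] /andP[i3 i4] /andP[i5 i6]; apply/andP; split; lraw i1 i2 i3 i4 i5 i6.
Qed.

End Regular.

Lemma chart_num (R : realType) (th r lam s t c D D0 F : R) : 0 < th <= 1 -> 0 < lam ->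
  0 <= s -> 0 <= t -> lam * s < r -> lam * t < r -> 0 <= D0 -> 0 <= F ->
  `|D0 ^+ 2 - (s ^+ 2 + t ^+ 2 - 2 * s * t * c)| <= th ^+ 2 * (s ^+ 2 + t ^+ 2) ->
  `|F ^+ 2 - ((lam * s) ^+ 2 + (lam * t) ^+ 2 - 2 * (lam * s) * (lam * t) * c)| <=
     th ^+ 2 * (lam * s + lam * t) ^+ 2 ->
  `|D - D0| <= th ^+ 2 * (s + t) -> `|F - lam * D| <= 5 * (th * r).
Proof.
move=> /andP[th0 th1] l0 s0 t0 sr tr D00 F0 h1 h2 h3.
have th2 : 0 < th ^+ 2 by rewrite exprn_gt0.
have thl : th ^+ 2 <= th by rewrite expr2 ler_piMl// ltW.
have ls0 : 0 <= lam * s by rewrite mulr_ge0// ltW.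
have lt0 : 0 <= lam * t by rewrite mulr_ge0// ltW.
have r0 : 0 <= r by lraw ls0 sr.
have k1 : `|F ^+ 2 - (lam * D0) ^+ 2| <= (3 * (th * r)) ^+ 2.
  have h1' : `|(lam * D0) ^+ 2 - ((lam * s) ^+ 2 + (lam * t) ^+ 2 - 2 * (lam * s) * (lam * t) * c)|
      <= th ^+ 2 * ((lam * s) ^+ 2 + (lam * t) ^+ 2).
    rewrite (_ : _ - _ = lam ^+ 2 * (D0 ^+ 2 - (s ^+ 2 + t ^+ 2 - 2 * s * t * c))); last by ring.
    rewrite normrM ger0_norm ?sqr_ge0//.
    rewrite (_ : th ^+ 2 * _ = lam ^+ 2 * (th ^+ 2 * (s ^+ 2 + t ^+ 2))); last by ring.
    by rewrite ler_pM2l// exprn_gt0.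
  have sq z : 0 <= z -> z < r -> th ^+ 2 * z ^+ 2 <= th ^+ 2 * r ^+ 2.
    by move=> z0 zr; rewrite ler_pM2l// ler_sqr ?nnegrE// ltW.
  have st : th ^+ 2 * ((lam * s) * (lam * t)) <= th ^+ 2 * r ^+ 2.
    by rewrite ler_pM2l// expr2 ler_pM// ltW.
  have := sq _ ls0 sr; have := sq _ lt0 tr.
  have -> : (3 * (th * r)) ^+ 2 = 9 * (th ^+ 2 * r ^+ 2) by ring.
  have : 0 <= th ^+ 2 * r ^+ 2 by rewrite mulr_ge0 ?sqr_ge0.
  move: h1' h2; rewrite !ler_norml => /andP[? ?] /andP[? ?] *; apply/andP; split; lra.
have k2 : `|F - lam * D0| <= 3 * (th * r).
  apply: sqr_sub_le k1 => //; first by rewrite mulr_ge0// ltW.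
  by rewrite !mulr_ge0// ltW.
have k3 : `|lam * D - lam * D0| <= 2 * (th * r).
  rewrite -mulrBr normrM (gtr0_norm l0).
  apply: le_trans (ler_wpM2l (ltW l0) h3) _.
  have : th ^+ 2 * (lam * s + lam * t) <= th * (2 * r).
    by apply: ler_pM; rewrite ?sqr_ge0//; lraw ls0 lt0 sr tr.
  lraw.
move: k2 k3; rewrite !ler_norml => /andP[i1 i2] /andP[i3 i4]; apply/andP; split; lraw i1 i2 i3 i4.
Qed.

Lemma onto_norm_num (R : realType) (th r e ka rho nu nv : R) :
  0 < th <= 1 / 2 -> 0 < e -> 0 <= ka -> 0 <= rho -> th * (6 * r + ka) <= e / 4 -> e < r ->
  0 <= nu -> 1 - th ^+ 2 <= nu ^+ 2 -> nv < r - e -> rho * nu <= nv + th ^+ 2 * ka -> rho < r.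
Proof.
move=> /andP[th0 th1] e0 ka0 rho0 hth er nu0 hnu hnv h.
have thl : th ^+ 2 <= th by rewrite expr2 ler_piMl; lraw th1.
have nu1 : 1 - th ^+ 2 <= nu.
  have [//|n1] := leP (1 - th ^+ 2) nu.
  have : nu ^+ 2 <= nu by rewrite expr2 ler_piMl//; have := sqr_ge0 th; lra.
  lra.
have thk : th ^+ 2 * ka <= th * ka by rewrite ler_wpM2r.
have r1 : rho * (1 - th ^+ 2) <= rho * nu by rewrite ler_wpM2l.
have thr : 0 <= th * r by rewrite mulr_ge0//; lraw er.
have r2 : rho * th ^+ 2 <= rho * th by rewrite ler_wpM2l.
have thk0 : 0 <= th * ka by rewrite mulr_ge0// ltW.
have r3 : rho * th <= rho * (1 / 2) by rewrite ler_wpM2l.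
have r4 : rho <= 2 * r by lraw h hnv hth r1 r2 r3 thk thr.
have r5 : rho * th <= 2 * r * th by rewrite ler_wpM2r// ltW.
lraw h hnv hth r1 r2 r5 thk thr.
Qed.

Section Regular.
Variable R : realType.
Variables (T : Type) (d : T -> T -> R).
Variable G : T -> T -> R -> T.
Hypothesis dmet : is_metric d.
Hypothesis HG : forall x y, is_geodesic d (G x y) x y.
Hypothesis glob : glob_cmp d d.
Variable a : nat -> T.
Hypothesis adense : forall x e, 0 < e -> exists i, d x (a i) < e.
Variables A b : R.
Hypothesis A0 : 0 < A.
Hypothesis pk : forall x s K (I : finType) (f : I -> T),
    0 < s <= 1 -> 1 <= K -> (forall i, d x (f i) <= s) -> separated d f (s / K) ->
    #|I|%:R <= A * K `^ b.
Variable x : T.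
Hypothesis gx : generic d G a x.
Local Notation c i k := (cs d G x (a i) (a k)).
Local Notation P i s := (pt d G x (a i) s).

Let dpm : is_pseudometric d. Proof. exact: metric_pseudo. Qed.
Let d_ge0 p q : 0 <= d p q. Proof. exact: pm_ge0. Qed.
Let ds p q : d p q = d q p. Proof. by case: dmet. Qed.
Let d0 p : d p p = 0. Proof. by case: dmet. Qed.
Let dt p q r : d p r <= d p q + d q r. Proof. by case: dmet. Qed.
Let xa i : 0 < d x (a i). Proof. by case: gx. Qed.

Lemma gram_close j (idx : 'I_j -> nat) th i k rho r : 0 < th -> 0 <= rho -> rho <= r ->
  (forall i k, `|c i k - \sum_p c (idx p) i * c (idx p) k| <= th ^+ 2) ->
  rho ^+ 2 * (1 - c i k) <= 2 * (th ^+ 2 * rho ^+ 2) ->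
  enorm (fun q => rho * c (idx q) i - rho * c (idx q) k) <= 3 * (th * r).
Proof.
move=> th0 rho0 rr par h; apply: (@le_trans _ _ (3 * (th * rho))); last first.
  by rewrite ler_pM2l// ler_pM2l.
apply: le_of_sqr; first by rewrite !mulr_ge0// ltW.
have := gram_dist dmet HG gx i k rho0 rho0 par.
have : 0 <= th ^+ 2 * rho ^+ 2 by rewrite mulr_ge0 ?sqr_ge0.
rewrite ler_norml => ? /andP[? ?]; lra.
Qed.

(** Testing the approximation on the almost orthonormal directions recovers the coefficients. *)
Lemma lin_coord j (idx : 'I_j -> nat) (v : 'I_j -> R) e1 r l rho :
  0 < e1 -> (forall q, `|v q| <= r) -> orthosys d G a x e1 idx ->
  (forall w, `|rho * c l w - \sum_q v q * c (idx q) w| <= e1) ->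
  forall q, `|rho * c (idx q) l - v q| <= e1 * (1 + j%:R * r).
Proof.
move=> e10 vr ort h q; have := h (idx q).
rewrite (bigD1 q)//= (c_diag dmet HG gx) mulr1 (c_sym dmet HG glob a x l).
set S := \sum_(p | _) _ => h1.
have r0 : 0 <= r by apply: le_trans (vr q).
have : `|S| <= j%:R * (r * e1).
  apply: le_trans (ler_norm_sum _ _ _) _.
  apply: (@le_trans _ _ (\sum_(p : 'I_j) r * e1)).
    rewrite [leRHS](bigD1 q)//= -[leLHS]add0r lerD ?mulr_ge0 ?(ltW e10)//.
    by apply: ler_sum => p pq; rewrite normrM ler_pM//; exact: ort.
  by rewrite sumr_const card_ord -[(r * e1) *+ j]mulr_natl.
move: h1; rewrite !ler_norml => /andP[i1 i2] /andP[i3 i4]; apply/andP; split; lraw i1 i2 i3 i4.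
Qed.

(** The chart multiplies the rescaled distance of [p] by the cosines of its net direction with
    [idx]. It is almost onto since, by [approx_sum], the functional with coefficients v is nearly
    rho times the cosine with one direction, whose net ray carries an approximate preimage. *)
Lemma generic_regular : exists j, regular_pt d j x.
Proof.
have [j par] := parseval dmet HG glob adense A0 pk gx.
exists j => r e r0 e0.
(* Factor from the tolerance in [lin_coord] to the error in the norm. *)
have [ka kaE ka0] : exists2 ka, ka = j%:R * (1 + j%:R * r) & 0 <= ka.
  by exists (j%:R * (1 + j%:R * r)) => //; rewrite mulr_ge0// addr_ge0// mulr_ge0// ltW.
have den : 0 < 4 * (6 * r + ka + 1) by lra.
have [th th0 [th1 _ thE]] : exists2 th, 0 < th &
    [/\ th <= 1 / 2, th <= 1 / 2 & th <= e / (4 * (6 * r + ka + 1))].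
  by apply: min3; rewrite ?divr_gt0.
have thK : th * (6 * r + ka) <= e / 4.
  rewrite ler_pdivlMr// in thE; have : 0 <= th * 4 by lra. lra.
have th01 : 0 < th ^+ 2 <= 1 by rewrite exprn_gt0//= expr_le1 ?(ltW th0)//; lraw th1.
have th20 : 0 < th ^+ 2 by case/andP: th01.
have [idx [ort pars]] := par _ th20.
have [N [h [s0 [/andP[s00 s01] hs0 net near apx]]]] :=
  near_net dmet HG glob adense A0 pk gx th01.
exists (r / s0); first by rewrite divr_gt0.
move=> lam lamr; have lam0 : 0 < lam by apply: lt_le_trans lamr; rewrite divr_gt0.
have small s : lam * s < r -> s <= s0.
  move=> h1; rewrite -(ler_pM2l lam0); apply: le_trans (ltW h1) _.
  by rewrite -ler_pdivrMr.
have LL p : exists i : 'I_N, d x p <= s0 -> d p (P (h i) (d x p)) <= th ^+ 2 * d x p.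
  have [ps|ps] := leP (d x p) s0.
    by have [i hi] := near p ps; exists i.
  by have [i _] := net 0%N; exists i.
have [L HL] := choice LL.
pose f p : 'rV[R]_j := \row_q (lam * d x p * c (idx q) (h (L p))).
exists f; split.
- by apply/rowP => q; rewrite !mxE d0 mulr0 mul0r.
- move=> p p' pr p'r.
  have ps := small _ pr; have ps' := small _ p'r.
  apply: (@le_lt_trans _ _ (5 * (th * r))); last first.
    have : 0 <= th * ka by rewrite mulr_ge0// ltW.
    have : 0 <= th * r by rewrite mulr_ge0// ltW.
    lraw thK.
  have i1 : 0 <= d x p <= s0 by rewrite d_ge0.
  have i2 : 0 <= d x p' <= s0 by rewrite d_ge0.
  apply: (chart_num _ lam0 (d_ge0 x p) (d_ge0 x p') pr p'r _ _ (apx (L p) (L p') _ _ i1 i2)) => //.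
  + by rewrite th0/=; lraw th1.
  + exact: sqrtr_ge0.
  + rewrite euc_distE.
    under eq_enorm do rewrite !mxE.
    by apply: (gram_dist dmet HG gx) => //; rewrite mulr_ge0 ?(ltW lam0).
  + have h1 := HL p ps; have h2 := HL p' ps'.
    set q1 := P _ _ in h1 *; set q2 := P _ _ in h2 *.
    have t1 := dt p q1 p'; have t2 := dt q1 q2 p'; have t3 := dt q1 p q2; have t4 := dt p p' q2.
    rewrite (ds q2 p') in t2; rewrite (ds q1 p) in t3.
    by rewrite ler_norml; apply/andP; split; lraw h1 h2 t1 t2 t3 t4.
- move=> v vr; rewrite euc_distE (eq_enorm (g := v ord0)) in vr; last first.
    by move=> q; rewrite mxE subr0.
  have er : e < r by have := enorm_ge0 (v ord0); lraw vr.
  have [l [rho [rho0 hl]]] := approx_sum dmet HG glob adense A0 pk gx (v ord0) idx th20.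
  have vq q : `|v ord0 q| <= r by apply: le_trans (coord_le_enorm _ q) _; lraw vr.
  have co := lin_coord th20 vq ort hl.
  have k1 : enorm (fun q => rho * c (idx q) l - v ord0 q) <= th ^+ 2 * ka.
    apply: le_trans (enorm_le _ co) _; first by rewrite mulr_ge0 ?(ltW th20)// addr_ge0// mulr_ge0// ltW.
    by rewrite card_ord kaE mulrCA.
  have nu : 1 - th ^+ 2 <= enorm (fun q => c (idx q) l) ^+ 2.
    have := pars l l; rewrite (c_diag dmet HG gx) enorm_sqr ler_norml => /andP[_].
    rewrite (eq_bigr (fun q => c (idx q) l ^+ 2)); last by move=> q _; rewrite expr2.
    by lraw.
  have rr : rho < r.
    apply: (onto_norm_num (th := th) (ka := ka) _ e0 ka0 rho0 thK er (enorm_ge0 _) nu vr).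
      by rewrite th0.
    have := enormD (fun q => rho * c (idx q) l - v ord0 q) (v ord0).
    rewrite (eq_enorm (g := fun q => rho * c (idx q) l)); last by move=> q; rewrite subrK.
    by rewrite enormZ (ger0_norm rho0); lraw k1.
  have [M hM] := net l.
  have rl : lam * (rho / lam) = rho by rewrite mulrC divfK// gt_eqF.
  have rs : rho / lam <= s0 by apply: small; rewrite rl.
  have rs0 : 0 <= rho / lam <= s0 by rewrite divr_ge0// ltW.
  have rx : 0 <= rho / lam <= d x (a (h M)).
    by case/andP: rs0 => -> /= h1; exact: le_trans (hs0 M).
  exists (P (h M) (rho / lam)); first by rewrite (pt_d dmet HG (xa _) rx) rl.
  set p := P _ _; have dp : d x p = rho / lam by rewrite (pt_d dmet HG (xa _) rx).
  have hp := HL p; rewrite dp in hp; have {}hp := hp rs.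
  have ap := apx M (L p) _ _ rs0 rs0; rewrite -/p in ap.
  have cM : rho ^+ 2 * (1 - c (h M) (h (L p))) <= 2 * (th ^+ 2 * rho ^+ 2).
    have hp2 : d p (P (h (L p)) (rho / lam)) ^+ 2 <= (th ^+ 2 * (rho / lam)) ^+ 2.
      by rewrite ler_sqr ?nnegrE ?d_ge0// mulr_ge0 ?sqr_ge0//; case/andP: rs0.
    have : (th ^+ 2 * (rho / lam)) ^+ 2 <= th ^+ 2 * (rho / lam) ^+ 2.
      rewrite exprMn ler_wpM2r ?sqr_ge0// [leLHS]expr2 ler_piMr// ?(ltW th20)//.
      by case/andP: th01.
    move=> hp3; have l2 : 0 < lam ^+ 2 by rewrite exprn_gt0.
    have -> : rho ^+ 2 * (1 - c (h M) (h (L p))) =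
      lam ^+ 2 * ((rho / lam) ^+ 2 * (1 - c (h M) (h (L p)))).
      by rewrite mulrA -exprMn rl.
    have -> : 2 * (th ^+ 2 * rho ^+ 2) = lam ^+ 2 * (2 * (th ^+ 2 * (rho / lam) ^+ 2)).
      by rewrite -[in LHS]rl; ring.
    rewrite ler_pM2l//; move: ap; rewrite ler_norml => /andP[ap _].
    have : 0 <= th ^+ 2 * (rho / lam) ^+ 2 by rewrite mulr_ge0 ?sqr_ge0.
    lraw ap hp2 hp3.
  have cl : rho ^+ 2 * (1 - c l (h M)) <= 2 * (th ^+ 2 * rho ^+ 2).
    have : rho ^+ 2 * (1 - c l (h M)) <= rho ^+ 2 * th ^+ 2 by rewrite ler_wpM2l ?sqr_ge0//; lraw hM.
    have : 0 <= th ^+ 2 * rho ^+ 2 by rewrite mulr_ge0 ?sqr_ge0.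
    lraw.
  have g1 := gram_close th0 rho0 (ltW rr) pars cM.
  have g2 := gram_close th0 rho0 (ltW rr) pars cl.
  have [_ _ ec _] := euc_metric R j; rewrite ec euc_distE.
  rewrite (eq_enorm (g := fun q => (v ord0 q - rho * c (idx q) l) +
     ((rho * c (idx q) l - rho * c (idx q) (h M)) +
     (rho * c (idx q) (h M) - rho * c (idx q) (h (L p)))))); last first.
    by move=> q; rewrite mxE dp rl; ring.
  apply: le_lt_trans (enormD _ _) _.
  have k1' : enorm (fun q => v ord0 q - rho * c (idx q) l) <= th ^+ 2 * ka.
    apply: le_trans k1; rewrite le_eqVlt; apply/orP; left; apply/eqP.
    by congr Num.sqrt; apply: eq_bigr => q _; rewrite -sqrrN opprB.
  apply: (@le_lt_trans _ _ (th ^+ 2 * ka + (3 * (th * r) + 3 * (th * r)))).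
    by apply: lerD => //; apply: le_trans (enormD _ _) _; exact: lerD.
  have : th ^+ 2 * ka <= th * ka by rewrite ler_wpM2r// expr2 ler_piMl ?(ltW th0)//; lraw th1.
  lraw thK.
Qed.

End Regular.

(** * Regular points *)

Section Counting.
Variable R : realType.

(** Cut the cube into cells of side w: no two members share one. *)
Lemma cell_count (I J : finType) (f : I -> J -> R) (rho w : R) : 0 < w -> 0 <= rho ->
  (forall i q, `|f i q| <= rho) ->
  (forall i k, i != k -> exists q, w <= `|f i q - f k q|) ->
  #|I|%:R <= (2 * rho / w + 1) ^+ #|J|.
Proof.
move=> w0 rho0 frho sep.
pose cell i q : nat := Num.trunc ((f i q + rho) / w).
pose M := (Num.trunc (2 * rho / w)).+1.
have ge0 i q : 0 <= (f i q + rho) / w.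
  by rewrite divr_ge0 ?(ltW w0)//; have := frho i q; rewrite ler_norml => /andP[]; lra.
have cellM i q : (cell i q < M)%N.
  rewrite ltnS; apply: le_truncn; rewrite ler_pM2r ?invr_gt0//.
  by have := frho i q; rewrite ler_norml => /andP[]; lra.
pose F i : {ffun J -> 'I_M} := [ffun q => Ordinal (cellM i q)].
have Finj : injective F.
  move=> i k eF; apply/eqP; apply/negPn/negP => /sep[q]; rewrite leNgt => /negP; apply.
  have := congr1 (fun g : {ffun J -> 'I_M} => val (g q)) eF; rewrite !ffunE /= => ec.
  have /andP[i1 i2] := truncn_itv (ge0 i q); have /andP[k1 k2] := truncn_itv (ge0 k q).
  rewrite -/(cell i q) in i1 i2; rewrite -/(cell k q) -ec in k1 k2.
  move: i1 i2 k1 k2; rewrite !ler_pdivlMr// !ltr_pdivrMr// -natr1 mulrDl mul1r => *.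
  by rewrite ltr_norml; apply/andP; split; lra.
have le := leq_card F Finj; rewrite card_ffun card_ord in le.
apply: (@le_trans _ _ ((M ^ #|J|)%N%:R : R)); first by rewrite ler_nat.
rewrite natrX lerXn2r ?nnegrE// ?addr_ge0 ?divr_ge0 ?mulr_ge0 ?(ltW w0)//.
by rewrite /M -natr1 lerD2r truncn_le// divr_ge0 ?mulr_ge0// ltW.
Qed.

Lemma nat_dist_ge1 (p q : nat) : p != q -> 1 <= `|p%:R - q%:R| :> R.
Proof.
have aux (k l : nat) : (k < l)%N -> 1 <= l%:R - k%:R :> R.
  by move=> h; rewrite lerBrDr nat1r ler_nat.
rewrite neq_ltn => /orP[/aux h|/aux h].
  by rewrite distrC (le_trans h)// ler_norm.
by rewrite (le_trans h)// ler_norm.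
Qed.

Lemma powR_unbounded (b B : R) (j : nat) : b < j%:R ->
  ~ (forall K : nat, (0 < K)%N -> K%:R ^+ j <= B * K%:R `^ b).
Proof.
move=> bj H; pose be := j%:R - b; have be0 : 0 < be by rewrite /be; lra.
have B0 : 0 <= B by have := H 1%N isT; rewrite expr1n powR1 mulr1; lra.
pose K := (Num.bound (B `^ be^-1)).+1.
have Kb : B `^ be^-1 < K%:R.
  apply: lt_trans (archi_boundP (powR_ge0 _ _)) _; by rewrite ltr_nat.
have K0 : 0 < K%:R :> R by rewrite ltr0n.
have E : K%:R ^+ j = K%:R `^ be * K%:R `^ b :> R.
  rewrite -powRD; last by apply/implyP => _; rewrite gt_eqF.
  by rewrite /be subrK powR_mulrn// ltW.
have := H K isT; rewrite E.
rewrite ler_pM2r ?powR_gt0// leNgt => /negP; apply.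
have E2 : (B `^ be^-1) `^ be = B by rewrite -powRrM mulVf ?gt_eqF// powRr1.
by rewrite -[X in X < _]E2; apply: gt0_ltr_powR => //; rewrite nnegrE ?powR_ge0.
Qed.

End Counting.

Section RegularDim.
Variable R : realType.
Variables (T : Type) (d : T -> T -> R).
Hypothesis dmet : is_metric d.
Hypothesis dcpl : complete_metric d.
Hypothesis geo : forall a b, exists g, is_geodesic d g a b.
Hypothesis glob : glob_cmp d d.

Let dpm : is_pseudometric d. Proof. exact: metric_pseudo. Qed.
Let d_ge0 a b : 0 <= d a b. Proof. exact: pm_ge0. Qed.

Lemma dim_null (nu b : R) : hausdorff_dim d = nu%:E -> nu < b ->
  exists2 s, 0 <= s < b & hausdorff_measure d s = 0%E.
Proof.
move=> dn nb; have : (hausdorff_dim d < b%:E)%E by rewrite dn lte_fin.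
by move=> /ereal_inf_lt[_ [s [s0 Hs] <-]]; rewrite lte_fin => sb; exists s; rewrite ?s0.
Qed.

Lemma null_dim (nu s : R) : hausdorff_dim d = nu%:E -> 0 <= s ->
  hausdorff_measure d s = 0%E -> nu <= s.
Proof.
by move=> dn s0 Hs; rewrite -lee_fin -dn; apply: ereal_inf_lbound; exists s.
Qed.

Lemma dim_packing (nu b : R) : hausdorff_dim d = nu%:E -> nu < b ->
  exists s A, [/\ 0 <= s < b, 0 < A & forall x r K (I : finType) (f : I -> T),
    0 < r <= 1 -> 1 <= K -> (forall i, d x (f i) <= r) -> separated d f (r / K) ->
    #|I|%:R <= A * K `^ s].
Proof.
move=> dn nb; have [s /andP[s0 sb] Hs] := dim_null dn nb.
have [A A0 HA] := null_packing dmet dcpl (contr_cst_ge1 2) s0 (glob_contracting dmet (M := 2) geo glob) Hs.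
by exists s, A; rewrite s0.
Qed.

(** If j > n, a grid of K^j vectors is pulled back by the chart of a small ball to a family
    separated at relative scale of order 1 / K, against a packing bound with exponent below n + 1 <=
    j. *)
Lemma regular_dim_le n j x : hausdorff_dim d = (n%:R)%:E -> regular_pt d j x -> (j <= n)%N.
Proof.
move=> dn reg; rewrite leqNgt; apply/negP => nj.
have nb : n%:R < n.+1%:R :> R by rewrite ltr_nat.
have [b [A [/andP[b0 bn] A0 pk]]] := dim_packing dn nb.
have bj : b < j%:R by apply: lt_le_trans bn _; rewrite ler_nat.
pose J : R := j.+1%:R; have J1 : 1 <= J by rewrite ler1n.
apply: (powR_unbounded (B := A * (8 * J) `^ b) bj) => K K0.
have K1 : 1 <= K%:R :> R by rewrite ler1n.
have KJ : 1 <= K%:R * J by rewrite -[leLHS]mul1r ler_pM.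
(* The grid has step 4 e, with 4 e K J = 1 to keep it in the unit ball; the chart loses 3 e, so a
   separation e remains. *)
pose e := (4 * (K%:R * J))^-1.
have e0 : 0 < e by rewrite invr_gt0; lra.
have eE : 4 * e * (K%:R * J) = 1 by rewrite mulrAC mulfV// gt_eqF//; lra.
have e4 : e <= 1 / 4.
  have : e * 1 <= e * (K%:R * J) by rewrite ler_pM2l.
  lra.
have [l0 l00 Hl] := reg 2 e (ltr0Sn R 1) e0.
have [l l0l l2] : exists2 l, l0 <= l & 2 <= l.
  by exists (Num.max l0 2); rewrite le_max lexx ?orbT.
have lp : 0 < l by lraw l0l.
have [f [fx fiso fonto]] := Hl l l0l.
pose v (g : {ffun 'I_j -> 'I_K}) : 'rV[R]_j := \row_q ((g q)%:R * (4 * e)).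
have vn g : euc_dist (v g) 0 < 2 - e.
  rewrite euc_distE; apply: (@le_lt_trans _ _ 1); last by lraw e4.
  apply: (@le_trans _ _ (#|'I_j|%:R * J^-1)).
    apply: enorm_le; first by rewrite invr_ge0; lraw J1.
    move=> q; rewrite !mxE subr0 ger0_norm; last by rewrite mulr_ge0//; lraw.
    apply: (@le_trans _ _ (K%:R * (4 * e))).
      by rewrite ler_wpM2r// ?ler_nat 1?ltnW//; lraw.
    rewrite -(ler_pM2r (_ : 0 < J)); last by lraw J1.
    by rewrite mulVf; [lraw eE|rewrite gt_eqF//; lra].
  rewrite card_ord ler_pdivrMr; last by lraw J1.
  by rewrite mul1r ler_nat.
have ex g : exists p, l * d x p < 2 /\ euc_dist (f p) (v g) < e.
  by have [p h1 h2] := fonto (v g) (vn g); exists p.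
have [p Hp] := choice ex.
have [_ _ ec et] := euc_metric R j.
have := pk x (2 / l) (8 * (K%:R * J)) _ p.
rewrite card_ffun !card_ord natrX => H.
rewrite -mulrA [_ * K%:R `^ b]mulrC -powRM//; last by lraw J1.
rewrite (_ : K%:R * (8 * J) = 8 * (K%:R * J)); last by ring.
apply: H.
- by rewrite divr_gt0//= ler_pdivrMr// mul1r.
- by lraw KJ.
- by move=> g; rewrite ler_pdivlMr// mulrC ltW//; case: (Hp g).
move=> g g' gg'.
have -> : 2 / l / (8 * (K%:R * J)) = e / l.
  have KJ0 : K%:R * J != 0 by rewrite gt_eqF//; lraw KJ.
  have l_neq0 := lt0r_neq0 lp.
  by rewrite /e; move: KJ0; move: (K%:R * J) => z z0; field; rewrite z0 l_neq0.
rewrite ler_pdivrMr// mulrC.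
have [pg vg] := Hp g; have [pg' vg'] := Hp g'.
have iso := fiso _ _ pg pg'.
have vv : 4 * e <= euc_dist (v g) (v g').
  have [q gq] : exists q, g q != g' q.
    apply: contrapT => /forallNP no; move/eqP: gg'; apply; apply/ffunP => q.
    by apply/eqP; apply/negPn/negP; exact: no.
  rewrite euc_distE; apply: le_trans (coord_le_enorm _ q); rewrite !mxE -mulrBl normrM.
  rewrite (ger0_norm (_ : 0 <= 4 * e)); last by lraw.
  rewrite ler_peMl//; first by lraw.
  exact: nat_dist_ge1.
have t1 := et (v g) (f (p g)) (v g'); have t2 := et (f (p g)) (f (p g')) (v g').
rewrite (ec (v g) (f (p g))) in t1; move: iso; rewrite ltr_norml => /andP[_ iso].
lraw iso t1 t2 vg vg' vv.
Qed.

(** Contraction by 1 / l brings the unit ball into a ball where the chart is almost isometric.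
    Counting cells in R^j gives packing exponent j, so the dimension is at most j + 1/2. *)
Lemma regular_dim_ge n j x : hausdorff_dim d = (n%:R)%:E -> regular_pt d j x -> (n <= j)%N.
Proof.
move=> dn reg; rewrite leqNgt; apply/negP => jn.
pose C := contr_cst (R := R) 1; have C1 : 1 <= C := contr_cst_ge1 1.
pose J : R := j.+1%:R; have J1 : 1 <= J by rewrite ler1n.
have CJ : 1 <= C * J by rewrite -[leLHS]mul1r ler_pM.
have b0 : 0 <= j%:R :> R by [].
have bb : j%:R < j%:R + 1 / 2 :> R by lra.
have A0 : 0 < (10 * (C * J)) ^+ j by rewrite exprn_gt0//; lra.
suff pk : forall eta (I : finType) (f : I -> T), 0 < eta <= 1 ->
     (forall i, d x (f i) <= 1) -> separated d f eta ->
     #|I|%:R <= (10 * (C * J)) ^+ j * eta^-1 `^ j%:R.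
  have bb0 : 0 <= j%:R + 1 / 2 :> R by lra.
  have := null_dim dn bb0 (packing_null dmet geo glob ltr01 A0 b0 bb pk).
  have : j.+1%:R <= n%:R :> R by rewrite ler_nat.
  rewrite -natr1; lra.
move=> eta I f /andP[eta0 eta1] f1 fsep.
rewrite powR_mulrn ?invr_ge0 ?(ltW eta0)// -exprMn.
pose e := eta / (4 * C); have e0 : 0 < e by rewrite divr_gt0//; lra.
have eE : 4 * C * e = eta by rewrite /e; field; rewrite gt_eqF//; lra.
have eC : e <= C * e by rewrite ler_peMl// ltW.
have [l0 l00 Hl] := reg 2 e (ltr0Sn R 1) e0.
have [l l0l l1] : exists2 l, l0 <= l & 1 <= l.
  by exists (Num.max l0 1); rewrite le_max lexx ?orbT.
have lp : 0 < l by lraw l0l.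
have [F [Fx Fiso _]] := Hl l l0l.
have li : 0 <= l^-1 <= 1 by rewrite invr_ge0 ltW//= invf_le1.
have [g [g1 g2]] := glob_contracting dmet geo glob (M := 1) (y := x) li f1.
have gl i : l * d x (g i) <= 1 by rewrite g1 mulrA mulfV ?mul1r// gt_eqF.
have [_ _ ec et] := euc_metric R j.
have dx0 : d x x = 0 by case: dmet.
pose w := 2 * e / J.
have w0 : 0 < w by rewrite divr_gt0//; lraw.
have := @cell_count R I 'I_j (fun i q => F (g i) ord0 q) 2 w w0 (ler0n R 2).
rewrite card_ord => H; apply: le_trans (H _ _) _ => [i q|i k ik|].
- apply: (@le_trans _ _ (euc_dist (F (g i)) (F x))).
    rewrite euc_distE Fx (eq_enorm (g := F (g i) ord0)); first exact: coord_le_enorm.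
    by move=> q'; rewrite mxE subr0.
  have h1 : l * d x (g i) < 2 by have := gl i; lraw.
  have h2 : l * d x x < 2 by rewrite dx0 mulr0.
  have [_ _ sd _] := dmet.
  have := Fiso _ _ h1 h2; rewrite (sd (g i)) ltr_norml => /andP[_].
  by have := gl i; lraw eC eE eta1.
- apply: contrapT => /forallNP no.
  have h i' : l * d x (g i') < 2 by have := gl i'; lraw.
  have := Fiso _ _ (h i) (h k); rewrite ltr_norml => /andP[iso _].
  have : euc_dist (F (g i)) (F (g k)) <= j%:R * w.
    rewrite euc_distE -[X in X%:R * w]card_ord; apply: enorm_le; first exact: ltW.
    by move=> q; rewrite leNgt; apply/negP => hq; apply: (no q); exact: ltW.
  have : j%:R * w <= J * w by rewrite ler_pM2r// ler_nat.
  have -> : J * w = 2 * e by rewrite /w mulrC divfK// gt_eqF//; lra.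
  have : eta <= C * (l * d (g i) (g k)).
    rewrite mulrCA; have := g2 i k; rewrite -(ler_pM2l lp) !mulrA mulfV ?gt_eqF// mul1r -mulrA.
    by move=> h3; apply: le_trans h3; exact: fsep.
  move=> h3 h4 h5.
  have : C * (l * d (g i) (g k)) < C * (3 * e) by rewrite ltr_pM2l; lraw C1 h4 h5 iso.
  have : 0 < C * e by lraw eE.
  lra.
- have -> : 2 * 2 / w + 1 = 8 * (C * J) * eta^-1 + 1.
    rewrite /w /e; field; rewrite !gt_eqF//=; lra.
  have e1 : 1 <= eta^-1 by rewrite invf_ge1.
  rewrite lerXn2r ?nnegrE//.
  + by rewrite addr_ge0// mulr_ge0// ?(le_trans ler01)//; lra.
  + by rewrite mulr_ge0// ?(le_trans ler01)//; lra.
  have : 1 * 1 <= (C * J) * eta^-1 by rewrite ler_pM.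
  lra.
Qed.

Lemma regular_dim n j x : hausdorff_dim d = (n%:R)%:E -> regular_pt d j x -> j = n.
Proof.
move=> dn reg; apply/eqP; rewrite eqn_leq.
by rewrite (regular_dim_le dn reg) (regular_dim_ge dn reg).
Qed.

End RegularDim.

(** * Generic points by Baire category, and existence of a regular point *)

Section Generic.
Variable R : realType.
Local Notation ch := (@hcosh R).
Local Notation sh := (@hsinh R).

(** For a third side u + v the comparison cosine is exactly -1; being close to -1 is an open
    condition, written without division as 0 < H. *)
Lemma opposite_open (u v e : R) : 0 < u -> 0 < v -> 0 < e -> exists2 eta, 0 < eta &
  forall u' v' w', `|u - u'| < eta -> `|v - v'| < eta -> `|u + v - w'| < eta ->
    [/\ 0 < u', 0 < v' & (ch u' * ch v' - ch w') / (sh u' * sh v') < -1 + e].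
Proof.
move=> u0 v0 e0.
pose H (z : R * R * R) := (e - 1) * (sh z.1.1 * sh z.1.2) - ch z.1.1 * ch z.1.2 + ch z.2.
have cH : {for (u, v, u + v), continuous H}.
  have c1 : continuous (fun z : R * R * R => z.1.1).
    by move=> z; apply: cvg_comp; [exact: cvg_fst|exact: cvg_fst].
  have c2 : continuous (fun z : R * R * R => z.1.2).
    by move=> z; apply: cvg_comp; [exact: cvg_fst|exact: cvg_snd].
  have c3 : continuous (fun z : R * R * R => z.2) by move=> z; exact: cvg_snd.
  have cc (f : R -> R) (g : R * R * R -> R) : continuous f -> continuous g -> continuous (f \o g).
    by move=> cf cg z; apply: continuous_comp; [exact: cg|exact: cf].
  have ch1 := cc _ _ (@ch_continuous R) c1; have ch2 := cc _ _ (@ch_continuous R) c2.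
  have ch3 := cc _ _ (@ch_continuous R) c3.
  have sh1 := cc _ _ (@sh_continuous R) c1; have sh2 := cc _ _ (@sh_continuous R) c2.
  apply: cvgD; last exact: ch3.
  apply: cvgB; last by apply: cvgM; [exact: ch1|exact: ch2].
  by apply: cvgM; [exact: cvg_cst|apply: cvgM; [exact: sh1|exact: sh2]].
have H0 : 0 < H (u, v, u + v).
  rewrite /H /= chD.
  have : 0 < e * (sh u * sh v) by rewrite mulr_gt0// mulr_gt0// sh_gt0.
  lra.
have : nbhs (u, v, u + v) [set z | 0 < H z].
  have := cH; move=> /(_ [set y | 0 < y]) h; apply: h.
  exact: (@open_nbhs_nbhs _ _ [set y : R | 0 < y] (conj (@open_gt R 0) H0)).
move=> /nbhs_ballP[eta eta0 Heta].
have [m m0 [m1 m2 m3]] := min3 eta0 u0 v0.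
exists m => // u' v' w' hu hv hw.
have u'0 : 0 < u' by move: hu; rewrite ltr_norml => /andP[_]; lra.
have v'0 : 0 < v' by move: hv; rewrite ltr_norml => /andP[_]; lra.
have := Heta (u', v', w'); rewrite /ball /= /prod_ball /= => h.
have {}h : 0 < H (u', v', w').
  by apply: h; split; [split|]; rewrite /ball /=; [apply: lt_le_trans hu _|apply: lt_le_trans hv _|apply: lt_le_trans hw _].
split => //; rewrite ltr_pdivrMr ?mulr_gt0 ?sh_gt0//.
by move: h; rewrite /H /=; lraw.
Qed.

Section Baire.
Variables (T : Type) (d : T -> T -> R).
Hypothesis dmet : is_metric d.
Hypothesis dcpl : complete_metric d.

Let dpm : is_pseudometric d. Proof. exact: metric_pseudo. Qed.
Let d_ge0 a b : 0 <= d a b. Proof. exact: pm_ge0. Qed.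
Let ds a b : d a b = d b a. Proof. by case: dmet. Qed.
Let dt a b c : d a c <= d a b + d b c. Proof. by case: dmet. Qed.
Let d0 a : d a a = 0. Proof. by case: dmet. Qed.

(** The hypothesis packs openness and density into one move inside a given ball; the closed balls so
    obtained are nested and their radii are at least halved. *)
Lemma baire (x0 : T) (O : nat -> set T) :
  (forall n x r, 0 < r -> exists y r', [/\ 0 < r', d x y + r' <= r, r' <= r / 2 &
     forall z, d y z <= r' -> O n z]) ->
  exists z, forall n, O n z.
Proof.
move=> H.
have st (nz : nat * (T * R)) : exists y : T * R, 0 < nz.2.2 ->
   [/\ 0 < y.2, d nz.2.1 y.1 + y.2 <= nz.2.2, y.2 <= nz.2.2 / 2 &
     forall z, d y.1 z <= y.2 -> O nz.1 z].
  have [r0|r0] := ltP 0 nz.2.2; last by exists nz.2.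
  by have [y [r' h]] := H nz.1 nz.2.1 _ r0; exists (y, r').
have [S HS] := choice st.
pose sq := fix sq n := match n with 0%N => (x0, 1) | m.+1 => S (m, sq m) end.
have pos n : 0 < (sq n).2 by elim: n => [|n IH] /=; [exact: ltr01|have [] := HS (n, sq n) IH].
have step n := HS (n, sq n) (pos n).
have rad n : (sq n).2 <= (1 / 2) ^+ n.
  elim: n => [|n IH]; first by rewrite expr0.
  by have [_ _ h _] := step n; apply: le_trans h _; rewrite exprS /=; lra.
have far n p : (n <= p)%N -> d (sq n).1 (sq p).1 + (sq p).2 <= (sq n).2.
  elim: p => [|p IH]; first by rewrite leqn0 => /eqP ->; rewrite d0 add0r.
  rewrite leq_eqVlt => /orP[/eqP ->|]; first by rewrite d0 add0r.
  rewrite ltnS => /IH h; have [_ h2 _ _] := step p.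
  have := dt (sq n).1 (sq p).1 (sq p.+1).1; rewrite /= in h2 *; lra.
have [|z Hz] := dcpl (u := fun n => (sq n).1).
  move=> e e0; have [N hN] : exists N : nat, (1 / 2) ^+ N < e / 2.
    have e20 : 0 < e / 2 by lra.
    have h2 : 0 <= (1 / 2 : R) < 1 by lra.
    have [N HN] := geom_small 1 h2 e20; exists N.
    by have := HN N (leqnn N); rewrite mul1r.
  exists N => p q Np Nq.
  have h1 := far _ _ Np; have h2 := far _ _ Nq; have := pos p; have := pos q; have := rad N.
  have := dt (sq p).1 (sq N).1 (sq q).1; rewrite (ds (sq p).1 (sq N).1); lraw h1 h2 hN.
exists z => n; have [_ _ _] := step n; apply; rewrite -/(sq n.+1).
apply/ler_addgt0Pr => e e0; have [N hN] := Hz _ e0.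
have := far n.+1 (maxn n.+1 N) (leq_maxl _ _); have := hN _ (leq_maxr n.+1 N).
have := dt (sq n.+1).1 (sq (maxn n.+1 N)).1 z; have := pos (maxn n.+1 N); lra.
Qed.

Variable G : T -> T -> R -> T.
Hypothesis HG : forall x y, is_geodesic d (G x y) x y.
Hypothesis glob : glob_cmp d d.
Variable a : nat -> T.
Hypothesis adense : forall x e, 0 < e -> exists i, d x (a i) < e.

(** On a geodesic from [a i] to some [x'] near [x], a point [y] shortly before [x'] sees the two
    ends in opposite directions. By openness [x'] may be replaced by a dense point [a k], and [y] by
    any point of a small ball. *)
Lemma generic_step p q i x r e : 0 < d p q -> 0 < r -> 0 < e ->
  exists y r', [/\ 0 < r', d x y + r' <= r, r' <= r / 2 & forall z, d y z <= r' ->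
    0 < d z (a i) /\ exists k, ccos d z (a i) (a k) < -1 + e].
Proof.
move=> pq r0 e0.
have [x' xx' ax'] : exists2 x', d x x' <= r / 4 & 0 < d (a i) x'.
  have [ai|ai] := ltP 0 (d (a i) x); first by exists x => //; rewrite d0; lra.
  have [z xz] : exists z, 0 < d x z.
    have [xp|xp] := ltP 0 (d x p); first by exists p.
    by exists q; have := dt p x q; rewrite (ds p x); lra.
  pose t := Num.min 1 (r / 4 / d x z).
  have r4 : 0 < r / 4 by lra.
  have t0 : 0 < t by rewrite lt_min ltr01 divr_gt0.
  have t01 : 0 <= t <= 1 by rewrite ltW//= ge_min lexx.
  exists (G x z t).
    by rewrite (geod_d0 (HG x z) t01) -ler_pdivlMr// ge_min lexx orbT.
  have : 0 < d x (G x z t) by rewrite (geod_d0 (HG x z) t01) mulr_gt0.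
  have := dt x (a i) (G x z t); rewrite (ds x (a i)); have := d_ge0 (a i) x; lra.
pose D := d (a i) x'; pose t := Num.min (1 / 2) (r / 4 / D).
have r4 : 0 < r / 4 by lra.
have t0 : 0 < t by rewrite lt_min !divr_gt0.
have t2 : t <= 1 / 2 by rewrite ge_min lexx.
have tD : t * D <= r / 4 by rewrite -ler_pdivlMr// ge_min lexx orbT.
have t01 : 0 <= 1 - t <= 1 by lra.
pose y := G (a i) x' (1 - t).
have yi : d y (a i) = (1 - t) * D by rewrite ds (geod_d0 (HG _ _) t01).
have yx : d y x' = t * D.
  by rewrite (geod_d1 (HG _ _) t01) (_ : 1 - (1 - t) = t)//; ring.
have u0 : 0 < (1 - t) * D by rewrite mulr_gt0//; lra.
have v0 : 0 < t * D by rewrite mulr_gt0.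
have [eta eta0 Heta] := opposite_open u0 v0 e0.
have eta2 : 0 < eta / 2 by lraw.
have [k hk] := adense x' eta2.
have eta4 : 0 < eta / 4 by lraw.
have [r' r'0 [r'1 r'2 _]] := min3 eta4 r4 r4.
exists y, r'; split => //; first by have := dt x x' y; rewrite (ds x' y); lraw r'2 tD xx' yx.
  lraw r'2.
move=> z yz.
have [||| zi zk cz] := Heta (d z (a i)) (d z (a k)) (d (a i) (a k)).
- rewrite -yi; have := dt y z (a i); have := dt z y (a i); rewrite (ds z y) => *.
  by rewrite ltr_norml; apply/andP; split; lra.
- have := dt y z x'; have := dt z y (a k); have := dt y x' (a k); have := dt z x' (a k).
  have := dt z (a k) x'; rewrite (ds z y) (ds (a k) x') -yx => *.
  by rewrite ltr_norml; apply/andP; split; lra.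
- rewrite (_ : (1 - t) * D + t * D = D); last by ring.
  have := dt (a i) x' (a k); have := dt (a i) (a k) x'; rewrite (ds (a k)) -/D => *.
  by rewrite ltr_norml; apply/andP; split; lra.
by split => //; exists k.
Qed.

(** Comparison cosines, being continuous, define the sets for [baire]; [cs_le_ccos] passes to
    angles. Sets are numbered by codes of pairs (i, N), and a number that codes no pair imposes no
    condition. *)
Lemma generic_ex p q : 0 < d p q -> exists x, generic d G a x.
Proof.
move=> pq.
pose O (n : nat) : set T := [set z | forall i N, pickle (i, N) = n ->
  0 < d z (a i) /\ exists k, ccos d z (a i) (a k) < -1 + (N.+1%:R)^-1].
have [|x Hx] := baire p (O := O).
  move=> n x r r0; have [[i [N iN]]|no] := pselect (exists i N : nat, pickle (i, N) = n).
    have e0 : 0 < (N.+1%:R)^-1 :> R by rewrite invr_gt0.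
    have [y [r' [h1 h2 h3 h4]]] := generic_step i x pq r0 e0.
    exists y, r'; split => // z /h4 hz i' N' iN'.
    by have [-> ->] : (i', N') = (i, N) by apply: (pcan_inj pickleK); rewrite iN' iN.
  exists x, (r / 2); split; rewrite ?d0; try lra.
  by move=> z _ i N iN; exfalso; apply: no; exists i, N.
exists x; split; first by move=> i; have [] := Hx (pickle (i, 0%N)) i 0%N erefl.
move=> i e e0.
have [_ [k hk]] := Hx (pickle (i, Num.bound e^-1)) i (Num.bound e^-1) erefl.
exists k; apply: le_trans (cs_le_ccos dmet HG glob _ _ _) _; apply: le_trans (ltW hk) _.
rewrite lerD2l invf_ple ?posrE//.
have ei : 0 <= e^-1 by rewrite invr_ge0 ltW.
by apply: le_trans (ltW (archi_boundP ei)) _; rewrite ler_nat.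
Qed.

End Baire.

(** Nullity yields countable covers by sets of arbitrarily small diameter; one point is taken from
    each nonempty member, and [t0] for an empty one. *)
Lemma dense_seq (T : Type) (d : T -> T -> R) s (t0 : T) : is_metric d ->
  hausdorff_measure d s = 0%E ->
  exists a : nat -> T, forall x e, 0 < e -> exists i, d x (a i) < e.
Proof.
move=> dmet H0.
have cov (N : nat) : exists U, delta_covers d (N.+1%:R)^-1 U.
  have h : (Hdelta d s (N.+1%:R)^-1 <= 0)%E.
    by rewrite -H0; apply: ereal_sup_ubound; exists (N.+1%:R)^-1 => //=; rewrite invr_gt0.
  have /ereal_inf_lt[_ [U HU _] _] := le_lt_trans h lte01.
  by exists U.
have [U HU] := choice cov.
have pick (n : nat * nat) : exists z, forall y, U n.1 n.2 y -> U n.1 n.2 z.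
  have [[z hz]|no] := pselect (exists z, U n.1 n.2 z); first by exists z.
  by exists t0 => y hy; exfalso; apply: no; exists y.
have [z Hz] := choice pick.
exists (fun n => if unpickle n is Some m then z m else t0) => x e e0.
have ei : 0 <= e^-1 by rewrite invr_ge0 ltW.
have [bd cv] := HU (Num.bound e^-1); have [i _ Ui] := cv x I.
exists (pickle (Num.bound e^-1, i)); rewrite pickleK.
apply: le_lt_trans (bd i _ _ Ui (Hz (_, i) x Ui)) _.
rewrite invf_plt ?posrE//; apply: lt_le_trans (archi_boundP ei) _.
by rewrite ler_nat.
Qed.

Lemma exists_regular (T : Type) (d : T -> T -> R) n (t0 : T) : is_metric d ->
  complete_metric d -> (forall a b, exists g, is_geodesic d g a b) -> glob_cmp d d ->
  hausdorff_dim d = (n%:R)%:E -> exists x, regular_pt d n x.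
Proof.
move=> dmet dcpl geo glob dn.
suff [x [j reg]] : exists x j, regular_pt d j x.
  by exists x; rewrite -(regular_dim dmet dcpl geo glob dn reg).
have [[p [q pq]]|no] := pselect (exists p q, 0 < d p q); last first.
  (* Without two distinct points [generic_ex] cannot start; all distances vanish and the space is
     regular of dimension 0. *)
  exists t0, 0%N => r e r0 e0; exists 1 => // l l1.
  have dz p q : d p q = 0.
    have d_ge0 : 0 <= d p q by apply: pm_ge0; exact: metric_pseudo.
    apply/eqP; rewrite eq_le d_ge0 andbT leNgt; apply/negP => h.
    by apply: no; exists p, q.
  have e00 (v w : 'rV[R]_0) : euc_dist v w = 0 by rewrite /euc_dist big_ord0 sqrtr0.
  exists (fun=> 0); split => //.
    by move=> *; rewrite e00 dz mulr0 subrr normr0.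
  by move=> v vr; exists t0; rewrite ?dz ?mulr0 ?e00.
have [GG HGG] := choice (fun z => geo z.1 z.2).
pose G x y := GG (x, y); have HG x y : is_geodesic d (G x y) x y := HGG (x, y).
have nb : n%:R < n%:R + 1 :> R by lra.
have [s _ Hs] := dim_null dn nb.
have [a adense] := dense_seq t0 dmet Hs.
have [x gx] := generic_ex dmet dcpl HG glob adense pq.
have [b [A [_ A0 pk]]] := dim_packing dmet dcpl geo glob dn nb.
by exists x; exact: (generic_regular dmet HG glob adense A0 pk gx).
Qed.

End Generic.

(** * Filling fibres *)

Lemma cauchy2 (R : realType) (a b c d p q : R) : 0 <= p -> 0 <= q ->
  a ^+ 2 + b ^+ 2 = p ^+ 2 -> c ^+ 2 + d ^+ 2 = q ^+ 2 -> a * c + b * d <= p * q.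
Proof.
move=> p0 q0 h1 h2; apply: le_of_sqr; first exact: mulr_ge0.
rewrite exprMn -h1 -h2; have := sqr_ge0 (a * d - b * c); lra.
Qed.

(* Equality in Cauchy--Schwarz forces the two halves of a minimizing path to be parallel. *)
Lemma split_num (R : realType) (s L Y H a A b B : R) : 0 <= s <= 1 -> 0 <= L ->
  0 <= Y -> 0 <= H -> Y ^+ 2 + H ^+ 2 = L ^+ 2 -> a ^+ 2 + A ^+ 2 = (s * L) ^+ 2 ->
  b ^+ 2 + B ^+ 2 = ((1 - s) * L) ^+ 2 -> Y <= a + b -> H <= A + B ->
  a = s * Y /\ A = s * H.
Proof.
move=> /andP[s0 s1] L0 Y0 H0 e1 e2 e3 h1 h2.
have L1 : 0 <= (1 - s) * L by rewrite mulr_ge0//; lra.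
have k1 := cauchy2 L1 L0 e3 e1.
have k2 : Y * Y <= (a + b) * Y by rewrite ler_wpM2r.
have k3 : H * H <= (A + B) * H by rewrite ler_wpM2r.
have k4 : s * (s * L ^+ 2) <= s * (a * Y + A * H) by rewrite ler_wpM2l//; lra.
have : (a - s * Y) ^+ 2 + (A - s * H) ^+ 2 <= 0.
  rewrite (_ : _ + _ = (a ^+ 2 + A ^+ 2) - 2 * (s * (a * Y + A * H)) + s ^+ 2 * (Y ^+ 2 + H ^+ 2)).
    by rewrite e1 e2; lra.
  by ring.
have q1 := sqr_ge0 (a - s * Y); have q2 := sqr_ge0 (A - s * H) => q3.
have z1 : (a - s * Y) ^+ 2 = 0 by lra.
have z2 : (A - s * H) ^+ 2 = 0 by lra.
by move/eqP: z1; rewrite sqrf_eq0 subr_eq0 => /eqP; move/eqP: z2; rewrite sqrf_eq0 subr_eq0 => /eqP.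
Qed.

Section EuclidStewart.
Variables (R : realType) (m : nat).
Implicit Types u v w : 'rV[R]_m.

Lemma euc_sqr u v : euc_dist u v ^+ 2 = \sum_i (u ord0 i - v ord0 i) ^+ 2.
Proof. by rewrite euc_distE enorm_sqr. Qed.

Lemma euc_stewart u v w (t : R) :
  euc_dist u ((1 - t) *: v + t *: w) ^+ 2 = (1 - t) * euc_dist u v ^+ 2 +
    t * euc_dist u w ^+ 2 - t * (1 - t) * euc_dist v w ^+ 2.
Proof.
rewrite !euc_sqr !mulr_sumr -big_split -sumrB /=.
by apply: eq_bigr => i _; rewrite !mxE; ring.
Qed.

Lemma euc_dist_ge0 u v : 0 <= euc_dist u v. Proof. exact: sqrtr_ge0. Qed.

Lemma euc_transl u v w : euc_dist (u + w) (v + w) = euc_dist u v.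
Proof. by congr Num.sqrt; apply: eq_bigr => i _; rewrite !mxE; congr (_ ^+ 2); ring. Qed.

Lemma euc_scale (s : R) u v : euc_dist (s *: u) (s *: v) = `|s| * euc_dist u v.
Proof. by rewrite !euc_distE -enormZ; apply: eq_enorm => i; rewrite !mxE mulrBr. Qed.

End EuclidStewart.

Section Split.
Variables (R : realType) (m : nat) (X : Type) (D Y : X -> X -> R) (h : X -> 'rV[R]_m).
Hypothesis Dmet : is_metric D.
Hypothesis Ypm : is_pseudometric Y.
Hypothesis DYh : forall a b, D a b ^+ 2 = Y a b ^+ 2 + euc_dist (h a) (h b) ^+ 2.
Local Notation H a b := (euc_dist (h a) (h b)).

Let Dpm : is_pseudometric D. Proof. exact: metric_pseudo. Qed.
Let D_ge0 a b : 0 <= D a b. Proof. exact: pm_ge0. Qed.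
Let Y_ge0 a b : 0 <= Y a b. Proof. exact: pm_ge0. Qed.
Let Ds a b : D a b = D b a. Proof. by case: Dmet. Qed.
Let Ys a b : Y a b = Y b a. Proof. by case: Ypm. Qed.
Let Yt a b c : Y a c <= Y a b + Y b c. Proof. by case: Ypm. Qed.
Let Ht (u v w : 'rV[R]_m) : euc_dist u w <= euc_dist u v + euc_dist v w.
Proof. by case: (euc_metric R m). Qed.
Let Hs (u v : 'rV[R]_m) : euc_dist u v = euc_dist v u.
Proof. by case: (euc_metric R m). Qed.
Let H_ge0 (u v : 'rV[R]_m) : 0 <= euc_dist u v. Proof. exact: euc_dist_ge0. Qed.

Lemma split_Yle a b : Y a b <= D a b.
Proof. by apply: le_of_sqr => //; rewrite DYh lerDl sqr_ge0. Qed.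

Lemma split_Hle a b : H a b <= D a b.
Proof. by apply: le_of_sqr => //; rewrite DYh lerDr sqr_ge0. Qed.

(** Equality in the triangle inequality along [g] passes to both components ([split_num]); in R^m it
    determines the point, by [euc_stewart]. *)
Lemma split_geod0 g a b s : is_geodesic D g a b -> 0 <= s <= 1 ->
  [/\ Y a (g s) = s * Y a b, Y (g s) b = (1 - s) * Y a b &
      h (g s) = (1 - s) *: h a + s *: h b].
Proof.
move=> gg s01; have [s0 s1] := andP s01.
have e2 := DYh a (g s); rewrite (geod_d0 gg s01) in e2.
have e3 := DYh (g s) b; rewrite (geod_d1 gg s01) in e3.
have [e4 e5] := split_num s01 (D_ge0 a b) (Y_ge0 a b) (H_ge0 (h a) (h b)) (esym (DYh a b))
  (esym e2) (esym e3) (Yt a (g s) b) (Ht _ (h (g s)) _).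
have s01' : 0 <= 1 - s <= 1 by lra.
have e3' : (1 - (1 - s)) = s by ring.
have [e7 e6] : Y (g s) b = (1 - s) * Y a b /\ H (g s) b = (1 - s) * H a b.
  apply: (split_num s01' (D_ge0 a b) (Y_ge0 a b) (H_ge0 (h a) (h b)) (esym (DYh a b))
    (esym e3) (a := Y (g s) b) (b := Y a (g s)) (B := H a (g s))).
  - by rewrite e3' -e2.
  - by rewrite addrC Yt.
  - by rewrite addrC Ht.
split => //; apply/eqP; have [_ z _ _] := euc_metric R m; apply/eqP/z.
apply/eqP; rewrite -sqrf_eq0 euc_stewart (Hs _ (h a)) e5 e6; apply/eqP; ring.
Qed.

Lemma split_geodY g a b : is_geodesic D g a b ->
  forall s t, 0 <= s <= 1 -> 0 <= t <= 1 -> Y (g s) (g t) = `|s - t| * Y a b.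
Proof.
move=> gg; have [g0 g1 gd] := gg.
suff H s t : 0 <= s -> s <= t -> t <= 1 -> Y (g s) (g t) = `|s - t| * Y a b.
  move=> s t /andP[s0 s1] /andP[t0 t1]; have [st|/ltW st] := leP s t; first exact: H.
  by rewrite Ys H// distrC.
move=> s0 st t1; have s01 : 0 <= s <= 1 by lra.
have t01 : 0 <= t <= 1 by lra.
have [e2 _ _] := split_geod0 gg t01.
have [t0|t0] := eqVneq t 0.
  have -> : s = t by lra.
  by rewrite subrr normr0 mul0r; case: Ypm.
have tp : 0 < t by rewrite lt_def t0; lra.
have z01 : 0 <= (0 : R) <= 1 by lra.
have gs := geod_sub Dpm gg z01 t01.
have st01 : 0 <= s / t <= 1 by rewrite divr_ge0 ?(ltW tp)//= ler_pdivrMr// mul1r.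
have [_ e3 _] := split_geod0 gs st01.
have es : 0 + s / t * (t - 0) = s by rewrite add0r subr0 divfK.
rewrite es g0 e2 in e3; rewrite e3 mulrA mulrBl divfK// mul1r distrC ger0_norm//.
by rewrite subr_ge0.
Qed.

(** By Cauchy-Schwarz, the square of D a b + D b c is at least the sum of the squares of the
    corresponding [Y]- and height sums; the height part is then discarded. *)
Lemma split_excess a b c :
  (Y a b + Y b c - Y a c) ^+ 2 <= (D a b + D b c + D a c) * (D a b + D b c - D a c).
Proof.
have h1 := Yt a b c; have h2 := Ht (h a) (h b) (h c).
have h3 := cauchy2 (D_ge0 a b) (D_ge0 b c) (esym (DYh a b)) (esym (DYh b c)).
have h4 : Y a c * Y a c <= Y a c * (Y a b + Y b c) by rewrite ler_wpM2l.
have h5 : H a c ^+ 2 <= (H a b + H b c) ^+ 2 by rewrite ler_sqr ?nnegrE// addr_ge0.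
have := DYh a b; have := DYh b c; have := DYh a c; lra.
Qed.

End Split.

(** Flat Stewart inequality at relative distance eta from the end of a side, with remainder of third
    order, as [fill_step] requires. Since |a - c| = O(eta), replacing ch a by its tangent at c costs
    only such terms. *)
Lemma stewart_near_end (R : realType) (M : R) : 1 <= M -> exists2 C, 0 < C & forall eta a b c e : R,
  0 < eta <= 1 -> 0 <= a -> 0 <= c <= M -> 0 <= b <= M * eta -> 0 <= e <= M * eta ->
  `|a - c| <= M * eta -> (c = 0 -> a = b /\ e = b) -> hyp_cmp a b c (1 - eta) e ->
  b ^+ 2 + eta * a ^+ 2 - eta * c ^+ 2 + eta ^+ 2 * c ^+ 2 - e ^+ 2 <= C * eta ^+ 3.
Proof.
move=> M1; pose K := @hcosh R (M + 1) ^+ 2.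
have K1 : 1 <= K by rewrite exprn_ege1// ch_ge1.
have M0 : 0 < M by lra.
have M2 : 0 < M ^+ 2 by rewrite exprn_gt0.
have M4 : 0 < M ^+ 4 by rewrite exprn_gt0.
have K0 : 0 < K by lra.
have KM4 : 0 < K * M ^+ 4 by rewrite mulr_gt0.
have KM2 : 0 < K * M ^+ 2 by rewrite mulr_gt0.
exists (M ^+ 2 + 2 * K * M ^+ 4 + K * M ^+ 2); first by lra.
move=> eta a b c e /andP[et0 et1] a0 /andP[c0 cM] /andP[b0 bM] /andP[e0 eM] ac deg cmp.
have Me1 : M * eta <= M by rewrite ler_piMr// ltW.
have et2 : 0 < eta ^+ 2 by rewrite exprn_gt0.
have et3 : 0 < eta ^+ 3 by rewrite exprn_gt0.
have et43 : eta ^+ 4 <= eta ^+ 3 by rewrite (exprS eta 3) ler_piMl// ltW.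
have bq : b ^+ 2 <= M ^+ 2 * eta ^+ 2 by rewrite -exprMn ler_sqr ?nnegrE// ltW// mulr_gt0.
have k1 : K * (eta * b ^+ 2) <= K * M ^+ 2 * eta ^+ 3.
  rewrite -mulrA ler_pM2l// (_ : M ^+ 2 * eta ^+ 3 = eta * (M ^+ 2 * eta ^+ 2)); last by ring.
  by rewrite ler_pM2l.
have b20 : 0 <= eta * b ^+ 2 by rewrite mulr_ge0 ?sqr_ge0// ltW.
have Kb : eta * b ^+ 2 <= K * (eta * b ^+ 2) by rewrite ler_peMl.
have q1 : 0 < M ^+ 2 * eta ^+ 3 by rewrite mulr_gt0.
have q2 : 0 < K * M ^+ 4 * eta ^+ 3 by rewrite mulr_gt0.
move: c0; rewrite le_eqVlt => /orP[/eqP c0|c0].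
  by have [-> ->] := deg (esym c0); rewrite -c0 expr0n /= !mulr0; lraw Kb k1 q1 q2.
have sc : 0 < @hsinh R c by rewrite sh_gt0.
have ec0 : 0 <= eta * c by rewrite mulr_ge0// ltW.
have ecM : eta * c <= M by rewrite -[leRHS]mul1r ler_pM// ltW.
set s1 := @hsinh R (eta * c).
have s1l : eta * c <= s1 by exact: sh_geid.
have s1u : s1 <= eta * c * @hcosh R (eta * c) by apply: sh_le_ch.
have che : @hcosh R (eta * c) <= 1 + (eta * c) ^+ 2 / 2 * K.
  by apply: ch_le_sqr; rewrite ger0_norm//; lraw ecM.
have chl := ch_ge_sqr (eta * c).
have s1K : s1 - eta * c <= M ^+ 3 * eta ^+ 3 / 2 * K.
  have h1 : eta * c * (@hcosh R (eta * c) - 1) <= eta * c * ((eta * c) ^+ 2 / 2 * K).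
    by rewrite ler_wpM2l//; lraw che.
  have h2 : (eta * c) ^+ 3 <= (eta * M) ^+ 3.
    by rewrite lerXn2r ?nnegrE// ?mulr_ge0 ?ler_wpM2l// ltW.
  have h3 : (eta * c) ^+ 3 * K <= (eta * M) ^+ 3 * K by rewrite ler_wpM2r// ltW.
  have -> : M ^+ 3 * eta ^+ 3 / 2 * K = (eta * M) ^+ 3 * K / 2 by field.
  have : eta * c * ((eta * c) ^+ 2 / 2 * K) = (eta * c) ^+ 3 * K / 2 by field.
  lraw h1 h3 s1u.
have tg : @hcosh R c + (a - c) * @hsinh R c <= @hcosh R a by apply: ch_tangent => //; exact: ltW.
have chb := ch_ge_sqr b.
have ce : @hcosh R e <= 1 + e ^+ 2 / 2 + e ^+ 4 / 2 * K.
  have h1 : @hcosh R e <= 1 + e ^+ 2 / 2 * @hcosh R e ^+ 2 by apply: ch_le_sqr; rewrite ger0_norm.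
  have h2 : @hsinh R e <= e * @hcosh R (M + 1) by apply: sh_le_ch => //; lraw Me1 eM.
  have h3 : @hsinh R e ^+ 2 <= e ^+ 2 * K.
    rewrite -exprMn ler_sqr ?nnegrE//; first exact: sh_ge0.
    by rewrite mulr_ge0// ltW// ch_gt0.
  have h4 := ch2_sh2 e.
  have h5 : e ^+ 2 * @hcosh R e ^+ 2 <= e ^+ 2 * (1 + e ^+ 2 * K).
    by rewrite ler_wpM2l ?sqr_ge0//; lraw h3 h4.
  have -> : e ^+ 4 = e ^+ 2 * e ^+ 2 by ring.
  lraw h1 h5.
have e4 : e ^+ 4 * K <= K * M ^+ 4 * eta ^+ 3.
  have : e ^+ 4 <= (M * eta) ^+ 4 by rewrite lerXn2r ?nnegrE// mulr_ge0// ltW.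
  rewrite exprMn => h1; have h2 : M ^+ 4 * eta ^+ 4 <= M ^+ 4 * eta ^+ 3 by rewrite ler_pM2l.
  by rewrite mulrC -mulrA ler_pM2l//; lraw h1 h2.
have cK : @hcosh R c * s1 <= eta * K * @hsinh R c.
  have h1 : s1 <= eta * c * @hcosh R (M + 1).
    by apply: sh_le_ch => //; apply: le_trans ecM _; lraw.
  have h2 : @hcosh R c <= @hcosh R (M + 1) by apply: ch_le; lraw cM.
  have h3 : c <= @hsinh R c by apply: sh_geid; exact: ltW.
  have c1 : 0 < @hcosh R (M + 1) by exact: ch_gt0.
  apply: (@le_trans _ _ (@hcosh R (M + 1) * (eta * c * @hcosh R (M + 1)))).
    by apply: ler_pM => //; [exact: ltW (ch_gt0 _)|exact: le_trans s1l].
  rewrite (_ : _ * _ = eta * K * c); last by rewrite /K; ring.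
  by rewrite ler_pM2l// mulr_gt0.
have main : @hcosh R (eta * c) + s1 * (a - c) + (1 - eta * K) * (b ^+ 2 / 2) <= @hcosh R e.
  rewrite -(ler_pM2r sc); apply: le_trans cmp.
  rewrite (_ : 1 - (1 - eta) = eta); last by ring.
  have -> : (1 - eta) * c = c - eta * c by ring.
  have s10 : 0 <= s1 by exact: le_trans s1l.
  have sd0 : 0 <= @hsinh R (c - eta * c).
    by apply: sh_ge0; rewrite -[X in 0 <= X - _]mul1r -mulrBl mulr_ge0 ?subr_ge0// ltW.
  have h1 := ler_wpM2l s10 tg.
  have h2 := ler_wpM2l sd0 chb.
  have b2 : 0 <= b ^+ 2 / 2 by rewrite divr_ge0 ?sqr_ge0.
  have h3 : (1 - eta * K) * @hsinh R c * (b ^+ 2 / 2) <= @hsinh R (c - eta * c) * (b ^+ 2 / 2).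
    rewrite ler_wpM2r// shB -/s1.
    have : @hsinh R c * 1 <= @hsinh R c * @hcosh R (eta * c) by rewrite ler_pM2l// ch_ge1.
    lraw cK.
  rewrite -/s1; move: h1 h2 h3; rewrite shB -/s1 => h1 h2 h3; lraw h1 h2 h3.
have ac2 : eta * (a - c) ^+ 2 <= M ^+ 2 * eta ^+ 3.
  have : (a - c) ^+ 2 <= (M * eta) ^+ 2.
    by rewrite -real_normK ?num_real// ler_sqr ?nnegrE// ltW// mulr_gt0.
  have -> : M ^+ 2 * eta ^+ 3 = eta * (M * eta) ^+ 2 by ring.
  by rewrite ler_pM2l.
have sac : - (M ^+ 4 * eta ^+ 3 / 2 * K) <= (s1 - eta * c) * (a - c).
  have h0 : 0 <= s1 - eta * c by lraw s1l.
  have h1 : - (M * eta) <= a - c by move: ac; rewrite ler_norml => /andP[].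
  have h2 := ler_wpM2l h0 h1.
  have Me0 : 0 <= M * eta by rewrite mulr_ge0// ltW.
  have h3 := ler_wpM2r Me0 s1K.
  have h4 : M ^+ 3 * eta ^+ 3 / 2 * K * (M * eta) = eta ^+ 4 * (M ^+ 4 * K / 2) by field.
  have h5 : eta ^+ 4 * (M ^+ 4 * K / 2) <= eta ^+ 3 * (M ^+ 4 * K / 2).
    by rewrite ler_wpM2r// divr_ge0// mulr_ge0// ltW.
  lraw h2 h3 h5.
have := che; lraw ac2 ce chl e4 k1 main sac.
Qed.

Lemma bernoulli_inv (R : realType) (eta : R) N : 0 <= eta <= 1 ->
  (1 - eta) ^+ N * (1 + N%:R * eta) <= 1.
Proof.
move=> /andP[e0 e1]; elim: N => [|N IH]; first by rewrite expr0 mul0r; lra.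
apply: le_trans IH; rewrite exprSr -mulrA ler_wpM2l ?exprn_ge0//; first by lra.
rewrite -natr1; have : 0 <= N%:R * (eta * eta) by rewrite !mulr_ge0.
have : 0 <= eta * eta by rewrite mulr_ge0.
lra.
Qed.

Lemma euc_ray (R : realType) m (u v w : 'rV[R]_m) (s : R) : u - w = s *: (v - w) ->
  euc_dist u w = `|s| * euc_dist v w.
Proof.
move=> e; rewrite !euc_distE -enormZ; apply: eq_enorm => i.
by have /rowP/(_ i) := e; rewrite !mxE.
Qed.

Section Fill.
Variables (R : realType) (m : nat) (X : Type) (D Y : X -> X -> R) (h : X -> 'rV[R]_m).
Hypothesis Dmet : is_metric D.
Hypothesis Ypm : is_pseudometric Y.
Hypothesis DYh : forall a b, D a b ^+ 2 = Y a b ^+ 2 + euc_dist (h a) (h b) ^+ 2.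
Hypothesis Dgeo : forall a b, exists g, is_geodesic D g a b.
Hypothesis glob : glob_cmp D D.
Local Notation H a b := (euc_dist (h a) (h b)).

Let Dpm : is_pseudometric D. Proof. exact: metric_pseudo. Qed.
Let D_ge0 a b : 0 <= D a b. Proof. exact: pm_ge0. Qed.
Let Y_ge0 a b : 0 <= Y a b. Proof. exact: pm_ge0. Qed.
Let Ds a b : D a b = D b a. Proof. by case: Dmet. Qed.
Let Dt a b c : D a c <= D a b + D b c. Proof. by case: Dmet. Qed.
Let Ys a b : Y a b = Y b a. Proof. by case: Ypm. Qed.
Let Yt a b c : Y a c <= Y a b + Y b c. Proof. by case: Ypm. Qed.
Let Ht (u v w : 'rV[R]_m) : euc_dist u w <= euc_dist u v + euc_dist v w.
Proof. by case: (euc_metric R m). Qed.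
Let Hs (u v : 'rV[R]_m) : euc_dist u v = euc_dist v u.
Proof. by case: (euc_metric R m). Qed.
Let H_ge0 (u v : 'rV[R]_m) : 0 <= euc_dist u v. Proof. exact: euc_dist_ge0. Qed.
Let geodY := split_geod0 Dmet Ypm DYh.

Lemma split_le_sum a b : D a b <= Y a b + H a b.
Proof.
apply: le_of_sqr; first by rewrite addr_ge0.
by rewrite DYh sqrrD lerD2r lerDl mulrn_wge0// mulr_ge0.
Qed.

(** From x one goes a fraction eta towards x1 and towards x2, and takes the point z at ratio t
    between the two. In [stewart_near_end] the heights contribute a nonnegative term, by
    [euc_stewart], and the [Y]-distances from x and z to x1 cancel, both being t Y x1 x2; only Y x z
    ^ 2 is left to be bounded. *)
Lemma fill_step M : 1 <= M -> exists2 C, 0 < C & forall x x1 x2 t eta,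
  0 <= t <= 1 -> 0 < eta <= 1 -> D x x1 <= M -> D x x2 <= M ->
  Y x x1 <= t * Y x1 x2 -> Y x x2 <= (1 - t) * Y x1 x2 ->
  exists z, [/\ Y z x1 <= t * Y x1 x2, Y z x2 <= (1 - t) * Y x1 x2,
    h z = (1 - eta) *: h x + eta *: ((1 - t) *: h x1 + t *: h x2) & Y x z ^+ 2 <= C * eta ^+ 3].
Proof.
move=> M1; have M31 : 1 <= 3 * M by lra.
have [C C0 HC] := stewart_near_end M31; exists C => // x x1 x2 t eta t01 eta01 xM1 xM2 a1 a2.
have [et0 et1] := andP eta01; have [t0 t1] := andP t01.
have e01 : 0 <= eta <= 1 by rewrite ltW.
have [g1 G1] := Dgeo x x1; have [g2 G2] := Dgeo x x2.
set c := Y x1 x2 in a1 a2 *.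
have [A1 A2] : Y x x1 = t * c /\ Y x x2 = (1 - t) * c.
  by have := Yt x1 x x2; rewrite (Ys x1 x) -/c => ?; split; lra.
have [p1a p1b p1h] := geodY G1 e01; have [p2a p2b p2h] := geodY G2 e01.
have D1 := geod_d0 G1 e01; have D2 := geod_d0 G2 e01.
set p1 := g1 eta in p1a p1b p1h D1; set p2 := g2 eta in p2a p2b p2h D2.
have [g G] := Dgeo p1 p2; have [za zb zh] := geodY G t01; have Dz := geod_d0 G t01.
set z := g t in za zb zh Dz.
have p12 : Y p1 p2 <= eta * c.
  by have := Yt p1 x p2; rewrite (Ys p1 x) p1a p2a A1 A2; lraw.
have tp : t * Y p1 p2 <= t * (eta * c) by rewrite ler_wpM2l.
have tp' : (1 - t) * Y p1 p2 <= (1 - t) * (eta * c) by rewrite ler_wpM2l//; lraw t01.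
have z1 : Y z x1 <= t * c.
  by have := Yt z p1 x1; rewrite (Ys z p1) za p1b A1; lraw tp.
have z2 : Y z x2 <= (1 - t) * c.
  by have := Yt z p2 x2; rewrite zb p2b A2; lraw tp'.
have z1' : Y z x1 = t * c by have := Yt x1 z x2; rewrite (Ys x1 z) -/c; lraw z1 z2.
exists z; split => //.
  rewrite zh p1h p2h; apply/rowP => k; rewrite !mxE; ring.
have D12 : D p1 p2 <= 2 * M * eta.
  have := Dt p1 x p2; rewrite (Ds p1 x) D1 D2.
  have : eta * D x x1 <= eta * M by rewrite ler_pM2l.
  have : eta * D x x2 <= eta * M by rewrite ler_pM2l.
  lraw.
have De : D z p1 <= 2 * M * eta.
  by rewrite Ds Dz; apply: le_trans D12; rewrite ler_piMl.
have Db : D z x <= 3 * M * eta.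
  have := Dt z p1 x; rewrite (Ds p1 x) D1.
  have : eta * D x x1 <= eta * M by rewrite ler_pM2l.
  lraw De.
have rt : 0 <= 1 - eta <= 1 by lraw eta01.
have := glob z (geod_rev G1 Ds) rt; rewrite /= (_ : 1 - (1 - eta) = eta); last by ring.
rewrite -/p1 => cmp.
have Dxx1 := Ds x x1.
have M0 : 0 <= M * eta by rewrite mulr_ge0// ?(ltW et0)// (le_trans ler01).
have c1 : 0 <= D x1 x <= 3 * M by rewrite D_ge0 -Dxx1 /=; apply: le_trans xM1 _; rewrite ler_peMl ?ler1n// (le_trans ler01).
have c2 : 0 <= D z x <= 3 * M * eta by rewrite D_ge0.
have c3 : 0 <= D z p1 <= 3 * M * eta.
  rewrite D_ge0 /=; apply: le_trans De _; rewrite -!mulrA; apply: ler_wpM2r => //.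
  by rewrite ler_nat.
have c4 : `|D z x1 - D x1 x| <= 3 * M * eta.
  apply: le_trans Db; rewrite ler_distl -Dxx1; apply/andP; split.
    by rewrite lerBlDr addrC (Ds z x) Dt.
  by rewrite addrC Dt.
have c5 : D x1 x = 0 -> D z x1 = D z x /\ D z p1 = D z x.
  move=> x0; have -> : x1 = x by case: Dmet => _ dz _ _; exact: dz.
  split => //; congr D; case: Dmet => _ dz _ _; apply: esym; apply: dz.
  by rewrite D1 Dxx1 x0 mulr0.
have := HC eta (D z x1) (D z x) (D x1 x) (D z p1) eta01 (D_ge0 _ _) c1 c2 c3 c4 c5 cmp.
have st : H z p1 ^+ 2 = (1 - eta) * H z x ^+ 2 + eta * H z x1 ^+ 2 - eta * (1 - eta) * H x x1 ^+ 2.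
  by rewrite p1h euc_stewart.
rewrite !DYh (Ys x1 x) (Hs (h x1)) (Ys z p1) za st A1 z1' (Ys z x) => fin.
have q1 : (t * Y p1 p2) ^+ 2 <= (t * (eta * c)) ^+ 2.
  rewrite ler_sqr ?nnegrE//; first exact: mulr_ge0.
  exact: (mulr_ge0 t0 (mulr_ge0 (ltW et0) (Y_ge0 x1 x2))).
have q2 : 0 <= eta * H z x ^+ 2 by rewrite mulr_ge0 ?sqr_ge0// ltW.
lraw fin q1 q2.
Qed.

Lemma fill_iter M x x1 x2 t : 1 <= M -> 0 <= t <= 1 ->
  Y x1 x2 + H x x1 + H x x2 + H x1 x2 <= M -> 
  Y x x1 <= t * Y x1 x2 -> Y x x2 <= (1 - t) * Y x1 x2 ->
  exists2 K, 0 < K & forall N : nat, (0 < N)%N ->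
   exists z, Y x z <= K / N%:R /\
     euc_dist (h z) ((1 - t) *: h x1 + t *: h x2) <= M / N%:R.
Proof.
move=> M1 t01 HM a1 a2; have [t0 t1] := andP t01.
have M21 : 1 <= 2 * M by lra.
have [C C0 HC] := fill_step M21.
set hs := (1 - t) *: h x1 + t *: h x2.
have hs_le u : euc_dist u (h x1) <= M -> euc_dist u (h x2) <= M -> euc_dist u hs <= M.
  move=> u1 u2; apply: le_of_sqr; first by lraw M21.
  have s1 : euc_dist u (h x1) ^+ 2 <= M ^+ 2 by rewrite ler_sqr ?nnegrE//; lraw M21.
  have s2 : euc_dist u (h x2) ^+ 2 <= M ^+ 2 by rewrite ler_sqr ?nnegrE//; lraw M21.
  rewrite euc_stewart.
  have : (1 - t) * euc_dist u (h x1) ^+ 2 <= (1 - t) * M ^+ 2 by rewrite ler_wpM2l//; lraw t1.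
  have : t * euc_dist u (h x2) ^+ 2 <= t * M ^+ 2 by rewrite ler_wpM2l.
  have : 0 <= t * (1 - t) * H x1 x2 ^+ 2 by rewrite !mulr_ge0 ?sqr_ge0//; lraw t1.
  lraw.
have Y12 := Y_ge0 x1 x2; have H1 := H_ge0 (h x) (h x1); have H2 := H_ge0 (h x) (h x2).
have H12 := H_ge0 (h x1) (h x2).
have xs : euc_dist (h x) hs <= M by apply: hs_le; lraw H1 H12 H2 HM Y12.
have K0 : 0 < Num.sqrt C by rewrite sqrtr_gt0.
have Y1 z : Y z x1 <= t * Y x1 x2 -> Y z x1 <= Y x1 x2.
  by move=> h1; apply: le_trans h1 _; rewrite ler_piMl.
have Y2 z : Y z x2 <= (1 - t) * Y x1 x2 -> Y z x2 <= Y x1 x2.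
  by move=> h1; apply: le_trans h1 _; rewrite ler_piMl//; lraw t0.
exists (Num.sqrt C) => // N N0.
have N1 : 1 <= N%:R :> R by rewrite ler1n.
(* With eta = N^-4 and N^5 steps, the total drift in [Y] is N^5 sqrt C eta^(3/2) = sqrt C / N, and
   the gap in height is multiplied by (1 - eta)^(N^5) <= 1 / (1 + N). *)
pose q : R := N%:R^-1; pose eta := q ^+ 4.
have q0 : 0 < q by rewrite invr_gt0; lraw N1.
have q1 : q <= 1 by rewrite invf_le1//; lraw N1.
have e0 : 0 < eta by rewrite exprn_gt0.
have e1 : eta <= 1 by rewrite exprn_ile1// ltW.
have eta01 : 0 < eta <= 1 by rewrite e0.
suff it k : exists z, [/\ Y z x1 <= t * Y x1 x2, Y z x2 <= (1 - t) * Y x1 x2,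
    Y x z <= k%:R * (Num.sqrt C * q ^+ 6) & h z - hs = (1 - eta) ^+ k *: (h x - hs)].
  have [z [_ _ z3 z4]] := it (N ^ 5)%N.
  have qN : N%:R * q = 1 by rewrite mulfV// gt_eqF//; lraw N1.
  have N5 : (N ^ 5)%N%:R * q ^+ 5 = 1 by rewrite natrX -exprMn qN expr1n.
  exists z; split.
    apply: le_trans z3 _; rewrite le_eqVlt; apply/orP; left; apply/eqP.
    have -> : (N ^ 5)%N%:R * (Num.sqrt C * q ^+ 6) = (N ^ 5)%N%:R * q ^+ 5 * (Num.sqrt C * q) by ring.
    by rewrite N5 mul1r.
  have bn := bernoulli_inv (N ^ 5) (_ : 0 <= eta <= 1).
  have {}bn : (1 - eta) ^+ (N ^ 5) * (1 + N%:R) <= 1.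
    have -> : N%:R = (N ^ 5)%N%:R * eta :> R.
      have -> : (N ^ 5)%N%:R * eta = N%:R * ((N%:R * q) ^+ 4) :> R.
        by rewrite natrX /eta exprMn; ring.
      by rewrite qN expr1n mulr1.
    by apply: bernoulli_inv; rewrite (ltW e0) e1.
  have en : 0 <= (1 - eta) ^+ (N ^ 5) by rewrite exprn_ge0//; lraw e1.
  have -> : euc_dist (h z) hs = (1 - eta) ^+ (N ^ 5) * euc_dist (h x) hs.
    by rewrite (euc_ray z4) ger0_norm.
  rewrite mulrC; apply: ler_pM => //.
  rewrite -(ler_pM2r (_ : 0 < N%:R)) ?mulVf; try by [rewrite gt_eqF//; lra|lra].
elim: k => [|k [z [z1 z2 z3 z4]]].
  by exists x; split => //; rewrite ?mul0r ?expr0 ?scale1r//; case: Ypm => ->.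
have en : 0 <= (1 - eta) ^+ k by rewrite exprn_ge0//; lraw e1.
have zs : euc_dist (h z) hs <= M.
  have -> : euc_dist (h z) hs = (1 - eta) ^+ k * euc_dist (h x) hs.
    by rewrite (euc_ray z4) ger0_norm.
  by rewrite -[leRHS]mul1r ler_pM// exprn_ile1//; lraw e1.
have eu0 (u : 'rV[R]_m) : euc_dist u u = 0 by case: (euc_metric R m).
have H120 : 0 <= H x1 x2 ^+ 2 by exact: sqr_ge0.
have tt : 0 <= t * (1 - t) by rewrite mulr_ge0//; lraw t01.
have e11 : euc_dist (h x1) hs <= H x1 x2.
  apply: le_of_sqr => //; rewrite euc_stewart eu0 expr0n mulr0 add0r.
  have : t * H x1 x2 ^+ 2 <= H x1 x2 ^+ 2 by rewrite ler_piMl.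
  have : 0 <= t * (1 - t) * H x1 x2 ^+ 2 by rewrite mulr_ge0.
  lraw.
have e12 : euc_dist (h x2) hs <= H x1 x2.
  apply: le_of_sqr => //; rewrite euc_stewart eu0 expr0n mulr0 addr0 (Hs (h x2)).
  have : (1 - t) * H x1 x2 ^+ 2 <= H x1 x2 ^+ 2 by rewrite ler_piMl//; lraw t01.
  have : 0 <= t * (1 - t) * H x1 x2 ^+ 2 by rewrite mulr_ge0.
  lraw.
have zM1 : D z x1 <= 2 * M.
  have := split_le_sum z x1; have := Ht (h z) hs (h x1); rewrite (Hs hs (h x1)).
  by have := Y1 z z1; lraw H1 H2 HM e11 zs.
have zM2 : D z x2 <= 2 * M.
  have := split_le_sum z x2; have := Ht (h z) hs (h x2); rewrite (Hs hs (h x2)).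
  by have := Y2 z z2; lraw H1 H2 HM e12 zs.
have [z' [w1 w2 w3 w4]] := HC z x1 x2 t eta t01 eta01 zM1 zM2 z1 z2.
exists z'; split => //.
  have : Y z z' <= Num.sqrt C * q ^+ 6.
    apply: le_of_sqr; first by rewrite mulr_ge0 ?exprn_ge0// ltW.
    rewrite exprMn sqr_sqrtr ?(ltW C0)//; apply: le_trans w4 _.
    by rewrite /eta -!exprM.
  by have := Yt x z z'; rewrite -natr1 mulrDl mul1r; lraw z3.
rewrite w3 exprS -scalerA -z4 -/hs; apply/rowP => l; rewrite !mxE; ring.
Qed.

Hypothesis Dcpl : complete_metric D.

(** The points of [fill_iter] form a Cauchy sequence of [D] as N grows; the limit has the required
    fibre and height exactly. *)
Lemma vertical_fill x x1 x2 t : 0 <= t <= 1 ->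
  Y x x1 <= t * Y x1 x2 -> Y x x2 <= (1 - t) * Y x1 x2 ->
  exists z, Y x z = 0 /\ h z = (1 - t) *: h x1 + t *: h x2.
Proof.
move=> t01 a1 a2.
have [M M1 ML] : exists2 M, 1 <= M & Y x1 x2 + H x x1 + H x x2 + H x1 x2 <= M.
  by exists (Y x1 x2 + H x x1 + H x x2 + H x1 x2 + 1); rewrite ?lerDr ?lerDl// !addr_ge0.
have [K K0 HK] := fill_iter M1 t01 ML a1 a2.
set hs := (1 - t) *: h x1 + t *: h x2 in HK *.
have [iv ivE] : exists iv : nat -> R, forall p, iv p = p.+1%:R^-1 by eexists.
have iv0 p : 0 < iv p by rewrite ivE invr_gt0.
have ex N : exists z, Y x z <= K * iv N /\ euc_dist (h z) hs <= M * iv N.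
  by rewrite ivE; exact: HK.
have [z Hz] := choice ex.
have KM : 0 < 2 * (K + M) by lra.
have dz p q : D (z p) (z q) <= (K + M) * iv p + (K + M) * iv q.
  apply: le_trans (split_le_sum _ _) _; have [p1 p2] := Hz p; have [q1 q2] := Hz q.
  have t1 := Yt (z p) x (z q); rewrite (Ys (z p) x) in t1.
  have t2 := Ht (h (z p)) hs (h (z q)); rewrite (Hs hs (h (z q))) in t2.
  lraw p1 p2 q1 q2 t1 t2.
have small (p : nat) e : 0 < e -> (Num.bound (2 * (K + M) / e) <= p)%N ->
    (K + M) * iv p < e / 2.
  move=> e0 Np; rewrite ivE ltr_pdivrMr//.
  have h0 : 0 <= 2 * (K + M) / e by rewrite divr_ge0 ?ltW.
  have : 2 * (K + M) / e < p.+1%:R.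
    by apply: lt_le_trans (archi_boundP h0) _; rewrite ler_nat leqW.
  by rewrite ltr_pdivrMr//; lraw.
have [|l Hl] := Dcpl (u := z).
  move=> e e0; exists (Num.bound (2 * (K + M) / e)) => p q Np Nq.
  by have := dz p q; have := small p _ e0 Np; have := small q _ e0 Nq; lraw.
have lim0 (r : R) : 0 <= r -> (forall e, 0 < e -> r <= e) -> r = 0.
  move=> r0 hr; apply/eqP; rewrite eq_le r0 andbT; apply/ler_addgt0Pr => e e0.
  by rewrite add0r; exact: hr.
exists l; have near e : 0 < e -> exists N, [/\ D (z N) l < e / 2, Y x (z N) < e / 2 &
    euc_dist (h (z N)) hs < e / 2].
  move=> e0; have e20 : 0 < e / 2 by lra.
  have [N HN] := Hl _ e20; pose p := maxn N (Num.bound (2 * (K + M) / e)).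
  exists p; have := small p _ e0 (leq_maxr _ _); have [p1 p2] := Hz p.
  have k1 : 0 < K * iv p by rewrite mulr_gt0.
  have k2 : 0 < M * iv p by rewrite mulr_gt0//; lraw M1.
  by rewrite mulrDl; split; [exact: HN (leq_maxl _ _)|lraw H k2 p1|lraw H k1 p2].
split.
  apply: lim0 => // e e0; have [N [h1 h2 h3]] := near e e0.
  by have := Yt x (z N) l; have := split_Yle Dmet DYh (z N) l; lraw h1 h2.
have [_ ez _ _] := euc_metric R m; apply: ez; apply: lim0 => // e e0.
have [N [h1 h2 h3]] := near e e0.
have := Ht (h l) (h (z N)) hs; have := split_Hle Dmet DYh (z N) l; rewrite (Hs (h l) (h (z N))); lraw h1 h3.
Qed.

End Fill.

(** * Thick fibres *)

Section Thick.
Variables (R : realType) (m : nat) (X : Type) (D Y : X -> X -> R) (h : X -> 'rV[R]_m).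
Hypothesis Dmet : is_metric D.
Hypothesis Dcpl : complete_metric D.
Hypothesis Ypm : is_pseudometric Y.
Hypothesis DYh : forall a b, D a b ^+ 2 = Y a b ^+ 2 + euc_dist (h a) (h b) ^+ 2.
Hypothesis Dgeo : forall a b, exists g, is_geodesic D g a b.
Hypothesis glob : glob_cmp D D.
Local Notation H a b := (euc_dist (h a) (h b)).

Let Dpm : is_pseudometric D. Proof. exact: metric_pseudo. Qed.
Let D_ge0 a b : 0 <= D a b. Proof. exact: pm_ge0. Qed.
Let Y_ge0 a b : 0 <= Y a b. Proof. exact: pm_ge0. Qed.
Let Ds a b : D a b = D b a. Proof. by case: Dmet. Qed.
Let Dt a b c : D a c <= D a b + D b c. Proof. by case: Dmet. Qed.
Let D0 a : D a a = 0. Proof. by case: Dmet. Qed.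
Let Deq a b : D a b = 0 -> a = b. Proof. by case: Dmet a b. Qed.
Let Ys a b : Y a b = Y b a. Proof. by case: Ypm. Qed.
Let Yt a b c : Y a c <= Y a b + Y b c. Proof. by case: Ypm. Qed.
Let Y0 a : Y a a = 0. Proof. by case: Ypm. Qed.
Let Ht (u v w : 'rV[R]_m) : euc_dist u w <= euc_dist u v + euc_dist v w.
Proof. by case: (euc_metric R m). Qed.
Let Hs (u v : 'rV[R]_m) : euc_dist u v = euc_dist v u.
Proof. by case: (euc_metric R m). Qed.
Let H0 (u : 'rV[R]_m) : euc_dist u u = 0. Proof. by case: (euc_metric R m). Qed.
Let Heq (u v : 'rV[R]_m) : euc_dist u v = 0 -> u = v. Proof. by case: (euc_metric R m) u v. Qed.
Let H_ge0 (u v : 'rV[R]_m) : 0 <= euc_dist u v. Proof. exact: euc_dist_ge0. Qed.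

(** [thick rho x]: the fibre of [X] over the [Y]-component of [x] contains the closed
    [rho]-ball around [x]. *)
Definition thick (rho : R) (x : X) : Prop := forall w : 'rV[R]_m, euc_dist w 0 <= rho ->
  exists z, Y x z = 0 /\ h z = h x + w.

Lemma Y_fibre x y z : Y y z = 0 -> Y x y = Y x z.
Proof.
move=> e; apply/eqP; rewrite eq_le; have := Yt x y z; have := Yt x z y.
by rewrite (Ys z y) e !addr0 => -> ->.
Qed.

Lemma Y_fibre2 x y x' y' : Y x x' = 0 -> Y y y' = 0 -> Y x y = Y x' y'.
Proof. by move=> e1 e2; rewrite (Y_fibre x e2) !(Ys _ y') (Y_fibre y' e1). Qed.

Lemma D_fibre x y x' y' : Y x x' = 0 -> Y y y' = 0 -> h x' = h y' -> D x' y' = Y x y.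
Proof.
move=> e1 e2 eh; apply/eqP; rewrite -(eqrXn2 (n := 2))//.
by rewrite DYh eh H0 expr0n addr0 (Y_fibre2 e1 e2).
Qed.

Lemma thick_mono rho rho' x : rho' <= rho -> thick rho x -> thick rho' x.
Proof. by move=> rr tx w wr; apply: tx; exact: le_trans rr. Qed.

Lemma thick_npos rho x : rho <= 0 -> thick rho x.
Proof.
move=> r0 w wr; exists x; split => //.
have -> : w = 0 by apply: Heq; apply/eqP; rewrite eq_le H_ge0 andbT (le_trans wr).
by rewrite addr0.
Qed.

Lemma thick_fill rho rho' g a b t : thick rho a -> thick rho' b -> is_geodesic D g a b ->
  0 <= t <= 1 -> forall w w', euc_dist w 0 <= rho -> euc_dist w' 0 <= rho' ->
  exists z, Y (g t) z = 0 /\ h z = h (g t) + ((1 - t) *: w + t *: w').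
Proof.
move=> ta tb gg t01 w w' wr wr'.
have [a' [ya ha]] := ta _ wr; have [b' [yb hb]] := tb _ wr'.
have [e1 e2 e3] := split_geod0 Dmet Ypm DYh gg t01.
have [||z [z1 z2]] := vertical_fill Dmet Ypm DYh Dgeo glob Dcpl (x := g t) (x1 := a') (x2 := b') t01.
- by rewrite -(Y_fibre _ ya) Ys e1 (Y_fibre2 ya yb).
- by rewrite -(Y_fibre _ yb) e2 (Y_fibre2 ya yb).
by exists z; split => //; rewrite z2 ha hb e3; apply/rowP => i; rewrite !mxE; ring.
Qed.

Lemma thick_convex rho g a b t : thick rho a -> thick rho b -> is_geodesic D g a b ->
  0 <= t <= 1 -> thick rho (g t).
Proof.
move=> ta tb gg t01 w wr; have [z [z1 z2]] := thick_fill ta tb gg t01 wr wr.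
by exists z; split => //; rewrite z2 -scalerDl subrK scale1r.
Qed.

(** The end [b] has thickness 0 at least; the fibre ball over [a] shrinks linearly towards it, as in
    a cone. *)
Lemma thick_contract rho g a b t : 0 <= rho -> thick rho a -> is_geodesic D g a b ->
  0 <= t <= 1 -> thick ((1 - t) * rho) (g t).
Proof.
move=> rho0 ta gg t01 w wr; have [t0 t1] := andP t01.
have [t1'|t1'] := eqVneq t 1; first by apply: (@thick_npos 0) => //; move: wr; rewrite t1' subrr mul0r.
have tp : 0 < 1 - t by rewrite subr_gt0 lt_neqAle t1'.
have w0 : euc_dist (0 : 'rV[R]_m) 0 <= 0 by rewrite H0.
have wt : euc_dist ((1 - t)^-1 *: w) 0 <= rho.
  rewrite -(scaler0 _ ((1 - t)^-1)) euc_scale gtr0_norm ?invr_gt0//.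
  by rewrite ler_pdivrMl.
have [z [z1 z2]] := thick_fill ta (@thick_npos 0 b (lexx 0)) gg t01 wt w0.
by exists z; split => //; rewrite z2 scaler0 addr0 scalerA mulfV ?scale1r// gt_eqF.
Qed.

Lemma thick_closed rho (u : nat -> X) l : (forall n, thick rho (u n)) ->
  (forall e, 0 < e -> exists N, forall p, (N <= p)%N -> D (u p) l < e) -> thick rho l.
Proof.
move=> tu ul w wr.
have [z Hz] := choice (fun n => tu n w wr).
have Dz p q : D (z p) (z q) = D (u p) (u q).
  have [p1 p2] := Hz p; have [q1 q2] := Hz q.
  apply/eqP; rewrite -(eqrXn2 (n := 2))// !DYh p2 q2 euc_transl.
  by rewrite (Y_fibre2 p1 q1).
have [|z0 Hz0] := Dcpl (u := z).
  move=> e e0; have e2 : 0 < e / 2 by lra.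
  have [N HN] := ul _ e2; exists N => p q Np Nq; rewrite Dz.
  by have := Dt (u p) l (u q); rewrite (Ds l); have := HN p Np; have := HN q Nq; lra.
have near e : 0 < e -> exists n, D (u n) l < e / 2 /\ D (z n) z0 < e / 2.
  move=> e0; have e2 : 0 < e / 2 by lra.
  have [N HN] := ul _ e2; have [N' HN'] := Hz0 _ e2; exists (maxn N N').
  by split; [apply: HN; exact: leq_maxl|apply: HN'; exact: leq_maxr].
have lim0 (r : R) : 0 <= r -> (forall e, 0 < e -> r <= e) -> r = 0.
  move=> r0 hr; apply/eqP; rewrite eq_le r0 andbT; apply/ler_addgt0Pr => e e0.
  by rewrite add0r; exact: hr.
exists z0; split.
  apply: lim0 => // e e0; have [n [n1 n2]] := near e e0; have [p1 _] := Hz n.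
  have := Yt l (u n) z0; have := Yt (u n) (z n) z0; rewrite p1 (Ys l (u n)).
  by have := split_Yle Dmet DYh (u n) l; have := split_Yle Dmet DYh (z n) z0; lra.
apply: Heq; apply: lim0 => // e e0; have [n [n1 n2]] := near e e0; have [_ p2] := Hz n.
have := Ht (h z0) (h (z n)) (h l + w); rewrite {2}p2 euc_transl (Hs (h z0) (h (z n))).
by have := split_Hle Dmet DYh (u n) l; have := split_Hle Dmet DYh (z n) z0; lra.
Qed.

(** All points are moved within their fibres to the height of [y], which is less than rho away. At
    constant height [D] and [Y] agree, so the lifted curve is a geodesic of [D] and the comparison
    of [D] applies to it. *)
Lemma thick_slice rho y p q r g tau : (forall t, 0 <= t <= 1 -> thick rho (g t)) -> thick rho p ->
  D y p < rho / 4 -> D y q < rho / 4 -> D y r < rho / 4 -> is_geodesic D g q r -> 0 <= tau <= 1 ->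
  hyp_cmp (Y p q) (Y p r) (Y q r) tau (Y p (g tau)).
Proof.
move=> tg tp yp yq yr gg tau01; have [g0 g1 gd] := gg.
have lift x : thick rho x -> D y x <= rho -> exists z, Y x z = 0 /\ h z = h y.
  move=> tx yx; have [|z [z1 z2]] := tx (h y - h x).
    rewrite -(subrr (h x)) euc_transl.
    exact: le_trans (split_Hle Dmet DYh _ _) yx.
  by exists z; split => //; rewrite z2 addrC subrK.
have yg t : 0 <= t <= 1 -> D y (g t) <= rho.
  move=> t01; have [t0 t1] := andP t01.
  have := Dt y q (g t); rewrite (geod_d0 gg t01).
  have : t * D q r <= D q r by rewrite ler_piMl.
  by have := Dt q y r; rewrite (Ds q y); have := D_ge0 y p; lra.
have ex t : exists z, 0 <= t <= 1 -> Y (g t) z = 0 /\ h z = h y.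
  have [t01|t01] := pselect (is_true (0 <= t <= 1)); last by exists y.
  by have [z Hz] := lift _ (tg t t01) (yg t t01); exists z.
have [G HG] := choice ex.
have [|p' [p1 p2]] := lift p tp; first by have := D_ge0 y p; lra.
have z01 : 0 <= (0 : R) <= 1 by lra.
have o01 : 0 <= (1 : R) <= 1 by lra.
have DG s t : 0 <= s <= 1 -> 0 <= t <= 1 -> D (G s) (G t) = Y (g s) (g t).
  by move=> s01 t01; have [? ?] := HG s s01; have [? ?] := HG t t01; apply: D_fibre; congruence.
have DP t : 0 <= t <= 1 -> D p' (G t) = Y p (g t).
  by move=> t01; have [? ?] := HG t t01; apply: D_fibre; congruence.
have GG : is_geodesic D G (G 0) (G 1).
  split => // s t s01 t01; rewrite !DG// g0 g1.
  exact: (split_geodY Dmet Ypm DYh gg).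
by have := glob p' GG tau01; rewrite !DP// DG// g0 g1.
Qed.

(** The points of thickness [rho] form a complete convex subspace, to which globalization of the
    pair applies: [thick_slice] is its local hypothesis and [split_excess] its excess condition. *)
Theorem thick_cmp rho p q r g tau : 0 < rho -> thick rho p -> thick rho q -> thick rho r ->
  is_geodesic D g q r -> 0 <= tau <= 1 -> hyp_cmp (Y p q) (Y p r) (Y q r) tau (Y p (g tau)).
Proof.
move=> rho0 tp tq tr gg tau01.
pose XR := {x : X | thick rho x}.
pose DR (x y : XR) := D (sval x) (sval y); pose YR (x y : XR) := Y (sval x) (sval y).
have lift g' (a b : XR) : is_geodesic D g' (sval a) (sval b) -> exists2 G : R -> XR,
    is_geodesic DR G a b & forall t, 0 <= t <= 1 -> sval (G t) = g' t.
  move=> gg'; have [g0 g1 gd] := gg'.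
  have ex t : exists z : XR, 0 <= t <= 1 -> sval z = g' t.
    have [t01|t01] := pselect (is_true (0 <= t <= 1)); last by exists a.
    by exists (exist _ (g' t) (thick_convex (svalP a) (svalP b) gg' t01)).
  have [G HG] := choice ex.
  have z01 : 0 <= (0 : R) <= 1 by lra.
  have o01 : 0 <= (1 : R) <= 1 by lra.
  exists G => //; split.
  - by apply: eq_sig_hprop => [? ? ?|]; [exact: Prop_irrelevance|rewrite HG].
  - by apply: eq_sig_hprop => [? ? ?|]; [exact: Prop_irrelevance|rewrite HG].
  - by move=> s t s01 t01; rewrite /DR !HG// gd.
have proj G (a b : XR) : is_geodesic DR G a b -> is_geodesic D (fun t => sval (G t)) (sval a) (sval b).
  by move=> [G0 G1 Gd]; split => //; rewrite ?G0 ?G1.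
have [G GG HG] := lift g (exist _ q tq) (exist _ r tr) gg.
have := @global_cmp R XR DR YR _ _ _ _ _ _ _ _ (exist _ p tp) (exist _ q tq) (exist _ r tr) G tau GG tau01.
rewrite /YR /= HG//; apply.
- split; rewrite /DR => //.
  by move=> a b /Deq e; apply: eq_sig_hprop => // ? ? ?; exact: Prop_irrelevance.
- by split; rewrite /YR => //.
- by move=> a b; exact: (split_Yle Dmet DYh).
- by move=> G' a b /proj/(split_geodY Dmet Ypm DYh); apply.
- move=> y; exists (rho / 4); first by lra.
  move=> p' q' r' G' tau' h1 h2 h3 h4 h5.
  apply: (@thick_slice rho (sval y) (sval p') (sval q') (sval r') (fun t => sval (G' t))) => //.
  + by move=> t _; exact: svalP.
  + exact: svalP.
  + exact: proj.
- move=> a b; have [g' gg'] := Dgeo (sval a) (sval b).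
  by have [G' GG' _] := lift _ _ _ gg'; exists G'.
- by move=> a b c; exact: (split_excess Dmet Ypm DYh).
- move=> u cu; have [l Hl] := Dcpl cu.
  have tl : thick rho l by apply: (thick_closed (u := fun n => sval (u n))) => // n; exact: svalP.
  by exists (exist _ l tl).
Qed.

(** On a geodesic from a thick point every point except possibly the far end is thick, by
    [thick_contract]. *)
Lemma thick_dense x0 rho x e : 0 < rho -> thick rho x0 -> 0 < e ->
  exists x' rho', [/\ 0 < rho', thick rho' x' & D x x' < e].
Proof.
move=> rho0 t0 e0; have [g gg] := Dgeo x0 x.
pose t := 1 - Num.min 1 (e / 2 / (D x0 x + 1)).
have Dp : 0 < D x0 x + 1 by have := D_ge0 x0 x; lra.
have mp : 0 < Num.min 1 (e / 2 / (D x0 x + 1)) by rewrite lt_min ltr01 !divr_gt0.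
have m1 : Num.min 1 (e / 2 / (D x0 x + 1)) <= 1 by rewrite ge_min lexx.
have t01 : 0 <= t <= 1 by rewrite /t; lra.
exists (g t), ((1 - t) * rho); split; first by rewrite mulr_gt0// /t; lra.
  by apply: thick_contract gg t01 => //; exact: ltW.
rewrite Ds (geod_d1 gg t01) /t (_ : 1 - (1 - Num.min 1 (e / 2 / (D x0 x + 1))) =
  Num.min 1 (e / 2 / (D x0 x + 1))); last by ring.
have h1 : Num.min 1 (e / 2 / (D x0 x + 1)) * (D x0 x + 1) <= e / 2.
  by rewrite -ler_pdivlMr// ge_min lexx orbT.
lra.
Qed.

End Thick.

(** * The union of the thick sets, and packing numbers of Y *)

Section Core.
Variables (R : realType) (m : nat) (X : Type) (D Y : X -> X -> R) (h : X -> 'rV[R]_m).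
Hypothesis Dmet : is_metric D.
Hypothesis Dcpl : complete_metric D.
Hypothesis Ypm : is_pseudometric Y.
Hypothesis DYh : forall a b, D a b ^+ 2 = Y a b ^+ 2 + euc_dist (h a) (h b) ^+ 2.
Hypothesis Dgeo : forall a b, exists g, is_geodesic D g a b.
Hypothesis glob : glob_cmp D D.

Let Dpm : is_pseudometric D. Proof. exact: metric_pseudo. Qed.
Let D_ge0 a b : 0 <= D a b. Proof. exact: pm_ge0. Qed.
Let Y_ge0 a b : 0 <= Y a b. Proof. exact: pm_ge0. Qed.
Let Ds a b : D a b = D b a. Proof. by case: Dmet. Qed.
Let Dt a b c : D a c <= D a b + D b c. Proof. by case: Dmet. Qed.
Let Ys a b : Y a b = Y b a. Proof. by case: Ypm. Qed.
Let Yt a b c : Y a c <= Y a b + Y b c. Proof. by case: Ypm. Qed.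
Let H_ge0 (u v : 'rV[R]_m) : 0 <= euc_dist u v. Proof. exact: euc_dist_ge0. Qed.
Let Hs (u v : 'rV[R]_m) : euc_dist u v = euc_dist v u.
Proof. by case: (euc_metric R m). Qed.
Let Ht (u v w : 'rV[R]_m) : euc_dist u w <= euc_dist u v + euc_dist v w.
Proof. by case: (euc_metric R m). Qed.

(** No single radius need serve all points, and the union need not be complete; comparison holds on
    it because any three points share a radius ([core_common]). *)
Definition core : Type := {x : X | exists2 rho, 0 < rho & thick Y h rho x}.
Definition coreD (a b : core) : R := D (sval a) (sval b).
Definition coreY (a b : core) : R := Y (sval a) (sval b).

Lemma core_metric : is_metric coreD.
Proof.
case: Dmet => d0 deq ds dt; split; rewrite /coreD => //.
by move=> a b /deq e; apply: eq_sig_hprop => // ? ? ?; exact: Prop_irrelevance.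
Qed.

Lemma core_pseudo : is_pseudometric coreY.
Proof. by case: Ypm => d0 ds dt; split; rewrite /coreY. Qed.

Lemma core_common (a b c : core) : exists2 rho, 0 < rho &
  [/\ thick Y h rho (sval a), thick Y h rho (sval b) & thick Y h rho (sval c)].
Proof.
have [ra ra0 ta] := svalP a; have [rb rb0 tb] := svalP b; have [rc rc0 tc] := svalP c.
have [r r0 [r1 r2 r3]] := min3 ra0 rb0 rc0.
by exists r => //; split; [exact: thick_mono ta|exact: thick_mono tb|exact: thick_mono tc].
Qed.

Lemma core_lift g (a b : core) : is_geodesic D g (sval a) (sval b) ->
  exists2 G : R -> core, is_geodesic coreD G a b & forall t, 0 <= t <= 1 -> sval (G t) = g t.
Proof.
move=> gg; have [g0 g1 gd] := gg.
have ex t : exists z : core, 0 <= t <= 1 -> sval z = g t.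
  have [t01|t01] := pselect (is_true (0 <= t <= 1)); last by exists a.
  have [r r0 [ra rb _]] := core_common a b b.
  have tg : exists2 rho, 0 < rho & thick Y h rho (g t).
    by exists r => //; exact: (thick_convex Dmet Dcpl Ypm DYh Dgeo glob ra rb gg t01).
  by exists (exist _ (g t) tg).
have [G HG] := choice ex.
have z01 : 0 <= (0 : R) <= 1 by lra.
have o01 : 0 <= (1 : R) <= 1 by lra.
exists G => //; split.
- by apply: eq_sig_hprop => [? ? ?|]; [exact: Prop_irrelevance|rewrite HG].
- by apply: eq_sig_hprop => [? ? ?|]; [exact: Prop_irrelevance|rewrite HG].
- by move=> s t s01 t01; rewrite /coreD !HG// gd.
Qed.

Lemma core_proj G (a b : core) : is_geodesic coreD G a b ->
  is_geodesic D (fun t => sval (G t)) (sval a) (sval b).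
Proof. by move=> [G0 G1 Gd]; split => //; rewrite ?G0 ?G1. Qed.

Lemma core_geo (a b : core) : exists g, is_geodesic coreD g a b.
Proof. by have [g gg] := Dgeo (sval a) (sval b); have [G GG _] := core_lift gg; exists G. Qed.

Lemma core_geodY G (a b : core) : is_geodesic coreD G a b ->
  forall s t, 0 <= s <= 1 -> 0 <= t <= 1 -> coreY (G s) (G t) = `|s - t| * coreY a b.
Proof. by move=> /core_proj/(split_geodY Dmet Ypm DYh); apply. Qed.

Lemma core_cmp : glob_cmp coreD coreY.
Proof.
move=> p q r g tau /core_proj gg tau01; have [rho rho0 [tp tq tr]] := core_common p q r.
exact: (thick_cmp Dmet Dcpl Ypm DYh Dgeo glob rho0 tp tq tr gg tau01).
Qed.

Lemma core_dense (a : core) x e : 0 < e -> exists b : core, D x (sval b) < e.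
Proof.
move=> e0; have [rho rho0 ta] := svalP a.
have [x' [rho' [r0 tx' xx']]] := thick_dense Dmet Dcpl Ypm DYh Dgeo glob x rho0 ta e0.
have ex : exists2 rho, 0 < rho & thick Y h rho x' by exists rho'.
by exists (exist _ x' ex).
Qed.

Lemma euc_shift (u w : 'rV[R]_m) : euc_dist u (u + w) = euc_dist w 0.
Proof. by rewrite Hs [u + w]addrC -{2}(add0r u) euc_transl. Qed.

Variables A s : R.
Hypothesis A0 : 0 < A.
Hypothesis pk : forall x r K (I : finType) (f : I -> X),
    0 < r <= 1 -> 1 <= K -> (forall i, D x (f i) <= r) -> separated D f (r / K) ->
    #|I|%:R <= A * K `^ s.

Lemma grid_le (K : nat) (u : R) (g : {ffun 'I_m -> 'I_K}) : 0 <= u ->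
  euc_dist (\row_q ((g q)%:R * u)) 0 <= m%:R * (K%:R * u).
Proof.
move=> u0; rewrite euc_distE -[X in X%:R * (_ * _)]card_ord; apply: enorm_le.
  by rewrite mulr_ge0.
move=> q; rewrite !mxE subr0 ger0_norm ?mulr_ge0// ler_wpM2r// ler_nat ltnW//.
Qed.

Lemma grid_sep (K : nat) (u : R) (g g' : {ffun 'I_m -> 'I_K}) : 0 <= u -> g != g' ->
  u <= euc_dist (\row_q ((g q)%:R * u)) (\row_q ((g' q)%:R * u)).
Proof.
move=> u0 gg'; have [q gq] : exists q, g q != g' q.
  apply: contrapT => /forallNP no; move/eqP: gg'; apply; apply/ffunP => q.
  by apply/eqP; apply/negPn/negP; exact: no.
rewrite euc_distE; apply: le_trans (coord_le_enorm _ q); rewrite !mxE -mulrBl normrM.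
by rewrite (ger0_norm u0) ler_peMl// nat_dist_ge1.
Qed.

(** A family separated in [Y] is contracted towards [a] until all its fibres contain a ball of
    radius rho / 2; over each member a vertical grid of K^m points is erected, with K about 1 / eta.
    These #|I| K^m points are separated in X, which gains m in the exponent. *)
Lemma pack_down (a : core) M : 1 <= M -> exists2 A', 0 < A' &
  forall eta (I : finType) (f : I -> core), 0 < eta <= 1 -> (forall i, coreY a (f i) <= M) ->
    separated coreY f eta -> #|I|%:R <= A' * eta^-1 `^ (s - m%:R).
Proof.
move=> M1; pose C := contr_cst M; have C1 : 1 <= C := contr_cst_ge1 M.
have [rho rho0 ta] := svalP a.
pose B := M + 2 * m%:R; have B1 : 1 <= B by rewrite /B; have := ler0n R m; lra.
exists (A * (B * C) `^ s).
  by rewrite mulr_gt0// powR_gt0// mulr_gt0//; lra.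
move=> eta I f /andP[eta0 eta1] fM fsep.
have [al Hal] := choice (fun i => core_geo a (f i)).
have [b b1 fb] : exists2 b, 1 <= b & forall i, coreD a (f i) <= b.
  have pos i : 0 < (coreD a (f i) + 1)^-1.
    by rewrite invr_gt0; have := D_ge0 (sval a) (sval (f i)); rewrite -/(coreD a (f i)); lra.
  have [b b0 hb] := fin_min pos; exists (Num.max 1 b^-1); first by rewrite le_max lexx.
  move=> i; rewrite le_max; apply/orP; right.
  have := hb i; rewrite -lef_pV2 ?posrE ?invr_gt0// ?invrK; first by lra.
  by have := pos i; rewrite invr_gt0.
have B0 : 0 < B by lra.
have b0 : 0 < b by lra.
have r80 : 0 < rho / (4 * b) by rewrite divr_gt0// mulr_gt0.
have r81 : 0 < rho / (4 * B) by rewrite divr_gt0// mulr_gt0.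
have iB : 0 < B^-1 / 2 by rewrite divr_gt0// invr_gt0.
(* [b] bounds the [D]-distances in this particular family, and [la] depends on it. The final
   constant does not, since only the ratio of radius to separation enters the packing bound. *)
have [la la0 [la1 la2 la3]] := min3 r80 r81 iB.
have lab : la * b <= rho / 4 by move: la1; rewrite invfM mulrA ler_pdivlMr.
have laB : la * B <= rho / 4 by move: la2; rewrite invfM mulrA ler_pdivlMr.
have laB1 : la * B <= 1 / 2.
  have : la * B <= B^-1 / 2 * B by rewrite ler_pM2r.
  by rewrite mulrAC mulVf ?gt_eqF//; lra.
have lale : la <= la * B by rewrite ler_peMr// ltW.
have la01 : 0 <= la <= 1 by rewrite (ltW la0) /=; lraw laB1 lale.
pose g i := sval (al i la).
have gg i := core_proj (Hal i).
have gY i : Y (sval a) (g i) <= la * M.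
  have [-> _ _] := split_geod0 Dmet Ypm DYh (gg i) la01.
  by rewrite ler_wpM2l ?(ltW la0)//; exact: fM.
have gD i : D (sval a) (g i) <= rho / 4.
  rewrite (geod_d0 (gg i) la01); apply: le_trans lab; rewrite ler_wpM2l ?(ltW la0)//.
  exact: fb.
have gT i : thick Y h (rho / 2) (g i).
  have := thick_contract Dmet Dcpl Ypm DYh Dgeo glob (ltW rho0) ta (gg i) la01.
  apply: thick_mono; have : la * rho <= 1 / 2 * rho by rewrite ler_pM2r//; lraw laB1 lale.
  lraw.
have gsep i k : i != k -> la * eta / C <= Y (g i) (g k).
  move=> ik; rewrite ler_pdivrMr; last by lraw C1.
  have [i0 i1 _] := Hal i; have [k0 k1 _] := Hal k.
  have H : hinge coreD (al i) (al k) by split; rewrite /geod_from ?i0 ?i1 ?k0 ?k1.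
  have := contraction (M := M) core_metric core_pseudo core_geodY core_cmp H.
  rewrite i0 i1 k0 k1 => /(_ la (fM i) (fM k) la01) h1.
  rewrite [leRHS]mulrC; apply: (le_trans _ h1); rewrite ler_pM2l//; exact: fsep.
pose u := la * eta / C.
have C0 : 0 < C by lraw C1.
have u0 : 0 < u by rewrite divr_gt0// mulr_gt0.
pose K := (Num.trunc eta^-1).+1.
have ei1 : 1 <= eta^-1 by rewrite invf_ge1.
have ei0 : 0 <= eta^-1 by lraw ei1.
have /andP[K1 K2] := truncn_itv ei0.
have Ku : K%:R * u <= 2 * la.
  have h0 : K%:R <= 2 * eta^-1 :> R by rewrite /K -natr1; lraw K1 ei1.
  have h1 : K%:R * u <= 2 * eta^-1 * u by rewrite ler_pM2r.
  apply: le_trans h1 _.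
  have -> : 2 * eta^-1 * u = 2 * la / C by rewrite /u; field; rewrite !gt_eqF.
  by rewrite ler_pdivrMr// ler_peMr//; lraw.
have wle (w : {ffun 'I_m -> 'I_K}) : euc_dist (\row_q ((w q)%:R * u)) 0 <= 2 * m%:R * la.
  apply: le_trans (grid_le w (ltW u0)) _.
  by rewrite (_ : 2 * m%:R * la = m%:R * (2 * la)); [rewrite ler_wpM2l|ring].
have ex (iw : I * {ffun 'I_m -> 'I_K}) : exists z, Y (g iw.1) z = 0 /\
    h z = h (sval a) + \row_q ((iw.2 q)%:R * u).
  case: iw => i w /=; set wv := \row_q _.
  have [|z [z1 z2]] := gT i (h (sval a) + wv - h (g i)).
    rewrite -(subrr (h (g i))) euc_transl.
    have h1 := Ht (h (sval a) + wv) (h (sval a)) (h (g i)).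
    have h2 : euc_dist (h (sval a) + wv) (h (sval a)) <= 2 * m%:R * la.
      by rewrite Hs euc_shift wle.
    have h3 := split_Hle Dmet DYh (sval a) (g i).
    have h4 : 2 * m%:R * la <= la * B by rewrite /B; have : 0 < la * M; [rewrite mulr_gt0//; lraw M1|lraw].
    by have := gD i; lraw h1 h2 h3 h4 laB.
  by exists z; split => //; rewrite z2 addrC subrK.
have [z Hz] := choice ex.
have := pk (x := sval a) (r := la * B) (K := B * C / eta) (f := z).
rewrite card_prod card_ffun !card_ord natrM natrX => H.
have {H} : #|I|%:R * K%:R ^+ m <= A * (B * C / eta) `^ s.
  apply: H.
  - by rewrite mulr_gt0//=; lraw laB1.
  - by rewrite ler_pdivlMr// mul1r; apply: le_trans eta1 _; rewrite -[leLHS]mul1r ler_pM.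
  - move=> [i w]; have [/= z1 z2] := Hz (i, w).
    apply: le_trans (split_le_sum Ypm DYh _ _) _.
    rewrite -(Y_fibre Ypm _ z1) z2 euc_shift.
    by have := gY i; have := wle w; rewrite /B; lraw.
  - have -> : la * B / (B * C / eta) = u by rewrite /u; field; rewrite !gt_eqF.
    move=> [i w] [k w'] ne; have [/= z1 z2] := Hz (i, w); have [/= z3 z4] := Hz (k, w').
    have [ik|ik] := eqVneq i k; last first.
      apply: le_trans (split_Yle Dmet DYh _ _); rewrite -(Y_fibre2 Ypm z1 z3).
      exact: gsep.
    apply: le_trans (split_Hle Dmet DYh _ _); rewrite z2 z4 ![h (sval a) + _]addrC euc_transl.
    by apply: grid_sep; [exact: ltW|apply: contra_neq ne => ->; rewrite ik].
move=> cnt.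
have Ke : eta^-1 ^+ m <= K%:R ^+ m :> R by rewrite lerXn2r ?nnegrE// ltW.
have e0 : 0 < eta^-1 by rewrite invr_gt0.
rewrite -(ler_pM2r (_ : 0 < eta^-1 ^+ m)) ?exprn_gt0//.
apply: le_trans (_ : _ <= #|I|%:R * K%:R ^+ m) _; first by rewrite ler_wpM2l.
apply: le_trans cnt _; rewrite -[leRHS]mulrA -[leRHS]mulrA ler_pM2l//.
have BC0 : 0 <= B * C by rewrite mulr_ge0// ltW.
rewrite (powRM s BC0 ei0) ler_wpM2l ?powR_ge0//.
rewrite -(powR_mulrn m ei0) -powRD ?subrK//.
by apply/implyP => _; rewrite gt_eqF.
Qed.

End Core.

(** * The completion *)

(** The midpoint inequality for a short segment of half-length l around the point is combined with
    the comparisons on both long sides, eliminating the distances u and v to its ends. *)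
Lemma hyp_glue (R : realType) (l L L' a b u v e : R) (ch := @hcosh R) (sh := @hsinh R) :
  0 < l -> 0 < L -> 0 < L' ->
  ch u + ch v <= 2 * ch l * ch e ->
  sh (L - l) * ch e + sh l * ch a <= ch u * sh L ->
  sh (L' - l) * ch e + sh l * ch b <= ch v * sh L' ->
  sh L' * ch a + sh L * ch b <= ch e * sh (L + L').
Proof.
rewrite /ch /sh => l0 L0 L'0 h1 h2 h3.
have sl : 0 < @hsinh R l by rewrite sh_gt0.
have sL : 0 < @hsinh R L by rewrite sh_gt0.
have sL' : 0 < @hsinh R L' by rewrite sh_gt0.
rewrite -(ler_pM2l sl) shD.
have k1 := ler_wpM2l (ltW sL') h2; have k2 := ler_wpM2l (ltW sL) h3.
have sLL : 0 < @hsinh R L * @hsinh R L' by rewrite mulr_gt0.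
have k3 := ler_wpM2l (ltW sLL) h1.
move: k1 k2; rewrite !shB => k1 k2; lra.
Qed.

Section Completion.
Variable R : realType.
Variables (Yb : Type) (Z : Yb -> Yb -> R).
Hypothesis Zmet : is_metric Z.
Hypothesis Zcpl : complete_metric Z.
Local Notation ch := (@hcosh R).
Local Notation sh := (@hsinh R).

Let Zpm : is_pseudometric Z. Proof. exact: metric_pseudo. Qed.
Let Z_ge0 a b : 0 <= Z a b. Proof. exact: pm_ge0. Qed.
Let Zs a b : Z a b = Z b a. Proof. by case: Zmet. Qed.
Let Zt a b c : Z a c <= Z a b + Z b c. Proof. by case: Zmet. Qed.
Let Z0 a : Z a a = 0. Proof. by case: Zmet. Qed.
Let Zeq a b : Z a b = 0 -> a = b. Proof. by case: Zmet a b. Qed.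

Definition special (g : R -> Yb) (a b : Yb) : Prop := is_geodesic Z g a b /\
  forall p tau, 0 <= tau <= 1 -> hyp_cmp (Z p a) (Z p b) (Z a b) tau (Z p (g tau)).

(* If every pair of points is joined by one geodesic satisfying the comparison, then all
   geodesics satisfy it: for s on [q,r], a short special geodesic around s whose ends lie
   on special geodesics [s,q] and [s,r] has to pass through s. *)
Lemma special_cmp : (forall a b, exists g, special g a b) -> glob_cmp Z Z.
Proof.
move=> sp p q r g tau gg tau01; have [t0 t1] := andP tau01.
have [c0|c0] := eqVneq (Z q r) 0.
  by rewrite /hyp_cmp c0 !mulr0 sh0; lra.
have cp : 0 < Z q r by rewrite lt_def c0 Z_ge0.
have g0 : g 0 = q by case: gg.
have g1 : g 1 = r by case: gg.
have [t0'|t0'] := eqVneq tau 0.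
  by rewrite t0' g0; exact: hyp_cmp0.
have [t1'|t1'] := eqVneq tau 1.
  by rewrite t1' g1; exact: hyp_cmp1.
set s := g tau; pose L := Z s q; pose L' := Z s r.
have LE : L = tau * Z q r by rewrite /L Zs (geod_d0 gg tau01).
have L'E : L' = (1 - tau) * Z q r by rewrite /L' (geod_d1 gg tau01).
have L0 : 0 < L by rewrite LE mulr_gt0// lt_def t0' t0.
have L'0 : 0 < L' by rewrite L'E mulr_gt0// subr_gt0 lt_neqAle t1' t1.
have LL : L + L' = Z q r by rewrite LE L'E; ring.
have Lh : 0 < L / 2 by rewrite divr_gt0.
have L'h : 0 < L' / 2 by rewrite divr_gt0.
have [l l0 [l1 l2 _]] := min3 Lh L'h Lh.
have lL1 : l < L by lra.
have lL'1 : l < L' by lraw l2.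
have [gm [Gm Cm]] := sp s q; have [gp [Gp Cp]] := sp s r.
have lL : 0 <= l / L <= 1 by rewrite divr_ge0 ?(ltW l0) ?(ltW L0)//= ler_pdivrMr// mul1r ltW.
have lL' : 0 <= l / L' <= 1 by rewrite divr_ge0 ?(ltW l0) ?(ltW L'0)//= ler_pdivrMr// mul1r ltW.
have eL : l / L * L = l by rewrite divfK// gt_eqF.
have eL' : l / L' * L' = l by rewrite divfK// gt_eqF.
set qt := gm (l / L); set rt := gp (l / L').
have sq : Z s qt = l by rewrite (geod_d0 Gm lL) -/L eL.
have sr : Z s rt = l by rewrite (geod_d0 Gp lL') -/L' eL'.
have qq : Z qt q = L - l by rewrite (geod_d1 Gm lL) -/L mulrBl mul1r eL.
have rr : Z rt r = L' - l by rewrite (geod_d1 Gp lL') -/L' mulrBl mul1r eL'.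
have qr : Z qt rt = 2 * l.
  have := Zt qt s rt; have := Zt q qt r; have := Zt qt rt r.
  by rewrite (Zs qt s) (Zs q qt); lraw L'E LE qq rr sq sr.
have [g2 [G2 C2]] := sp qt rt.
have h01 : 0 <= (1 / 2 : R) <= 1 by lraw.
set x := g2 (1 / 2).
have qx : Z qt x = l by rewrite (geod_d0 G2 h01) qr; field.
have xr : Z x rt = l by rewrite (geod_d1 G2 h01) qr; field.
have xq : Z x q = L.
  have := Zt q x r; have := Zt x qt q; have := Zt x rt r.
  by rewrite (Zs q x) (Zs x qt); lraw L'E LE qq qx rr xr.
have xs : x = s.
  apply: Zeq; apply/eqP; rewrite eq_le Z_ge0 andbT.
  have := Cm x _ lL; rewrite /hyp_cmp -/qt -/L xq (Zs x qt) qx mulrBl mul1r eL => h1.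
  have sLl : 0 < sh (L - l) by rewrite sh_gt0; lraw l1.
  have h2 : ch (Z x s) <= ch 0 by rewrite ch0 -(ler_pM2l sLl) shB; move: h1; rewrite shB; lraw.
  by rewrite leNgt; apply/negP => h3; have := ch_lt (lexx 0) h3; rewrite ltNge h2.
have mid : ch (Z p qt) + ch (Z p rt) <= 2 * ch l * ch (Z p s).
  have := C2 p _ h01; rewrite /hyp_cmp -/x xs qr.
  rewrite (_ : (1 - 1 / 2) * (2 * l) = l); last by field.
  rewrite (_ : 1 / 2 * (2 * l) = l); last by field.
  rewrite (_ : 2 * l = l + l); last by ring.
  have sl : 0 < sh l by rewrite sh_gt0.
  by rewrite shD => hh; rewrite -(ler_pM2l sl); lraw hh.
rewrite /hyp_cmp -LE -L'E -LL; apply: (hyp_glue l0 L0 L'0 mid).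
  by have := Cm p _ lL; rewrite /hyp_cmp -/L -/qt mulrBl mul1r eL.
by have := Cp p _ lL'; rewrite /hyp_cmp -/L' -/rt mulrBl mul1r eL'.
Qed.

Variables (T : Type) (D Y : T -> T -> R) (J : T -> Yb).
Hypothesis Dgeo : forall a b, exists g, is_geodesic D g a b.
Hypothesis Ygeo : forall g a b, is_geodesic D g a b ->
  forall s t, 0 <= s <= 1 -> 0 <= t <= 1 -> Y (g s) (g t) = `|s - t| * Y a b.
Hypothesis glob : glob_cmp D Y.
Hypothesis ZJ : forall a b, Z (J a) (J b) = Y a b.
Hypothesis Jdense : forall z e, 0 < e -> exists a, Z (J a) z < e.
Variable b0 : Yb.
Hypothesis tot_bounded : forall M eta, 0 < M -> 0 < eta -> exists N (c : nat -> Yb),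
  forall z, Z b0 z <= M -> exists2 k, (k < N)%N & Z (c k) z < eta.

Section Ultra.
Variable U : set_system nat.
Hypothesis UU : UltraFilter U.
Hypothesis oU : (\oo : set_system nat) `<=` U.

Lemma ultra_finite N (A : nat -> set nat) : (forall n, exists2 k, (k < N)%N & A k n) ->
  exists k, U (A k).
Proof.
move=> cov; apply: contrapT => /forallNP no.
have all K : U [set n | forall k, (k < K)%N -> ~ A k n].
  elim: K => [|K IH]; first by apply: filterS filterT.
  have [/no//|nK] := in_ultra_setVsetC (A K) UU.
  apply: filterS (filterI IH nK) => n [h1 h2] k.
  by rewrite ltnS leq_eqVlt => /orP[/eqP ->|/h1].
by have [n hn] := filter_ex (all N); have [k kN] := cov n; exact: hn.
Qed.

(** At each scale the ultrafilter selects one centre of a finite net; successive centres are close,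
    hence converge. One ultrafilter serves all parameters of a sequence of curves at once, without
    extracting subsequences. *)
Lemma ultra_lim (u : nat -> Yb) M : (forall n, Z b0 (u n) <= M) ->
  exists z, forall e, 0 < e -> U [set n | Z (u n) z < e].
Proof.
move=> uM; have M0 : 0 < `|M| + 1 by have := normr_ge0 M; lra.
have ex (i : nat) : exists c, U [set n | Z c (u n) < (1 / 2) ^+ i].
  have e0 : 0 < (1 / 2 : R) ^+ i by rewrite exprn_gt0.
  have [N [c Hc]] := tot_bounded M0 e0.
  have [|k hk] := @ultra_finite N (fun k => [set n | Z (c k) (u n) < (1 / 2) ^+ i]).
    by move=> n; apply: Hc; apply: le_trans (uM n) _; have := ler_norm M; lra.
  by exists (c k).
have [c Hc] := choice ex.
have q01 : 0 <= (1 / 2 : R) < 1 by lra.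
have [|y Hy] := geom_limit (v := c) (C := 2) (q := 1 / 2) Zmet Zcpl q01.
  move=> i; have [n [n1 n2]] := filter_ex (filterI (Hc i) (Hc i.+1)).
  have := Zt (c i) (u n) (c i.+1); rewrite (Zs (u n)); rewrite /= in n1 n2.
  rewrite exprS in n2; have : 0 < (1 / 2 : R) ^+ i by rewrite exprn_gt0.
  by lra.
exists y => e e0; have [i hi] := geom_small 5 q01 e0.
apply: filterS (Hc i) => n /= hn; have := Zt (u n) (c i) y; rewrite (Zs (u n) (c i)).
have := Hy i; have := hi i (leqnn i); have -> : 2 / (1 - 1 / 2) = 4 :> R by field.
have : 0 < (1 / 2 : R) ^+ i by rewrite exprn_gt0.
by lra.
Qed.

Let ulim (u : nat -> Yb) z := forall e, 0 < e -> U [set n | Z (u n) z < e].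

Lemma ultra_dist u v a b : ulim u a -> ulim v b -> Z (u n) (v n) @[n --> U] --> Z a b.
Proof.
move=> ua vb; apply/cvgrPdist_lt => e e0; have e2 : 0 < e / 2 by lra.
apply: filterS (filterI (ua _ e2) (vb _ e2)) => n [/= h1 h2].
have := Zt a (u n) b; have := Zt (u n) (v n) b; have := Zt (u n) a (v n); have := Zt a b (v n).
rewrite (Zs a (u n)) (Zs b (v n)) => *.
by rewrite ltr_norml; apply/andP; split; lra.
Qed.

Lemma ultra_approx z (u : nat -> T) : (forall n, Z (J (u n)) z < (1 / 2) ^+ n) ->
  ulim (J \o u) z.
Proof.
move=> hu e e0; have q01 : 0 <= (1 / 2 : R) < 1 by lra.
have [N HN] := geom_small 1 q01 e0.
apply: oU; exists N => // n /= Nn; apply: lt_trans (hu n) _.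
by have := HN n Nn; rewrite mul1r.
Qed.

(** Geodesics between approximating points of the dense image converge pointwise along [U];
    distances, hence also the comparison inequality, pass to the limit. *)
Lemma special_ex a b : exists g, special g a b.
Proof.
have e0 (n : nat) : 0 < (1 / 2 : R) ^+ n by rewrite exprn_gt0.
have ap z : exists u : nat -> T, forall n, Z (J (u n)) z < (1 / 2) ^+ n.
  by have [u Hu] := choice (fun n => Jdense z (e0 n)); exists u.
have [q Hq] := ap a; have [r Hr] := ap b.
have [g Hg] := choice (fun n => Dgeo (q n) (r n)).
have uq := ultra_approx Hq; have ur := ultra_approx Hr.
have e1 n : (1 / 2 : R) ^+ n <= 1 by rewrite exprn_ile1//; lra.
have Yqr n : Y (q n) (r n) <= Z a b + 2.
  rewrite -ZJ; have := Zt (J (q n)) a (J (r n)); have := Zt a b (J (r n)).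
  by rewrite (Zs b (J (r n))); have := Hq n; have := Hr n; have := e1 n; lra.
have ex s : exists z, 0 <= s <= 1 -> ulim (fun n => J (g n s)) z.
  have [s01|s01] := pselect (is_true (0 <= s <= 1)); last by exists a.
  have [|z Hz] := @ultra_lim (fun n => J (g n s)) (Z b0 a + 1 + (Z a b + 2)).
    move=> n; have := Zt b0 a (J (g n s)); have := Zt a (J (q n)) (J (g n s)).
    rewrite ZJ (Zs a (J (q n))).
    have [g0 _ _] := Hg n; have z01 : 0 <= (0 : R) <= 1 by lra.
    have := Ygeo (Hg n) z01 s01; rewrite g0 sub0r normrN => ->.
    have : `|s| * Y (q n) (r n) <= Y (q n) (r n).
      rewrite ler_piMl//; first by rewrite -ZJ.
      by rewrite ger0_norm; lra.
    by have := Yqr n; have := Hq n; have := e1 n; lra.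
  by exists z.
have [gam Hgam] := choice ex.
have uniq u y z : ulim u y -> ulim u z -> y = z.
  move=> uy uz; apply: Zeq; have h1 := ultra_dist uy uz.
  have h2 : Z (u n) (u n) @[n --> U] --> (0 : R).
    by under eq_fun do rewrite Z0; exact: cvg_cst.
  exact: (@cvg_unique _ (@norm_hausdorff _ R) _ _ _ _ h1 h2).
have z01 : 0 <= (0 : R) <= 1 by lra.
have o01 : 0 <= (1 : R) <= 1 by lra.
have cqr : Y (q n) (r n) @[n --> U] --> Z a b.
  by under eq_fun do rewrite -ZJ; exact: ultra_dist uq ur.
exists gam; split; first split.
- apply: (uniq (J \o q)) => //.
  by have := Hgam 0 z01; congr ulim; apply/funext => n /=; have [-> _ _] := Hg n.
- apply: (uniq (J \o r)) => //.
  by have := Hgam 1 o01; congr ulim; apply/funext => n /=; have [_ -> _] := Hg n.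
- move=> s t s01 t01; have h1 := ultra_dist (Hgam s s01) (Hgam t t01).
  have h2 : Z (J (g n s)) (J (g n t)) @[n --> U] --> `|s - t| * Z a b.
    under eq_fun => n do rewrite ZJ (Ygeo (Hg n) s01 t01).
    by apply: cvgM => //; exact: cvg_cst.
  exact: (@cvg_unique _ (@norm_hausdorff _ R) _ _ _ _ h1 h2).
move=> p tau tau01; have [pn Hp] := ap p; have up := ultra_approx Hp.
have c1 : Y (pn n) (q n) @[n --> U] --> Z p a.
  by under eq_fun do rewrite -ZJ; exact: ultra_dist up uq.
have c2 : Y (pn n) (r n) @[n --> U] --> Z p b.
  by under eq_fun do rewrite -ZJ; exact: ultra_dist up ur.
have c3 : Y (pn n) (g n tau) @[n --> U] --> Z p (gam tau).
  by under eq_fun do rewrite -ZJ; exact: ultra_dist up (Hgam tau tau01).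
have cc (f : R -> R) (u : nat -> R) l : continuous f -> u @ U --> l -> f (u n) @[n --> U] --> f l.
  by move=> cf ul; apply: continuous_cvg => //; exact: cf.
have cs' k : k * Y (q n) (r n) @[n --> U] --> k * Z a b by apply: cvgM => //; exact: cvg_cst.
apply: (ler_cvg_to (f := fun n => sh ((1 - tau) * Y (q n) (r n)) * ch (Y (pn n) (q n)) +
     sh (tau * Y (q n) (r n)) * ch (Y (pn n) (r n)))
   (g := fun n => ch (Y (pn n) (g n tau)) * sh (Y (q n) (r n))) (a := U)).
- apply: cvgD; apply: cvgM.
  + exact: (cc _ _ _ (@sh_continuous R) (cs' _)).
  + exact: (cc _ _ _ (@ch_continuous R) c1).
  + exact: (cc _ _ _ (@sh_continuous R) (cs' _)).
  + exact: (cc _ _ _ (@ch_continuous R) c2).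
- by apply: cvgM; [exact: (cc _ _ _ (@ch_continuous R) c3)|exact: (cc _ _ _ (@sh_continuous R) cqr)].
- by apply: filterE => n; exact: (glob (pn n) (Hg n) tau01).
Qed.

End Ultra.

Theorem completion_cmp : (forall a b, exists g, is_geodesic Z g a b) /\ glob_cmp Z Z.
Proof.
have [U [UU oU]] := ultraFilterLemma (eventually_filter).
have sp := special_ex UU oU.
by split; [move=> a b; have [g []] := sp a b; exists g|exact: special_cmp].
Qed.

End Completion.

Lemma cell_count_label (R : realType) (I J : finType) N (lab : I -> 'I_N) (f : I -> J -> R)
    (rho w : R) : 0 < w -> 0 <= rho -> (forall i q, `|f i q| <= rho) ->
  (forall i k, i != k -> lab i = lab k -> exists q, w <= `|f i q - f k q|) ->
  #|I|%:R <= N%:R * (2 * rho / w + 1) ^+ #|J|.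
Proof.
move=> w0 rho0 fr sep.
have fib k : #|[pred i | lab i == k]|%:R <= (2 * rho / w + 1) ^+ #|J|.
  rewrite -card_sig; apply: (@cell_count R _ J (fun i => f (sval i)) rho w) => //.
  move=> i l ne; apply: sep; last by rewrite (eqP (svalP i)) (eqP (svalP l)).
  by apply: contra_neq ne => e; apply: val_inj.
rewrite -sum1_card (partition_big lab xpredT)//= natr_sum.
apply: (@le_trans _ _ (\sum_(k < N) (2 * rho / w + 1) ^+ #|J|)).
  by apply: ler_sum => k _; rewrite sum1_card; exact: fib.
by rewrite sumr_const card_ord -[leLHS]mulr_natl.
Qed.

(** * Comparison and dimension for the completion of Y *)

Section Quotient.
Variables (R : realType) (n m : nat) (X : Type) (D Y : X -> X -> R) (h : X -> 'rV[R]_m).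
Hypothesis Dmet : is_metric D.
Hypothesis Dcpl : complete_metric D.
Hypothesis Ypm : is_pseudometric Y.
Hypothesis DYh : forall a b, D a b ^+ 2 = Y a b ^+ 2 + euc_dist (h a) (h b) ^+ 2.
Hypothesis Dgeo : forall a b, exists g, is_geodesic D g a b.
Hypothesis glob : glob_cmp D D.
Hypothesis Ddim : hausdorff_dim D = (n%:R)%:E.
Hypothesis mn : (m <= n)%N.
Variables (x0 : X) (rho0 : R).
Hypothesis rho0_gt0 : 0 < rho0.
Hypothesis x0_thick : thick Y h rho0 x0.
Variables (Yb : Type) (Z : Yb -> Yb -> R) (J : X -> Yb).
Hypothesis Zmet : is_metric Z.
Hypothesis Zcpl : complete_metric Z.
Hypothesis ZJ : forall a b, Z (J a) (J b) = Y a b.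
Hypothesis Jdense : forall z e, 0 < e -> exists a, Z (J a) z < e.

Let Z_ge0 a b : 0 <= Z a b. Proof. by apply: pm_ge0; exact: metric_pseudo. Qed.
Let Zs a b : Z a b = Z b a. Proof. by case: Zmet. Qed.
Let Zt a b c : Z a c <= Z a b + Z b c. Proof. by case: Zmet. Qed.

Let c0 : core Y h := exist _ x0 (ex_intro2 _ _ rho0 rho0_gt0 x0_thick).

Lemma core_denseZ z e : 0 < e -> exists a : core Y h, Z (J (sval a)) z < e.
Proof.
move=> e0; have e2 : 0 < e / 2 by lra.
have [x hx] := Jdense z e2.
have [a ha] := core_dense Dmet Dcpl Ypm DYh Dgeo glob c0 x e2.
exists a; have := Zt (J (sval a)) (J x) z; rewrite ZJ.
have := split_Yle Dmet DYh x (sval a); case: Ypm => _ -> _; lra.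
Qed.

Lemma pack_quotient s A M : 0 < A -> (forall x r K (I : finType) (f : I -> X),
    0 < r <= 1 -> 1 <= K -> (forall i, D x (f i) <= r) -> separated D f (r / K) ->
    #|I|%:R <= A * K `^ s) -> 0 < M ->
  exists2 A', 0 < A' & forall eta (I : finType) (f : I -> Yb), 0 < eta <= 1 ->
    (forall i, Z (J x0) (f i) <= M) -> separated Z f eta ->
    #|I|%:R <= A' * eta^-1 `^ (s - m%:R).
Proof.
move=> A0 pk M0; have M1 : 1 <= M + 1 by lra.
have [A' A'0 H] := pack_down Dmet Dcpl Ypm DYh Dgeo glob A0 pk c0 M1.
exists (A' * 2 `^ (s - m%:R)); first by rewrite mulr_gt0// powR_gt0.
move=> eta I f /andP[e0 e1] fM fsep; have e4 : 0 < eta / 4 by lra.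
have [g Hg] := choice (fun i => core_denseZ (f i) e4).
have -> : A' * 2 `^ (s - m%:R) * eta^-1 `^ (s - m%:R) = A' * (eta / 2)^-1 `^ (s - m%:R).
  have -> : (eta / 2)^-1 = 2 * eta^-1 by rewrite invfM invrK mulrC.
  by rewrite powRM ?invr_ge0 ?(ltW e0)// mulrA.
apply: (H (eta / 2) I g).
- by apply/andP; split; lra.
- move=> i; rewrite /coreY -ZJ /=; have := Zt (J x0) (f i) (J (sval (g i))).
  by rewrite (Zs (f i)); have := fM i; have := Hg i; lra.
- move=> i k ik; rewrite /coreY -ZJ; have := fsep i k ik.
  have := Zt (f i) (J (sval (g i))) (f k); have := Zt (J (sval (g i))) (J (sval (g k))) (f k).
  by rewrite (Zs (f i) (J _)); have := Hg i; have := Hg k; lra.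
Qed.

Lemma quotient_cmp : (forall a b, exists g, is_geodesic Z g a b) /\ glob_cmp Z Z.
Proof.
have nb : n%:R < n%:R + 1 :> R by lra.
have [s [A [_ A0 pk]]] := dim_packing Dmet Dcpl Dgeo glob Ddim nb.
have ZJ' (a b : core Y h) : Z (J (sval a)) (J (sval b)) = coreY a b by rewrite ZJ.
apply: (@completion_cmp R Yb Z Zmet Zcpl (core Y h) (coreD D (h := h)) (coreY (h := h)) (fun a => J (sval a)) _ _ _ ZJ' core_denseZ (J x0)).
- exact: (core_geo Dmet Dcpl Ypm DYh Dgeo glob).
- move=> g a b; exact: (core_geodY Dmet Ypm DYh).
- exact: (core_cmp Dmet Dcpl Ypm DYh Dgeo glob).
move=> M eta M0 eta0.
have [A' A'0 H] := pack_quotient A0 pk M0.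
pose e := Num.min 1 eta; have e0 : 0 < e by rewrite lt_min ltr01.
have e01 : 0 < e <= 1 by rewrite e0 ge_min lexx.
have [|N [c [_ Hc]]] := max_net (d := Z) Zmet (x0 := J x0) (eta := e) (M := A' * e^-1 `^ (s - m%:R)) (ltW M0) _ e0.
  by move=> I f fM fs; exact: H.
exists N, c => z zM; have [k kN hk] := Hc z zM; exists k => //.
by apply: lt_le_trans hk _; rewrite ge_min lexx orbT.
Qed.

Lemma quotient_dim_le : (hausdorff_dim Z <= ((n - m)%:R)%:E)%E.
Proof.
have [Zgeo Zglob] := quotient_cmp.
apply/lee_addgt0Pr => e e0; rewrite -EFinD.
have nb : n%:R < n%:R + e :> R by lra.
have [s [A [/andP[s0 sn] A0 pk]]] := dim_packing Dmet Dcpl Dgeo glob Ddim nb.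
have [A' A'0 H] := pack_quotient A0 pk ltr01.
have nm0 : 0 <= (n - m)%:R :> R by [].
have nmE : (n - m)%:R = n%:R - m%:R :> R by rewrite natrB.
(* [packing_null] wants a nonnegative exponent, whereas s - m could be negative. *)
pose b := Num.max 0 (s - m%:R).
have b0 : 0 <= b by rewrite le_max lexx.
have bb : b < (n - m)%:R + e by rewrite gt_max; apply/andP; split; lraw nm0 nmE sn.
apply: ereal_inf_lbound; exists ((n - m)%:R + e) => //; split; first by lra.
apply: (packing_null Zmet Zgeo Zglob (x0 := J x0) ltr01 A'0 b0 bb) => eta I f e01 fM fs.
apply: le_trans (H _ _ _ e01 fM fs) _; rewrite ler_pM2l//.
have [h0 h1] := andP e01.
by apply: ler_powR; [rewrite invf_ge1|rewrite le_max lexx orbT].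
Qed.

(** An eta-separated family of X is labelled by an eta / 4-net of the completion. Equal labels leave
    a [Y]-distance below eta / 2, so the heights differ by more than eta / 4 and are counted by
    cells in R^m. Thus X has packing exponent b + m, whence n <= b + m. *)
Lemma quotient_dim_ge b : 0 <= b -> hausdorff_measure Z b = 0%E -> (n - m)%:R <= b.
Proof.
move=> b0 Hb; have [Zgeo Zglob] := quotient_cmp.
have [A A0 pk] := null_packing Zmet Zcpl (contr_cst_ge1 2) b0 (glob_contracting Zmet (M := 2) Zgeo Zglob) Hb.
have bm0 : 0 <= b + m%:R by rewrite addr_ge0.
pose C : R := 4 `^ b * (9 * m.+1%:R) ^+ m.
have C0 : 0 < C by rewrite mulr_gt0 ?powR_gt0// exprn_gt0// mulr_gt0.
suff pkX : forall eta (I : finType) (f : I -> X), 0 < eta <= 1 ->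
     (forall i, D x0 (f i) <= 1) -> separated D f eta ->
     #|I|%:R <= A * C * eta^-1 `^ (b + m%:R).
  rewrite natrB// lerBlDr; apply/ler_addgt0Pr => e e0.
  have be : b + m%:R < b + m%:R + e by lra.
  apply: (null_dim Ddim); first by lra.
  by apply: (packing_null Dmet Dgeo glob (x0 := x0) ltr01 _ bm0 be pkX); rewrite mulr_gt0.
move=> eta I f /andP[e0 e1] f1 fs.
have e4 : 0 < eta / 4 by lra.
have e40 : 4 / eta != 0 by rewrite gt_eqF// divr_gt0.
have [|N [c [NA Hc]]] := max_net (d := Z) Zmet (x0 := J x0) (eta := eta / 4) (M := A * (4 / eta) `^ b) ler01 _ e4.
  move=> I' f' f'1 f's; apply: (pk (J x0) 1 (4 / eta) I' f').
  - by rewrite ltr01 lexx.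
  - by rewrite ler_pdivlMr//; lra.
  - by [].
  - by rewrite mul1r invf_div.
have Jf i : Z (J x0) (J (f i)) <= 1.
  by rewrite ZJ; apply: le_trans (split_Yle Dmet DYh _ _) (f1 i).
have ex i : exists k : 'I_N, Z (c k) (J (f i)) < eta / 4.
  by have [k kN hk] := Hc _ (Jf i); exists (Ordinal kN).
have [lab Hlab] := choice ex.
pose M : R := m.+1%:R; have M1 : 1 <= M by rewrite ler1n.
have M0 : 0 < M by lra.
pose w := eta / 4 / M; have w0 : 0 < w by rewrite divr_gt0.
have wM : w * M = eta / 4 by rewrite /w divfK// gt_eqF.
have := @cell_count_label R I 'I_m N lab (fun i q => h (f i) ord0 q - h x0 ord0 q) 1 w w0 ler01.
rewrite card_ord => H; apply: le_trans (H _ _) _ => [i q|i k ik lik|].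
- apply: le_trans (coord_le_enorm (fun q => h (f i) ord0 q - h x0 ord0 q) q) _.
  rewrite -euc_distE; have [_ _ es _] := euc_metric R m; rewrite es.
  by apply: le_trans (split_Hle Dmet DYh _ _) (f1 i).
- apply: contrapT => /forallNP no.
  have := fs i k ik; apply/negP; rewrite -ltNge.
  apply: le_lt_trans (split_le_sum Ypm DYh _ _) _.
  have h1 : Y (f i) (f k) < eta / 2.
    rewrite -ZJ; have := Zt (J (f i)) (c (lab i)) (J (f k)).
    by rewrite (Zs (J (f i)) (c _)) {2}lik; have := Hlab i; have := Hlab k; lraw.
  have h2 : euc_dist (h (f i)) (h (f k)) <= eta / 4.
    rewrite -wM mulrC; apply: (@le_trans _ _ (m%:R * w)); last by rewrite ler_pM2r// ler_nat.
    rewrite euc_distE -[X in X%:R * w]card_ord; apply: enorm_le; first exact: ltW.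
    move=> q; rewrite leNgt; apply/negP => hq; apply: (no q).
    by rewrite (_ : _ - _ = h (f i) ord0 q - h (f k) ord0 q); [exact: ltW|ring].
  by lraw h1 h2.
have ei0 : 0 < eta^-1 by rewrite invr_gt0.
have ei1 : 1 <= eta^-1 by rewrite invf_ge1.
have -> : A * C * eta^-1 `^ (b + m%:R) = A * (4 / eta) `^ b * (9 * M * eta^-1) ^+ m.
  rewrite /C powRD; last by apply/implyP => _; rewrite gt_eqF.
  by rewrite powR_mulrn ?(ltW ei0)// powRM ?(ltW ei0)// [(9 * M * _) ^+ m]exprMn /M; ring.
have -> : 2 * 1 / w + 1 = 8 * M * eta^-1 + 1.
  by rewrite /w; field; rewrite !gt_eqF.
apply: ler_pM => //.
  by rewrite exprn_ge0// addr_ge0// mulr_ge0 ?(ltW ei0)// mulr_ge0// ltW.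
have Me : 1 * 1 <= M * eta^-1 by rewrite ler_pM.
by rewrite lerXn2r ?nnegrE//; lraw Me.
Qed.

Theorem quotient_dim : hausdorff_dim Z = ((n - m)%:R)%:E.
Proof.
apply/eqP; rewrite eq_le quotient_dim_le /=.
apply: le_ereal_inf_tmp => _ [b [b0 Hb] <-].
by rewrite lee_fin; exact: quotient_dim_ge.
Qed.

End Quotient.

(** * Scaling and curvature bounds *)

Section Scaling.
Variable R : realType.
Variables (T : Type) (d : T -> T -> R) (ka : R).
Hypothesis ka0 : 0 < ka.

Definition scl (d : T -> T -> R) (c : R) (a b : T) : R := c * d a b.

Lemma scl_metric : is_metric d -> is_metric (scl d ka).
Proof.
case=> d0 deq ds dt; split; rewrite /scl.
- by move=> a; rewrite d0 mulr0.
- by move=> a b /eqP; rewrite mulf_eq0 gt_eqF//= => /eqP/deq.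
- by move=> a b; rewrite ds.
- by move=> a b c; rewrite -mulrDr ler_pM2l.
Qed.

Lemma scl_complete : complete_metric d -> complete_metric (scl d ka).
Proof.
move=> cp u cu; have [e e0|l Hl] := cp u.
  have ke : 0 < ka * e by rewrite mulr_gt0.
  have [N HN] := cu _ ke; exists N => p q Np Nq.
  by have := HN p q Np Nq; rewrite ltr_pM2l.
exists l => e e0; have ke : 0 < e / ka by rewrite divr_gt0.
have [N HN] := Hl _ ke; exists N => p Np.
by have := HN p Np; rewrite ltr_pdivlMr// mulrC.
Qed.

Lemma scl_geodesic g a b : is_geodesic (scl d ka) g a b <-> is_geodesic d g a b.
Proof.
split=> -[g0 g1 gd]; split => // s t s01 t01; last by rewrite /scl gd// mulrCA.
have := gd s t s01 t01; rewrite /scl mulrCA => /(mulfI _); apply.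
by rewrite gt_eqF.
Qed.

Lemma scl_null s : is_metric d -> 0 <= s -> hausdorff_measure d s = 0%E ->
  hausdorff_measure (scl d ka) s = 0%E.
Proof.
move=> dmet s0 H0; have smet := scl_metric dmet.
have ks : 0 < ka `^ s by rewrite powR_gt0.
have Hd (de : R) : 0 < de -> Hdelta (scl d ka) s de = 0%E.
  move=> de0; apply/eqP; rewrite eq_le; apply/andP; split; last first.
    apply: le_ereal_inf_tmp => _ [U _ <-].
    by apply: nneseries_ge0 => i _ _; exact: hterm_ge0.
  apply/lee_addgt0Pr => ep ep0; rewrite add0e.
  have dk : 0 < de / ka by rewrite divr_gt0.
  have e0 : (0 < (ep / ka `^ s)%:E)%E by rewrite lte_fin divr_gt0.
  have h : (Hdelta d s (de / ka) <= 0)%E.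
    by rewrite -H0; apply: ereal_sup_ubound; exists (de / ka).
  have /ereal_inf_lt[_ [U [Ubd Ucov] <-] hU] := le_lt_trans h e0.
  apply: (@le_trans _ _ (\sum_(i <oo) hterm (scl d ka) s (U i))%E).
    apply: ereal_inf_lbound; exists U => //; split => // i a b Ua Ub.
    by have := Ubd i a b Ua Ub; rewrite ler_pdivlMr// mulrC.
  apply: (@le_trans _ _ (\sum_(i <oo) ((ka `^ s)%:E * hterm d s (U i)))%E).
    apply: lee_nneseries => [i _ _|i _]; first exact: hterm_ge0.
    have dg := diam_ge0 dmet (Ubd i).
    have [U0|Un] := pselect (U i = set0).
      by rewrite /hterm; case: pselect => //= _; rewrite mule0.
    have -> : ((ka `^ s)%:E * hterm d s (U i) = ((ka * alx_diam d (U i)) `^ s)%:E)%E.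
      by rewrite /hterm; case: pselect => //= _; rewrite -EFinM powRM// ltW.
    apply: hterm_le => //; first by rewrite mulr_ge0// ltW.
    by move=> u v Uu Uv; rewrite /scl ler_pM2l//; exact: (le_diam (Ubd i)).
  rewrite nneseriesZl; last by move=> i _; exact: hterm_ge0.
  apply: (@le_trans _ _ ((ka `^ s)%:E * (ep / ka `^ s)%:E)%E).
    by rewrite lee_pmul2l ?lte_fin// ltW.
  by rewrite -EFinM lee_fin mulrC divfK// gt_eqF.
apply/eqP; rewrite eq_le; apply/andP; split.
  by apply: ge_ereal_sup => _ [de /= de0 <-]; rewrite Hd.
by apply: ereal_sup_ubound; exists 1; [exact: ltr01|rewrite Hd].
Qed.

End Scaling.

Lemma scl_dim (R : realType) (T : Type) (d : T -> T -> R) (ka : R) : 0 < ka -> is_metric d ->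
  hausdorff_dim (scl d ka) = hausdorff_dim d.
Proof.
move=> ka0 dmet; rewrite /hausdorff_dim.
have ki : 0 < ka^-1 by rewrite invr_gt0.
have E : scl (scl d ka) ka^-1 = d.
  by apply/funext => a; apply/funext => b; rewrite /scl mulKf// gt_eqF.
have ES : [set s : R | 0 <= s /\ hausdorff_measure (scl d ka) s = 0%E] =
    [set s : R | 0 <= s /\ hausdorff_measure d s = 0%E].
  apply/seteqP; split => s [s0 Hs]; (split; [exact: s0|]); last exact: (scl_null ka0 dmet s0 Hs).
  by have := scl_null ki (scl_metric ka0 dmet) s0 Hs; rewrite E.
exact: (congr1 (fun A : set R => ereal_inf [set s%:E | s in A]) ES).
Qed.

Lemma scl_regular (R : realType) (T : Type) (d : T -> T -> R) (ka : R) n x : 0 < ka ->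
  regular_pt (scl d ka) n x -> regular_pt d n x.
Proof.
move=> ka0 reg r e r0 e0; have [l0 l00 H] := reg r e r0 e0.
exists (ka * l0); first by rewrite mulr_gt0.
move=> l hl; have [|f [f0 f1 f2]] := H (l / ka); first by rewrite ler_pdivlMr// mulrC.
have E a b : l / ka * scl d ka a b = l * d a b by rewrite /scl mulrA divfK// gt_eqF.
exists f; split => //.
  by move=> a b ha hb; have := f1 a b; rewrite !E; apply.
by move=> v hv; have [a] := f2 v hv; rewrite E; exists a.
Qed.

Lemma half01 (R : realType) : 0 <= (1 / 2 : R) <= 1. Proof. lra. Qed.
Arguments half01 {R}.

Section Curvature.
Variable R : realType.
Variables (T : Type) (d : T -> T -> R).
Hypothesis dmet : is_metric d.
Local Notation ch := (@hcosh R).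
Local Notation sh := (@hsinh R).

Let dpm : is_pseudometric d. Proof. exact: metric_pseudo. Qed.
Let d_ge0 a b : 0 <= d a b. Proof. exact: pm_ge0. Qed.
Let ds a b : d a b = d b a. Proof. by case: dmet. Qed.
Let dt a b c : d a c <= d a b + d b c. Proof. by case: dmet. Qed.
Let deq a b : d a b = 0 -> a = b. Proof. by case: dmet a b. Qed.

(** Extends a geodesic from [0, 1] to all of R, so that continuity can be proved on R and then
    restricted. *)
Definition clamp (x : R) : R := Num.max 0 (Num.min 1 x).

Lemma clamp_id x : 0 <= x <= 1 -> clamp x = x.
Proof. by move=> /andP[x0 x1]; rewrite /clamp (min_idPr x1) (max_idPr x0). Qed.

Lemma clamp01 x : 0 <= clamp x <= 1.
Proof. by rewrite /clamp le_max lexx /= ge_max ler01 ge_min lexx. Qed.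

Lemma clamp_lip x y : `|clamp x - clamp y| <= `|x - y|.
Proof.
wlog xy : x y / x <= y.
  by move=> H; have [/H//|/ltW/H] := leP x y; rewrite distrC (distrC y).
rewrite (distrC x) (ger0_norm (_ : 0 <= y - x)); last by lra.
have cx z : [\/ z <= 0 /\ clamp z = 0, 0 <= z <= 1 /\ clamp z = z | 1 <= z /\ clamp z = 1].
  have /orP[z0|z0] := le_total z 0.
    by apply: Or31; split => //; rewrite /clamp (min_idPr _) ?(max_idPl _)//; lra.
  have /orP[z1|z1] := le_total z 1.
    by apply: Or32; rewrite z1 z0; split => //; apply: clamp_id; rewrite z1 z0.
  by apply: Or33; split => //; rewrite /clamp (min_idPl z1) (max_idPr _)//; exact: ler01.
by case: (cx x) => -[hx ->]; case: (cx y) => -[hy ->]; rewrite ler_norml; apply/andP; split; lraw hx hy xy.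
Qed.

Lemma geod_dist_continuous p g q r : is_geodesic d g q r -> continuous (fun x => d p (g (clamp x))).
Proof.
move=> gg x; apply/cvgrPdist_lt => e e0.
have c0 : 0 < d q r + 1 by have := d_ge0 q r; lra.
have ec : 0 < e / (d q r + 1) by rewrite divr_gt0.
near=> y.
have xy : `|x - y| < e / (d q r + 1) by near: y; apply/nbhs_ballP; exists (e / (d q r + 1)).
have [_ _ gd] := gg.
have h1 : d (g (clamp x)) (g (clamp y)) < e.
  rewrite gd ?clamp01//; apply: (@le_lt_trans _ _ (`|x - y| * (d q r + 1))).
    by apply: ler_pM; rewrite ?normr_ge0 ?clamp_lip//; lra.
  by rewrite -ltr_pdivlMr.
have := dt p (g (clamp x)) (g (clamp y)); have := dt p (g (clamp y)) (g (clamp x)).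
rewrite (ds (g (clamp y))) => *; rewrite ltr_norml; apply/andP; split; lra.
Unshelve. all: end_near.
Qed.

Definition mid_flat p (g : R -> T) u v : Prop :=
  d p u ^+ 2 + d p v ^+ 2 <= 2 * d p (g (1 / 2)) ^+ 2 + d u v ^+ 2 / 2.

Lemma mid_degenerate g u v : is_geodesic d g u v -> d u v = 0 -> g (1 / 2) = u /\ v = u.
Proof.
move=> gg c0; split; apply: deq; rewrite ds ?c0//.
by rewrite (geod_d0 gg half01) c0 mulr0.
Qed.

(** For k > 0 the radius is cut until all lengths times sqrt k are far below pi; then
    [mid_flat_of_sph] turns the spherical midpoint inequality into the flat one. *)
Lemma curv_mid_flat k : 0 <= k -> curv_ge d k -> forall x, exists2 rho, 0 < rho &
  forall p u v g, d x p < rho -> d x u < rho -> d x v < rho -> is_geodesic d g u v ->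
  mid_flat p g u v.
Proof.
move=> k0 cv x; have [rho rho0 H] := cv x; rewrite /mid_flat.
move: k0; rewrite le_eqVlt => /orP[/eqP k0|k0].
  exists rho => // p u v g xp xu xv gg.
  have [c0|c0] := eqVneq (d u v) 0.
    by have [-> ->] := mid_degenerate gg c0; case: dmet => -> _ _ _; lra.
  have cp : 0 < d u v by rewrite lt_def c0 d_ge0.
  have := H p u v g (1 / 2) xp xu xv gg half01; rewrite -k0 ltxx => /(_ (fun e => False_ind _ (Bool.diff_false_true e))).
  rewrite /model_cmp eqxx => h1; rewrite -(ler_pM2l cp); lra.
pose s := Num.sqrt k; have s0 : 0 < s by rewrite sqrtr_gt0.
have s4 : 0 < (4 * s)^-1 by rewrite invr_gt0 mulr_gt0.
have [r r0 [r1 r2 _]] := min3 rho0 s4 s4.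
have rs : 4 * (s * r) <= 1.
  have : r * (4 * s) <= (4 * s)^-1 * (4 * s) by rewrite ler_pM2r// mulr_gt0.
  by rewrite mulVf ?gt_eqF ?mulr_gt0//; lra.
have pi2 := pi_ge2 R.
exists r => // p u v g xp xu xv gg.
have [c0|c0] := eqVneq (d u v) 0.
  by have [-> ->] := mid_degenerate gg c0; case: dmet => -> _ _ _; lra.
have cp : 0 < d u v by rewrite lt_def c0 d_ge0.
have pu : d p u < 2 * r by have := dt p x u; rewrite (ds p x); lraw xp xu.
have pv : d p v < 2 * r by have := dt p x v; rewrite (ds p x); lraw xp xv.
have uv : d u v < 2 * r by have := dt u x v; rewrite (ds u x); lraw xu xv.
have um := geod_d0 gg half01; have mv := geod_d1 gg half01.
set e := d p (g (1 / 2)); have e0 : 0 <= e by exact: d_ge0.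
have e1 := dt p u (g (1 / 2)); have e2 := dt p (g (1 / 2)) u.
have e3 := dt p v (g (1 / 2)); have e4 := dt p (g (1 / 2)) v.
rewrite (ds (g _) u) um -/e in e1 e2; rewrite (ds v (g _)) mv -/e in e3 e4.
have e5 := dt u p (g (1 / 2)); have e6 := dt (g (1 / 2)) p v.
rewrite (ds u p) um -/e in e5; rewrite (ds (g _) p) mv -/e in e6.
have per : 0 < k -> d p u + d p v + d u v < 2 * pi / Num.sqrt k.
  move=> _; rewrite -/s ltr_pdivlMr//.
  have : s * d p u <= s * (2 * r) by rewrite ler_pM2l// ltW.
  have : s * d p v <= s * (2 * r) by rewrite ler_pM2l// ltW.
  have : s * d u v <= s * (2 * r) by rewrite ler_pM2l// ltW.
  lraw pi2 rs.
have := H p u v g (1 / 2) (lt_le_trans xp r1) (lt_le_trans xu r1) (lt_le_trans xv r1) gg half01 per.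
rewrite /model_cmp gt_eqF//= k0 -/s -/e; set th := s * d u v / 2.
have th0 : 0 < th by rewrite divr_gt0// mulr_gt0.
have thpi : th < pi.
  have : s * d u v < s * (2 * r) by rewrite ltr_pM2l.
  by rewrite /th; lraw pi2 rs.
have sth : 0 < sin th by apply: sin_gt0_pi; rewrite th0 thpi.
have -> : s * (d u v - 1 / 2 * d u v) = th by rewrite /th; field.
have -> : s * (1 / 2 * d u v) = th by rewrite /th; field.
have -> : s * d u v = th + th by rewrite /th; field.
rewrite sinD => h1.
have h2 : 2 * cos th * cos (s * e) <= cos (s * d p u) + cos (s * d p v).
  by rewrite -(ler_pM2l sth); lraw h1.
have se0 : 0 <= s * e by rewrite mulr_ge0// ltW.
have sm a b : a <= b -> s * a <= s * b by move=> ab; rewrite ler_pM2l.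
have thE : th = s * (d u v / 2) by rewrite /th; ring.
have := mid_flat_of_sph se0 (ltW th0) _ _ _ h2.
have -> : 2 * (s * e) ^+ 2 + 2 * th ^+ 2 = s ^+ 2 * (2 * e ^+ 2 + d u v ^+ 2 / 2) by rewrite thE; field.
have -> : (s * d p u) ^+ 2 + (s * d p v) ^+ 2 = s ^+ 2 * (d p u ^+ 2 + d p v ^+ 2) by ring.
rewrite ler_pM2l ?exprn_gt0//; apply.
- have : s * e <= s * (3 * r) by apply: sm; lraw e1 pu uv.
  have : s * (d u v / 2) <= s * r by apply: sm; lraw uv.
  by rewrite thE; lraw pi2 rs.
- rewrite thE -mulrBr -mulrDr normrM (gtr0_norm s0) !ler_pM2l// ler_norml.
  by apply/andP; split; [apply/andP; split|]; lraw e1 e2 e5.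
- rewrite thE -mulrBr -mulrDr normrM (gtr0_norm s0) !ler_pM2l// ler_norml.
  by apply/andP; split; [apply/andP; split|]; lraw e3 e4 e6.
Qed.

(** The flat midpoint inequality is scale-free and implies the hyperbolic one for every [ka];
    [hyp_interp] passes from midpoints to all parameters. The radius is divided by 3 because a
    geodesic may leave the ball that contains its ends. *)
Lemma mid_flat_loc ka x rho : 0 < ka -> 0 < rho ->
  (forall p u v g, d x p < rho -> d x u < rho -> d x v < rho -> is_geodesic d g u v ->
     mid_flat p g u v) -> loc_cmp (scl d ka) (scl d ka) x (ka * (rho / 3)).
Proof.
move=> ka0 rho0 H p q r g tau; rewrite /scl !ltr_pM2l// => xp xq xr.
rewrite -[is_geodesic _ _ _ _]/(is_geodesic (scl d ka) g q r) => /(scl_geodesic d ka0) gg tau01.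
have [g0 g1 gd] := gg.
have c0 : 0 <= ka * d q r by rewrite mulr_ge0// ltW.
pose f y := ch (ka * d p (g (clamp y))).
have z01 : 0 <= (0 : R) <= 1 by lra.
have o01 : 0 <= (1 : R) <= 1 by lra.
have inb t : 0 <= t <= 1 -> d x (g t) < rho.
  move=> t01; have [t0 t1] := andP t01; have := dt x q (g t); rewrite (geod_d0 gg t01).
  have := dt q x r; rewrite (ds q x); have : t * d q r <= d q r by rewrite ler_piMl.
  lra.
have fc : {within `[0, 1], continuous f}.
  apply: continuous_subspaceT => y; apply: continuous_comp; last exact: ch_continuous.
  by apply: cvgM; [exact: cvg_cst|exact: (geod_dist_continuous gg)].
have := hyp_interp c0 fc _ tau01; rewrite /hyp_cmp /f !clamp_id// g0 g1; apply.
move=> y l l0 yl yl'.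
have y01 : 0 <= y <= 1 by lraw l0 yl yl'.
have a01 : 0 <= y - l <= 1 by lraw l0 yl yl'.
have b01 : 0 <= y + l <= 1 by lraw l0 yl yl'.
rewrite !clamp_id//.
have gs := geod_sub dpm gg a01 b01.
have ym : y - l + 1 / 2 * (y + l - (y - l)) = y by field.
have xp' : d x p < rho by lraw xp.
have := H p _ _ _ xp' (inb _ a01) (inb _ b01) gs; rewrite /mid_flat ym gd//.
have -> : y - l - (y + l) = - (2 * l) by ring.
rewrite normrN ger0_norm; last by lraw l0.
move=> h1.
have e0 : 0 <= ka * d p (g y) by rewrite mulr_ge0// ltW.
have l0' : 0 <= l * (ka * d q r) by rewrite mulr_ge0.
have lE : l * (ka * d q r) = ka * (l * d q r) by ring.
have d1 : d (g (y - l)) (g y) = l * d q r.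
  by rewrite gd// (_ : y - l - y = - l) ?normrN ?ger0_norm//; ring.
have d2 : d (g y) (g (y + l)) = l * d q r.
  by rewrite gd// (_ : y - (y + l) = - l) ?normrN ?ger0_norm//; ring.
have t1 := dt p (g y) (g (y - l)); have t2 := dt p (g (y - l)) (g y).
have t3 := dt (g y) p (g (y - l)); have t4 := dt p (g y) (g (y + l)).
have t5 := dt p (g (y + l)) (g y); have t6 := dt (g y) p (g (y + l)).
rewrite (ds (g y) (g (y - l))) d1 in t1 t3; rewrite d1 in t2; rewrite d2 in t4 t6.
rewrite (ds (g (y + l))) d2 in t5; rewrite (ds (g y) p) in t3 t6.
apply: mid_hyp_of_flat => //.
- rewrite lE -mulrBr -mulrDr normrM (gtr0_norm ka0) !ler_pM2l// ler_norml.
  by apply/andP; split; [apply/andP; split|]; lraw t1 t2 t3.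
- rewrite lE -mulrBr -mulrDr normrM (gtr0_norm ka0) !ler_pM2l// ler_norml.
  by apply/andP; split; [apply/andP; split|]; lraw t4 t5 t6.
- have ka2 : 0 <= ka ^+ 2 by exact: sqr_ge0.
  by rewrite lE; have := ler_wpM2l ka2 h1; lraw.
Qed.

(** For k >= 0 every scale is allowed, which [glob_curv0] needs; for k < 0 the scale is
    prescribed. *)
Lemma curv_loc k ka : curv_ge d k -> 0 < ka -> (k < 0 -> ka = Num.sqrt (- k)) ->
  forall y, exists2 rho, 0 < rho & loc_cmp (scl d ka) (scl d ka) y rho.
Proof.
move=> cv ka0 kaE y; have [k0|k0] := leP 0 k.
  have [rho rho0 H] := curv_mid_flat k0 cv y.
  exists (ka * (rho / 3)); first by rewrite mulr_gt0// divr_gt0.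
  exact: mid_flat_loc.
have [rho rho0 H] := cv y; exists (ka * rho); first by rewrite mulr_gt0.
move=> p q r g tau; rewrite /scl !ltr_pM2l// => xp xq xr.
rewrite -[is_geodesic _ _ _ _]/(is_geodesic (scl d ka) g q r) => /(scl_geodesic d ka0) gg tau01.
have per : 0 < k -> d p q + d p r + d q r < 2 * pi / Num.sqrt k.
  by move=> k0'; have := lt_trans k0 k0'; rewrite ltxx.
have := H p q r g tau xp xq xr gg tau01 per.
rewrite /model_cmp lt_eqF// ltNge (ltW k0) /= -(kaE k0) -hcoshE -hsinhE /hyp_cmp.
have -> : ka * (d q r - tau * d q r) = (1 - tau) * (ka * d q r) by ring.
by have -> : ka * (tau * d q r) = tau * (ka * d q r) by ring.
Qed.

Lemma glob_curv_neg k : k < 0 -> glob_cmp (scl d (Num.sqrt (- k))) (scl d (Num.sqrt (- k))) ->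
  curv_ge d k.
Proof.
move=> k0 gl x; exists 1 => // p q r g tau _ _ _ gg tau01 _.
have ka0 : 0 < Num.sqrt (- k) by rewrite sqrtr_gt0 oppr_gt0.
have /(scl_geodesic d ka0) gg' := gg.
have := gl p q r g tau gg' tau01; rewrite /hyp_cmp /scl.
rewrite /model_cmp lt_eqF// ltNge (ltW k0) /= -hcoshE -hsinhE.
have -> : Num.sqrt (- k) * (d q r - tau * d q r) = (1 - tau) * (Num.sqrt (- k) * d q r) by ring.
by have -> : Num.sqrt (- k) * (tau * d q r) = tau * (Num.sqrt (- k) * d q r) by ring.
Qed.

(** The midpoint inequalities at all scales give the flat one ([mid_flat_of_hyp]), and [flat_interp]
    extends it to all parameters. *)
Lemma glob_curv0 : (forall ka, 0 < ka -> glob_cmp (scl d ka) (scl d ka)) -> curv_ge d 0.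
Proof.
move=> gl x; exists 1 => // p q r g tau _ _ _ gg tau01 _.
have [g0 g1 gd] := gg.
have z01 : 0 <= (0 : R) <= 1 by lra.
have o01 : 0 <= (1 : R) <= 1 by lra.
pose f y := d p (g (clamp y)) ^+ 2.
have fc : {within `[0, 1], continuous f}.
  apply: continuous_subspaceT => y.
  by apply: (continuous_comp (g := fun z : R => z ^+ 2)); [exact: (geod_dist_continuous gg)|exact: exprn_continuous].
have c0 := d_ge0 q r.
suff : (1 - tau) * f 0 + tau * f 1 - tau * (1 - tau) * d q r ^+ 2 <= f tau.
  rewrite /f !clamp_id// g0 g1 /model_cmp eqxx => h1.
  have := ler_wpM2l c0 h1; lra.
apply: (flat_interp fc) => // y l l0 yl yl'.
have y01 : 0 <= y <= 1 by lra.
have a01 : 0 <= y - l <= 1 by lra.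
have b01 : 0 <= y + l <= 1 by lra.
rewrite /f !clamp_id//; apply: mid_flat_of_hyp => //; first by rewrite mulr_ge0.
move=> ka ka0.
have gs := geod_sub dpm gg a01 b01.
have /(scl_geodesic d ka0) gs' := gs.
have ym : y - l + 1 / 2 * (y + l - (y - l)) = y by field.
have := gl ka ka0 p _ _ _ (1 / 2) gs' half01; rewrite /hyp_cmp /scl ym gd//.
have -> : y - l - (y + l) = - (2 * l) by ring.
rewrite normrN ger0_norm; last by lraw l0.
have -> : (1 - 1 / 2) * (ka * (2 * l * d q r)) = ka * (l * d q r) by field.
have -> : 1 / 2 * (ka * (2 * l * d q r)) = ka * (l * d q r) by field.
have -> : ka * (2 * l * d q r) = ka * (l * d q r) + ka * (l * d q r) by ring.
set u := ka * (l * d q r); rewrite shD.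
have u0 : 0 <= u by rewrite mulr_ge0 ?mulr_ge0// ltW.
move: u0; rewrite le_eqVlt => /orP[/eqP u0 _|u0 h1].
  have lq : l * d q r = 0 by apply/eqP; move/eqP: u0; rewrite eq_sym mulf_eq0 gt_eqF.
  have d1 : g (y - l) = g y.
    by apply: deq; rewrite gd// (_ : y - l - y = - l) ?normrN ?ger0_norm//; ring.
  have d2 : g (y + l) = g y.
    by apply: deq; rewrite gd// (_ : y + l - y = l) ?ger0_norm//; ring.
  by rewrite d1 d2 -u0 ch0; lraw.
have su : 0 < sh u by rewrite sh_gt0.
by rewrite -(ler_pM2l su); lraw h1.
Qed.

End Curvature.

(** * Degenerate cases: empty spaces, flat rectangles in positive curvature *)

Section Final.
Variable R : realType.

Lemma dim_empty (T : Type) (d : T -> T -> R) : (T -> False) -> hausdorff_dim d = 0%E.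
Proof.
move=> T0; have H0 : hausdorff_measure d 0 = 0%E.
  have Hd (de : R) : Hdelta d 0 de = 0%E.
    apply/eqP; rewrite eq_le; apply/andP; split; last first.
      apply: le_ereal_inf_tmp => _ [U _ <-].
      by apply: nneseries_ge0 => i _ _; exact: hterm_ge0.
    apply: ereal_inf_lbound; exists (fun=> set0); first by split => // x; case: (T0 x).
    by apply: eseries0 => i _ _; rewrite /hterm; case: pselect.
  apply/eqP; rewrite eq_le; apply/andP; split.
    by apply: ge_ereal_sup => _ [de /= de0 <-]; rewrite Hd.
  by apply: ereal_sup_ubound; exists 1; [exact: ltr01|rewrite Hd].
apply/eqP; rewrite eq_le; apply/andP; split.
  by apply: ereal_inf_lbound; exists 0.
by apply: le_ereal_inf_tmp => _ [s [s0 _] <-]; rewrite lee_fin.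
Qed.

Lemma self_glob (T : Type) (d : T -> T -> R) : is_metric d -> complete_metric d ->
  (forall a b, exists g, is_geodesic d g a b) ->
  (forall y, exists2 rho, 0 < rho & loc_cmp d d y rho) -> glob_cmp d d.
Proof.
move=> dmet dcpl dgeo loc p q r g tau gg tau01.
have dpm := metric_pseudo dmet.
apply: (@global_cmp R T d d dmet dpm _ _ loc dgeo _ dcpl p q r g tau gg tau01) => //.
  by move=> g' a b; exact: geod_affine.
move=> a b c; rewrite expr2; case: dmet => _ _ _ dt.
apply: ler_wpM2r; first by have := dt a b c; lra.
by have := pm_ge0 a c dpm; lra.
Qed.

(** A flat right triangle with legs de and median e. Then P = s (e - de / 2) and Q = s (e + de / 2)
    have P^2 + Q^2 = (s a)^2 + (s b)^2, and strict convexity of [cos] in t^2 gives cos (s a) + cos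
    (s b) < cos P + cos Q = 2 cos (s de / 2) cos (s e), contrary to the spherical inequality. *)
Lemma rect_contra (s de a b e : R) : 0 < s -> 0 < de -> 4 * (s * de) <= 1 ->
  0 <= a -> 0 <= b -> 0 <= e -> a ^+ 2 = de ^+ 2 -> b ^+ 2 = 2 * de ^+ 2 ->
  e ^+ 2 = 5 / 4 * de ^+ 2 ->
  cos (s * e) * sin (s * de) <=
    sin (s * (de - 1 / 2 * de)) * cos (s * a) + sin (s * (1 / 2 * de)) * cos (s * b) -> False.
Proof.
move=> s0 de0 sde a0 b0 e0 a2 b2 e2.
have pi2 := pi_ge2 R.
have ae : a = de by apply/eqP; rewrite -(eqrXn2 (n := 2))// ?a2//; exact: ltW.
have d2 : 0 < de ^+ 2 by rewrite exprn_gt0.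
have e1 : de < e by rewrite -(ltr_pXn2r (_ : 0 < 2)%N)// ?nnegrE ?(ltW de0)// e2; lra.
have e3 : e < 3 / 2 * de.
  rewrite -(ltr_pXn2r (_ : 0 < 2)%N)// ?nnegrE ?mulr_ge0 ?(ltW de0)// e2.
  by rewrite exprMn; lra.
have de_e : de * de < e * de by rewrite ltr_pM2r.
have be : b < e + de / 2.
  rewrite -(ltr_pXn2r (_ : 0 < 2)%N)// ?nnegrE ?addr_ge0 ?divr_ge0 ?(ltW de0)//.
  by rewrite b2 sqrrD e2; lra.
have db : de < b by rewrite -(ltr_pXn2r (_ : 0 < 2)%N)// ?nnegrE ?(ltW de0)// b2; lra.
pose P := s * (e - de / 2); pose Q := s * (e + de / 2).
have sm u v : u < v -> s * u < s * v by move=> uv; rewrite ltr_pM2l.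
have P0 : 0 <= P by rewrite mulr_ge0 ?(ltW s0)//; lra.
have Qpi : Q <= pi.
  have : Q < s * (2 * de) by apply: sm; lra.
  lra.
have Pa : P < s * a by apply: sm; lra.
have aQ : s * a < Q by apply: sm; lraw ae e1.
have Pb : P < s * b by apply: sm; lraw db e3.
have bQ : s * b < Q by apply: sm; lraw be.
have c1 := cos_chord_lt P0 Pa aQ Qpi; have c2 := cos_chord_lt P0 Pb bQ Qpi.
have PQ : P < Q by apply: lt_trans aQ.
have PQ2 : 0 < Q ^+ 2 - P ^+ 2.
  by rewrite subr_gt0 ltr_pXn2r// nnegrE// ltW// (le_lt_trans P0).
have eqs : (s * a) ^+ 2 + (s * b) ^+ 2 = P ^+ 2 + Q ^+ 2.
  rewrite /P /Q; transitivity (s ^+ 2 * (a ^+ 2 + b ^+ 2)); first by ring.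
  transitivity (s ^+ 2 * (2 * e ^+ 2 + de ^+ 2 / 2)); last by field.
  by rewrite a2 b2 e2; field.
have lt : cos (s * a) + cos (s * b) < cos P + cos Q.
  rewrite -(ltr_pM2l PQ2); move: c1 c2 eqs.
  move: (cos (s * a)) (cos (s * b)) (cos P) (cos Q) => ca cb cP cQ c1 c2 eqs.
  have -> : (Q ^+ 2 - P ^+ 2) * (cP + cQ) =
     (Q ^+ 2 - (s * a) ^+ 2) * cP + ((s * a) ^+ 2 - P ^+ 2) * cQ +
     ((Q ^+ 2 - (s * b) ^+ 2) * cP + ((s * b) ^+ 2 - P ^+ 2) * cQ).
    have -> : (s * b) ^+ 2 = P ^+ 2 + Q ^+ 2 - (s * a) ^+ 2 by rewrite -eqs; ring.
    by ring.
  by rewrite mulrDr; exact: ltrD.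
set th := s * (1 / 2 * de).
have th0 : 0 < th by rewrite mulr_gt0//; lraw.
have thpi : th < pi by rewrite /th; lraw pi2 sde.
have sth : 0 < sin th by apply: sin_gt0_pi; rewrite th0 thpi.
have -> : s * (de - 1 / 2 * de) = th by rewrite /th; field.
have -> : s * de = th + th by rewrite /th; field.
rewrite sinD => h1.
have h2 : 2 * cos th * cos (s * e) <= cos (s * a) + cos (s * b).
  by rewrite -(ler_pM2l sth); lraw h1.
have cPQ : cos P + cos Q = 2 * cos th * cos (s * e).
  have -> : P = s * e - th by rewrite /P /th; field.
  have -> : Q = s * e + th by rewrite /Q /th; field.
  by rewrite cosB cosD; ring.
by move: lt; rewrite cPQ ltNge h2.
Qed.

(** Otherwise a short geodesic of Y times a vertical segment would lie in X near [x0]; half of this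
    flat rectangle is the triangle of [rect_contra]. *)
Lemma pos_curv_trivial m (X Y : Type) (dX : X -> X -> R) (dY : Y -> Y -> R)
    (i : X -> Y * 'rV[R]_m.+1) k x0 r y :
  0 < k -> curv_ge dX k -> geodesic_space dY -> is_metric dX ->
  (forall a b, prod_dist dY (i a) (i b) = dX a b) -> 0 < r ->
  (forall b, prod_dist dY (i x0) b < r -> exists z, i z = b) -> dY (i x0).1 y = 0.
Proof.
move=> k0 cv [Ymet Ygeo] Xmet iso r0 op.
have Y_ge0 a b : 0 <= dY a b by apply: pm_ge0; exact: metric_pseudo.
have X_ge0 a b : 0 <= dX a b by apply: pm_ge0; exact: metric_pseudo.
have [Y00 _ Ys _] := Ymet; have [_ Xeq Xs _] := Xmet.
have [H0 _ Hs _] := euc_metric R m.+1.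
set y0 := (i x0).1; set h0 := (i x0).2.
have ix0 : i x0 = (y0, h0) by rewrite /y0 /h0; case: (i x0).
apply: contrapT => /eqP yn; have c0 : 0 < dY y0 y by rewrite lt_def yn Y_ge0.
have [ga gg] := Ygeo y0 y; have [g0 g1 gd] := gg.
have [rho rho0 H] := cv x0.
pose s := Num.sqrt k; have s0 : 0 < s by rewrite sqrtr_gt0.
have s4 : 0 < (4 * s)^-1 by rewrite invr_gt0 mulr_gt0.
have r2 : 0 < r / 2 by lra.
have rho2 : 0 < rho / 2 by lra.
have [d1 d10 [d11 d12 d13]] := min3 c0 r2 rho2.
have [de de0 [de1 de2 _]] := min3 d10 s4 s4.
have sde : 4 * (s * de) <= 1.
  have : de * (4 * s) <= (4 * s)^-1 * (4 * s) by rewrite ler_pM2r// mulr_gt0.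
  by rewrite mulVf ?gt_eqF ?mulr_gt0//; lraw.
have sqrt1 u v : 0 <= u -> v = u ^+ 2 -> Num.sqrt v = u.
  by move=> u0 ->; rewrite sqrtr_sqr ger0_norm.
pose la := de / dY y0 y; have la0 : 0 < la by rewrite divr_gt0.
have la1 : la <= 1 by rewrite ler_pdivrMr// mul1r; lraw d11 de1.
have lac : la * dY y0 y = de by rewrite /la divfK// gt_eqF.
have tla t : 0 <= t <= 1 -> 0 <= t * la <= 1.
  by move=> /andP[t0 t1]; rewrite mulr_ge0 ?(ltW la0)//= mulr_ile1// ltW.
have gadist a b : 0 <= a <= 1 -> 0 <= b <= 1 ->
    dY (ga (a * la)) (ga (b * la)) = `|a - b| * de.
  move=> a01 b01; rewrite gd ?tla// -mulrBl normrM (gtr0_norm la0) -mulrA lac.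
  by [].
have z01 : 0 <= (0 : R) <= 1 by lraw.
have o01 : 0 <= (1 : R) <= 1 by lraw.
have h01 : 0 <= (1 / 2 : R) <= 1 by lraw.
have g0' : ga (0 * la) = y0 by rewrite mul0r.
have ex t : exists z, 0 <= t <= 1 -> i z = (ga (t * la), h0).
  have [t01|t01] := pselect (is_true (0 <= t <= 1)); last by exists x0.
  have [|z Hz] := op (ga (t * la), h0); last by exists z.
  rewrite /prod_dist /= -/y0 -/h0 H0 expr0n addr0 sqrtr_sqr ger0_norm//.
  rewrite -g0' gadist// sub0r normrN; have [t0 t1] := andP t01.
  have : t * de <= 1 * de by rewrite ler_pM2r.
  by rewrite ger0_norm//; lraw d12 de1.
have [G HG] := choice ex.
pose w : 'rV[R]_m.+1 := de *: delta_mx 0 0.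
have wn u : euc_dist (u + w) u = de.
  rewrite /euc_dist (bigD1 ord0)//= big1 => [|q qn].
    rewrite !mxE eqxx addr0; apply: sqrt1; first exact: ltW.
    by rewrite /= ?mulr1; congr (_ ^+ 2); ring.
  by rewrite !mxE (negbTE qn) andbF mulr0 addr0 subrr expr0n.
have [|p Hp] := op (y0, h0 + w).
  by rewrite /prod_dist /= -/y0 -/h0 Y00 Hs wn expr0n add0r sqrtr_sqr ger0_norm ?(ltW de0)//; lraw d12 de1.
have DG a b : 0 <= a <= 1 -> 0 <= b <= 1 -> dX (G a) (G b) = `|a - b| * de.
  move=> a01 b01; rewrite -iso HG// HG// /prod_dist /= H0 gadist// expr0n addr0.
  by rewrite sqrtr_sqr ger0_norm// mulr_ge0// ltW.
have Dp a : 0 <= a <= 1 -> dX p (G a) ^+ 2 = (a ^+ 2 + 1) * de ^+ 2.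
  move=> a01; rewrite -iso HG// Hp /prod_dist /= wn sqr_sqrtr ?addr_ge0 ?sqr_ge0//.
  rewrite -g0' gadist// sub0r normrN exprMn real_normK ?num_real//; ring.
have G0 : G 0 = x0.
  by apply: Xeq; rewrite -iso HG// ix0 g0' /prod_dist /= Y00 H0 expr0n addr0 sqrtr0.
have GG : is_geodesic dX G (G 0) (G 1).
  split => // a b a01 b01; rewrite !DG// sub0r normrN normr1 mul1r; by [].
have D01 : dX (G 0) (G 1) = de by rewrite DG// sub0r normrN normr1 mul1r.
have p1 : dX p (G 1) <= 2 * de.
  apply: le_of_sqr; first by lraw.
  by rewrite Dp// exprMn; have := sqr_ge0 de; lraw.
have p0 : dX p (G 0) = de.
  by apply/eqP; rewrite -(eqrXn2 (n := 2)) ?(ltW de0)// Dp// expr0n add0r mul1r.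
have per : 0 < k -> dX p (G 0) + dX p (G 1) + dX (G 0) (G 1) < 2 * pi / Num.sqrt k.
  move=> _; rewrite -/s ltr_pdivlMr// p0 D01.
  have : (de + dX p (G 1) + de) * s <= (4 * de) * s by rewrite ler_pM2r//; lraw p1.
  by have := pi_ge2 R; lraw sde.
have := H p (G 0) (G 1) G (1 / 2) _ _ _ GG h01 per.
have xp : dX x0 p < rho by rewrite -G0 Xs p0; lraw d13 de1.
have xg0 : dX x0 (G 0) < rho by rewrite G0; case: Xmet => -> _ _ _.
have xg1 : dX x0 (G 1) < rho by rewrite -G0 D01; lraw d13 de1.
move=> /(_ xp xg0 xg1); rewrite /model_cmp gt_eqF//= k0 -/s D01.
apply: rect_contra => //.
- by rewrite Dp// expr0n add0r mul1r.
- by rewrite Dp// expr1n; ring.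
- by rewrite Dp//; field.
Qed.

Lemma curv_isometry (X W : Type) (dX : X -> X -> R) (dW : W -> W -> R) (f : X -> W) k :
  is_metric dX -> alx_isometry dX dW f -> curv_ge dX k -> curv_ge dW k.
Proof.
move=> [X0 Xeq _ _] [iso sur] cv w; have [x <-] := sur w.
have [rho rho0 H] := cv x; exists rho => // p q r g tau.
have [p' <-] := sur p; have [q' <-] := sur q; have [r' <-] := sur r.
rewrite !iso => xp xq xr [g0 g1 gd] tau01 per.
have [G HG] := choice (fun t => sur (g t)).
rewrite -HG iso; apply: H => //; split.
- by apply: Xeq; rewrite -iso HG g0 iso X0.
- by apply: Xeq; rewrite -iso HG g1 iso X0.
- by move=> s t s01 t01; rewrite -!iso !HG gd.
Qed.

End Final.

(** * Application to the embedded space *)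

Section Embedding.
Variables (R : realType) (k : R) (n m : nat) (X Y : Type).
Variables (dX : X -> X -> R) (dY : Y -> Y -> R) (i : X -> Y * 'rV[R]_m).
Hypothesis XAlex : Alex n k dX.
Hypothesis Ygeo : geodesic_space dY.
Hypothesis mn : (m <= n)%N.
Hypothesis iso : forall a b, prod_dist dY (i a) (i b) = dX a b.
Hypothesis sur : forall y, exists x, (i x).1 = y.
Variable U : set X.
Hypothesis Ureg : forall x, regular_pt dX n x -> U x.
Hypothesis Uopen : open_in (prod_dist dY) (i @` U).
Variables (Yb : Type) (dYb : Yb -> Yb -> R) (j : Y -> Yb).
Hypothesis cpl : is_completion dY dYb j.
Variable t0 : X.

Let yd a b := dY (i a).1 (i b).1.
Let h a := (i a).2.
Let Xmet : is_metric dX. Proof. by case: XAlex => -[]. Qed.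
Let Xgeo : forall a b, exists g, is_geodesic dX g a b. Proof. by case: XAlex => -[]. Qed.
Let Xcpl : complete_metric dX. Proof. by case: XAlex. Qed.
Let Xcurv : curv_ge dX k. Proof. by case: XAlex. Qed.
Let Xdim : hausdorff_dim dX = (n%:R)%:E. Proof. by case: XAlex. Qed.
Let Ymet : is_metric dY. Proof. by case: Ygeo. Qed.

Lemma emb_split a b : dX a b ^+ 2 = yd a b ^+ 2 + euc_dist (h a) (h b) ^+ 2.
Proof. by rewrite -iso sqr_sqrtr// addr_ge0// sqr_ge0. Qed.

Lemma emb_glob ka : 0 < ka -> (k < 0 -> ka = Num.sqrt (- k)) -> glob_cmp (scl dX ka) (scl dX ka).
Proof.
move=> ka0 kaE; apply: self_glob.
- exact: scl_metric.
- exact: scl_complete.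
- by move=> a b; have [g gg] := Xgeo a b; exists g; apply/scl_geodesic.
- exact: (curv_loc Xmet Xcurv ka0 kaE).
Qed.

Lemma emb_good_scale : exists2 ka, 0 < ka & (k < 0 -> ka = Num.sqrt (- k)).
Proof.
have [k0|k0] := leP 0 k; first by exists 1.
by exists (Num.sqrt (- k)) => //; rewrite sqrtr_gt0 oppr_gt0.
Qed.

Lemma emb_open_point : exists x0, exists2 r, 0 < r &
  forall b, prod_dist dY (i x0) b < r -> exists z, i z = b.
Proof.
have [ka ka0 kaE] := emb_good_scale.
have [||||x reg] := exists_regular (n := n) t0 (scl_metric ka0 Xmet).
- exact: scl_complete.
- by move=> a b; have [g gg] := Xgeo a b; exists g; apply/scl_geodesic.
- exact: emb_glob.
- exact: (etrans (scl_dim ka0 Xmet) Xdim).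
have Ux := Ureg (scl_regular ka0 reg).
have [|r r0 H] := Uopen (a := i x); first by exists x.
by exists x, r => // b /H[z _ <-]; exists z.
Qed.

Lemma emb_thick : exists x0, exists2 r, 0 < r & thick yd h r x0.
Proof.
have [x [r r0 H]] := emb_open_point; exists x, (r / 2); first by lra.
move=> w wr; have [|z Hz] := H ((i x).1, (i x).2 + w); last first.
  by exists z; rewrite /yd /h Hz /=; case: Ymet.
rewrite /prod_dist /= euc_shift; case: Ymet => -> _ _ _; rewrite expr0n add0r sqrtr_sqr.
by rewrite ger0_norm ?euc_dist_ge0//; lra.
Qed.

(** Distances and heights are rescaled by the same [ka], so the splitting of the squared distance
    persists; geodesics and dimension do not change. *)
Lemma emb_quotient ka : 0 < ka -> (k < 0 -> ka = Num.sqrt (- k)) ->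
  [/\ forall a b, exists g, is_geodesic dYb g a b, glob_cmp (scl dYb ka) (scl dYb ka) &
      hausdorff_dim dYb = ((n - m)%:R)%:E].
Proof.
move=> ka0 kaE; have [x0 [r r0 tx]] := emb_thick.
have [Zmet Zcpl Zj Zdense] := cpl.
have smet := scl_metric ka0 Xmet.
have ypm : is_pseudometric (scl yd ka).
  case: Ymet => y0 _ ys yt; split; rewrite /scl /yd.
  - by move=> a; rewrite y0 mulr0.
  - by move=> a b; rewrite ys.
  - by move=> a b c; rewrite -mulrDr ler_pM2l.
have split' a b : scl dX ka a b ^+ 2 = scl yd ka a b ^+ 2 +
    euc_dist (ka *: h a) (ka *: h b) ^+ 2.
  by rewrite /scl euc_scale (gtr0_norm ka0) !exprMn emb_split mulrDr.
have tx' : thick (scl yd ka) (fun a => ka *: h a) (ka * r) x0.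
  move=> w wr; have [|z [z1 z2]] := tx (ka^-1 *: w).
    rewrite -(scaler0 _ ka^-1) euc_scale gtr0_norm ?invr_gt0//.
    by rewrite ler_pdivrMl.
  exists z; rewrite /scl z1 mulr0; split => //.
  by rewrite z2 scalerDr scalerA mulfV ?scale1r// gt_eqF.
have sgeo a b : exists g, is_geodesic (scl dX ka) g a b.
  by have [g gg] := Xgeo a b; exists g; apply/scl_geodesic.
have sdim : hausdorff_dim (scl dX ka) = (n%:R)%:E := etrans (scl_dim ka0 Xmet) Xdim.
have kr : 0 < ka * r by rewrite mulr_gt0.
have sZ := scl_metric ka0 Zmet.
have sJ a b : scl dYb ka (j (i a).1) (j (i b).1) = scl yd ka a b by rewrite /scl Zj.
have sD z e : 0 < e -> exists a, scl dYb ka (j (i a).1) z < e.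
  move=> e0; have ek : 0 < e / ka by rewrite divr_gt0.
  have [y hy] := Zdense z _ ek; have [x xy] := sur y; exists x.
  by rewrite /scl xy mulrC -ltr_pdivlMr.
have [qg qc] := quotient_cmp smet (scl_complete ka0 Xcpl) ypm split' sgeo (emb_glob ka0 kaE) sdim
  kr tx' sZ (scl_complete ka0 Zcpl) sJ sD.
have qd := quotient_dim smet (scl_complete ka0 Xcpl) ypm split' sgeo (emb_glob ka0 kaE) sdim
  mn kr tx' sZ (scl_complete ka0 Zcpl) sJ sD.
split; [|exact: qc|exact: (etrans (esym (scl_dim ka0 Zmet)) qd)].
by move=> a b; have [g gg] := qg a b; exists g; apply/(scl_geodesic dYb ka0).
Qed.

End Embedding.

(** Without a Euclidean factor, X is isometric to Y, which is therefore complete already, and the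
    dense image of Y fills the completion. *)
Lemma dim0_isometry (R : realType) (X Y Yb : Type) (dX : X -> X -> R) (dY : Y -> Y -> R)
    (i : X -> Y * 'rV[R]_0) (dYb : Yb -> Yb -> R) (j : Y -> Yb) : complete_metric dX ->
  is_metric dY -> (forall a b, prod_dist dY (i a) (i b) = dX a b) ->
  (forall y, exists x, (i x).1 = y) -> is_completion dY dYb j ->
  alx_isometry dX dYb (fun x => j (i x).1).
Proof.
move=> Xcpl Ymet iso sur [[_ Zeq Zs Zt] _ Zj Zdense].
have Zi a b : dYb (j (i a).1) (j (i b).1) = dX a b.
  rewrite Zj -iso /prod_dist /euc_dist big_ord0 sqrtr0 expr0n addr0 sqrtr_sqr ger0_norm//.
  by apply: pm_ge0; exact: metric_pseudo.
split => // z.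
have e0 (p : nat) : 0 < (1 / 2 : R) ^+ p by rewrite exprn_gt0.
have ap p : exists x, dYb (j (i x).1) z < (1 / 2) ^+ p.
  by have [y hy] := Zdense z _ (e0 p); have [x xy] := sur y; exists x; rewrite xy.
have [u Hu] := choice ap.
have q01 : 0 <= (1 / 2 : R) < 1 by lra.
have small e : 0 < e -> exists N, forall p, (N <= p)%N -> dYb (j (i (u p)).1) z < e.
  move=> e1; have [N HN] := geom_small 1 q01 e1; exists N => p Np.
  by apply: lt_trans (Hu p) _; have := HN p Np; rewrite mul1r.
have [|l Hl] := Xcpl u.
  move=> e e1; have e2 : 0 < e / 2 by lra.
  have [N HN] := small _ e2; exists N => p q Np Nq; rewrite -Zi.
  have := Zt (j (i (u p)).1) z (j (i (u q)).1); rewrite (Zs z).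
  by have := HN p Np; have := HN q Nq; lra.
exists l; apply: Zeq; have zge : 0 <= dYb (j (i l).1) z.
  have := Zt (j (i l).1) z (j (i l).1); rewrite (Zs z) Zi.
  have -> : dX l l = 0.
    by rewrite -iso /prod_dist; case: Ymet => -> _ _ _; case: (euc_metric R 0) => -> _ _ _;
      rewrite expr0n addr0 sqrtr0.
  by lra.
apply/eqP; rewrite eq_le zge andbT; apply/ler_addgt0Pr => e e1; rewrite add0r.
have e2 : 0 < e / 2 by lra.
have [N HN] := small _ e2; have [N' HN'] := Hl _ e2.
have h1 := HN _ (leq_maxl N N'); have h2 := HN' _ (leq_maxr N N').
have := Zt (j (i l).1) (j (i (u (maxn N N'))).1) z; rewrite (Zs (j (i l).1) (j (i (u _)).1)) Zi.
by lra.
Qed.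

Theorem theorem1p6 (R : realType) (k : R) (n m : nat) (X Y : Type)
  (dX : X -> X -> R) (dY : Y -> Y -> R) (i : X -> Y * 'rV[R]_m) :
  Alex n k dX ->
  geodesic_space dY ->
  (m <= n)%N ->
  (forall a b, prod_dist dY (i a) (i b) = dX a b) ->
  (* (a) *) (forall y, exists x, (i x).1 = y) ->
  (* (b) *) (forall f : X -> R, lipschitz_fun dX f -> affine_fun dX f ->
               exists2 fh : 'rV[R]_m -> R, affine_fun (@euc_dist R m) fh &
                 forall x, f x = fh (i x).2) ->
  (* (c) *) (forall phi : X -> X, alx_isometry dX dX phi ->
               exists! Phi : Y * 'rV[R]_m -> Y * 'rV[R]_m,
                 alx_isometry (prod_dist dY) (prod_dist dY) Phi /\
                 forall x, Phi (i x) = i (phi x)) ->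
  (* (d) *) (exists U : set X, [/\ open_in dX U,
               forall x, regular_pt dX n x -> U x &
               forall V : set X, open_in dX V -> V `<=` U ->
                 open_in (prod_dist dY) (i @` V)]) ->
  forall (Yb : Type) (dYb : Yb -> Yb -> R) (j : Y -> Yb),
    is_completion dY dYb j -> Alex (n - m) k dYb.
Proof.
move=> XA Yg mn iso sur _ _ [U [Uo Ureg Uop]] Yb dYb j cpl.
have [Zmet Zcpl Zj Zdense] := cpl.
have [[[Xmet Xgeo] Xcpl Xcurv Xdim] [Ymet _]] := (XA, Yg).
have UU := Uop U Uo (@subset_refl _ U).
have [[t0 _]|noX] := pselect (exists t : X, True); last first.
  (* The empty space has dimension 0, so n = 0, and the completion is empty too. *)
  have noX' : X -> False by move=> x; apply: noX; exists x.
  have noZ : Yb -> False.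
    by move=> z; have [y _] := Zdense z 1 ltr01; have [x _] := sur y; exact: noX'.
  have n0 : n = 0%N.
    move: Xdim; rewrite (dim_empty _ noX') => -[] /esym/eqP; rewrite pnatr_eq0; exact: eqP.
  split; [split; [exact: Zmet|]|exact: Zcpl| |]; try by move=> z; case: (noZ z).
  by rewrite n0 sub0n (dim_empty _ noZ).
have Q := emb_quotient XA Yg mn iso sur Ureg UU cpl t0.
have [ka ka0 kaE] := emb_good_scale k.
have [Zgeo _ Zdim] := Q ka ka0 kaE.
split; [exact: (conj Zmet Zgeo)|exact: Zcpl| |exact: Zdim].
(* For k < 0 the single scale sqrt (- k) suffices, for k = 0 all scales are used; for k > 0 the
   hyperbolic comparison would be too weak. *)
have [k0|k0|k0] := ltgtP k 0.
- apply: glob_curv_neg => //.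
  have s0 : 0 < Num.sqrt (- k) by rewrite sqrtr_gt0 oppr_gt0.
  by have [] := Q _ s0 (fun=> erefl).
- have [m0|m0] := posnP m.
    subst m; exact: (curv_isometry Xmet (dim0_isometry Xcpl Ymet iso sur cpl) Xcurv).
  have [x0 [r r0 op]] := emb_open_point XA Ureg UU t0.
  have Y0 y : dY (i x0).1 y = 0.
    case: m m0 i iso sur op {mn Q Ureg UU Uop Zdim} => // m' _ i iso _ op.
    exact: (pos_curv_trivial y k0 Xcurv Yg Xmet iso r0 op).
  have Z0 a b : dYb a b = 0.
    have Z_ge0 u v : 0 <= dYb u v by apply: pm_ge0; exact: metric_pseudo.
    case: Zmet => _ _ Zs Zt.
    apply/eqP; rewrite eq_le Z_ge0 andbT; apply/ler_addgt0Pr => e e1; rewrite add0r.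
    have e2 : 0 < e / 2 by lra.
    have [ya ha] := Zdense a _ e2; have [yb hb] := Zdense b _ e2.
    have yab : dY ya yb = 0.
      apply/eqP; rewrite eq_le (pm_ge0 ya yb (metric_pseudo Ymet)) andbT.
      case: Ymet => _ _ Ys Yt; have := Yt ya (i x0).1 yb.
      by rewrite (Ys ya (i x0).1) !Y0 addr0.
    have := Zt a (j ya) b; have := Zt (j ya) (j yb) b.
    by rewrite Zj yab (Zs a (j ya)); lraw ha hb.
  move=> x; exists 1 => // p q r' g tau _ _ _ _ _ _.
  rewrite /model_cmp gt_eqF// k0 !Z0 !mulr0 subr0 mulr0 sin0; lra.
- rewrite k0 in Q *; apply: glob_curv0 => // ka' ka'0.
  by have [] := Q ka' ka'0 _ => //; rewrite ltxx.
Qed.
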